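(* There is a cyclic double multicategory $\mathbb{M}\mathbf{Adj}$, extending the cyclic multicategory $\mathbf{MAdj}$ of multivariable (left) adjunctions, given as follows. - 0-cells are categories. - Horizontal 1-cells are functors. - A vertical 1-cell $A_1,\ldots,A_n\to A_0^\bullet$ is a functor $F\colon A_1\times\cdots\times A_n\to A_0^\bullet$ equipped with $n$-variable left adjoints. - A 2-cell with horizontal source $F\colon A_1,\ldots,A_n\to A_0^\bullet$, horizontal target $G\colon B_1,\ldots,B_n\to B_0^\bullet$, vertical source $S_1,\ldots,S_n$ and vertical target $S_0^\bullet$ (where $S_i\colon A_i\to B_i$ are functors) is a natural transformation $$\alpha\colon S_0^\bullet F\Rightarrow G(S_1\times\cdots\times S_n)$$ of functors $A_1\times\cdots\times A_n\to B_0^\bullet$. The involution on 0-cells and horizontal 1-cells is $(\ )^\bullet$, composition of 2-cells is by pasting of natural transformations, and the cyclic action on 2-cells is given by the multivariable mates correspondence, $\sigma(\alpha)=\alpha_{01}$.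
   Context: $A^\bullet$ is the opposite category of $A$, $S^\bullet$ the opposite functor. Indices $0,\ldots,n$ are cyclic mod $n+1$; $\hat a_i$ denotes $a_{i+1},\ldots,a_n,a_0,\ldots,a_{i-1}$. Multivariable adjunctions. An $n$-variable left adjunction consists of functors $F_i\colon A_{i+1}\times\cdots\times A_{i-1}\to A_i^\bullet$, $0\le i\le n$, and isomorphisms $A_{i-1}(F_{i-1}(\hat a_{i-1}),a_{i-1})\cong A_i(F_i(\hat a_i),a_i)$ for all $i$ (cyclically), natural in all variables, whose composite once around the cycle is the identity; one says $F_0$ is equipped with $n$-variable left adjoints $F_1,\ldots,F_n$. For $n=0$ it is a functor $1\to A_0^\bullet$. Cyclic multicategories. A cyclic multicategory is a (non-symmetric) multicategory $X$ with an involution $x\mapsto x^*$ on objects and, for all $x_0,\ldots,x_n$, $n\ge0$, a bijection $\sigma=\sigma_{n+1}\colon X(x_1,\ldots,x_n;x_0)\to X(x_2,\ldots,x_n,x_0^*;x_1^* )$ (the identity for $n=0$) such that: (1) $(\sigma_{n})^{n}=1$; (2) $\sigma_2(1_x)=1_{x^*}$; (3) for $g\in X(y_1,\ldots,y_m;y_0)$, $f\in X(x_1,\ldots,x_n;y_i)$, writing $g\circ_i f$ for composition at the $i$th input and $\circ_{-1}$ for composition at the last input, $\sigma(g\circ_1 f)=(\sigma f)\circ_{-1}(\sigma g)$ (for $n\ge1$) and $\sigma(g\circ_i f)=(\sigma g)\circ_{i-1}f$ for $2\le i\le m$. Maps of cyclic multicategories are maps of multicategories preserving involution and $\sigma$.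 $\mathbf{MAdj}$. Objects are categories; a multimap $A_1,\ldots,A_n\to A_0^\bullet$ is a functor $F_0\colon A_1\times\cdots\times A_n\to A_0^\bullet$ equipped with $n$-variable left adjoints $F_1,\ldots,F_n$. The involution is $(\ )^\bullet$ and $\sigma$ sends $F_i$ to $F_{i+1}$, so sends $(F_0;F_1,\ldots,F_n)$ to $(F_1;F_2,\ldots,F_n,F_0)$. Composition: if $F_{i0}\colon A_{i1}\times\cdots\times A_{in_i}\to A_{i0}^\bullet=B_i$ ($1\le i\le k$) and $G_0\colon B_1\times\cdots\times B_k\to B_0^\bullet$ are equipped with multivariable left adjoints, the composite is $G_0(F_{10},\ldots,F_{k0})$ with the multivariable left adjoints determined by composing 1-variable adjunctions: with $b_q=F_{q0}(a_{q1},\ldots,a_{qn_q})$, $B_0(G_0(b_1,\ldots,b_k),b_0)\cong B_i(G_i(b_{i+1},\ldots,b_0,\ldots,b_{i-1}),b_i)=A_{i0}(F_{i0}(a_{i1},\ldots,a_{in_i}),G_i(b_{i+1},\ldots,b_0,\ldots,b_{i-1}))\cong A_{ij}(F_{ij}(a_{i,j+1},\ldots,a_{in_i},G_i(\ldots),a_{i1},\ldots,a_{i,j-1}),a_{ij})$. Cyclic double multicategories. A cyclic double multicategory is a category object in the category of cyclic multicategories: cyclic multicategories $\mathcal A,\mathcal B$ with maps of cyclic multicategories $s,t\colon\mathcal B\to\mathcal A$ (horizontal source and target), $I\colon\mathcal A\to\mathcal B$ (horizontal identities), $\gamma\colon\mathcal B\times_{\mathcal A}\mathcal B\to\mathcal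 B$ (horizontal composition) satisfying the category axioms. Objects of $\mathcal A$ are the 0-cells, multimaps of $\mathcal A$ the vertical 1-cells, objects of $\mathcal B$ the horizontal 1-cells, multimaps of $\mathcal B$ the 2-cells. ''Extending $\mathbf{MAdj}$'' means $\mathcal A=\mathbf{MAdj}$. Mates. For functors $F_0,G_0$ equipped with $n$-variable left adjoints $F_i,G_i$, functors $S_i\colon A_i\to B_i$ and $\alpha\colon S_0^\bullet F_0\Rightarrow G_0(S_1\times\cdots\times S_n)$ (components $G_0(S_1a_1,\ldots,S_na_n)\to S_0F_0(a_1,\ldots,a_n)$ in $B_0$), the mate $\alpha_{01}\colon S_1^\bullet F_1\Rightarrow G_1(S_2\times\cdots\times S_n\times S_0)$ has component $G_1(S_2a_2,\ldots,S_na_n,S_0a_0)\to S_1F_1(\hat a_1)$ corresponding under $B_0(G_0(\hat b_0),b_0)\cong B_1(G_1(\hat b_1),b_1)$ to the composite $G_0(S_1F_1(\hat a_1),S_2a_2,\ldots,S_na_n)\xrightarrow{\alpha}S_0F_0(F_1(\hat a_1),a_2,\ldots,a_n)\xrightarrow{S_0\varepsilon}S_0a_0$, where $\varepsilon\colon F_0(F_1(\hat a_1),a_2,\ldots,a_n)\to a_0$ corresponds to the identity of $F_1(\hat a_1)$ under $A_0(F_0(\hat a_0),a_0)\cong A_1(F_1(\hat a_1),a_1)$. *)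

(* Defs.v *)
From mathcomp Require Import all_boot.
From Stdlib Require Import ProofIrrelevance FunctionalExtensionality.

Set Implicit Arguments.
Unset Strict Implicit.
Unset Printing Implicit Defensive.

(* [compm g f] is the composite g o f. *)
Record category := Category {
  Ob :> Type;
  Hom : Ob -> Ob -> Type;
  idm : forall x, Hom x x;
  compm : forall x y z, Hom y z -> Hom x y -> Hom x z;
  compm_idl : forall x y (f : Hom x y), compm (idm y) f = f;
  compm_idr : forall x y (f : Hom x y), compm f (idm x) = f;
  compm_assoc : forall x y z t (h : Hom z t) (g : Hom y z) (f : Hom x y),
    compm h (compm g f) = compm (compm h g) f }.

Arguments Hom {c} x y.
Arguments idm {c} x.
Arguments compm {c x y z} g f.

Definition op (C : category) : category :=
  @Category C (fun x y => Hom y x) (fun x => idm x)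
    (fun x y z g f => compm f g)
    (fun x y f => compm_idr f) (fun x y f => compm_idl f)
    (fun x y z t h g f => esym (compm_assoc f g h)).

Definition prod_cat (I : Type) (A : I -> category) : category :=
  @Category (forall i, A i) (fun a b => forall i, Hom (a i) (b i))
    (fun a i => idm (a i)) (fun a b c v u i => compm (v i) (u i))
    (fun a b u => functional_extensionality_dep _ _ (fun i => compm_idl (u i)))
    (fun a b u => functional_extensionality_dep _ _ (fun i => compm_idr (u i)))
    (fun a b c d w v u => functional_extensionality_dep _ _
       (fun i => compm_assoc (w i) (v i) (u i))).

Record functor (C D : category) := Functor {
  fob :> C -> D;
  fmap : forall x y, Hom x y -> Hom (fob x) (fob y);
  fmap_id : forall x, fmap (idm x) = idm (fob x);
  fmap_comp : forall x y z (g : Hom y z) (f : Hom x y),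
    fmap (compm g f) = compm (fmap g) (fmap f) }.

Arguments fmap {C D} _ {x y} _.

Definition id_functor (C : category) : functor C C :=
  @Functor C C id (fun _ _ => id) (fun _ => erefl) (fun _ _ _ _ _ => erefl).

Definition comp_functor (C D E : category) (T : functor D E) (S : functor C D) :
    functor C E :=
  @Functor C E (fun x => T (S x)) (fun _ _ f => fmap T (fmap S f))
    (fun x => etrans (congr1 _ (fmap_id S x)) (fmap_id T (S x)))
    (fun x y z g f => etrans (congr1 _ (fmap_comp S g f))
                             (fmap_comp T (fmap S g) (fmap S f))).

Definition op_functor (C D : category) (S : functor C D) :
    functor (op C) (op D) :=
  @Functor (op C) (op D) S (fun _ _ f => fmap S f) (fmap_id S)
    (fun x y z g f => fmap_comp S f g).

Definition prod_functor (I : Type) (A B : I -> category)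
    (S : forall i, functor (A i) (B i)) : functor (prod_cat A) (prod_cat B) :=
  @Functor (prod_cat A) (prod_cat B) (fun a i => S i (a i))
    (fun _ _ u i => fmap (S i) (u i))
    (fun a => functional_extensionality_dep _ _ (fun i => fmap_id (S i) (a i)))
    (fun a b c v u => functional_extensionality_dep _ _
       (fun i => fmap_comp (S i) (v i) (u i))).

Definition reindex_functor (I J : Type) (A : J -> category) (e : I -> J) :
    functor (prod_cat A) (prod_cat (fun i => A (e i))) :=
  @Functor (prod_cat A) (prod_cat (fun i => A (e i)))
    (fun a i => a (e i)) (fun _ _ u i => u (e i))
    (fun _ => erefl) (fun _ _ _ _ _ => erefl).

Record nat_trans (C D : category) (F G : functor C D) := NatTrans {
  component :> forall x, Hom (F x) (G x);
  naturality : forall x y (f : Hom x y),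
    compm (component y) (fmap F f) = compm (fmap G f) (component x) }.

(* The type of all arrows of all categories.  An equation [Arrow f = Arrow g]
   says that f and g live in the same category, have the same source and
   target, and are equal. *)
Record arrow := Arrow' {
  arrow_cat : category;
  arrow_src : arrow_cat;
  arrow_tgt : arrow_cat;
  arrow_hom : Hom arrow_src arrow_tgt }.

Notation Arrow := (@Arrow' _ _ _).
Notation Arrow_in C := (@Arrow' C _ _).

(* The cyclic index set {0, ..., n} is ['I_n.+1], and [ordS] is i |-> i + 1
   mod n + 1.  The domain A_{i+1} x ... x A_{i-1} of F_i is the product indexed
   by {j | j <> i}; the restriction [omit i a] of a full family
   a = (a_0, ..., a_n) is the family written \hat a_i. *)
Definition but (n : nat) (i : 'I_n.+1) := {j : 'I_n.+1 | j != i}.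

Definition omit (n : nat) (P : 'I_n.+1 -> Type) (i : 'I_n.+1)
    (a : forall j, P j) : forall j : but i, P (val j) := fun j => a (val j).
Arguments omit {n P} i a j.

Definition prod_but (n : nat) (A : 'I_n.+1 -> category) (i : 'I_n.+1) :
  category := prod_cat (fun j : but i => A (val j)).

Section AdjHom.
Variables (n : nat) (A : 'I_n.+1 -> category).
Variable F : forall i, functor (prod_but A i) (op (A i)).

Definition adj_hom (a : forall j, A j) (i : 'I_n.+1) : Type :=
  @Hom (A i) (F i (omit i a)) (a i).

(* The functoriality of A_i(F_i(\hat a_i), a_i) in all the variables:
   F_i lands in the opposite of A_i, so all of them are covariant. *)
Definition adj_hom_map (a b : forall j, A j) (u : forall j, Hom (a j) (b j))
    (i : 'I_n.+1) (x : adj_hom a i) : adj_hom b i :=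
  compm (u i) (compm x (fmap (F i) (x := omit i a) (y := omit i b) (omit i u))).

Definition adj_step (theta : forall a i, adj_hom a i -> adj_hom a (ordS i))
    (a : forall j, A j) (x : {i & adj_hom a i}) : {i & adj_hom a i} :=
  existT _ (ordS (tag x)) (theta a (tag x) (tagged x)).

End AdjHom.

Record madj (n : nat) (A : 'I_n.+1 -> category) := MAdjunction {
  ladj :> forall i, functor (prod_but A i) (op (A i));
  transpose : forall a i, adj_hom ladj a i -> adj_hom ladj a (ordS i);
  transpose_bij : forall a i, bijective (@transpose a i);
  transpose_nat : forall (a b : forall j, A j) (u : forall j, Hom (a j) (b j))
      (i : 'I_n.+1) (x : adj_hom ladj a i),
    transpose (adj_hom_map u x) = adj_hom_map u (transpose x);
  transpose_cycle : forall a (x : {i & adj_hom ladj a i}),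
    iter n.+1 (adj_step transpose (a := a)) x = x }.

Arguments transpose {n A} m {a i} x.

(* x and y correspond to each other under the isomorphism
   A_i(F_i(\hat a_i), a_i) ~ A_j(F_j(\hat a_j), a_j). *)
Definition corresponds (n : nat) (A : 'I_n.+1 -> category) (F : madj A)
    (a : forall j, A j) (i j : 'I_n.+1)
    (x : adj_hom F a i) (y : adj_hom F a j) : Prop :=
  exists m, iter m (adj_step (@transpose _ _ F) (a := a)) (existT _ i x)
            = existT _ j y.

(* Multimaps form a single type, fibred over their domains and codomains, so
   that equations between multimaps of provably equal types need no
   transport. *)
Record multigraph := Multigraph {
  obj : Type;
  mmap : Type;
  dom : mmap -> seq obj;
  cod : mmap -> obj }.

Arguments dom {m} f.
Arguments cod {m} f.

Definition composable (X : multigraph) (g : mmap X) (fs : seq (mmap X)) : Prop :=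
  [seq cod f | f <- fs] = dom g.

Record block (X : multigraph) := Block {
  btop : mmap X;
  bargs : seq (mmap X);
  bcomp : composable btop bargs }.

Record multicategory (X : multigraph) := Multicategory {
  mid : obj X -> mmap X;
  mcomp : forall (g : mmap X) (fs : seq (mmap X)), composable g fs -> mmap X;
  dom_id : forall x, dom (mid x) = [:: x];
  cod_id : forall x, cod (mid x) = x;
  dom_comp : forall g fs (p : composable g fs),
    dom (mcomp p) = flatten [seq dom f | f <- fs];
  cod_comp : forall g fs (p : composable g fs), cod (mcomp p) = cod g;
  mcomp_idl : forall f (p : composable (mid (cod f)) [:: f]), mcomp p = f;
  mcomp_idr : forall f (p : composable f [seq mid x | x <- dom f]), mcomp p = f;
  mcomp_assoc : forall (g : mmap X) (bs : seq (block X))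
      (p : composable g [seq btop b | b <- bs])
      (q : composable (mcomp p) (flatten [seq bargs b | b <- bs]))
      (r : composable g [seq mcomp (bcomp b) | b <- bs]),
    mcomp q = mcomp r }.

Arguments mid {X} m x.
Arguments mcomp {X} m {g fs} p.

(* The arguments of g in the partial composite of g and f at input i, which is
   g(1, ..., 1, f, 1, ..., 1); inputs are counted from 0 here. *)
Definition insert_at (X : multigraph) (M : multicategory X) (i : nat)
    (g f : mmap X) : seq (mmap X) :=
  [seq mid M x | x <- take i (dom g)] ++ f
    :: [seq mid M x | x <- drop i.+1 (dom g)].

Record cyclic_multicategory (X : multigraph) := CyclicMulticategory {
  multi :> multicategory X;
  invol : obj X -> obj X;
  involK : involutive invol;
  sigma : mmap X -> mmap X;
  sigma_bij : bijective sigma;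
  dom_sigma : forall f x l, dom f = x :: l ->
    dom (sigma f) = rcons l (invol (cod f));
  cod_sigma : forall f x l, dom f = x :: l -> cod (sigma f) = invol x;
  sigma_nullary : forall f, dom f = [::] -> sigma f = f;
  sigma_cycle : forall f, iter (size (dom f)).+1 sigma f = f;
  sigma_id : forall x, sigma (mid multi x) = mid multi (invol x);
  sigma_comp_first : forall (g f : mmap X)
      (p : composable g (insert_at multi 0 g f))
      (q : composable (sigma f)
             (insert_at multi (size (dom (sigma f))).-1 (sigma f) (sigma g))),
    dom f <> [::] -> sigma (mcomp multi p) = mcomp multi q;
  sigma_comp_next : forall (g f : mmap X) (i : nat)
      (p : composable g (insert_at multi i.+1 g f))
      (q : composable (sigma g) (insert_at multi i (sigma g) f)),
    sigma (mcomp multi p) = mcomp multi q }.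

Arguments invol {X} c x.
Arguments sigma {X} c f.

Record cyclic_map (X Y : multigraph) (CX : cyclic_multicategory X)
    (CY : cyclic_multicategory Y) := CyclicMap {
  on_obj : obj X -> obj Y;
  on_mmap : mmap X -> mmap Y;
  cmap_dom : forall f, dom (on_mmap f) = [seq on_obj x | x <- dom f];
  cmap_cod : forall f, cod (on_mmap f) = on_obj (cod f);
  cmap_id : forall x, on_mmap (mid CX x) = mid CY (on_obj x);
  cmap_comp : forall g fs (p : composable g fs)
      (q : composable (on_mmap g) [seq on_mmap f | f <- fs]),
    on_mmap (mcomp CX p) = mcomp CY q;
  cmap_inv : forall x, on_obj (invol CX x) = invol CY (on_obj x);
  cmap_sigma : forall f, on_mmap (sigma CX f) = sigma CY (on_mmap f) }.

Arguments on_obj {X Y CX CY} c x.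
Arguments on_mmap {X Y CX CY} c f.

Record pullback (U V W : Type) (f : U -> W) (g : V -> W) := Pb {
  pb1 : U;
  pb2 : V;
  pb_eq : f pb1 = g pb2 }.

Arguments Pb {U V W f g} pb1 pb2 pb_eq.

Section PullbackTypes.
Variables (U V W : Type) (f : U -> W) (g : V -> W).
Let P := pullback f g.

Lemma pb_inj (x y : P) : pb1 x = pb1 y -> pb2 x = pb2 y -> x = y.
Proof.
case: x y => [x1 x2 ex] [y1 y2 ey] /= e1 e2; subst y1 y2.
by rewrite (proof_irrelevance _ ex ey).
Qed.

Lemma pbs_inj (l l' : seq P) :
  map (@pb1 _ _ _ f g) l = map (@pb1 _ _ _ f g) l' ->
  map (@pb2 _ _ _ f g) l = map (@pb2 _ _ _ f g) l' -> l = l'.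
Proof.
elim: l l' => [|x l IH] [|y l'] //= [e1 e1'] [e2 e2'].
by rewrite (pb_inj e1 e2) (IH l').
Qed.

Lemma pbs_head x l y l' : map f (x :: l) = map g (y :: l') -> f x = g y.
Proof. by case. Qed.

Lemma pbs_tail x l y l' :
  map f (x :: l) = map g (y :: l') -> map f l = map g l'.
Proof. by case. Qed.

Fixpoint pair_up (l : seq U) (l' : seq V) : map f l = map g l' -> seq P :=
  match l, l' return map f l = map g l' -> seq P with
  | x :: l0, y :: l0' => fun e =>
      Pb x y (pbs_head e) :: pair_up (pbs_tail e)
  | _, _ => fun _ => [::]
  end.

Lemma pair_up1 l l' (e : map f l = map g l') :
  map (@pb1 _ _ _ f g) (pair_up e) = l.
Proof. by elim: l l' e => [|x l IH] [|y l'] //= e; rewrite IH. Qed.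

Lemma pair_up2 l l' (e : map f l = map g l') :
  map (@pb2 _ _ _ f g) (pair_up e) = l'.
Proof. by elim: l l' e => [|x l IH] [|y l'] //= e; rewrite IH. Qed.

End PullbackTypes.

Section Pullback.
Variables (X Y Z : multigraph).
Variables (CX : cyclic_multicategory X) (CY : cyclic_multicategory Y).
Variable CZ : cyclic_multicategory Z.
Variables (t : cyclic_map CX CZ) (s : cyclic_map CY CZ).

Notation pobj := (pullback (on_obj t) (on_obj s)).
Notation pmmap := (pullback (on_mmap t) (on_mmap s)).

Lemma pb_dom_eq (f : pmmap) :
  map (on_obj t) (dom (pb1 f)) = map (on_obj s) (dom (pb2 f)).
Proof. by rewrite -!cmap_dom pb_eq. Qed.

Lemma pb_cod_eq (f : pmmap) :
  on_obj t (cod (pb1 f)) = on_obj s (cod (pb2 f)).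
Proof. by rewrite -!cmap_cod pb_eq. Qed.

Definition pb_graph : multigraph :=
  @Multigraph pobj pmmap (fun f => pair_up (pb_dom_eq f))
    (fun f => Pb (cod (pb1 f)) (cod (pb2 f)) (pb_cod_eq f)).

Local Notation pO1 := (@pb1 _ _ _ (on_obj t) (on_obj s)).
Local Notation pO2 := (@pb2 _ _ _ (on_obj t) (on_obj s)).
Local Notation pM1 := (@pb1 _ _ _ (on_mmap t) (on_mmap s)).
Local Notation pM2 := (@pb2 _ _ _ (on_mmap t) (on_mmap s)).

Lemma pb_dom1 (f : mmap pb_graph) : map pO1 (dom f) = dom (pb1 f).
Proof. exact: pair_up1. Qed.

Lemma pb_dom2 (f : mmap pb_graph) : map pO2 (dom f) = dom (pb2 f).
Proof. exact: pair_up2. Qed.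

Lemma pb_composable1 (g : mmap pb_graph) (fs : seq (mmap pb_graph)) :
  composable g fs -> composable (pb1 g) (map pM1 fs).
Proof. by move=> p; rewrite /composable -pb_dom1 -p -!map_comp. Qed.

Lemma pb_composable2 (g : mmap pb_graph) (fs : seq (mmap pb_graph)) :
  composable g fs -> composable (pb2 g) (map pM2 fs).
Proof. by move=> p; rewrite /composable -pb_dom2 -p -!map_comp. Qed.

Lemma mcomp_congr (U : multigraph) (M : multicategory U) (g g' : mmap U) fs fs'
    (p : composable g fs) (p' : composable g' fs') :
  g = g' -> fs = fs' -> mcomp M p = mcomp M p'.
Proof. by move=> eg ef; subst g' fs'; rewrite (proof_irrelevance _ p p'). Qed.

Lemma map_composable (U U' : multigraph) (C : cyclic_multicategory U)
    (C' : cyclic_multicategory U') (h : cyclic_map C C') g fs :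
  composable g fs -> composable (on_mmap h g) (map (on_mmap h) fs).
Proof.
rewrite /composable => p; rewrite cmap_dom -p -!map_comp.
by apply: eq_map => f /=; rewrite cmap_cod.
Qed.

Lemma map_pb_eq (fs : seq pmmap) :
  map (on_mmap t) (map pM1 fs) = map (on_mmap s) (map pM2 fs).
Proof. by rewrite -!map_comp; apply: eq_map => f /=; rewrite pb_eq. Qed.

Lemma pb_id_eq (x : pobj) :
  on_mmap t (mid CX (pb1 x)) = on_mmap s (mid CY (pb2 x)).
Proof. by rewrite !cmap_id pb_eq. Qed.

Lemma pb_comp_eq (g : mmap pb_graph) (fs : seq (mmap pb_graph))
    (p : composable g fs) :
  on_mmap t (mcomp CX (pb_composable1 p)) =
  on_mmap s (mcomp CY (pb_composable2 p)).
Proof.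
rewrite (cmap_comp _ (map_composable t (pb_composable1 p))).
rewrite (cmap_comp _ (map_composable s (pb_composable2 p))).
by apply: mcomp_congr; [rewrite pb_eq | rewrite map_pb_eq].
Qed.

Definition pb_id (x : obj pb_graph) : mmap pb_graph := Pb _ _ (pb_id_eq x).

Definition pb_comp (g : mmap pb_graph) (fs : seq (mmap pb_graph))
  (p : composable g fs) : mmap pb_graph := Pb _ _ (pb_comp_eq p).

Lemma pb_list_inj (l l' : seq (obj pb_graph)) :
  map pO1 l = map pO1 l' -> map pO2 l = map pO2 l' -> l = l'.
Proof. exact: pbs_inj. Qed.

Lemma pb_mmap_inj (f g : mmap pb_graph) : pb1 f = pb1 g -> pb2 f = pb2 g -> f = g.
Proof. exact: pb_inj. Qed.

Lemma pb_flatten1 (fs : seq (mmap pb_graph)) :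
  map pO1 (flatten (map dom fs)) = flatten (map dom (map pM1 fs)).
Proof. by elim: fs => //= f fs IH; rewrite map_cat IH pair_up1. Qed.

Lemma pb_flatten2 (fs : seq (mmap pb_graph)) :
  map pO2 (flatten (map dom fs)) = flatten (map dom (map pM2 fs)).
Proof. by elim: fs => //= f fs IH; rewrite map_cat IH pair_up2. Qed.

Lemma pb_dom_id (x : obj pb_graph) : dom (pb_id x) = [:: x].
Proof. by apply: pb_list_inj; rewrite ?pb_dom1 ?pb_dom2 /= dom_id. Qed.

Lemma pb_cod_id (x : obj pb_graph) : cod (pb_id x) = x.
Proof. by apply: pb_inj; rewrite /= cod_id. Qed.

Lemma pb_dom_comp (g : mmap pb_graph) fs (p : composable g fs) :
  dom (pb_comp p) = flatten (map dom fs).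
Proof.
by apply: pb_list_inj;
  rewrite ?pb_dom1 ?pb_dom2 ?pb_flatten1 ?pb_flatten2 /= dom_comp.
Qed.

Lemma pb_cod_comp (g : mmap pb_graph) fs (p : composable g fs) :
  cod (pb_comp p) = cod g.
Proof. by apply: pb_inj; rewrite /= cod_comp. Qed.

Lemma mcomp_idl' (U : multigraph) (M : multicategory U) x f fs
    (p : composable (mid M x) fs) : x = cod f -> fs = [:: f] -> mcomp M p = f.
Proof. by move=> ex ef; subst x fs; apply: mcomp_idl. Qed.

Lemma mcomp_idr' (U : multigraph) (M : multicategory U) f fs
    (p : composable f fs) : fs = map (mid M) (dom f) -> mcomp M p = f.
Proof. by move=> ef; subst fs; apply: mcomp_idr. Qed.

Lemma pb_comp_idl (f : mmap pb_graph)
    (p : composable (pb_id (cod f)) [:: f]) : pb_comp p = f.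
Proof. by apply: pb_mmap_inj; apply: mcomp_idl'. Qed.

Lemma pb_comp_idr (f : mmap pb_graph)
    (p : composable f [seq pb_id x | x <- dom f]) : pb_comp p = f.
Proof.
apply: pb_mmap_inj; apply: mcomp_idr'.
  by rewrite -pb_dom1 -!map_comp.
by rewrite -pb_dom2 -!map_comp.
Qed.

Definition pb_block1 (b : block pb_graph) : block X :=
  Block (pb_composable1 (bcomp b)).
Definition pb_block2 (b : block pb_graph) : block Y :=
  Block (pb_composable2 (bcomp b)).

Lemma mcomp_assoc' (U : multigraph) (M : multicategory U) (g : mmap U)
    (bs : seq (block U)) fs k hs ks (p : composable g fs) (q : composable k hs)
    (r : composable g ks) :
  fs = [seq btop b | b <- bs] -> k = mcomp M p ->
  hs = flatten [seq bargs b | b <- bs] ->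
  ks = [seq mcomp M (bcomp b) | b <- bs] -> mcomp M q = mcomp M r.
Proof. by move=> ef ek eh es; subst fs k hs ks; apply: mcomp_assoc. Qed.

Lemma pb_comp_assoc (g : mmap pb_graph) (bs : seq (block pb_graph))
    (p : composable g [seq btop b | b <- bs])
    (q : composable (pb_comp p) (flatten [seq bargs b | b <- bs]))
    (r : composable g [seq pb_comp (bcomp b) | b <- bs]) :
  pb_comp q = pb_comp r.
Proof.
apply: pb_mmap_inj => /=.
  apply: (mcomp_assoc' (bs := map pb_block1 bs) (p := pb_composable1 p)) => //.
  - by rewrite -!map_comp.
  - by rewrite map_flatten -!map_comp.
  - by rewrite -!map_comp.
apply: (mcomp_assoc' (bs := map pb_block2 bs) (p := pb_composable2 p)) => //.
- by rewrite -!map_comp.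
- by rewrite map_flatten -!map_comp.
- by rewrite -!map_comp.
Qed.

Definition pb_multi : multicategory pb_graph :=
  @Multicategory pb_graph pb_id pb_comp pb_dom_id pb_cod_id pb_dom_comp
    pb_cod_comp pb_comp_idl pb_comp_idr pb_comp_assoc.

Lemma pb_inv_eq (x : pobj) :
  on_obj t (invol CX (pb1 x)) = on_obj s (invol CY (pb2 x)).
Proof. by rewrite !cmap_inv pb_eq. Qed.

Lemma pb_sigma_eq (f : pmmap) :
  on_mmap t (sigma CX (pb1 f)) = on_mmap s (sigma CY (pb2 f)).
Proof. by rewrite !cmap_sigma pb_eq. Qed.

Definition pb_invol (x : obj pb_graph) : obj pb_graph := Pb _ _ (pb_inv_eq x).

Definition pb_sigma (f : mmap pb_graph) : mmap pb_graph :=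
  Pb _ _ (pb_sigma_eq f).

Lemma pb_invK : involutive pb_invol.
Proof. by move=> x; apply: pb_inj; rewrite /= involK. Qed.

Lemma pb_size1 (f : mmap pb_graph) : size (dom f) = size (dom (pb1 f)).
Proof. by rewrite -pb_dom1 size_map. Qed.

Lemma pb_size2 (f : mmap pb_graph) : size (dom f) = size (dom (pb2 f)).
Proof. by rewrite -pb_dom2 size_map. Qed.

Lemma pb_sigma_cycle (f : mmap pb_graph) :
  iter (size (dom f)).+1 pb_sigma f = f.
Proof.
have it1 m : pb1 (iter m pb_sigma f) = iter m (sigma CX) (pb1 f).
  by elim: m => //= m ->.
have it2 m : pb2 (iter m pb_sigma f) = iter m (sigma CY) (pb2 f).
  by elim: m => //= m ->.
apply: pb_mmap_inj; first by rewrite it1 pb_size1 sigma_cycle.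
by rewrite it2 pb_size2 sigma_cycle.
Qed.

Lemma pb_dom_cons1 (f : mmap pb_graph) x l :
  dom f = x :: l -> dom (pb1 f) = pb1 x :: map pO1 l.
Proof. by rewrite -pb_dom1 => ->. Qed.

Lemma pb_dom_cons2 (f : mmap pb_graph) x l :
  dom f = x :: l -> dom (pb2 f) = pb2 x :: map pO2 l.
Proof. by rewrite -pb_dom2 => ->. Qed.

Lemma pb_dom_sigma (f : mmap pb_graph) x l : dom f = x :: l ->
  dom (pb_sigma f) = rcons l (pb_invol (cod f)).
Proof.
move=> e; apply: pb_list_inj; rewrite ?pb_dom1 ?pb_dom2 map_rcons /=.
  exact: dom_sigma (pb_dom_cons1 e).
exact: dom_sigma (pb_dom_cons2 e).
Qed.

Lemma pb_cod_sigma (f : mmap pb_graph) x l :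
  dom f = x :: l -> cod (pb_sigma f) = pb_invol x.
Proof.
move=> e; apply: pb_inj => /=.
  exact: cod_sigma (pb_dom_cons1 e).
exact: cod_sigma (pb_dom_cons2 e).
Qed.

Lemma pb_sigma_nullary (f : mmap pb_graph) : dom f = [::] -> pb_sigma f = f.
Proof.
move=> e; apply: pb_mmap_inj => /=; apply: sigma_nullary.
  by rewrite -pb_dom1 e.
by rewrite -pb_dom2 e.
Qed.

Lemma pb_sigma_bij : bijective pb_sigma.
Proof.
exists (fun f => iter (size (dom f)) pb_sigma f) => f; last first.
  by rewrite -iterS pb_sigma_cycle.
have -> : size (dom (pb_sigma f)) = size (dom f).
  case e : (dom f) => [|x l]; first by rewrite pb_sigma_nullary // e.
  by rewrite (pb_dom_sigma e) size_rcons.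
by rewrite -iterSr pb_sigma_cycle.
Qed.

Lemma pb_sigma_id (x : obj pb_graph) : pb_sigma (pb_id x) = pb_id (pb_invol x).
Proof. by apply: pb_mmap_inj; rewrite /= sigma_id. Qed.

Lemma pb_insert1 i (g f : mmap pb_graph) :
  map pM1 (insert_at pb_multi i g f) = insert_at CX i (pb1 g) (pb1 f).
Proof.
rewrite /insert_at -[dom (pb1 g)]pb_dom1 -map_take -map_drop map_cat map_cons.
by rewrite -!map_comp.
Qed.

Lemma pb_insert2 i (g f : mmap pb_graph) :
  map pM2 (insert_at pb_multi i g f) = insert_at CY i (pb2 g) (pb2 f).
Proof.
rewrite /insert_at -[dom (pb2 g)]pb_dom2 -map_take -map_drop map_cat map_cons.
by rewrite -!map_comp.
Qed.

Lemma pb_sigma_comp_first (g f : mmap pb_graph)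
    (p : composable g (insert_at pb_multi 0 g f))
    (q : composable (pb_sigma f)
       (insert_at pb_multi (size (dom (pb_sigma f))).-1 (pb_sigma f) (pb_sigma g))) :
  dom f <> [::] -> pb_sigma (pb_comp p) = pb_comp q.
Proof.
move=> ne; apply: pb_mmap_inj => /=.
- move: (pb_composable1 p) (pb_composable1 q).
  rewrite !pb_insert1 pb_size1 => p1 q1; apply: sigma_comp_first.
  by move=> e; apply: ne; apply/size0nil; rewrite pb_size1 e.
- move: (pb_composable2 p) (pb_composable2 q).
  rewrite !pb_insert2 pb_size2 => p2 q2; apply: sigma_comp_first.
  by move=> e; apply: ne; apply/size0nil; rewrite pb_size2 e.
Qed.

Lemma pb_sigma_comp_next (g f : mmap pb_graph) (i : nat)
    (p : composable g (insert_at pb_multi i.+1 g f))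
    (q : composable (pb_sigma g) (insert_at pb_multi i (pb_sigma g) f)) :
  pb_sigma (pb_comp p) = pb_comp q.
Proof.
apply: pb_mmap_inj => /=.
- move: (pb_composable1 p) (pb_composable1 q).
  by rewrite !pb_insert1 => p1 q1; apply: sigma_comp_next.
- move: (pb_composable2 p) (pb_composable2 q).
  by rewrite !pb_insert2 => p2 q2; apply: sigma_comp_next.
Qed.

Definition pb_cyclic : cyclic_multicategory pb_graph :=
  @CyclicMulticategory pb_graph pb_multi pb_invol pb_invK pb_sigma pb_sigma_bij
    pb_dom_sigma pb_cod_sigma pb_sigma_nullary pb_sigma_cycle pb_sigma_id
    pb_sigma_comp_first pb_sigma_comp_next.

End Pullback.

(* The axioms of a category with type of objects U, type of arrows V, source s,
   target t, identities i and composition c, in diagrammatic order. *)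
Definition category_laws (U V : Type) (s t : V -> U) (i : U -> V)
    (c : pullback t s -> V) : Prop :=
  [/\ (forall u, s (i u) = u) /\ (forall u, t (i u) = u),
      forall fg, s (c fg) = s (pb1 fg) /\ t (c fg) = t (pb2 fg),
      forall f (e : t (i (s f)) = s f), c (Pb (i (s f)) f e) = f,
      forall f (e : t f = s (i (t f))), c (Pb f (i (t f)) e) = f &
      forall f g h (e : t f = s g) (e' : t g = s h)
        (e1 : t (c (Pb f g e)) = s h) (e2 : t f = s (c (Pb g h e'))),
        c (Pb (c (Pb f g e)) h e1) = c (Pb f (c (Pb g h e')) e2)].

Record cyclic_double_multicategory (X Y : multigraph) := CyclicDouble {
  vert : cyclic_multicategory X;
  cells : cyclic_multicategory Y;
  hsrc : cyclic_map cells vert;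
  htgt : cyclic_map cells vert;
  hid : cyclic_map vert cells;
  hcomp : cyclic_map (pb_cyclic htgt hsrc) cells;
  laws_obj : @category_laws _ _ (on_obj hsrc) (on_obj htgt) (on_obj hid)
               (on_obj hcomp);
  laws_mmap : @category_laws _ _ (on_mmap hsrc) (on_mmap htgt) (on_mmap hid)
                (on_mmap hcomp) }.

Record vcell := VCell {
  varity : nat;
  vcat : 'I_varity.+1 -> category;
  vadj :> madj vcat }.

Arguments VCell {varity vcat} vadj.
Arguments vcat v i : clear implicits.

Definition madj_graph : multigraph :=
  @Multigraph category vcell
    (fun F => [seq vcat F (lift ord0 j) | j <- enum 'I_(varity F)])
    (fun F => op (vcat F ord0)).

Lemma ordS_but_subproof n (i : 'I_n.+1) (j : but i) : ordS (val j) != ordS i.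
Proof. by rewrite (inj_eq (@ordS_inj _)); case: j. Qed.

Definition ordS_but n (i : 'I_n.+1) (j : but i) : but (ordS i) :=
  exist _ (ordS (val j)) (ordS_but_subproof j).

(* F' is (F_1; F_2, ..., F_n, F_0): on objects,
   F'_i (\hat{a'}_i) = F_{i+1} (\hat a_{i+1}) for a' = (a_1, ..., a_n, a_0). *)
Definition is_rotation n (A : 'I_n.+1 -> category)
    (F : madj A) (F' : madj (fun i => A (ordS i))) : Prop :=
  (forall i, comp_functor (F' i)
               (reindex_functor (fun k : but (ordS i) => A (val k)) (@ordS_but n i))
             = F (ordS i)) /\
  (forall (a : forall j, A j) i (x' : adj_hom F' (fun j => a (ordS j)) i)
      (x : adj_hom F a (ordS i)),
    Arrow x' = Arrow x -> Arrow (transpose F' x') = Arrow (transpose F x)).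

Section Composite.

(* G = (G_0, G_1, ..., G_k) has source B_1, ..., B_k; F_q, for 0 <= q < k, is
   put at the input B_{q+1} = A_{q,0}^op of G; H is the composite. *)
Variables (G : vcell) (F : 'I_(varity G) -> vcell) (H : vcell).

(* The input of H that is the input j of F_q; it is counted from 0. *)
Definition input_pos (q : 'I_(varity G)) (j : nat) : nat :=
  flatten_index [seq varity (F r) | r <- enum 'I_(varity G)] q j.

(* Compatible families of arrows w in (C_p)_p, u_q in (A_{q,j})_j and v in
   (B_q)_q.  The family w is arbitrary and determines the other ones:
   - v_0 = w_0, and the u_{q,j} with j > 0 are the entries of w other than w_0;
   - v_{q+1} = F_{q,0} (u_{q,1}, ..., u_{q,n_q});
   - u_{q,0} = G_{q+1} (v_{q+2}, ..., v_k, v_0, v_1, ..., v_q). *)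
Definition compatible (c c' : forall p, vcat H p) (w : forall p, Hom (c p) (c' p))
    (a a' : forall q j, vcat (F q) j) (u : forall q j, Hom (a q j) (a' q j))
    (b b' : forall q, vcat G q) (v : forall q, Hom (b q) (b' q)) : Prop :=
  [/\ Arrow (v ord0) = Arrow (w ord0),
      forall q (j : 'I_(varity (F q))) (p : 'I_(varity H)),
        p = input_pos q j :> nat ->
        Arrow (u q (lift ord0 j)) = Arrow (w (lift ord0 p)),
      forall q, Arrow (v (lift ord0 q)) =
        Arrow (fmap (F q ord0) (x := omit ord0 (a q)) (y := omit ord0 (a' q))
                 (omit ord0 (u q))) &
      forall q, Arrow (u q ord0) =
        Arrow (fmap (G (lift ord0 q)) (x := omit _ b) (y := omit _ b')
                 (omit (lift ord0 q) v))].

Definition compatible_obj (c : forall p, vcat H p)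
    (a : forall q j, vcat (F q) j) (b : forall q, vcat G q) : Prop :=
  compatible (fun p => idm (c p)) (fun q j => idm (a q j)) (fun q => idm (b q)).

(* H_0 = G_0 (F_{0,0}, F_{1,0}, ...) and, at the input j of F_q,
   H_p = F_{q,j+1} (..., G_{q+1} (...), ...). *)
Definition composite_functors : Prop :=
  forall (c c' : forall p, vcat H p) (w : forall p, Hom (c p) (c' p))
    (a a' : forall q j, vcat (F q) j) (u : forall q j, Hom (a q j) (a' q j))
    (b b' : forall q, vcat G q) (v : forall q, Hom (b q) (b' q)),
  compatible w u v ->
  Arrow (fmap (H ord0) (x := omit _ c) (y := omit _ c') (omit ord0 w)) =
  Arrow (fmap (G ord0) (x := omit _ b) (y := omit _ b') (omit ord0 v)) /\
  forall q (j : 'I_(varity (F q))) (p : 'I_(varity H)),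
    p = input_pos q j :> nat ->
    Arrow (fmap (H (lift ord0 p)) (x := omit _ c) (y := omit _ c')
             (omit (lift ord0 p) w)) =
    Arrow (fmap (F q (lift ord0 j)) (x := omit _ (a q)) (y := omit _ (a' q))
             (omit (lift ord0 j) (u q))).

(* The isomorphism between the hom-sets of H at 0 and at the input j of F_q is
   B_0(G_0(b_1, ..., b_k), b_0) ~ B_{q+1}(G_{q+1}(...), b_{q+1})
     = A_{q,0}(F_{q,0}(...), G_{q+1}(...)) ~ A_{q,j+1}(F_{q,j+1}(...), a_{q,j+1}),
   where the equality reverses arrows since B_{q+1} = A_{q,0}^op. *)
Definition composite_transpose : Prop :=
  forall (c : forall p, vcat H p) (a : forall q j, vcat (F q) j)
    (b : forall q, vcat G q),
  compatible_obj c a b ->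
  forall q (j : 'I_(varity (F q))) (p : 'I_(varity H)),
  p = input_pos q j :> nat ->
  forall (x : adj_hom H c ord0) (x' : adj_hom H c (lift ord0 p))
    (y : adj_hom G b ord0) (y' : adj_hom G b (lift ord0 q))
    (z : adj_hom (F q) (a q) ord0) (z' : adj_hom (F q) (a q) (lift ord0 j)),
  corresponds x x' -> Arrow x = Arrow y ->
  corresponds y y' -> Arrow_in (op (vcat G (lift ord0 q))) y' = Arrow z ->
  corresponds z z' -> Arrow x' = Arrow z'.

Definition is_composite : Prop := composite_functors /\ composite_transpose.

End Composite.

(* Identities are determined by composition. *)
Definition is_MAdj (M : cyclic_multicategory madj_graph) : Prop :=
  [/\ forall A, invol M A = op A,
      forall n (A : 'I_n.+1 -> category) (F : madj A),
        exists2 F' : madj (fun i => A (ordS i)),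
          sigma M (VCell F) = VCell F' & is_rotation F F' &
      forall (G : vcell) (F : 'I_(varity G) -> vcell)
        (p : @composable madj_graph G [seq F q | q <- enum 'I_(varity G)]),
        is_composite F (mcomp M p)].

Record hcell := HCell {
  hcell_src : category;
  hcell_tgt : category;
  hcell_functor :> functor hcell_src hcell_tgt }.

Arguments HCell {hcell_src hcell_tgt} hcell_functor.

(* Natural transformations S_0^op F_0 => G_0 (S_1 x ... x S_n). *)
Definition square n (A B : 'I_n.+1 -> category) (F : madj A) (G : madj B)
    (S : forall i, functor (A i) (B i)) : Type :=
  nat_trans (comp_functor (op_functor (S ord0)) (F ord0))
            (comp_functor (G ord0) (prod_functor (fun j : but ord0 => S (val j)))).

Record cell := Cell {
  carity : nat;
  csrc_cat : 'I_carity.+1 -> category;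
  ctgt_cat : 'I_carity.+1 -> category;
  csrc : madj csrc_cat;
  ctgt : madj ctgt_cat;
  cfun : forall i, functor (csrc_cat i) (ctgt_cat i);
  cnat : square csrc ctgt cfun }.

Arguments Cell {carity csrc_cat ctgt_cat csrc ctgt cfun} cnat.
Arguments cnat c : clear implicits.
Arguments csrc_cat c i : clear implicits.
Arguments ctgt_cat c i : clear implicits.
Arguments csrc c : clear implicits.
Arguments ctgt c : clear implicits.
Arguments cfun c i : clear implicits.

Definition cell_graph : multigraph :=
  @Multigraph hcell cell
    (fun f => [seq HCell (cfun f (lift ord0 j)) | j <- enum 'I_(carity f)])
    (fun f => HCell (op_functor (cfun f ord0))).

Definition cell_src (f : cell) : vcell := VCell (csrc f).
Definition cell_tgt (f : cell) : vcell := VCell (ctgt f).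

(* The equation on [epsilon] says that a_1 = F_1 (\hat a_1) and that [epsilon]
   corresponds to the identity of F_1 (\hat a_1). *)
Definition is_mate n (A B : 'I_n.+1 -> category) (F : madj A) (G : madj B)
    (S : forall i, functor (A i) (B i)) (alpha : square F G S)
    (F' : madj (fun i => A (ordS i))) (G' : madj (fun i => B (ordS i)))
    (alpha' : square F' G' (fun i => S (ordS i))) : Prop :=
  forall (a : forall j, A j) (epsilon : adj_hom F a ord0),
  Arrow (transpose F epsilon) =
    Arrow_in (A (ordS ord0)) (idm (F (ordS ord0) (omit _ a))) ->
  Arrow_in (B (ordS ord0)) (alpha' (omit ord0 (fun j => a (ordS j)))) =
  Arrow (@transpose _ _ G (fun j => S j (a j)) ord0
           (compm (fmap (S ord0) epsilon) (alpha (omit ord0 a)))).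

(* The component of a composite 2-cell is, in the opposite of B'_0,
   S_0 G_0 (F_{0,0}, ...) -> G'_0 (S_1 F_{0,0}, ...) -> G'_0 (F'_{0,0} (...), ...)
   where the first arrow is a component of g and the second one is G'_0 of
   components of the f_q. *)
Definition is_pasting (g : cell) (f : 'I_(carity g) -> cell) (h : cell) : Prop :=
  forall (c : forall p, csrc_cat h p) (a : forall q j, csrc_cat (f q) j)
    (b : forall q, csrc_cat g q),
  @compatible_obj (cell_src g) (fun q => cell_src (f q)) (cell_src h) c a b ->
  forall (b' : forall q, ctgt_cat g q)
    (v : forall q : but ord0, Hom (cfun g (val q) (b (val q))) (b' (val q))),
  (forall (q : 'I_(carity g)) (e : lift ord0 q != ord0),
    Arrow (v (exist _ (lift ord0 q) e)) = Arrow (cnat (f q) (omit ord0 (a q)))) ->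
  Arrow (cnat h (omit ord0 c)) =
  Arrow (compm (fmap (ctgt g ord0) (y := omit ord0 b') v) (cnat g (omit ord0 b))).

(* Main.v *)
Require Import Defs.
From mathcomp Require Import all_boot.
From mathcomp Require Import zify.
From Stdlib Require Import ProofIrrelevance FunctionalExtensionality.
From Stdlib Require Import ClassicalEpsilon.

Set Implicit Arguments.
Unset Strict Implicit.
Unset Printing Implicit Defensive.

(** A 2-cell compares functors whose categories agree only after a permutation
    or a concatenation of lists of indices.  To keep such comparisons free of
    transports, everything is expressed in one partial category, that of all the
    arrows of all categories ([parrow]); an equation there includes the equality
    of categories and ends, and reversing arrows is the involution [oop].  A
    multivariable adjunction is determined by its values on arrows: those of its
    functors on families indexed by natural numbers, and the transposition
    [tr i j] of elements F_i(\hat a_i) -> a_i from the position [i] to the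
    position [j].  The record [uadj] axiomatizes such values; [vcell_ext] and
    [under_realize] say that they are the same thing as adjunctions between
    categories.  All positions are on an equal footing, rotation is a shift of
    the positions ([urot]), and the composite ([ucomp]) transposes from an input
    to the root by transposing inside the argument, reversing, and transposing
    inside the outer adjunction.  The axioms of a cyclic multicategory then
    reduce to [ucomp_idl], [ucomp_idr], [ucomp_assoc], [urot_cycle] and the two
    laws [rotate_next] and [rotate_first] for the composites whose first
    argument is an identity, or whose other arguments are.

    For the 2-cells, the point is that a transformation alpha from F to G acts on
    elements at every position ([cell_act]): at the root it sends x to S_0(x) o alpha,
    and the actions at the other positions are obtained by transposition.  This
    action is natural, and by the Yoneda lemma alpha is determined by the action
    at any single position ([cell_ext_act]), its components being the values at
    universal elements.  In these terms the mate of alpha has the same action as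
    alpha, with the positions renumbered ([cell_act_rot]).  So the mates
    correspondence is cyclic and preserves identities, and it commutes with
    horizontal composition, which composes the actions ([cell_act_hcomp]).  Its
    compatibility with composition ([crot_comp_next], [crot_comp_first]) follows
    from the action of a composite ([cell_act_comp0], [cell_act_compE]) by comparing the
    two sides at the position to which the old root has been moved.  The
    interchange law between pasting and horizontal composition is the naturality
    of the components ([cell_at_interchange]). *)

(** * Partial arrows *)

(** Definite description, through which functional relations between arrows become
    partial operations. *)
Definition the (T : Type) (P : T -> Prop) : option T :=
  match excluded_middle_informative (exists x, P x) with
  | left e => Some (proj1_sig (constructive_indefinite_description P e))
  | right _ => None
  end.

Lemma the_some T (P : T -> Prop) x : the P = Some x -> P x.
Proof.
rewrite /the; case: excluded_middle_informative => // e [<-].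
exact: proj2_sig.
Qed.

Lemma the_none T (P : T -> Prop) : the P = None -> forall x, ~ P x.
Proof.
by rewrite /the; case: excluded_middle_informative => // n _ x Px; apply: n; exists x.
Qed.

Lemma theE T (P : T -> Prop) x : P x -> (forall y, P y -> y = x) -> the P = Some x.
Proof.
move=> Px u; case e : (the P) => [y|]; first by rewrite (u _ (the_some e)).
by case: (the_none e Px).
Qed.

(** [None] stands for an undefined result. *)
Notation parrow := (option arrow).

(** Objects are represented by their identities, and so need no separate treatment. *)
Definition aid (C : category) (x : C) : arrow := Arrow (idm x).

Definition aop (f : arrow) : arrow := @Arrow' (op (arrow_cat f)) _ _ (arrow_hom f).

Definition ocat (f : parrow) : option category := omap arrow_cat f.
Definition osrc (f : parrow) : parrow := omap (fun f => aid (arrow_src f)) f.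
Definition otgt (f : parrow) : parrow := omap (fun f => aid (arrow_tgt f)) f.
Definition oop (f : parrow) : parrow := omap aop f.

Definition ocomp (g f : parrow) : parrow :=
  the (fun h => exists C (x y z : Ob C) (g' : Hom y z) (f' : Hom x y),
    [/\ g = Some (Arrow g'), f = Some (Arrow f') & h = Arrow (compm g' f')]).

Lemma Arrow_inj C (x y : Ob C) (f g : Hom x y) : Arrow f = Arrow g -> f = g.
Proof.
case=> e.
have e1 := EqdepTheory.inj_pair2 _ _ _ _ _ e.
have e2 := EqdepTheory.inj_pair2 _ _ _ _ _ e1.
exact: (EqdepTheory.inj_pair2 _ _ _ _ _ e2).
Qed.

Lemma Arrow_ends C (x y x' y' : Ob C) (f : Hom x y) (g : Hom x' y') :
  Arrow f = Arrow g -> x = x' /\ y = y'.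
Proof.
case=> e1 e2 _.
by split; [move: e1 | move: e2]; exact: EqdepTheory.inj_pair2.
Qed.

Lemma aid_inj C (x y : Ob C) : aid x = aid y -> x = y.
Proof. by move=> /Arrow_ends[]. Qed.

Lemma homP (C : category) (x y : C) (f : parrow) :
  ocat f = Some C -> osrc f = Some (aid x) -> otgt f = Some (aid y) ->
  exists f' : Hom x y, f = Some (Arrow f').
Proof.
case: f => //= -[C' x' y' f] /= [e]; subst C' => /Some_inj e /Some_inj e'.
have ex := aid_inj e; have ey := aid_inj e'.
by subst x' y'; exists f.
Qed.

Lemma ocatP (C : category) (f : parrow) : ocat f = Some C ->
  exists (x y : C) (f' : Hom x y), f = Some (Arrow f').
Proof.
by case: f => //= -[C' x y f] /= [e]; subst C'; exists x, y, f.
Qed.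

(** This is an equality of categories because the laws of a category are propositions. *)
Lemma opK : involutive op.
Proof.
by case=> O H i c p1 p2 p3; rewrite /op /=; congr Category; apply: proof_irrelevance.
Qed.

Lemma Arrow_irr O H i c p1 p2 p3 q1 q2 q3 x y f :
  @Arrow' (@Category O H i c p1 p2 p3) x y f =
  @Arrow' (@Category O H i c q1 q2 q3) x y f.
Proof.
by rewrite (proof_irrelevance _ p1 q1) (proof_irrelevance _ p2 q2)
  (proof_irrelevance _ p3 q3).
Qed.

Lemma aopE C (x y : Ob C) (f : @Hom (op C) x y) :
  aop (@Arrow' (op C) x y f) = @Arrow' C y x f.
Proof. by case: C x y f => O H i c p1 p2 p3 x y f; apply: Arrow_irr. Qed.

Lemma aopK : involutive aop.
Proof. by case=> C x y f; rewrite [aop (Arrow _)]/aop aopE. Qed.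

Lemma oopK : involutive oop.
Proof. by case=> //= f; rewrite aopK. Qed.

Lemma ocat_op f : ocat (oop f) = omap op (ocat f).
Proof. by case: f. Qed.

Lemma osrc_op f : osrc (oop f) = oop (otgt f).
Proof. by case: f. Qed.

Lemma otgt_op f : otgt (oop f) = oop (osrc f).
Proof. by case: f. Qed.

Lemma ocat_src f : ocat (osrc f) = ocat f. Proof. by case: f. Qed.
Lemma ocat_tgt f : ocat (otgt f) = ocat f. Proof. by case: f. Qed.
Lemma osrc_src f : osrc (osrc f) = osrc f. Proof. by case: f. Qed.
Lemma osrc_tgt f : osrc (otgt f) = otgt f. Proof. by case: f. Qed.
Lemma otgt_src f : otgt (osrc f) = osrc f. Proof. by case: f. Qed.
Lemma ocompE C (x y z : Ob C) (g : Hom y z) (f : Hom x y) :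
  ocomp (Some (Arrow g)) (Some (Arrow f)) = Some (Arrow (compm g f)).
Proof.
apply: theE => [|h]; first by exists C, x, y, z, g, f.
case=> [C' [x' [y' [z' [g' [f' [/Some_inj eg /Some_inj ef ->]]]]]]].
have eC := congr1 arrow_cat eg; rewrite /= in eC; subst C'.
have [ey ez] := Arrow_ends eg; have [ex _] := Arrow_ends ef.
by subst x' y' z'; rewrite (Arrow_inj eg) (Arrow_inj ef).
Qed.

Lemma fitP (g f : parrow) : osrc g = otgt f ->
  (g = None /\ f = None) \/
  exists C (x y z : Ob C) (g' : Hom y z) (f' : Hom x y),
    g = Some (Arrow g') /\ f = Some (Arrow f').
Proof.
case: g f => [[C y z g]|] [[C' x y' f]|] //= => [/Some_inj e|]; last by left.
have eC := congr1 arrow_cat e; rewrite /= in eC; subst C'.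
by have ey := aid_inj e; subst y'; right; exists C, x, y, z, g, f.
Qed.

Lemma ocomp_fit g f : ocomp g f <> None -> osrc g = otgt f.
Proof.
rewrite /ocomp; case e : (the _) => [h|//] _.
by have [C [x [y [z [g' [f' [-> -> _]]]]]]] := the_some e.
Qed.

Lemma ocomp0 f : ocomp None f = None.
Proof.
rewrite /ocomp; case e : (the _) => [h|//].
by have [C [x [y [z [g' [f' []]]]]]] := the_some e.
Qed.

Lemma ocompN g : ocomp g None = None.
Proof.
rewrite /ocomp; case e : (the _) => [h|//].
by have [C [x [y [z [g' [f' []]]]]]] := the_some e.
Qed.

Lemma osrc_comp g f : osrc g = otgt f -> osrc (ocomp g f) = osrc f.
Proof.
case/fitP => [[-> ->]|[C [x [y [z [g' [f' [-> ->]]]]]]]]; first by rewrite ocomp0.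
by rewrite ocompE.
Qed.

Lemma otgt_comp g f : osrc g = otgt f -> otgt (ocomp g f) = otgt g.
Proof.
case/fitP => [[-> ->]|[C [x [y [z [g' [f' [-> ->]]]]]]]]; first by rewrite ocomp0.
by rewrite ocompE.
Qed.

Lemma ocat_comp g f : osrc g = otgt f -> ocat (ocomp g f) = ocat f.
Proof. by move=> /osrc_comp e; rewrite -ocat_src e ocat_src. Qed.

Lemma ocomp_src f : ocomp f (osrc f) = f.
Proof. by case: f => [[C x y f]|]; rewrite ?ocompE ?compm_idr ?ocompN. Qed.

Lemma ocomp_tgt f : ocomp (otgt f) f = f.
Proof. by case: f => [[C x y f]|]; rewrite ?ocompE ?compm_idl ?ocompN. Qed.

Lemma oop_comp g f : oop (ocomp g f) = ocomp (oop f) (oop g).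
Proof.
case e : (ocomp g f) => [h|].
  have : osrc g = otgt f by apply: ocomp_fit; rewrite e.
  case/fitP => [[eg ef]|[C [x [y [z [g' [f' [eg ef]]]]]]]].
    by move: e; rewrite eg ocomp0.
  by rewrite -e eg ef ocompE /= ocompE.
case e' : (ocomp _ _) => [h|//].
have : osrc (oop f) = otgt (oop g) by apply: ocomp_fit; rewrite e'.
rewrite osrc_op otgt_op => /(inv_inj oopK)/esym.
case/fitP => [[eg ef]|[C [x [y [z [g' [f' [eg ef]]]]]]]].
  by move: e'; rewrite ef ocomp0.
by move: e; rewrite eg ef ocompE.
Qed.

(** When the arrows do not fit together, both sides are undefined. *)
Lemma ocompA h g f : ocomp h (ocomp g f) = ocomp (ocomp h g) f.
Proof.
have none (a b : parrow) : osrc a <> otgt b -> ocomp a b = None.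
  by move=> n; case e : (ocomp a b) => //; case: n; apply: ocomp_fit; rewrite e.
have [egf|ngf] := classic (osrc g = otgt f).
  have [ehg|nhg] := classic (osrc h = otgt g).
    case/fitP: egf ehg => [[-> ->]|[C [x [y [z [g' [f' [-> ->]]]]]]]].
      by rewrite !ocompN.
    case/fitP => [[-> //]|[C2 [y2 [z2 [t2 [h2 [g2 [-> e]]]]]]]].
    rewrite ocompE; case: e => eC; subst C2 => e1 e2 e3.
    have [ey ez] : y = y2 /\ z = z2 by split; exact: EqdepTheory.inj_pair2.
    by subst y2 z2; rewrite !ocompE compm_assoc.
  by rewrite (none h g) // ocomp0 none // otgt_comp.
rewrite (none g f) // ocompN.
have [ehg|nhg] := classic (osrc h = otgt g); last by rewrite (none h g) ?ocomp0.
by rewrite none // osrc_comp.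
Qed.

Definition amap (S : hcell) (f : parrow) : parrow :=
  the (fun g => exists (x y : hcell_src S) (f' : Hom x y),
    f = Some (Arrow f') /\ g = Arrow (fmap S f')).

Lemma amapE (C D : category) (S : functor C D) (x y : C) (f : Hom x y) :
  amap (HCell S) (Some (Arrow f)) = Some (Arrow (fmap S f)).
Proof.
apply: theE => [|h /=]; first by exists x, y, f.
case=> [x' [y' [f' [/Some_inj e ->]]]].
by have [ex ey] := Arrow_ends e; subst x' y'; rewrite (Arrow_inj e).
Qed.

Lemma amap_none (S : hcell) f : ocat f <> Some (hcell_src S) -> amap S f = None.
Proof.
move=> n; rewrite /amap; case e : (the _) => [g|//].
by have [x [y [f' [ef _]]]] := the_some e; case: n; rewrite ef.
Qed.

Lemma amap_some (S : hcell) f : ocat f = Some (hcell_src S) ->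
  ocat (amap S f) = Some (hcell_tgt S).
Proof. by case: S => C D S /= /ocatP[x [y [f' ->]]]; rewrite amapE. Qed.

Lemma amapP (S : hcell) f : amap S f <> None <-> ocat f = Some (hcell_src S).
Proof.
split=> [n|/amap_some]; last by case: (amap S f).
by have [//|/amap_none] := classic (ocat f = Some (hcell_src S)).
Qed.

Lemma osrc_map S f : osrc (amap S f) = amap S (osrc f).
Proof.
have [|n] := classic (ocat f = Some (hcell_src S)).
  case: S => C D S /= /ocatP[x [y [f' ->]]].
  by rewrite /= /aid !amapE /= fmap_id.
by rewrite !amap_none ?ocat_src.
Qed.

Lemma otgt_map S f : otgt (amap S f) = amap S (otgt f).
Proof.
have [|n] := classic (ocat f = Some (hcell_src S)).
  case: S => C D S /= /ocatP[x [y [f' ->]]].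
  by rewrite /= /aid !amapE /= fmap_id.
by rewrite !amap_none ?ocat_tgt.
Qed.

Lemma amap_comp S g f : osrc g = otgt f ->
  amap S (ocomp g f) = ocomp (amap S g) (amap S f).
Proof.
move=> e; have [|n] := classic (ocat f = Some (hcell_src S)); last first.
  by rewrite (amap_none n) ocompN amap_none // ocat_comp.
case/fitP: e => [[-> ->]|[C [x [y [z [g' [f' [-> ->]]]]]]]]; first by [].
case: S => D E S /= [eC]; subst C.
by rewrite ocompE !amapE ocompE fmap_comp.
Qed.

Definition hop (S : hcell) : hcell := HCell (op_functor S).

Lemma amap_hop S f : amap (hop S) f = oop (amap S (oop f)).
Proof.
have [|n] := classic (ocat f = Some (hcell_src (hop S))); last first.
  rewrite !amap_none // ocat_op => e; apply: n; move: e.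
  by case: (ocat f) => //= C [<-]; rewrite opK.
case: S => D E S /= /ocatP[x [y [f' ->]]].
by rewrite amapE /= aopE amapE.
Qed.

Definition hidt (C : category) : hcell := HCell (id_functor C).
Lemma amap_id C f : ocat f = Some C -> amap (hidt C) f = f.
Proof. by case/ocatP=> [x [y [f' ->]]]; rewrite amapE. Qed.

Lemma functor_ext C D (S T : functor C D) :
  (forall x y (f : Hom x y), Arrow (fmap S f) = Arrow (fmap T f)) -> S = T.
Proof.
case: S T => S s s1 s2 [T t t1 t2] /= e.
have eo : S = T.
  apply: functional_extensionality => x.
  by have [] := Arrow_ends (e _ _ (idm x)).
subst T; have em : s = t.
  apply: functional_extensionality_dep => x.
  apply: functional_extensionality_dep => y.
  by apply: functional_extensionality => f; apply: Arrow_inj.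
by subst t; congr Functor; apply: proof_irrelevance.
Qed.

(** Functors between categories that are only provably equal are compared through
    their values on partial arrows. *)
Lemma hcell_ext (S T : hcell) : hcell_src S = hcell_src T ->
  hcell_tgt S = hcell_tgt T -> amap S =1 amap T -> S = T.
Proof.
case: S T => C D S [C' D' T] /= e e'; subst C' D' => e.
congr HCell; apply: functor_ext => x y f.
by apply: Some_inj; rewrite -!amapE e.
Qed.

Lemma hopK : involutive hop.
Proof.
by move=> S; apply: hcell_ext => [||f]; rewrite /= ?opK // !amap_hop !oopK.
Qed.

(** * Multivariable adjunctions on partial arrows *)

(** The inputs of the functor at the position [i] are the entries of [w] at the
    positions other than [i]. *)
Definition typed (n : nat) (A : nat -> category) (i : nat) (w : nat -> parrow) :=
  forall j, j <= n -> j <> i -> ocat (w j) = Some (A j).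

Definition objects (n : nat) (A : nat -> category) (a : nat -> parrow) :=
  forall j, j <= n -> ocat (a j) = Some (A j) /\ osrc (a j) = a j.

(** The elements of A_i(F_i(\hat a_i), a_i).  Since F_i takes its values in the
    opposite of A_i, its value has to be reversed. *)
Definition element (n : nat) (A : nat -> category)
    (e : nat -> (nat -> parrow) -> parrow) (a : nat -> parrow) (i : nat)
    (x : parrow) : Prop :=
  [/\ objects n A a, osrc x = oop (e i a) & otgt x = a i].

(** The functoriality of A_i(F_i(\hat a_i), a_i), covariant in all the variables,
    as in [adj_hom_map]. *)
Definition act (e : nat -> (nat -> parrow) -> parrow) (u : nat -> parrow)
    (i : nat) (x : parrow) : parrow :=
  ocomp (u i) (ocomp x (oop (e i u))).

(** The transposes around the cycle are replaced by transposes between any two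
    positions, and the condition on the composite around the cycle by the
    functoriality [tr_id], [tr_comp].  The axioms [ev_typed] and [tr_none] make the
    domains of definition part of the structure, so that equal values mean equal
    adjunctions. *)
Record uadj := UAdj {
  uar : nat;
  ucat : nat -> category;
  ev : nat -> (nat -> parrow) -> parrow;
  tr : nat -> nat -> (nat -> parrow) -> parrow -> parrow;
  ev_typed : forall i w, i <= uar -> ev i w <> None -> typed uar ucat i w;
  ev_cat : forall i w, i <= uar -> typed uar ucat i w ->
    ocat (ev i w) = Some (op (ucat i));
  ev_src : forall i w, i <= uar -> osrc (ev i w) = ev i (fun j => osrc (w j));
  ev_tgt : forall i w, i <= uar -> otgt (ev i w) = ev i (fun j => otgt (w j));
  ev_comp : forall i v w, i <= uar ->
    (forall j, j <= uar -> j <> i -> osrc (v j) = otgt (w j)) ->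
    ev i (fun j => ocomp (v j) (w j)) = ocomp (ev i v) (ev i w);
  ev_ext : forall i v w, i <= uar ->
    (forall j, j <= uar -> j <> i -> v j = w j) -> ev i v = ev i w;
  tr_element : forall i j a x, i <= uar -> j <= uar ->
    element uar ucat ev a i x -> element uar ucat ev a j (tr i j a x);
  tr_none : forall i j a x, i <= uar -> j <= uar ->
    ~ element uar ucat ev a i x -> tr i j a x = None;
  tr_id : forall i a x, i <= uar -> element uar ucat ev a i x -> tr i i a x = x;
  tr_comp : forall i j k a x, i <= uar -> j <= uar -> k <= uar ->
    tr j k a (tr i j a x) = tr i k a x;
  tr_nat : forall i j u x, i <= uar -> j <= uar ->
    (forall k, k <= uar -> ocat (u k) = Some (ucat k)) ->
    element uar ucat ev (fun k => osrc (u k)) i x ->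
    tr i j (fun k => otgt (u k)) (act ev u i x) =
    act ev u j (tr i j (fun k => osrc (u k)) x);
  tr_ext : forall i j a b x, i <= uar -> j <= uar ->
    (forall k, k <= uar -> a k = b k) -> tr i j a x = tr i j b x }.

Notation elt X := (element (uar X) (ucat X) (ev X)).

(** * From multivariable adjunctions to partial arrows *)

Section Corresponds.
Variables (n : nat) (A : 'I_n.+1 -> category) (F : madj A).

Local Notation step := (adj_step (@transpose _ _ F)).

Lemma tag_iter a (z : {i & adj_hom F a i}) m :
  tag (iter m (step (a := a)) z) = iter m (@ordS n.+1) (tag z).
Proof. by elim: m => //= m ->. Qed.

Lemma val_iter_ordS (i : 'I_n.+1) m : iter m (@ordS n.+1) i = (i + m) %% n.+1 :> nat.
Proof.
elim: m => [|m IH]; first by rewrite addn0 modn_small.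
by rewrite iterS /= IH addnS -addn1 modnDml addn1.
Qed.

Lemma iter_cycle a (z : {i & adj_hom F a i}) m :
  iter (m * n.+1) (step (a := a)) z = z.
Proof. by elim: m => [//|m IH]; rewrite mulSn iterD IH transpose_cycle. Qed.

Lemma corr_ex a i (x : adj_hom F a i) j : exists y : adj_hom F a j, corresponds x y.
Proof.
pose m := j + n.+1 - i.
have ej : tag (iter m (step (a := a)) (existT _ i x)) = j.
  rewrite tag_iter; apply: val_inj; rewrite /= val_iter_ordS /m.
  have -> : i + (j + n.+1 - i) = j + n.+1 by have := ltn_ord i; lia.
  by rewrite modnDr modn_small.
case e : (iter m _ _) ej => [j' y] /= ej; subst j'.
by exists y, m.
Qed.

(** The number of steps matters only modulo [n.+1], the composite around the cycle
    being the identity, and modulo [n.+1] it is determined by [i] and [j]. *)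
Lemma corr_fun a i j (x : adj_hom F a i) (y y' : adj_hom F a j) :
  corresponds x y -> corresponds x y' -> y = y'.
Proof.
case=> m em [m' em'].
have red k : iter k (step (a := a)) (existT _ i x) =
             iter (k %% n.+1) (step (a := a)) (existT _ i x).
  by rewrite {1}(divn_eq k n.+1) addnC iterD iter_cycle.
have ek : m = m' %[mod n.+1].
  have := congr1 (fun z : {i & adj_hom F a i} => (tag z + n.+1 - i) %% n.+1) em'.
  have := congr1 (fun z : {i & adj_hom F a i} => (tag z + n.+1 - i) %% n.+1) em.
  rewrite !tag_iter !val_iter_ordS /= => <-.
  have sh k : ((i + k) %% n.+1 + n.+1 - i) %% n.+1 = k %% n.+1.
    have li : i <= n.+1 by apply: ltnW.
    rewrite -(modnMDl ((i + k) %/ n.+1)) -[RHS]modnDr.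
    have := divn_eq (i + k) n.+1; set q := _ * _; set r := _ %% _ => e.
    by congr modn; lia.
  by rewrite !sh.
by move: em em'; rewrite red ek -red => -> e; apply: EqdepTheory.inj_pair2 e.
Qed.

Lemma corr_refl a i (x : adj_hom F a i) : corresponds x x.
Proof. by exists 0. Qed.

Lemma corr_trans a i j k (x : adj_hom F a i) (y : adj_hom F a j) (z : adj_hom F a k) :
  corresponds x y -> corresponds y z -> corresponds x z.
Proof. by case=> m em [m' em']; exists (m' + m); rewrite iterD em. Qed.

Lemma corr_transpose a i (x : adj_hom F a i) : corresponds x (transpose F x).
Proof. by exists 1. Qed.

Lemma corr_nat a b (u : forall j, Hom (a j) (b j)) i j
    (x : adj_hom F a i) (y : adj_hom F a j) :
  corresponds x y -> corresponds (adj_hom_map u x) (adj_hom_map u y).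
Proof.
case=> m em; exists m; move: em.
pose f (z : {i & adj_hom F a i}) : {i & adj_hom F b i} :=
  existT _ (tag z) (adj_hom_map u (tagged z)).
move/(congr1 f); rewrite /f /= => <-.
rewrite -/(f _) -[existT _ i _]/(f (existT _ i x)).
elim: m (existT _ i x) => //= m IH z.
by rewrite IH /f /adj_step /= transpose_nat.
Qed.

End Corresponds.

Section Underlying.
Variables (n : nat) (A : 'I_n.+1 -> category) (F : madj A).

(** The typed family with the given entries is unique when it exists, and similarly for
    the typed element below; hence descriptions define these operations. *)
Definition vev (i : nat) (w : nat -> parrow) : parrow :=
  the (fun g => exists (a b : prod_but A (inord i)) (u : Hom a b),
    (forall k : but (inord i), w (val (val k)) = Some (Arrow (u k))) /\
    g = Arrow (fmap (F (inord i)) u)).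

Definition vtr (i j : nat) (a : nat -> parrow) (x : parrow) : parrow :=
  the (fun y => exists b (x' : adj_hom F b (inord i)) (y' : adj_hom F b (inord j)),
    [/\ forall k : 'I_n.+1, a k = Some (aid (b k)),
        x = Some (Arrow_in (A (inord i)) x'), corresponds x' y' &
        y = Arrow_in (A (inord j)) y']).

Lemma family_inj (I : Type) (B : I -> category) (a b a' b' : forall i, B i)
    (u : forall i, Hom (a i) (b i)) (u' : forall i, Hom (a' i) (b' i)) :
  (forall i, Arrow (u i) = Arrow (u' i)) ->
  @Arrow' (prod_cat B) a b u = @Arrow' (prod_cat B) a' b' u'.
Proof.
move=> e.
have ea : a = a'.
  by apply: functional_extensionality_dep => i; have [] := Arrow_ends (e i).
have eb : b = b'.
  by apply: functional_extensionality_dep => i; have [] := Arrow_ends (e i).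
subst a' b'; suff -> : u = u' by [].
by apply: functional_extensionality_dep => i; apply: Arrow_inj.
Qed.

Lemma Arrow_fmap C D (S : functor C D) x y x' y' (f : Hom x y) (g : Hom x' y') :
  Arrow f = Arrow g -> Arrow (fmap S f) = Arrow (fmap S g).
Proof.
by move=> e; have [ex ey] := Arrow_ends e; subst x' y'; rewrite (Arrow_inj e).
Qed.

Lemma vevE i w (a b : prod_but A (inord i)) (u : Hom a b) :
  (forall k : but (inord i), w (val (val k)) = Some (Arrow (u k))) ->
  vev i w = Some (Arrow (fmap (F (inord i)) u)).
Proof.
move=> e; apply: theE => [|g]; first by exists a, b, u.
case=> [a' [b' [u' [e' ->]]]]; apply: Arrow_fmap; apply: family_inj => k.
by apply: Some_inj; rewrite -e'.
Qed.

Definition ncat (j : nat) : category := A (inord j).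

Lemma but_neq i (k : but (inord i : 'I_n.+1)) : i <= n -> val (val k) <> i.
Proof.
move=> le_in; have := valP k; rewrite -val_eqE /= inordK // => /eqP ne e.
exact: ne e.
Qed.

Lemma vtyped (i : nat) w : i <= n -> typed n ncat i w ->
  exists (a b : prod_but A (inord i)) (u : Hom a b),
    forall k : but (inord i), w (val (val k)) = Some (Arrow (u k)).
Proof.
move=> le_in t.
have h (k : but (inord i)) : exists z : {x : A (val k) & {y : A (val k) & Hom x y}},
    w (val (val k)) = Some (Arrow (tagged (tagged z))).
  have [|x [y [f e]]] := @ocatP (A (val k)) (w (val (val k))).
    have -> : A (val k) = ncat (val (val k)) by rewrite /ncat inord_val.
    apply: t; first exact: leq_ord.
    exact: but_neq.
  by exists (existT _ x (existT _ y f)).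
pose z k := proj1_sig (constructive_indefinite_description _ (h k)).
exists (fun k => tag (z k)), (fun k => tag (tagged (z k))),
  (fun k => tagged (tagged (z k))) => k.
by rewrite /z; case: (constructive_indefinite_description _ _).
Qed.

Lemma vev_typed i w : i <= n -> vev i w <> None -> typed n ncat i w.
Proof.
move=> le_in; rewrite /vev; case e : (the _) => [g|//] _ j le_jn ne.
have [a [b [u [ew _]]]] := the_some e.
have ne' : inord j != inord i :> 'I_n.+1.
  by apply/eqP => /(congr1 val) /=; rewrite !inordK.
by have := ew (exist (fun j => j != inord i) _ ne'); rewrite /= inordK // => ->.
Qed.

Lemma vev_cases i w : i <= n ->
  (exists (a b : prod_but A (inord i)) (u : Hom a b),
    (forall k : but (inord i), w (val (val k)) = Some (Arrow (u k))) /\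
    vev i w = Some (Arrow (fmap (F (inord i)) u))) \/
  ~ typed n ncat i w /\ vev i w = None.
Proof.
move=> le_in; case: (classic (typed n ncat i w)) => [t|nt].
  have [a [b [u e]]] := vtyped le_in t.
  by left; exists a, b, u; split; last exact: vevE.
right; split=> //; case e : (vev i w) => //.
by case: nt; apply: vev_typed; rewrite ?e.
Qed.

Lemma vev_cat i w : i <= n -> typed n ncat i w ->
  ocat (vev i w) = Some (op (ncat i)).
Proof. by move=> le_in /(vtyped le_in)[a [b [u e]]]; rewrite (vevE e). Qed.

Lemma vev_src i w : i <= n -> osrc (vev i w) = vev i (fun j => osrc (w j)).
Proof.
move=> le_in; case: (vev_cases w le_in) => [[a [b [u [e ->]]]]|[nt ->]].
  rewrite /= (@vevE _ _ a a (idm a)) ?fmap_id // => k.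
  by rewrite e.
case e : (vev i _) => //; case: nt => j le_jn ne.
by rewrite -ocat_src; apply: (@vev_typed i (fun j => osrc (w j))) => //; rewrite e.
Qed.

Lemma vev_tgt i w : i <= n -> otgt (vev i w) = vev i (fun j => otgt (w j)).
Proof.
move=> le_in; case: (vev_cases w le_in) => [[a [b [u [e ->]]]]|[nt ->]].
  rewrite /= (@vevE _ _ b b (idm b)) ?fmap_id // => k.
  by rewrite e.
case e : (vev i _) => //; case: nt => j le_jn ne.
by rewrite -ocat_tgt; apply: (@vev_typed i (fun j => otgt (w j))) => //; rewrite e.
Qed.

Lemma vev_ext i v w : i <= n ->
  (forall j, j <= n -> j <> i -> v j = w j) -> vev i v = vev i w.
Proof.
move=> le_in e.
have ek (k : but (inord i : 'I_n.+1)) : v (val (val k)) = w (val (val k)).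
  apply: e; first exact: leq_ord.
  exact: but_neq.
case: (vev_cases w le_in) => [[a [b [u [e1 ->]]]]|[nt ->]].
  by apply: vevE => k; rewrite ek.
case e1 : (vev i v) => //; case: nt => j le_jn ne.
by rewrite -e //; apply: (@vev_typed i v) => //; rewrite e1.
Qed.

Lemma vev_comp i v w : i <= n ->
  (forall j, j <= n -> j <> i -> osrc (v j) = otgt (w j)) ->
  vev i (fun j => ocomp (v j) (w j)) = ocomp (vev i v) (vev i w).
Proof.
move=> le_in e.
case: (vev_cases w le_in) => [[a [b [u [e1 ev1]]]]|[nt e1]]; last first.
  rewrite e1 ocompN; case e2 : (vev i _) => //; case: nt => j le_jn ne.
  rewrite -(ocat_comp (e _ le_jn ne)).
  by apply: (@vev_typed i (fun j => ocomp (v j) (w j))) => //; rewrite e2.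
have tv : typed n ncat i v.
  move=> j le_jn ne; rewrite -ocat_src e // ocat_tgt.
  by apply: vev_typed ne; rewrite ?ev1.
have [a' [b' [u' e2]]] := vtyped le_in tv.
have eb : b = a'.
  apply: functional_extensionality_dep => k.
  have /= ek := e (val (val k)).
  rewrite e1 e2 /= in ek; apply/esym/aid_inj; apply: Some_inj; apply: ek.
    by rewrite -ltnS.
  exact: but_neq.
subst a'; rewrite ev1 (vevE e2) ocompE -fmap_comp.
by apply: vevE => k; rewrite e1 e2 ocompE.
Qed.

Local Notation velt := (element n ncat vev).

Lemma vobjects a : objects n ncat a <->
  exists b : forall j, A j, forall k : 'I_n.+1, a k = Some (aid (b k)).
Proof.
split=> [o|[b e] j le_jn]; last first.
  by have := e (inord j); rewrite inordK // => ->.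
have h (k : 'I_n.+1) : exists b : A k, a k = Some (aid b).
  have [|eo es] := o k; first exact: leq_ord.
  have {eo} [x [y [f ef]]] := ocatP eo.
  have ec : ncat k = A k by rewrite /ncat inord_val.
  case: _ / ec x y f ef => x y f ef.
  by exists x; rewrite -es ef.
pose z k := constructive_indefinite_description _ (h k).
by exists (fun k => proj1_sig (z k)) => k; case: (z k).
Qed.

Lemma vev_ids i (b : forall j, A j) (a : nat -> parrow) :
  (forall k : 'I_n.+1, a k = Some (aid (b k))) ->
  vev i a = Some (@aid (op (A (inord i))) (F (inord i) (omit _ b))).
Proof.
move=> e; rewrite (@vevE _ _ (omit (inord i) b) (omit _ b) (idm _)).
  by rewrite fmap_id.
by move=> k; rewrite e.
Qed.

Lemma velementP a i x : i <= n -> velt a i x <->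
  exists b (x' : adj_hom F b (inord i)),
    (forall k : 'I_n.+1, a k = Some (aid (b k))) /\
    x = Some (Arrow_in (A (inord i)) x').
Proof.
move=> le_in; split=> [[/vobjects[b e] es et]|[b [x' [e ->]]]].
  move: es et; rewrite (vev_ids _ e) => es et.
  have ei : a i = Some (aid (b (inord i))) by rewrite -e inordK.
  have [|||x' ex] := @homP (A (inord i)) (F (inord i) (omit _ b)) (b (inord i)) x.
  - by rewrite -ocat_tgt et ei.
  - by rewrite es /= [@aid (op _) _]/aid aopE.
  - by rewrite et ei.
  by exists b, x'.
split; first by apply/vobjects; exists b.
  by rewrite (vev_ids _ e) /= [@aid (op _) _]/aid aopE.
by rewrite /= -e inordK.
Qed.

Lemma vtrE i j (a : nat -> parrow) b (x : adj_hom F b (inord i)) (y : adj_hom F b (inord j)) :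
  (forall k : 'I_n.+1, a k = Some (aid (b k))) -> corresponds x y ->
  vtr i j a (Some (Arrow_in (A (inord i)) x)) =
  Some (Arrow_in (A (inord j)) y).
Proof.
move=> e c; apply: theE => [|z]; first by exists b, x, y.
case=> [b' [x' [y' [e' ex c' ->]]]].
have eb : b = b'.
  by apply: functional_extensionality_dep => k; apply/aid_inj/Some_inj; rewrite -e'.
subst b'; move: c; rewrite (Arrow_inj (Some_inj ex)) => c.
by rewrite (corr_fun c c').
Qed.

Lemma vtr_none i j a x : i <= n -> j <= n -> ~ velt a i x -> vtr i j a x = None.
Proof.
move=> le_in _ ne; rewrite /vtr; case e : (the _) => [y|//].
have [b [x' [y' [ea ex _ _]]]] := the_some e.
by case: ne; apply/velementP => //; exists b, x'.
Qed.

Lemma vtr_element i j a x : i <= n -> j <= n ->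
  velt a i x -> velt a j (vtr i j a x).
Proof.
move=> le_in le_jn /(velementP _ _ le_in)[b [x' [e ->]]].
have [y c] := corr_ex x' (inord j).
by rewrite (vtrE e c); apply/velementP => //; exists b, y.
Qed.

Lemma vtr_id i a x : i <= n -> velt a i x -> vtr i i a x = x.
Proof.
move=> le_in /(velementP _ _ le_in)[b [x' [e ->]]].
exact: vtrE e (corr_refl x').
Qed.

Lemma vtr_comp i j k a x : i <= n -> j <= n -> k <= n ->
  vtr j k a (vtr i j a x) = vtr i k a x.
Proof.
move=> le_in le_jn le_kn; have [l|l] := classic (velt a i x); last first.
  rewrite !(@vtr_none i) // vtr_none // => -[o _ et].
  by have [] := o j le_jn; rewrite -et.
move: l => /(velementP _ _ le_in)[b [x' [e ->]]].
have [y c] := corr_ex x' (inord j); have [z c'] := corr_ex y (inord k).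
by rewrite (vtrE e c) (vtrE e c') (vtrE e (corr_trans c c')).
Qed.

Lemma vtr_ext i j a b x : i <= n -> j <= n ->
  (forall k, k <= n -> a k = b k) -> vtr i j a x = vtr i j b x.
Proof.
move=> le_in le_jn e; have [l|l] := classic (velt b i x).
  move: l => /(velementP _ _ le_in)[c [x' [eb ->]]].
  have [y cy] := corr_ex x' (inord j).
  rewrite (vtrE eb cy) (vtrE (b := c) (y := y)) // => k.
  by rewrite e //; exact: leq_ord.
rewrite !vtr_none // => -[o es et]; apply: l; split.
- by move=> k le_kn; rewrite -e //; apply: o.
- by rewrite es; congr oop; apply: vev_ext => // k le_kn _; apply: e.
- by rewrite et e.
Qed.

Lemma vactE (u : nat -> parrow) (a b : forall j, A j) (u' : forall j, Hom (a j) (b j)) i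
    (x : adj_hom F a (inord i)) : i <= n ->
  (forall k : 'I_n.+1, u k = Some (Arrow (u' k))) ->
  act vev u i (Some (Arrow_in (A (inord i)) x)) =
  Some (Arrow_in (A (inord i)) (adj_hom_map u' x)).
Proof.
move=> le_in e; rewrite /act (@vevE _ _ _ _ (omit (inord i) u')); last first.
  by move=> k; rewrite e.
by rewrite /= aopE -{1}[i](@inordK n) // e !ocompE.
Qed.

Lemma vtr_nat i j u x : i <= n -> j <= n ->
  (forall k, k <= n -> ocat (u k) = Some (ncat k)) ->
  velt (fun k => osrc (u k)) i x ->
  vtr i j (fun k => otgt (u k)) (act vev u i x) =
  act vev u j (vtr i j (fun k => osrc (u k)) x).
Proof.
move=> le_in le_jn t /(velementP _ _ le_in)[a [x' [e ->]]].
have h (k : 'I_n.+1) : exists z : {y : A k & Hom (a k) y}, u k = Some (Arrow (tagged z)).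
  have tk : ocat (u k) = Some (A k) by rewrite t ?/ncat ?inord_val //; exact: leq_ord.
  have [x1 [y [f ef]]] := ocatP tk.
  have := e k; rewrite ef /= => /Some_inj ek; have eak := aid_inj ek; subst x1.
  by exists (existT _ y f).
pose z k := constructive_indefinite_description _ (h k).
pose b k := tag (proj1_sig (z k)).
pose u' (k : 'I_n.+1) : Hom (a k) (b k) := tagged (proj1_sig (z k)).
have eu (k : 'I_n.+1) : u k = Some (Arrow (u' k)) by exact: (proj2_sig (z k)).
have [y c] := corr_ex x' (inord j).
rewrite (vtrE e c) !(vactE _ _ eu) //.
by apply: vtrE; [move=> k; rewrite eu | exact: corr_nat].
Qed.

Definition underlying : uadj :=
  @UAdj n ncat vev vtr vev_typed vev_cat vev_src vev_tgt vev_comp vev_ext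
    vtr_element vtr_none vtr_id vtr_comp vtr_nat vtr_ext.

End Underlying.

Lemma leq_ordP n j : j <= n -> exists k : 'I_n.+1, j = k.
Proof. by move=> le_jn; exists (Ordinal (le_jn : j < n.+1)). Qed.

Lemma but_leqP n (i : 'I_n.+1) j : j <= n -> j <> i ->
  exists k : but i, j = val (val k).
Proof.
move=> /leq_ordP[k ->] ne.
have ne' : k != i by apply/eqP => e; apply: ne; rewrite e.
by exists (exist (fun j => j != i) k ne').
Qed.

Section Ordinal.
Variables (n : nat) (A : 'I_n.+1 -> category) (F : madj A).

Lemma ev_ord (i : 'I_n.+1) (w : nat -> parrow) (a b : prod_but A i) (u : Hom a b) :
  (forall k : but i, w (val (val k)) = Some (Arrow (u k))) ->
  vev F i w = Some (Arrow (fmap (F i) u)).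
Proof.
move=> h; have gen i' : inord i' = i -> vev F i' w = Some (Arrow (fmap (F i) u)).
  by move=> e; subst i; exact: vevE.
by apply: gen; exact: inord_val.
Qed.

Lemma tr_ord (i j : 'I_n.+1) (a : nat -> parrow) b (x : adj_hom F b i)
    (y : adj_hom F b j) :
  (forall k : 'I_n.+1, a k = Some (aid (b k))) -> corresponds x y ->
  vtr F i j a (Some (Arrow_in (A i) x)) = Some (Arrow_in (A j) y).
Proof.
move=> e c; have gen i' j' : inord i' = i -> inord j' = j ->
    vtr F i' j' a (Some (Arrow_in (A i) x)) = Some (Arrow_in (A j) y).
  by move=> ei ej; subst i j; apply: vtrE.
by apply: gen; exact: inord_val.
Qed.

Definition but_family (i : 'I_n.+1) (a b : prod_but A i) (u : Hom a b) (j : nat) :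
    parrow :=
  omap (fun k : but i => Arrow (u k)) (insub (inord j : 'I_n.+1)).

Lemma but_familyE i (a b : prod_but A i) (u : Hom a b) (k : but i) :
  but_family u (val (val k)) = Some (Arrow (u k)).
Proof. by rewrite /but_family inord_val valK. Qed.

Definition full_family (a b : forall i, A i) (u : forall i, Hom (a i) (b i)) (j : nat) :
  parrow := Some (Arrow (u (inord j))).

Lemma full_familyE a b (u : forall i, Hom (a i) (b i)) (k : 'I_n.+1) :
  full_family u k = Some (Arrow (u k)).
Proof. by rewrite /full_family inord_val. Qed.

End Ordinal.

(** * Recovering multivariable adjunctions *)

(** Agreement at the positions of the adjunctions. *)
Definition ueq (X Y : uadj) : Prop :=
  [/\ uar X = uar Y, forall i, i <= uar X -> ucat X i = ucat Y i,
      forall i w, i <= uar X -> ev X i w = ev Y i w &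
      forall i j a x, i <= uar X -> j <= uar X -> tr X i j a x = tr Y i j a x].

Definition under (F : vcell) : uadj := underlying (vadj F).

(** Once the categories have been identified, the functors are equal because their values
    on arrows are, and the transposes because their values on elements are. *)
Lemma vcell_ext (F G : vcell) : ueq (under F) (under G) -> F = G.
Proof.
case: F G => n A F [m B G] [] /= en; subst m => ec ee et.
have eA : A = B.
  apply: functional_extensionality => i.
  by have := ec i (leq_ord i); rewrite /ncat inord_val.
subst B; congr VCell.
case: F G ee et {ec} => l t tb tn tc [l' t' tb' tn' tc'].
set F := MAdjunction tb tn tc; set G := MAdjunction tb' tn' tc'.
move=> ee et.
have el : l = l'.
  apply: functional_extensionality_dep => i; apply: functor_ext => a b u.
  apply: Some_inj; rewrite -(@ev_ord _ _ F i _ _ _ _ (but_familyE u)) ee ?leq_ord //.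
  exact: (@ev_ord _ _ G i _ _ _ _ (but_familyE u)).
rewrite {}/F {}/G in ee et *; subst l'.
have e : t = t'.
  apply: functional_extensionality_dep => a.
  apply: functional_extensionality_dep => i.
  apply: functional_extensionality => x; apply: Arrow_inj.
  apply: Some_inj.
  rewrite -(@tr_ord _ _ (MAdjunction tb tn tc) i (ordS i) _ a x _
    (full_familyE (fun k => idm (a k)))); last exact: corr_transpose.
  rewrite et ?leq_ord //.
  by apply: tr_ord; [exact: full_familyE | exact: corr_transpose].
by subst t'; congr MAdjunction; apply: proof_irrelevance.
Qed.

Section Realize.
Variable X : uadj.
Local Notation n := (uar X).
Local Notation A := (fun i : 'I_n.+1 => ucat X i).

Lemma but_family_typed (i : 'I_n.+1) (a b : prod_but A i) (u : Hom a b) :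
  typed n (ucat X) i (but_family u).
Proof.
by move=> j le_jn /(but_leqP le_jn)[k ->]; rewrite but_familyE.
Qed.

Lemma ob_exists (i : 'I_n.+1) (a : prod_but A i) :
  exists y : ucat X i, ev X i (but_family (idm a)) = Some (@aid (op (ucat X i)) y).
Proof.
have t := but_family_typed (idm a).
have [x [y [f e]]] := ocatP (ev_cat (leq_ord i) t).
exists x.
have -> : but_family (idm a) = fun j => osrc (but_family (idm a) j).
  apply: functional_extensionality => j.
  by rewrite /but_family; case: (insub _).
by rewrite -(ev_src _ (leq_ord i)) e.
Qed.

Definition rob (i : 'I_n.+1) (a : prod_but A i) : ucat X i :=
  proj1_sig (constructive_indefinite_description _ (ob_exists a)).

Lemma robE i (a : prod_but A i) :
  ev X i (but_family (idm a)) = Some (@aid (op (ucat X i)) (rob a)).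
Proof. exact: (proj2_sig (constructive_indefinite_description _ (ob_exists a))). Qed.

Lemma hom_exists (i : 'I_n.+1) (a b : prod_but A i) (u : Hom a b) :
  exists f : @Hom (op (ucat X i)) (rob a) (rob b),
    ev X i (but_family u) = Some (Arrow f).
Proof.
apply: homP.
- exact: ev_cat (leq_ord i) (but_family_typed u).
- rewrite ev_src ?leq_ord // -robE; congr ev.
  by apply: functional_extensionality => j; rewrite /but_family; case: (insub _).
- rewrite ev_tgt ?leq_ord // -robE; congr ev.
  by apply: functional_extensionality => j; rewrite /but_family; case: (insub _).
Qed.

Definition rhom i (a b : prod_but A i) (u : Hom a b) :
    @Hom (op (ucat X i)) (rob a) (rob b) :=
  proj1_sig (constructive_indefinite_description _ (hom_exists u)).

Lemma rhomE i (a b : prod_but A i) (u : Hom a b) :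
  ev X i (but_family u) = Some (Arrow (rhom u)).
Proof. exact: (proj2_sig (constructive_indefinite_description _ (hom_exists u))). Qed.

Lemma rhom_id i (a : prod_but A i) : rhom (idm a) = idm _.
Proof. by apply: Arrow_inj; apply: Some_inj; rewrite -rhomE robE. Qed.

Lemma rhom_comp i (a b c : prod_but A i) (v : Hom b c) (u : Hom a b) :
  rhom (compm v u) = compm (rhom v) (rhom u).
Proof.
apply: Arrow_inj; apply: Some_inj; rewrite -rhomE -ocompE -!rhomE -ev_comp ?leq_ord //.
  congr ev; apply: functional_extensionality => j.
  by rewrite /but_family; case: (insub _) => [k|]; rewrite /= ?ocompE ?ocomp0.
by move=> j _ _; rewrite /but_family; case: (insub _).
Qed.

Definition rfun i : functor (prod_but A i) (op (A i)) :=
  @Functor (prod_but A i) (op (A i)) (@rob i) (@rhom i) (@rhom_id i) (@rhom_comp i).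

Local Notation ids a := (full_family (fun k : 'I_n.+1 => idm (a k))).

Lemma ev_ids (a : forall i, A i) (i : 'I_n.+1) :
  ev X i (ids a) = Some (@aid (op (A i)) (rob (omit i a))).
Proof.
rewrite -robE; apply: ev_ext; rewrite ?leq_ord // => j le_jn.
by move=> /(but_leqP le_jn)[k ->]; rewrite but_familyE full_familyE.
Qed.

Lemma relement (a : forall i, A i) (i : 'I_n.+1) x :
  elt X (ids a) i x <-> exists x' : adj_hom rfun a i, x = Some (Arrow_in (A i) x').
Proof.
split=> [[o es et]|[x' ->]].
  apply: (@homP (A i) (rob (omit i a)) (a i)).
  - by rewrite -ocat_tgt et full_familyE.
  - by rewrite es ev_ids /= [@aid (op _) _]/aid aopE.
  - by rewrite et full_familyE.
split.
- by move=> j /leq_ordP[k ->]; rewrite full_familyE.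
- by rewrite ev_ids /= [@aid (op _) _]/aid aopE.
- by rewrite full_familyE.
Qed.

Lemma rtr_exists (a : forall i, A i) (i j : 'I_n.+1) (x : adj_hom rfun a i) :
  exists y : adj_hom rfun a j,
    tr X i j (ids a) (Some (Arrow_in (A i) x)) = Some (Arrow_in (A j) y).
Proof.
apply/relement; apply: tr_element; rewrite ?leq_ord //.
by apply/relement; exists x.
Qed.

Definition rtr (a : forall i, A i) (i j : 'I_n.+1) (x : adj_hom rfun a i) :
    adj_hom rfun a j :=
  proj1_sig (constructive_indefinite_description _ (rtr_exists j x)).

Lemma rtrE (a : forall i, A i) (i j : 'I_n.+1) (x : adj_hom rfun a i) :
  tr X i j (ids a) (Some (Arrow_in (A i) x)) = Some (Arrow_in (A j) (rtr j x)).
Proof. exact: (proj2_sig (constructive_indefinite_description _ (rtr_exists j x))). Qed.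

Lemma rtr_comp (a : forall i, A i) (i j k : 'I_n.+1) (x : adj_hom rfun a i) :
  rtr k (rtr j x) = rtr k x.
Proof.
apply: Arrow_inj; apply: Some_inj; rewrite -rtrE -rtrE -(rtrE k x).
by rewrite tr_comp ?leq_ord.
Qed.

Lemma rtr_id (a : forall i, A i) (i : 'I_n.+1) (x : adj_hom rfun a i) : rtr i x = x.
Proof.
apply: Arrow_inj; apply: Some_inj; rewrite -rtrE tr_id ?leq_ord //.
by apply/relement; exists x.
Qed.

Lemma ract (a b : forall i, A i) (u : forall i, Hom (a i) (b i)) (i : 'I_n.+1)
    (x : adj_hom rfun a i) :
  act (ev X) (full_family u) i (Some (Arrow_in (A i) x)) =
  Some (Arrow_in (A i) (adj_hom_map u x)).
Proof.
rewrite /act.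
have -> : ev X i (full_family u) = Some (Arrow (rhom (omit i u))).
  rewrite -rhomE; apply: ev_ext; rewrite ?leq_ord // => j le_jn.
  by move=> /(but_leqP le_jn)[k ->]; rewrite but_familyE full_familyE.
by rewrite /= aopE full_familyE !ocompE.
Qed.

Lemma rtr_nat (a b : forall j, A j) (u : forall j, Hom (a j) (b j))
    (i j : 'I_n.+1) (x : adj_hom rfun a i) :
  rtr j (adj_hom_map u x) = adj_hom_map u (rtr j x).
Proof.
apply: Arrow_inj; apply: Some_inj; rewrite -rtrE -!ract -rtrE.
apply: (@tr_nat X i j (full_family u)); rewrite ?leq_ord //; last first.
  by apply/relement; exists x.
by move=> k /leq_ordP[k' ->]; rewrite full_familyE.
Qed.

Lemma rtr_bij a i : bijective (@rtr a i (ordS i)).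
Proof. by exists (@rtr a (ordS i) i) => x; rewrite rtr_comp rtr_id. Qed.

Lemma rtr_iter (a : forall i, A i) (z : {i & adj_hom rfun a i}) m :
  iter m (adj_step (fun a i => @rtr a i (ordS i)) (a := a)) z =
  existT _ (iter m (@ordS _) (tag z)) (rtr _ (tagged z)).
Proof.
elim: m => [|m IH]; first by case: z => i x; rewrite /= rtr_id.
by rewrite iterS IH /adj_step /= rtr_comp.
Qed.

Lemma rtr_cycle (a : forall i, A i) (z : {i & adj_hom rfun a i}) :
  iter n.+1 (adj_step (fun a i => @rtr a i (ordS i)) (a := a)) z = z.
Proof.
rewrite rtr_iter.
have -> : iter n.+1 (@ordS _) (tag z) = tag z.
  by apply: val_inj; rewrite [LHS]val_iter_ordS modnDr modn_small.
by case: z => i x; rewrite rtr_id.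
Qed.

Definition realize : madj A :=
  @MAdjunction n A rfun (fun a i => @rtr a i (ordS i)) rtr_bij
    (fun a b u i x => rtr_nat u (ordS i) x) rtr_cycle.

Lemma realize_corr (a : forall i, A i) i j (x : adj_hom realize a i) :
  corresponds x (rtr j x : adj_hom realize a j).
Proof.
exists (j + n.+1 - i); rewrite rtr_iter /=.
suff -> : iter (j + n.+1 - i) (@ordS _) i = j by [].
apply: val_inj; rewrite /= val_iter_ordS.
have -> : i + (j + n.+1 - i) = j + n.+1 by have := ltn_ord i; lia.
by rewrite modnDr modn_small.
Qed.

(** With [vcell_ext], this allows multivariable adjunctions to be constructed, and
    equations between them to be proved, at the level of partial arrows. *)
Lemma under_realize : ueq (under (VCell realize)) X.
Proof.
have ec j : j <= n -> ncat A j = ucat X j by move=> le_jn; rewrite /ncat inordK.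
have ee i w : i <= n -> vev realize i w = ev X i w.
  move=> /leq_ordP[k ->] {i}.
  have [t|nt] := classic (typed n (ucat X) k w).
    have t' : typed n (ncat A) k w by move=> j le_jn ne; rewrite ec //; apply: t.
    have [a [b [u e]]] := vtyped (leq_ord k) t'.
    move: a b u e; rewrite inord_val => a b u e.
    rewrite (ev_ord _ e) /= -rhomE; apply: ev_ext; rewrite ?leq_ord // => j le_jn.
    by move=> /(but_leqP le_jn)[k' ->]; rewrite e but_familyE.
  case e : (vev _ _ _) => [g|].
    case: nt => j le_jn ne; rewrite -ec //.
    by apply: (@vev_typed _ _ realize _ _ _ _ _ le_jn ne); rewrite ?leq_ord ?e.
  by case e' : (ev X k w) => [g|//]; case: nt; apply: ev_typed; rewrite ?leq_ord ?e'.
have ex a i x : i <= n -> element n (ncat A) (vev realize) a i x <-> elt X a i x.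
  move=> le_in; split=> -[o es et]; split=> //; rewrite ?ee // -?ee // => j le_jn.
    by rewrite -ec //; apply: o.
  by rewrite ec //; apply: o.
split=> //= i j a x /leq_ordP[i' ->] /leq_ordP[j' ->] {i j}.
have [l|nl] := classic (elt X a i' x); last first.
  by rewrite (tr_none _ _ nl) ?leq_ord // vtr_none ?leq_ord // => /(ex _ _ _ (leq_ord i')).
move/(ex _ _ _ (leq_ord i'))/(velementP _ _ _ (leq_ord i')): l => [b].
rewrite inord_val => -[x' [e ->]].
have ea : forall k, k <= n -> a k = full_family (fun k => idm (b k)) k.
  by move=> k /leq_ordP[k' ->]; rewrite e full_familyE.
rewrite (tr_ord e (realize_corr _ x')) -rtrE.
by apply: tr_ext; rewrite ?leq_ord // => k /ea.
Qed.

End Realize.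

(** * Composition *)

(** The inputs of a composite are those of its arguments, one argument after the other:
    the input [j] of the argument [q], for 0 < [j] <= [m q], has the position
    [off m q + j], and 0 is the root. *)
Fixpoint off (m : nat -> nat) (q : nat) : nat :=
  if q is q'.+1 then off m q' + m q' else 0.

Lemma off_mono m q r : q <= r -> off m q <= off m r.
Proof.
elim: r => [|r IH]; first by case: q.
by rewrite leq_eqVlt ltnS => /orP[/eqP -> //|/IH /= h]; apply: leq_trans h (leq_addr _ _).
Qed.

(** The argument to which the position [p] belongs. *)
Definition blk (m : nat -> nat) (k p : nat) : nat :=
  find (fun q => p <= off m q.+1) (iota 0 k).

Lemma blkE m k q j : q < k -> 0 < j -> j <= m q -> blk m k (off m q + j) = q.
Proof.
move=> lt_qk lt0j le_jm; rewrite /blk.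
have -> : iota 0 k = iota 0 q ++ q :: iota q.+1 (k - q.+1).
  by rewrite -[q :: _]/(iota q (k - q.+1).+1) -{2}[q]add0n -iotaD; congr iota; lia.
rewrite find_cat; case: ifP => [/hasP[r]|_]; last first.
  by rewrite /= leq_add2l le_jm size_iota addn0.
rewrite mem_iota add0n /= => lt_rq.
by have := off_mono m (lt_rq : r.+1 <= q); rewrite /=; lia.
Qed.

Lemma offP m k p : 0 < p -> p <= off m k ->
  exists q j, [/\ q < k, 0 < j, j <= m q & p = off m q + j].
Proof.
move=> lt0p; elim: k => [|k IH] /= le_p; first by lia.
have [/IH[q [j [lt_qk lt0j le_jm ->]]]|lt] := leqP p (off m k).
  by exists q, j; split=> //; lia.
by exists k, (p - off m k); split=> //; lia.
Qed.

Lemma off_leq m k q j : q < k -> j <= m q -> off m q + j <= off m k.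
Proof. by move=> /(off_mono m) /= h le_jm; apply: leq_trans h; rewrite leq_add2l. Qed.

Lemma off_inj m k q j q' j' : q < k -> 0 < j -> j <= m q ->
  q' < k -> 0 < j' -> j' <= m q' -> off m q + j = off m q' + j' ->
  q = q' /\ j = j'.
Proof.
move=> h1 h2 h3 h4 h5 h6 e.
have eq : q = q' by rewrite -(blkE h1 h2 h3) e blkE.
by subst q'; split=> //; apply: addnI e.
Qed.

Lemma ev_some X i w : i <= uar X -> ev X i w <> None <-> typed (uar X) (ucat X) i w.
Proof.
move=> le_in; split; first exact: ev_typed.
by move/(ev_cat le_in); case: (ev X i w).
Qed.

Lemma objectsT n A a i : objects n A a -> typed n A i a.
Proof. by move=> o j le_jn _; case: (o j le_jn). Qed.

Definition guard (P : Prop) (x : parrow) : parrow :=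
  if excluded_middle_informative P then x else None.

Lemma guardT (P : Prop) x : P -> guard P x = x.
Proof. by rewrite /guard; case: excluded_middle_informative. Qed.

Lemma guardF (P : Prop) x : ~ P -> guard P x = None.
Proof. by rewrite /guard; case: excluded_middle_informative. Qed.

Section Composition.
Variables (G : uadj) (F : nat -> uadj).
Local Notation k := (uar G).
Local Notation m := (fun q => uar (F q)).
Local Notation N := (off m k).
Hypothesis joint : forall q, q < k -> ucat G q.+1 = op (ucat (F q) 0).

Definition cat_of (p : nat) : category :=
  if p is 0 then ucat G 0 else
  let q := blk m k p in ucat (F q) (p - off m q).

(** What the outer adjunction sees: the values of the arguments at their blocks of inputs. *)
Definition outer (w : nat -> parrow) (p : nat) : parrow :=
  if p is q.+1 then ev (F q) 0 (fun j => w (off m q + j)) else w 0.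

(** What the argument [q] sees: its own block of inputs and, at its root, the value of the
    functor of the outer adjunction at the input [q.+1]. *)
Definition inner (w : nat -> parrow) (q j : nat) : parrow :=
  if j is 0 then ev G q.+1 (outer w) else w (off m q + j).

Definition cev (p : nat) (w : nat -> parrow) : parrow :=
  if p is 0 then ev G 0 (outer w) else
  let q := blk m k p in ev (F q) (p - off m q) (inner w q).

Lemma cev0 w : cev 0 w = ev G 0 (outer w).
Proof. by []. Qed.

Lemma cevE q j w : q < k -> 0 < j -> j <= m q ->
  cev (off m q + j) w = ev (F q) j (inner w q).
Proof.
move=> lt_qk lt0j le_jm; rewrite /cev blkE // addKn.
by case: (off m q + j) (ltn_addl (off m q) lt0j).
Qed.

Lemma cat_ofE q j : q < k -> 0 < j -> j <= m q -> cat_of (off m q + j) = ucat (F q) j.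
Proof.
move=> lt_qk lt0j le_jm; rewrite /cat_of blkE // addKn.
by case: (off m q + j) (ltn_addl (off m q) lt0j).
Qed.

Lemma posP p : p <= N ->
  p = 0 \/ exists q j, [/\ q < k, 0 < j, j <= m q & p = off m q + j].
Proof. by case: p => [|p] le_p; [left | right; apply: offP]. Qed.

Lemma ev_inner0 w q : ev (F q) 0 (inner w q) = outer w q.+1.
Proof. by apply: ev_ext => // -[]. Qed.

(** Compatibility with sources, targets, equality and composition are all instances of this
    notion, so that the composite inherits the four of them by one argument. *)
Definition respects (n : nat) (e : nat -> (nat -> parrow) -> parrow)
    (R : (nat -> parrow) -> Prop) : Prop :=
  forall i (w : nat -> nat -> parrow), i <= n ->
  (forall j, j <= n -> j <> i -> R (fun z => w z j)) -> R (fun z => e i (w z)).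

Lemma outer_respects R (w : nat -> nat -> parrow) i :
  (forall q, q < k -> respects (uar (F q)) (ev (F q)) R) ->
  (i <> 0 -> R (fun z => w z 0)) ->
  (forall q j, q < k -> q.+1 <> i -> 0 < j -> j <= m q -> R (fun z => w z (off m q + j))) ->
  forall j, j <= k -> j <> i -> R (fun z => outer (w z) j).
Proof.
move=> rF r0 r [|q] lt_qk ne; first by apply: r0 => e; apply: ne.
apply: (rF q lt_qk 0 (fun z j => w z (off m q + j))) => // j le_jm ne0.
by apply: r => //; lia.
Qed.

Lemma cev_respects R : respects k (ev G) R ->
  (forall q, q < k -> respects (uar (F q)) (ev (F q)) R) -> respects N cev R.
Proof.
move=> rG rF p w le_p; case: (posP le_p) => [->|[q [j [lt_qk lt0j le_jm ->]]]] r.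
  apply: (rG 0 (fun z => outer (w z))) => //.
  apply: outer_respects => // q j lt_qk _ lt0j le_jm; apply: r; last by lia.
  exact: off_leq.
have -> : (fun z => cev (off m q + j) (w z)) =
          (fun z => ev (F q) j (inner (w z) q)).
  by apply: functional_extensionality => z; rewrite cevE.
apply: (rF q lt_qk j (fun z => inner (w z) q)) => // -[_ _|j' le_j' ne] /=; last first.
  by apply: r; [exact: off_leq | move=> /addnI].
apply: (rG q.+1 (fun z => outer (w z))) => //.
apply: outer_respects => // [_|q' j' lt_q' ne lt0j' le_j'].
  by apply: r => //; lia.
apply: r; first exact: off_leq.
by case/(off_inj lt_q' lt0j' le_j' lt_qk lt0j le_jm) => e _; apply: ne; rewrite e.
Qed.

Lemma respects_src X : respects (uar X) (ev X) (fun f => osrc (f 0) = f 1).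
Proof.
by move=> i w le_in r; rewrite ev_src //; apply: ev_ext => // j le_jn ne; apply: r.
Qed.

Lemma respects_tgt X : respects (uar X) (ev X) (fun f => otgt (f 0) = f 1).
Proof.
by move=> i w le_in r; rewrite ev_tgt //; apply: ev_ext => // j le_jn ne; apply: r.
Qed.

Lemma respects_eq X : respects (uar X) (ev X) (fun f => f 0 = f 1).
Proof. by move=> i w le_in r; apply: ev_ext => // j le_jn ne; apply: r. Qed.

Lemma respects_comp X : respects (uar X) (ev X)
  (fun f => osrc (f 1) = otgt (f 2) /\ f 0 = ocomp (f 1) (f 2)).
Proof.
move=> i w le_in r; split.
  rewrite ev_src // ev_tgt //; apply: ev_ext => // j le_jn ne.
  by case: (r j le_jn ne).
rewrite -ev_comp // => [|j le_jn ne]; last by case: (r j le_jn ne).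
by apply: ev_ext => // j le_jn ne; case: (r j le_jn ne).
Qed.

Lemma cev_src p w : p <= N -> osrc (cev p w) = cev p (fun j => osrc (w j)).
Proof.
move=> le_p; pose W z j := if z is 0 then w j else osrc (w j).
apply: (@cev_respects (fun f => osrc (f 0) = f 1) (@respects_src _) _ p W) => //.
by move=> q _; exact: respects_src.
Qed.

Lemma cev_tgt p w : p <= N -> otgt (cev p w) = cev p (fun j => otgt (w j)).
Proof.
move=> le_p; pose W z j := if z is 0 then w j else otgt (w j).
apply: (@cev_respects (fun f => otgt (f 0) = f 1) (@respects_tgt _) _ p W) => //.
by move=> q _; exact: respects_tgt.
Qed.

Lemma cev_ext p v w : p <= N ->
  (forall j, j <= N -> j <> p -> v j = w j) -> cev p v = cev p w.
Proof.
move=> le_p e; pose W z j := if z is 0 then v j else w j : parrow.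
apply: (@cev_respects (fun f => f 0 = f 1) (@respects_eq _) _ p W) => //.
by move=> q _; exact: respects_eq.
Qed.

Lemma cev_comp p v w : p <= N ->
  (forall j, j <= N -> j <> p -> osrc (v j) = otgt (w j)) ->
  cev p (fun j => ocomp (v j) (w j)) = ocomp (cev p v) (cev p w).
Proof.
move=> le_p e.
pose W z j := match z with 0 => ocomp (v j) (w j) | 1 => v j | _ => w j end.
have [j le_j ne|_ ->] // :=
  @cev_respects _ (@respects_comp G) (fun q _ => @respects_comp (F q)) p W le_p.
by split=> //; apply: e.
Qed.

Lemma outer_typed i w : i <= k ->
  typed k (ucat G) i (outer w) <->
  (i <> 0 -> ocat (w 0) = Some (ucat G 0)) /\
  (forall q j, q < k -> q.+1 <> i -> 0 < j -> j <= m q ->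
     ocat (w (off m q + j)) = Some (ucat (F q) j)).
Proof.
move=> le_ik; split=> [t|[t0 t] [|q] lt_qk ne]; last 2 first.
- by apply: t0 => e; apply: ne.
- rewrite /= joint // ev_cat // => j le_jm ne0.
  by apply: t => //; lia.
split=> [ne|q j lt_qk ne lt0j le_jm]; first by apply: (t 0) => // e; apply: ne.
have := t q.+1 lt_qk ne; rewrite /= => e.
have ne0 : ev (F q) 0 (fun j => w (off m q + j)) <> None by move=> e0; rewrite e0 in e.
by apply: (ev_typed _ ne0) => //; lia.
Qed.

Lemma cev_typed p w : p <= N -> cev p w <> None -> typed N cat_of p w.
Proof.
case/posP => [->|[q [j [lt_qk lt0j le_jm ->]]]].
  move/ev_some => /(_ (leq0n _)) /outer_typed-/(_ (leq0n _))[_ t].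
  move=> p' /posP[-> //|[q [j [lt_qk lt0j le_jm ->]]]] _.
  by rewrite cat_ofE //; apply: t.
rewrite cevE // => /ev_some-/(_ le_jm) t.
have [t1 t2] : (q.+1 <> 0 -> ocat (w 0) = Some (ucat G 0)) /\
  (forall r j, r < k -> r.+1 <> q.+1 -> 0 < j -> j <= m r ->
     ocat (w (off m r + j)) = Some (ucat (F r) j)).
  apply/outer_typed => //; apply/ev_some => // e.
  have ne0 : 0 <> j by lia.
  by have := t 0 isT ne0; rewrite /= e.
move=> p' /posP[-> _|[q' [j' [lt_q' lt0j' le_j' ->]]] ne]; first exact: t1.
rewrite cat_ofE //; have [e|ne'] := eqVneq q' q; last first.
  by apply: t2 => // -[e]; rewrite e eqxx in ne'.
subst q'; have := t j' le_j'; case: j' lt0j' {le_j'} ne => // j' _ ne; apply.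
by move=> e; apply: ne; rewrite e.
Qed.

Lemma cev_cat p w : p <= N -> typed N cat_of p w -> ocat (cev p w) = Some (op (cat_of p)).
Proof.
case/posP => [->|[q [j [lt_qk lt0j le_jm ->]]]] t.
  rewrite cev0 ev_cat //; apply/outer_typed => //; split=> // q j lt_qk _ lt0j le_jm.
  by rewrite t ?cat_ofE //; [exact: off_leq | lia].
rewrite cevE // cat_ofE // ev_cat // => -[_ _|j' le_j' ne]; last first.
  rewrite /= t ?cat_ofE //; first exact: off_leq.
  by move=> /addnI.
rewrite /= ev_cat // ?joint ?opK //; apply/outer_typed => //; split=> [_|q' j' lt_q' ne lt0j' le_j'].
  by rewrite t //; lia.
rewrite t ?cat_ofE //; first exact: off_leq.
by case/(off_inj lt_q' lt0j' le_j' lt_qk lt0j le_jm) => e _; apply: ne; rewrite e.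
Qed.

Local Notation celt := (element N cat_of cev).
Local Notation cobjects := (objects N cat_of).

Lemma outer_src w q : osrc (outer w q) = outer (fun j => osrc (w j)) q.
Proof. by case: q => //= q; rewrite ev_src. Qed.

Lemma outer_tgt w q : otgt (outer w q) = outer (fun j => otgt (w j)) q.
Proof. by case: q => //= q; rewrite ev_tgt. Qed.

Lemma inner_src w q j : q < k -> osrc (inner w q j) = inner (fun j => osrc (w j)) q j.
Proof.
move=> lt_qk; case: j => //=; rewrite ev_src //.
by congr ev; apply: functional_extensionality => j; rewrite outer_src.
Qed.

Lemma inner_tgt w q j : q < k -> otgt (inner w q j) = inner (fun j => otgt (w j)) q j.
Proof.
move=> lt_qk; case: j => //=; rewrite ev_tgt //.
by congr ev; apply: functional_extensionality => j; rewrite outer_tgt.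
Qed.

Lemma outer_ext v w q : q <= k -> (forall j, j <= N -> v j = w j) -> outer v q = outer w q.
Proof.
case: q => [_|q lt_qk] e; first exact: e.
by apply: ev_ext => // j le_j _; apply: e; apply: off_leq.
Qed.

Lemma inner_ext v w q j : q < k -> j <= m q -> (forall j, j <= N -> v j = w j) ->
  inner v q j = inner w q j.
Proof.
move=> lt_qk; case: j => [_|j le_j] e; last by apply: e; apply: off_leq.
by apply: ev_ext => // r le_r _; apply: outer_ext.
Qed.

Lemma typed_full u : (forall p, p <= N -> ocat (u p) = Some (cat_of p)) ->
  (forall q, q <= k -> ocat (outer u q) = Some (ucat G q)) /\
  (forall q j, q < k -> j <= m q -> ocat (inner u q j) = Some (ucat (F q) j)).
Proof.
move=> t.
have t0 q : q <= k -> typed k (ucat G) q (outer u).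
  move=> le_q; apply/outer_typed => //; split=> [_|r j lt_r _ lt0j le_j].
    by rewrite t.
  by rewrite t ?cat_ofE //; exact: off_leq.
split=> [q le_q|q [|j] lt_q le_j]; last 2 first.
- by rewrite /= ev_cat ?joint ?opK //; apply: t0.
- by rewrite /= t ?cat_ofE //; exact: off_leq.
case: q le_q => [_|q lt_q]; first by rewrite /= t.
rewrite joint //= ev_cat // => j le_j ne.
by rewrite t ?cat_ofE //; [lia | exact: off_leq].
Qed.

Lemma outer_objects a : cobjects a -> objects k (ucat G) (outer a).
Proof.
move=> o q le_q; have [t _] := @typed_full a (fun p le_p => proj1 (o p le_p)).
split; first exact: t.
by rewrite outer_src; apply: outer_ext => // j /o[].
Qed.

Lemma inner_objects a q : q < k -> cobjects a -> objects (m q) (ucat (F q)) (inner a q).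
Proof.
move=> lt_q o j le_j; have [_ t] := @typed_full a (fun p le_p => proj1 (o p le_p)).
split; first exact: t.
by rewrite inner_src //; apply: inner_ext => // p /o[].
Qed.

Lemma celt0 a x : cobjects a -> celt a 0 x <-> elt G (outer a) 0 x.
Proof. by move=> o; split=> -[_ es et]; split=> //; apply: outer_objects. Qed.

Lemma celtE a q j x : q < k -> 0 < j -> j <= m q -> cobjects a ->
  celt a (off m q + j) x <-> elt (F q) (inner a q) j x.
Proof.
move=> lt_q lt0j le_j o.
have e : a (off m q + j) = inner a q j by case: j lt0j {le_j}.
split=> -[_ es et]; split=> //; rewrite ?es ?et ?cevE //.
exact: inner_objects.
Qed.

(** The equality B_{q+1} = A_{q,0}^op, under which an element of the outer adjunction at an
    input becomes an element of the argument at its root. *)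
Lemma celt_turn a q x : q < k -> cobjects a ->
  elt G (outer a) q.+1 x <-> elt (F q) (inner a q) 0 (oop x).
Proof.
move=> lt_q o; split=> -[_ es et]; split; rewrite ?ev_inner0.
- exact: inner_objects.
- by rewrite osrc_op et.
- by rewrite otgt_op es oopK.
- exact: outer_objects.
- by move: et; rewrite otgt_op => /(canRL oopK).
- by move: es; rewrite osrc_op ev_inner0 => /(inv_inj oopK).
Qed.

Definition to_root (a : nat -> parrow) (p : nat) (x : parrow) : parrow :=
  if p is 0 then x else
  let q := blk m k p in
  tr G q.+1 0 (outer a) (oop (tr (F q) (p - off m q) 0 (inner a q) x)).

Definition from_root (a : nat -> parrow) (p : nat) (x : parrow) : parrow :=
  if p is 0 then x else
  let q := blk m k p in
  tr (F q) 0 (p - off m q) (inner a q) (oop (tr G 0 q.+1 (outer a) x)).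

Lemma to_rootE a q j x : q < k -> 0 < j -> j <= m q ->
  to_root a (off m q + j) x = tr G q.+1 0 (outer a) (oop (tr (F q) j 0 (inner a q) x)).
Proof.
move=> lt_qk lt0j le_jm; rewrite /to_root blkE // addKn.
by case: (off m q + j) (ltn_addl (off m q) lt0j).
Qed.

Lemma from_rootE a q j x : q < k -> 0 < j -> j <= m q ->
  from_root a (off m q + j) x = tr (F q) 0 j (inner a q) (oop (tr G 0 q.+1 (outer a) x)).
Proof.
move=> lt_qk lt0j le_jm; rewrite /from_root blkE // addKn.
by case: (off m q + j) (ltn_addl (off m q) lt0j).
Qed.

Lemma to_root_elt a p x : p <= N -> celt a p x -> celt a 0 (to_root a p x).
Proof.
case/posP => [->//|[q [j [lt_q lt0j le_j ->]]]] l; have [o _ _] := l.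
rewrite to_rootE //; apply/celt0 => //; apply: tr_element => //.
by apply/celt_turn => //; rewrite oopK; apply: tr_element => //; apply/celtE.
Qed.

Lemma from_root_elt a p x : p <= N -> celt a 0 x -> celt a p (from_root a p x).
Proof.
case/posP => [->//|[q [j [lt_q lt0j le_j ->]]]] l; have [o _ _] := l.
rewrite from_rootE //; apply/celtE => //; apply: tr_element => //.
by apply/celt_turn => //; apply: tr_element => //; apply/celt0.
Qed.

Lemma to_from a p x : p <= N -> celt a 0 x -> to_root a p (from_root a p x) = x.
Proof.
case/posP => [->//|[q [j [lt_q lt0j le_j ->]]]] l; have [o _ _] := l.
have lG : elt G (outer a) 0 x by apply/celt0.
rewrite to_rootE // from_rootE // tr_comp // tr_id //; last first.
  by apply/celt_turn => //; apply: tr_element.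
by rewrite oopK tr_comp // tr_id.
Qed.

Lemma from_to a p x : p <= N -> celt a p x -> from_root a p (to_root a p x) = x.
Proof.
case/posP => [->//|[q [j [lt_q lt0j le_j ->]]]] l; have [o _ _] := l.
have lF : elt (F q) (inner a q) j x by apply/celtE.
rewrite from_rootE // to_rootE // tr_comp // tr_id //; last first.
  by apply/celt_turn => //; rewrite oopK; apply: tr_element.
by rewrite oopK tr_comp // tr_id.
Qed.

Lemma act_turn u q x : q < k ->
  oop (act (ev (F q)) (inner u q) 0 x) = act (ev G) (outer u) q.+1 (oop x).
Proof. by move=> lt_q; rewrite /act !oop_comp ev_inner0 oopK ocompA. Qed.

(** The naturalities of the two transposes fit together because [act] for the outer
    adjunction and for the argument are exchanged by reversal ([act_turn]). *)
Lemma to_root_nat u p x : p <= N ->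
  (forall p, p <= N -> ocat (u p) = Some (cat_of p)) ->
  celt (fun j => osrc (u j)) p x ->
  to_root (fun j => otgt (u j)) p (act cev u p x) =
  act cev u 0 (to_root (fun j => osrc (u j)) p x).
Proof.
case/posP => [->//|[q [j [lt_q lt0j le_j ->]]]] t l; have [o _ _] := l.
have [tG tF] := typed_full t.
have eG : outer (fun j => otgt (u j)) = fun j => otgt (outer u j).
  by apply: functional_extensionality => i; rewrite outer_tgt.
have eG' : outer (fun j => osrc (u j)) = fun j => osrc (outer u j).
  by apply: functional_extensionality => i; rewrite outer_src.
have eF : inner (fun j => otgt (u j)) q = fun j => otgt (inner u q j).
  by apply: functional_extensionality => i; rewrite inner_tgt.
have eF' : inner (fun j => osrc (u j)) q = fun j => osrc (inner u q j).
  by apply: functional_extensionality => i; rewrite inner_src.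
have lF : elt (F q) (fun j => osrc (inner u q j)) j x by rewrite -eF'; apply/celtE.
have -> : act cev u (off m q + j) x = act (ev (F q)) (inner u q) j x.
  by rewrite /act cevE //; case: j lt0j {le_j l lF}.
rewrite !to_rootE // eG eF eG' eF' tr_nat //; last by move=> i le_i; apply: tF.
rewrite act_turn // tr_nat //.
by rewrite -eG'; apply/celt_turn => //; rewrite oopK eF'; apply: tr_element.
Qed.

Definition ctr (p p' : nat) (a : nat -> parrow) (x : parrow) : parrow :=
  guard (celt a p x) (from_root a p' (to_root a p x)).

Lemma ctr_element p p' a x : p <= N -> p' <= N -> celt a p x -> celt a p' (ctr p p' a x).
Proof.
by move=> le_p le_p' l; rewrite /ctr guardT //; apply/from_root_elt/to_root_elt.
Qed.

Lemma ctr_none p p' a x : p <= N -> p' <= N -> ~ celt a p x -> ctr p p' a x = None.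
Proof. by move=> _ _; apply: guardF. Qed.

Lemma ctr_id p a x : p <= N -> celt a p x -> ctr p p a x = x.
Proof. by move=> le_p l; rewrite /ctr guardT // from_to. Qed.

Lemma celt_none a p : p <= N -> ~ celt a p None.
Proof. by move=> le_p [o _ et]; have [] := o p le_p; rewrite -et. Qed.

Lemma ctr_comp i j l a x : i <= N -> j <= N -> l <= N ->
  ctr j l a (ctr i j a x) = ctr i l a x.
Proof.
move=> le_i le_j le_l; have [e|ne] := classic (celt a i x); last first.
  by rewrite /ctr (guardF _ ne) guardF ?(guardF _ ne) //; apply: celt_none.
rewrite {1}/ctr guardT; last exact: ctr_element.
by rewrite /ctr !(guardT _ e) to_from //; apply: to_root_elt.
Qed.

Lemma ctr_nat i j u x : i <= N -> j <= N ->
  (forall p, p <= N -> ocat (u p) = Some (cat_of p)) ->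
  celt (fun j => osrc (u j)) i x ->
  ctr i j (fun l => otgt (u l)) (act cev u i x) =
  act cev u j (ctr i j (fun l => osrc (u l)) x).
Proof.
move=> le_i le_j t l.
have act_elt p y : p <= N -> celt (fun l => osrc (u l)) p y ->
    celt (fun l => otgt (u l)) p (act cev u p y).
  move=> le_p [o es et].
  have e1 : osrc y = otgt (oop (cev p u)) by rewrite es otgt_op cev_src.
  have e2 : osrc (u p) = otgt (ocomp y (oop (cev p u))) by rewrite otgt_comp.
  split; last by rewrite /act otgt_comp.
    by move=> q le_q; rewrite ocat_tgt osrc_tgt t.
  by rewrite /act osrc_comp // osrc_comp // osrc_op cev_tgt.
rewrite /ctr guardT; last exact: act_elt.
rewrite (guardT _ l) to_root_nat //; set y := to_root _ _ _.
have ly : celt (fun l => osrc (u l)) 0 y by apply: to_root_elt.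
rewrite -{1}(to_from le_j ly) -to_root_nat ?from_to //; first apply: act_elt => //.
  exact: from_root_elt.
exact: from_root_elt.
Qed.

Lemma ctr_ext i j a b x : i <= N -> j <= N ->
  (forall p, p <= N -> a p = b p) -> ctr i j a x = ctr i j b x.
Proof.
have celt_ext c d p y : p <= N -> (forall p, p <= N -> c p = d p) ->
    celt c p y -> celt d p y.
  move=> le_p e [o es et]; split; rewrite -?e //.
    by move=> q le_q; rewrite -e //; apply: o.
  by rewrite es; congr oop; apply: cev_ext => // q le_q _; apply: e.
move=> le_i le_j e; have [l|nl] := classic (celt a i x); last first.
  rewrite !ctr_none // => l; apply: nl; apply: celt_ext l => // p le_p.
  by rewrite e.
rewrite /ctr guardT // guardT; last exact: celt_ext l.
have to_e p y : p <= N -> to_root a p y = to_root b p y.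
  case/posP => [->//|[q [r [lt_q lt0r le_r ->]]]]; rewrite !to_rootE //.
  rewrite (@tr_ext (F q) _ _ (inner a q) (inner b q)) //; last first.
    by move=> s le_s; apply: inner_ext.
  by apply: tr_ext => // s le_s; apply: outer_ext.
have from_e p y : p <= N -> from_root a p y = from_root b p y.
  case/posP => [->//|[q [r [lt_q lt0r le_r ->]]]]; rewrite !from_rootE //.
  rewrite (@tr_ext G _ _ (outer a) (outer b)) //; last first.
    by move=> s le_s; apply: outer_ext.
  by apply: tr_ext => // s le_s; apply: inner_ext.
by rewrite to_e // from_e.
Qed.

Definition ucomp : uadj :=
  @UAdj N cat_of cev ctr cev_typed cev_cat (fun i w => @cev_src i w)
    (fun i w => @cev_tgt i w) cev_comp cev_ext
    ctr_element ctr_none ctr_id ctr_comp ctr_nat ctr_ext.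

Lemma ucomp_tr0 p a x : elt ucomp a 0 x -> tr ucomp 0 p a x = from_root a p x.
Proof. exact: guardT. Qed.

End Composition.

Lemma typed_eq n A B i w : (forall j, j <= n -> A j = B j) ->
  typed n A i w -> typed n B i w.
Proof. by move=> e t j le_j ne; rewrite -e //; apply: t. Qed.

Lemma element_eq n A B e e' a b i x : i <= n -> (forall j, j <= n -> A j = B j) ->
  (forall i w, i <= n -> typed n A i w -> e i w = e' i w) ->
  (forall i v w, i <= n -> (forall j, j <= n -> j <> i -> v j = w j) -> e' i v = e' i w) ->
  (forall j, j <= n -> a j = b j) ->
  element n A e a i x -> element n B e' b i x.
Proof.
move=> le_i eA ee ext eab [o es et]; split.
- by move=> j le_j; rewrite -eab // -eA //; apply: o.
- rewrite es ee //; last exact: objectsT o.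
  by congr oop; apply: ext => // j le_j _; apply: eab.
- by rewrite et eab.
Qed.

Lemma elt_ext X a b i x : i <= uar X -> (forall j, j <= uar X -> a j = b j) ->
  elt X a i x -> elt X b i x.
Proof. by move=> le_i e; apply: element_eq => // *; apply: ev_ext. Qed.

(** All elements are transposes of elements at the position [r], so it suffices to compare the
    transposes from [r].  A good choice of [r] makes one of the two sides trivial. *)
Lemma ueq_intro r X Y : r <= uar X -> uar X = uar Y ->
  (forall i, i <= uar X -> ucat X i = ucat Y i) ->
  (forall i w, i <= uar X -> typed (uar X) (ucat X) i w -> ev X i w = ev Y i w) ->
  (forall i a x, i <= uar X -> elt X a r x -> tr X r i a x = tr Y r i a x) ->
  ueq X Y.
Proof.
move=> le_r en ec ee et.
have ee' i w : i <= uar X -> ev X i w = ev Y i w.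
  move=> le_i; have [t|nt] := classic (typed (uar X) (ucat X) i w); first exact: ee.
  case e1 : (ev X i w) => [f|]; first by case: nt; apply: ev_typed; rewrite ?e1.
  case e2 : (ev Y i w) => [f|//]; case: nt; apply: (@typed_eq _ (ucat Y)).
    by move=> j le_j; rewrite ec.
  by rewrite en; apply: ev_typed; rewrite -?en ?e2.
have eXY i a x : i <= uar X -> elt X a i x -> elt Y a i x.
  move=> le_i; rewrite -en; apply: element_eq => //.
  by move=> l v w le_l; rewrite en in le_l *; apply: ev_ext.
have eYX i a x : i <= uar X -> elt Y a i x -> elt X a i x.
  move=> le_i; rewrite -en; apply: element_eq => //.
  - by move=> j le_j; rewrite ec.
  - by move=> j w le_j _; rewrite ee'.
  - by move=> l v w le_l; apply: ev_ext.
split=> // i j a x le_i le_j; have [l|nl] := classic (elt X a i x); last first.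
  rewrite (tr_none _ _ nl) // tr_none -?en // => l; apply: nl.
  by apply: eYX => //; rewrite -en.
have l' : elt X a r (tr X i r a x) by apply: tr_element.
have e2 : tr Y r i a (tr X i r a x) = x by rewrite -et // tr_comp // tr_id.
have e1 : tr X i r a x = tr Y i r a x.
  rewrite -{2}e2 tr_comp -?en // tr_id -?en //.
  by have := eXY r a _ le_r l'; rewrite -en.
by rewrite -(@tr_comp X i r j) // et // e1 tr_comp -?en.
Qed.

Lemma ueq_refl X : ueq X X. Proof. by []. Qed.

Lemma ueq_sym X Y : ueq X Y -> ueq Y X.
Proof.
case=> en ec ee et; split=> //; rewrite -en => *.
- by rewrite ec.
- by rewrite ee.
- by rewrite et.
Qed.

Lemma ueq_trans X Y Z : ueq X Y -> ueq Y Z -> ueq X Z.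
Proof.
case=> en ec ee et [en' ec' ee' et']; split=> [|i le_i|i w le_i|i j a x le_i le_j].
- by rewrite en.
- by rewrite ec // ec' // -en.
- by rewrite ee // ee' // -en.
- by rewrite et // et' // -en.
Qed.

Lemma off_eq m m' k : (forall q, q < k -> m q = m' q) -> off m k = off m' k.
Proof.
elim: k => //= k IH e; rewrite IH ?e // => q lt_q.
by apply: e; apply: ltnW.
Qed.

Lemma off_le_eq m m' k q : q <= k -> (forall q, q < k -> m q = m' q) -> off m q = off m' q.
Proof. by move=> le_q e; apply: off_eq => r lt_r; apply: e; apply: leq_trans lt_r le_q. Qed.

Section CompEq.
Variables (G G' : uadj) (F F' : nat -> uadj).
Hypothesis jG : forall q, q < uar G -> ucat G q.+1 = op (ucat (F q) 0).
Hypothesis jG' : forall q, q < uar G' -> ucat G' q.+1 = op (ucat (F' q) 0).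
Hypothesis eG : ueq G G'.
Hypothesis eF : forall q, q < uar G -> ueq (F q) (F' q).
Local Notation m := (fun q => uar (F q)).
Local Notation m' := (fun q => uar (F' q)).

Let ek : uar G = uar G'. Proof. by case: eG. Qed.

Let em q : q < uar G -> m q = m' q.
Proof. by move=> /eF[]. Qed.

Let eo q : q <= uar G -> off m q = off m' q.
Proof. by move=> le_q; apply: off_le_eq le_q em. Qed.

Lemma outer_ueq w q : q <= uar G -> outer F w q = outer F' w q.
Proof.
case: q => //= q lt_q; case: (eF lt_q) => _ _ -> // _.
by rewrite (eo (ltnW lt_q)).
Qed.

Lemma inner_ueq w q j : q < uar G -> inner G F w q j = inner G' F' w q j.
Proof.
move=> lt_q; case: j => [|j] /=; last by rewrite (eo (ltnW lt_q)).
case: eG => _ _ <- // _; apply: ev_ext => // i le_i _; exact: outer_ueq.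
Qed.

Lemma ucomp_ueq : ueq (ucomp jG) (ucomp jG').
Proof.
apply: (@ueq_intro 0) => //=.
- by rewrite -ek eo.
- move=> p /posP[->|[q [j [lt_q lt0j le_j ->]]]]; first by case: eG => _ /(_ 0 isT).
  rewrite cat_ofE // eo ?(ltnW lt_q) // cat_ofE -?ek -?em //.
  by case: (eF lt_q) => _ /(_ j le_j).
- move=> p w /posP[->|[q [j [lt_q lt0j le_j ->]]]] _.
    rewrite !cev0; case: eG => _ _ <- // _; apply: ev_ext => // q le_q _.
    exact: outer_ueq.
  rewrite cevE // eo ?(ltnW lt_q) // cevE -?ek -?em //.
  case: (eF lt_q) => _ _ <- // _; apply: ev_ext => // i le_i _; exact: inner_ueq.
move=> p a x le_p l.
have le_p' : p <= off m' (uar G') by rewrite -ek -eo.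
have l' : element (off m' (uar G')) (cat_of G' F') (cev G' F') a 0 x.
  have [o es et] := l; split=> //; last first.
    rewrite es !cev0; case: eG => _ _ <- // _; congr oop.
    by apply: ev_ext => // q le_q _; apply: outer_ueq.
  rewrite -ek -eo // => j le_j; have [oc oi] := o j le_j; split=> //.
  rewrite oc; congr Some; case/posP: le_j => [->|[q [i [lt_q lt0i le_i ->]]]].
    by case: eG => _ /(_ 0 isT).
  rewrite cat_ofE // eo ?(ltnW lt_q) // cat_ofE -?ek -?em //.
  by case: (eF lt_q) => _ /(_ i le_i).
rewrite /ctr !guardT //=.
case/posP: le_p => [->//|[q [j [lt_q lt0j le_j ->]]]].
rewrite from_rootE // eo ?(ltnW lt_q) // from_rootE -?ek -?em //.
have [_ _ _ <- //] := eF lt_q; have [_ _ _ <- //] := eG.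
rewrite (@tr_ext G _ _ (outer F' a) (outer F a)) //; last first.
  by move=> i le_i; rewrite outer_ueq.
by apply: tr_ext => // i le_i; apply: inner_ueq.
Qed.

End CompEq.

(** * Identities and rotation *)

Section Identity.
Variable A : category.

(** Both functors of the identity adjunction are identities, and its transposes reverse
    arrows. *)
Definition id_cat (i : nat) : category := if i is 0 then op A else A.

Definition id_ev (i : nat) (w : nat -> parrow) : parrow :=
  if i is 0 then guard (ocat (w 1) = Some A) (w 1)
  else guard (ocat (w 0) = Some (op A)) (w 0).

Definition id_tr (i j : nat) (a : nat -> parrow) (x : parrow) : parrow :=
  guard (element 1 id_cat id_ev a i x) (if i == j then x else oop x).

Lemma guard_none (P : Prop) x : guard P x <> None -> P.
Proof. by rewrite /guard; case: excluded_middle_informative. Qed.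

Lemma leq1P i : i <= 1 -> i = 0 \/ i = 1.
Proof. by case: i => [|[|i]] //; [left | right]. Qed.

Lemma id_typed i w : i <= 1 -> id_ev i w <> None -> typed 1 id_cat i w.
Proof.
by move=> /leq1P[] -> /guard_none e j /leq1P[] -> // ne; case: ne.
Qed.

Lemma id_ev_cat i w : i <= 1 -> typed 1 id_cat i w ->
  ocat (id_ev i w) = Some (op (id_cat i)).
Proof.
move=> /leq1P[] -> t /=.
  by rewrite guardT ?opK; apply: (t 1).
by rewrite guardT; apply: (t 0).
Qed.

Lemma id_src i w : i <= 1 -> osrc (id_ev i w) = id_ev i (fun j => osrc (w j)).
Proof.
by move=> /leq1P[] -> /=; rewrite /guard ocat_src; case: excluded_middle_informative.
Qed.

Lemma id_tgt i w : i <= 1 -> otgt (id_ev i w) = id_ev i (fun j => otgt (w j)).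
Proof.
by move=> /leq1P[] -> /=; rewrite /guard ocat_tgt; case: excluded_middle_informative.
Qed.

Lemma id_comp i v w : i <= 1 ->
  (forall j, j <= 1 -> j <> i -> osrc (v j) = otgt (w j)) ->
  id_ev i (fun j => ocomp (v j) (w j)) = ocomp (id_ev i v) (id_ev i w).
Proof.
move=> /leq1P[] -> e /=.
  have ec : ocat (v 1) = ocat (w 1) by rewrite -ocat_src e // ocat_tgt.
  rewrite /guard ocat_comp ?e // ec.
  by case: excluded_middle_informative => h /=; rewrite ?ocomp0.
have ec : ocat (v 0) = ocat (w 0) by rewrite -ocat_src e // ocat_tgt.
rewrite /guard ocat_comp ?e // ec.
by case: excluded_middle_informative => h /=; rewrite ?ocomp0.
Qed.

Lemma id_ext i v w : i <= 1 ->
  (forall j, j <= 1 -> j <> i -> v j = w j) -> id_ev i v = id_ev i w.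
Proof. by move=> /leq1P[] -> e /=; rewrite e. Qed.

Local Notation ielt := (element 1 id_cat id_ev).

Lemma id_turn a i j x : i <= 1 -> j <= 1 -> i <> j -> ielt a i x -> ielt a j (oop x).
Proof.
move=> le_i le_j ne [o es et].
have [o0 _] := o 0 isT; have [o1 _] := o 1 isT.
split=> //; rewrite ?osrc_op ?otgt_op ?es ?et ?oopK;
  by case/leq1P: le_i ne => ->; case/leq1P: le_j => -> //= _; rewrite guardT.
Qed.

Lemma id_tr_elt i j a x : i <= 1 -> j <= 1 -> ielt a i x -> ielt a j (id_tr i j a x).
Proof.
move=> le_i le_j l; rewrite /id_tr guardT //; have [<- //|/eqP ne] := eqVneq i j.
exact: id_turn l.
Qed.

Lemma id_tr_comp i j k a x : i <= 1 -> j <= 1 -> k <= 1 ->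
  id_tr j k a (id_tr i j a x) = id_tr i k a x.
Proof.
move=> le_i le_j le_k; have [l|nl] := classic (ielt a i x); last first.
  have e l : id_tr i l a x = None by rewrite /id_tr guardF.
  rewrite !e /id_tr guardF // => -[o _ et].
  by have [] := o j le_j; rewrite -et.
rewrite {1}/id_tr guardT; last exact: id_tr_elt.
rewrite /id_tr !guardT //.
by case/leq1P: le_i => ->; case/leq1P: le_j => ->; case/leq1P: le_k => -> //=; rewrite oopK.
Qed.

Lemma id_tr_nat i j u x : i <= 1 -> j <= 1 ->
  (forall k, k <= 1 -> ocat (u k) = Some (id_cat k)) ->
  ielt (fun k => osrc (u k)) i x ->
  id_tr i j (fun k => otgt (u k)) (act id_ev u i x) =
  act id_ev u j (id_tr i j (fun k => osrc (u k)) x).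
Proof.
move=> le_i le_j t l; rewrite {2}/id_tr guardT //.
have [o es et] := l; rewrite /id_tr guardT; last first.
  have e1 : osrc x = otgt (oop (id_ev i u)) by rewrite es otgt_op id_src.
  have e2 : osrc (u i) = otgt (ocomp x (oop (id_ev i u))) by rewrite otgt_comp.
  split; last by rewrite /act otgt_comp.
    by move=> q le_q; rewrite ocat_tgt osrc_tgt t.
  by rewrite /act osrc_comp // osrc_comp // osrc_op id_tgt.
have t0 := t 0 isT; have t1 := t 1 isT.
case/leq1P: le_i => ->; case/leq1P: le_j => -> //=;
  by rewrite /act !oop_comp /= !guardT // ?oopK ocompA.
Qed.

Lemma id_tr_ext i j a b x : i <= 1 -> j <= 1 ->
  (forall k, k <= 1 -> a k = b k) -> id_tr i j a x = id_tr i j b x.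
Proof.
move=> le_i le_j e; have [l|nl] := classic (ielt a i x).
  rewrite /id_tr !guardT //; apply: element_eq l => //.
  by move=> *; apply: id_ext.
rewrite /id_tr !guardF // => l; apply: nl; apply: element_eq l => //.
- by move=> *; apply: id_ext.
- by move=> k le_k; rewrite e.
Qed.

Definition uid : uadj :=
  @UAdj 1 id_cat id_ev id_tr id_typed id_ev_cat (fun i w => @id_src i w)
    (fun i w => @id_tgt i w) id_comp id_ext id_tr_elt
    (fun i j a x _ _ => @guardF _ _)
    (fun i a x _ l => etrans (guardT _ l) (congr1 (fun b : bool => if b then x else _) (eqxx i)))
    id_tr_comp id_tr_nat id_tr_ext.

Lemma uid_ev0 w : ocat (w 1) = Some A -> ev uid 0 w = w 1.
Proof. exact: guardT. Qed.

Lemma uid_ev1 w : ocat (w 0) = Some (op A) -> ev uid 1 w = w 0.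
Proof. exact: guardT. Qed.

Lemma uid_tr a i j x : elt uid a i x -> i <> j -> tr uid i j a x = oop x.
Proof. by move=> l /eqP /negPf ne; rewrite /= /id_tr guardT // ne. Qed.

End Identity.

(** The cyclic successor on 0, ..., [n] and its inverse. *)
Definition sh (n i : nat) : nat := if i < n then i.+1 else 0.
Definition unsh (n i : nat) : nat := if i is i'.+1 then i' else n.

Lemma sh_leq n i : sh n i <= n.
Proof. by rewrite /sh; case: ltnP. Qed.
Lemma unsh_leq n i : i <= n -> unsh n i <= n.
Proof. by case: i => //= i; apply: ltnW. Qed.
Lemma shK n i : i <= n -> unsh n (sh n i) = i.
Proof. by rewrite /sh; case: ltnP => //= h h'; apply/eqP; rewrite eqn_leq h. Qed.
Lemma unshK n i : i <= n -> sh n (unsh n i) = i.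
Proof. by case: i => [|i] /=; rewrite /sh ?ltnn // => ->. Qed.
Lemma unsh_neq n i j : i <= n -> j <= n -> i <> sh n j -> unsh n i <> j.
Proof. by move=> le_i le_j ne e; apply: ne; rewrite -e unshK. Qed.

Section Rotation.
Variable X : uadj.
Local Notation n := (uar X).

Definition rot_ev (i : nat) (w : nat -> parrow) : parrow :=
  ev X (sh n i) (fun j => w (unsh n j)).
Definition rot_cat (i : nat) : category := ucat X (sh n i).
Definition rot_tr (i j : nat) (a : nat -> parrow) (x : parrow) : parrow :=
  tr X (sh n i) (sh n j) (fun j => a (unsh n j)) x.

Lemma rot_ty i w : i <= n -> typed n rot_cat i w <->
  typed n (ucat X) (sh n i) (fun j => w (unsh n j)).
Proof.
move=> le_i; split=> t j le_j ne.
  rewrite t ?unsh_leq //; last exact: unsh_neq.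
  by rewrite /rot_cat unshK.
rewrite /rot_cat -t ?sh_leq ?shK // => e; apply: ne.
by rewrite -(shK le_j) e shK.
Qed.

Lemma rot_elt i a x : i <= n -> element n rot_cat rot_ev a i x <->
  elt X (fun j => a (unsh n j)) (sh n i) x.
Proof.
move=> le_i; split=> -[o es et]; split=> //; rewrite ?et ?shK //.
  by move=> j le_j; rewrite -{2}(unshK le_j); apply: o; exact: unsh_leq.
by move=> j le_j; rewrite -{1 3 4}(shK le_j); apply: o; exact: sh_leq.
Qed.

Definition urot : uadj.
Proof.
refine (@UAdj n rot_cat rot_ev rot_tr _ _ _ _ _ _ _ _ _ _ _ _).
- by move=> i w le_i ne; apply/rot_ty => //; apply: ev_typed => //; apply: sh_leq.
- by move=> i w le_i /(rot_ty _ le_i); apply: ev_cat; apply: sh_leq.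
- by move=> i w le_i; apply: ev_src; apply: sh_leq.
- by move=> i w le_i; apply: ev_tgt; apply: sh_leq.
- move=> i v w le_i e; apply: ev_comp; first exact: sh_leq.
  by move=> j le_j ne; apply: e; [exact: unsh_leq | exact: unsh_neq].
- move=> i v w le_i e; apply: ev_ext; first exact: sh_leq.
  by move=> j le_j ne; apply: e; [exact: unsh_leq | exact: unsh_neq].
- move=> i j a x le_i le_j /(rot_elt _ _ le_i) l; apply/rot_elt => //.
  by apply: tr_element; rewrite ?sh_leq.
- by move=> i j a x le_i le_j l; apply: tr_none; rewrite ?sh_leq // => /(rot_elt _ _ le_i).
- by move=> i a x le_i /(rot_elt _ _ le_i) l; apply: tr_id; rewrite ?sh_leq.
- by move=> i j k a x le_i le_j le_k; apply: tr_comp; rewrite ?sh_leq.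
- move=> i j u x le_i le_j t /(rot_elt _ _ le_i) l.
  have ea p y : p <= n -> act rot_ev u p y = act (ev X) (fun j => u (unsh n j)) (sh n p) y.
    by move=> le_p; rewrite /act shK.
  rewrite !ea // /rot_tr; apply: (@tr_nat X _ _ (fun j => u (unsh n j))); rewrite ?sh_leq //.
  by move=> k le_k; rewrite t ?unsh_leq // /rot_cat unshK.
- move=> i j a b x le_i le_j e; apply: tr_ext; rewrite ?sh_leq // => k le_k.
  by apply: e; apply: unsh_leq.
Defined.

End Rotation.

Lemma urot_ueq X Y : ueq X Y -> ueq (urot X) (urot Y).
Proof.
case=> en ec ee et; split=> [//|i le_i|i w le_i|i j a x le_i le_j] /=.
- by rewrite /rot_cat -en ec ?sh_leq.
- by rewrite /rot_ev -en ee ?sh_leq.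
- by rewrite /rot_tr -en et ?sh_leq.
Qed.

(** * Unit laws and associativity *)

Lemma off_ones m k : (forall q, q < k -> m q = 1) -> forall q, q <= k -> off m q = q.
Proof.
move=> e; elim=> //= q IH lt_q; rewrite IH ?e ?addn1 //; exact: ltnW.
Qed.

Section UnitLeft.
Variables (A : category) (F : uadj).
Hypothesis joint : forall q, q < uar (uid A) -> ucat (uid A) q.+1 = op (ucat F 0).

Let eA : A = op (ucat F 0). Proof. exact: (joint (q := 0)). Qed.

Lemma ucomp_idl : ueq (ucomp (G := uid A) (F := fun _ => F) joint) F.
Proof.
have ev_cat0 w : ev F 0 w <> None -> ocat (ev F 0 w) = Some A.
  by move=> /ev_some-/(_ isT) t; rewrite ev_cat // eA.
have e1 w : ev F 0 (fun j => w (0 + j)) = ev F 0 w by [].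
have pos i : i <= uar F -> i = 0 \/ exists2 j, i = off (fun _ => uar F) 0 + j & 0 < j <= uar F.
  by case: i => [|i] le_i; [left | right; exists i.+1].
have ec i : i <= uar F -> cat_of (uid A) (fun _ => F) i = ucat F i.
  move=> /pos[->|[j -> /andP[lt0j le_j]]]; first by rewrite /= eA opK.
  by rewrite cat_ofE.
have eE i w : i <= uar F -> typed (uar F) (ucat F) i w ->
    cev (uid A) (fun _ => F) i w = ev F i w.
  move=> /pos[->|[j -> /andP[lt0j le_j]]] t.
    by rewrite cev0 uid_ev0 /= e1 //; apply: ev_cat0; apply/ev_some.
  rewrite cevE //; apply: ev_ext => // -[_ ne|//] /=.
  by rewrite guardT //= t ?eA ?opK //; lia.
apply: (@ueq_intro 0) => //=.
  by move=> i w le_i t; apply: eE => //; apply: typed_eq t => j /ec.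
move=> i a x le_i l.
have [o _ _] := l.
have l' : elt F a 0 x.
  by apply: element_eq l => //= [l w le_l t|*]; [apply: eE => //; apply: typed_eq t => j /ec | exact: ev_ext].
rewrite /ctr guardT //=; case/pos: le_i => [->|[j -> /andP[lt0j le_j]]]; first by rewrite tr_id.
rewrite from_rootE // uid_tr //; last exact/celt0.
rewrite oopK; apply: tr_ext => // -[_|//] /=.
by rewrite guardT //; case: (o 0 isT).
Qed.

End UnitLeft.

Section UnitRight.
Variables (G : uadj) (F : nat -> uadj).
Hypothesis joint : forall q, q < uar G -> ucat G q.+1 = op (ucat (F q) 0).
Hypothesis eF : forall q, q < uar G -> F q = uid (ucat G q.+1).
Local Notation m := (fun q => uar (F q)).

Lemma ucomp_idr : ueq (ucomp joint) G.
Proof.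
have eo q : q <= uar G -> off m q = q.
  by move=> le_q; apply: off_ones le_q => r lt_r; rewrite eF.
have eN : off m (uar G) = uar G by apply: eo.
have pos i : i <= uar G -> i = 0 \/ exists2 q, q < uar G & i = off m q + 1.
  by case: i => [|i] le_i; [left | right; exists i; rewrite ?eo ?addn1 // ltnW].
have one q : q < uar G -> 1 <= m q by move=> lt_q; rewrite eF.
have ec i : i <= uar G -> cat_of G F i = ucat G i.
  move=> /pos[->//|[q lt_q ->]]; rewrite cat_ofE ?one // eo ?(ltnW lt_q) // addn1.
  by rewrite eF.
have outerE w q : q <= uar G -> ocat (w q) = Some (ucat G q) -> outer F w q = w q.
  case: q => //= q lt_q e.
  by rewrite eF // uid_ev0 // eo ?addn1 // ltnW.
have eE i w : i <= uar G -> typed (uar G) (ucat G) i w -> cev G F i w = ev G i w.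
  move=> /pos[->|[q lt_q e]] t.
    by rewrite cev0; apply: ev_ext => // q le_q ne; rewrite outerE // t.
  have ei : i = q.+1 by rewrite e eo ?addn1 // ltnW.
  move: t; rewrite ei => t {i ei e}.
  have e : off m q + 1 = q.+1 by rewrite eo ?addn1 // ltnW.
  rewrite -{1}e cevE ?one //.
  have e2 : ev G q.+1 (outer F w) = ev G q.+1 w.
    by apply: ev_ext => // r le_r ne; rewrite outerE // t.
  by rewrite eF //= e2 guardT // ev_cat.
apply: (@ueq_intro 0) => //=; rewrite ?eN //.
  move=> i w le_i t; apply: eE => // j le_j ne; rewrite -ec //; exact: t.
move=> i a x le_i l.
have [o _ _] := l.
have o' : objects (uar G) (ucat G) a by move=> j le_j; rewrite -ec //; apply: o.
have l' : elt G a 0 x.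
  by apply: element_eq l => //= [j w le_j t|*]; [apply: eE => //; apply: typed_eq t => r /ec | exact: ev_ext].
rewrite /ctr guardT /= ?eN //; case/pos: le_i => [->|[q lt_q e]]; first by rewrite tr_id.
have ei : i = q.+1 by rewrite e eo ?addn1 // ltnW.
move: ei => {e} ->.
have e : off m q + 1 = q.+1 by rewrite eo ?addn1 // ltnW.
rewrite -{1}e from_rootE ?one //.
have e3 : tr G 0 q.+1 (outer F a) x = tr G 0 q.+1 a x.
  by apply: tr_ext => // j le_j; rewrite outerE //; case: (o' j le_j).
rewrite e3 [F q]eF // uid_tr ?oopK //.
have l2 : elt (F q) (inner G F a q) 0 (oop (tr G 0 q.+1 (outer F a) x)).
  have oN : objects (off m (uar G)) (cat_of G F) a by rewrite eN.
  apply/(celt_turn joint) => //; apply: tr_element => //.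
  by apply/(celt0 joint); rewrite ?eN.
by move: l2; rewrite e3 eF.
Qed.

End UnitRight.

Section Assoc.
Variables (G : uadj) (F : nat -> uadj) (H : nat -> nat -> uadj).
Local Notation k := (uar G).
Local Notation m := (fun q => uar (F q)).
Hypothesis jF : forall q, q < k -> ucat G q.+1 = op (ucat (F q) 0).
Hypothesis jH : forall q, forall l, l < uar (F q) -> ucat (F q) l.+1 = op (ucat (H q l) 0).
Local Notation P := (ucomp jF).
(** The arguments of the composite [P], in one list. *)
Definition flat (r : nat) : uadj :=
  let q := blk m k r.+1 in H q (r - off m q).
Hypothesis jP : forall r, r < uar P -> ucat P r.+1 = op (ucat (flat r) 0).
Local Notation C := (fun q => ucomp (jH (q := q))).
Hypothesis jC : forall q, q < k -> ucat G q.+1 = op (ucat (C q) 0).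
Local Notation M := (fun r => uar (flat r)).
Local Notation mm q := (fun l => uar (H q l)).
Local Notation mC := (fun q => off (mm q) (m q)).

Lemma flatE q l : q < k -> l < m q -> flat (off m q + l) = H q l.
Proof.
by move=> lt_q lt_l; rewrite /flat -addnS blkE // addKn.
Qed.

Lemma off_flat q l : q < k -> l <= m q ->
  off M (off m q + l) = off mC q + off (mm q) l.
Proof.
elim: q l => [|q IHq] l lt_q.
  elim: l => [//|l IHl] lt_l; rewrite addnS /= IHl ?(ltnW lt_l) //.
  by rewrite [flat l](flatE lt_q lt_l) addnA.
elim: l => [|l IHl] lt_l; last first.
  by rewrite addnS /= IHl ?(ltnW lt_l) // [flat _](flatE lt_q lt_l) -addnA.
by rewrite /= !addn0 IHq // ltnW.
Qed.

Lemma off_flat_total : off M (uar P) = off mC k.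
Proof.
rewrite /=; case ek : k => [//|k'] /=; rewrite off_flat //; by rewrite ek.
Qed.

Lemma pos3P p : p <= off mC k -> p = 0 \/ exists q l j,
  [/\ q < k, l < m q, 0 < j, j <= mm q l & p = off mC q + (off (mm q) l + j)].
Proof.
case: p => [|p] le_p; [by left | right].
have [q [i [lt_q lt0i le_i ->]]] := offP (ltn0Sn p) le_p.
have [l [j [lt_l lt0j le_j ->]]] := offP lt0i le_i.
by exists q, l, j.
Qed.

Lemma off_flatD q l j : q < k -> l < m q ->
  off M (off m q + l) + j = off mC q + (off (mm q) l + j).
Proof. by move=> lt_q lt_l; rewrite off_flat ?(ltnW lt_l) // addnA. Qed.

Lemma flat_leq q l : q < k -> l < m q -> off m q + l < uar P.
Proof. by move=> lt_q lt_l; rewrite -addnS; apply: off_leq. Qed.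

Lemma outer_flat w q l : q < k -> l < m q ->
  outer flat w (off m q + l).+1 = ev (H q l) 0 (fun j => w (off mC q + (off (mm q) l + j))).
Proof.
move=> lt_q lt_l /=; rewrite flatE //; apply: ev_ext => // j le_j _.
by rewrite off_flatD.
Qed.

Lemma outer_outer w q : q <= k -> outer F (outer flat w) q = outer C w q.
Proof.
case: q => [//|q] lt_q; rewrite [LHS]/= [RHS]/= /cev.
apply: ev_ext => // -[//|l] lt_l _; rewrite addnS.
by rewrite outer_flat.
Qed.

Lemma inner_outer w q l : q < k -> l <= m q ->
  inner G F (outer flat w) q l = outer (H q) (inner G C w q) l.
Proof.
move=> lt_q; case: l => [_|l lt_l].
  by apply: ev_ext => // r le_r _; apply: outer_outer.
rewrite [LHS]/= addnS outer_flat //=.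
by apply: ev_ext => // -[|j] //= _ _; rewrite addnS.
Qed.

Lemma inner_inner w q l j : q < k -> l < m q ->
  inner P flat w (off m q + l) j = inner (F q) (H q) (inner G C w q) l j.
Proof.
move=> lt_q lt_l; case: j => [|j]; last by rewrite /= off_flatD // addnS.
rewrite -[LHS]/(cev G F (off m q + l).+1 (outer flat w)) -addnS cevE // [RHS]/=; apply: ev_ext => // r le_r _.
exact: inner_outer.
Qed.

(** The two composites have the same inputs in the same order, and the three levels of
    adjunctions see the same families in both ([outer_outer], [inner_outer],
    [inner_inner]). *)
Lemma ucomp_assoc : ueq (ucomp jP) (ucomp jC).
Proof.
have ec p : p <= off mC k -> cat_of P flat p = cat_of G C p.
  move=> /pos3P[->//|[q [l [j [lt_q lt_l lt0j le_j ->]]]]].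
  rewrite -off_flatD // cat_ofE ?flat_leq ?flatE //.
  rewrite off_flatD // (@cat_ofE G C) //; [|lia|exact: off_leq].
  by rewrite /= cat_ofE.
have ee p w : p <= off mC k -> cev P flat p w = cev G C p w.
  move=> /pos3P[->|[q [l [j [lt_q lt_l lt0j le_j ->]]]]].
    by rewrite !cev0 /=; apply: ev_ext => // q le_q _; apply: outer_outer.
  rewrite -off_flatD // cevE ?flat_leq ?flatE //.
  rewrite off_flatD // (@cevE G C) //; [|lia|exact: off_leq].
  rewrite /= cevE //; apply: ev_ext => // i le_i _; exact: inner_inner.
have eN : uar (ucomp jP) = off mC k := off_flat_total.
apply: (@ueq_intro 0) => //.
- by move=> i; rewrite eN; apply: ec.
- by move=> i w; rewrite eN => le_i _; apply: ee.
move=> i a x le_i l; rewrite eN in le_i.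
have l' : elt (ucomp jC) a 0 x.
  move: (l); rewrite eN; apply: element_eq => //.
    by move=> j w le_j _; apply: ee.
  by move=> *; apply: (@ev_ext (ucomp jC)).
have [o _ _] := l; have [o' _ _] := l'.
rewrite /= /ctr (guardT _ l) (guardT _ l') /=.
move: le_i => /pos3P[->//|[q [l2 [j [lt_q lt_l lt0j le_j ->]]]]].
have lP : elt P (outer flat a) 0 x by apply/(celt0 jP _ o).
have lC : elt G (outer C a) 0 x by apply/(celt0 jC _ o').
have lC' : elt (C q) (inner G C a q) 0 (oop (tr G 0 q.+1 (outer C a) x)).
  by apply/(celt_turn jC) => //; apply: tr_element.
rewrite -off_flatD // from_rootE ?flat_leq ?flatE //.
rewrite off_flatD // (@from_rootE G C) //; [|lia|exact: off_leq].
rewrite (ucomp_tr0 _ lC') from_rootE // (ucomp_tr0 _ lP) -addnS from_rootE //.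
rewrite (@tr_ext (H q l2) _ _ _ (inner (F q) (H q) (inner G C a q) l2)) //; last first.
  by move=> r le_r; apply: inner_inner.
rewrite (@tr_ext (F q) _ _ _ (outer (H q) (inner G C a q))) //; last first.
  by move=> r le_r; apply: inner_outer.
by rewrite (@tr_ext G _ _ _ (outer C a)) // => r le_r; apply: outer_outer.
Qed.

End Assoc.

(** * Rotation of composites *)

Lemma urot_id A : ueq (urot (uid A)) (uid (op A)).
Proof.
apply: (@ueq_intro 0) => //=.
- by move=> i /leq1P[] -> //=; rewrite /rot_cat /= ?opK.
- move=> i w /leq1P[] -> t /=; rewrite /rot_ev /= ?opK //.
move=> i a x le_i l; have l' : elt (urot (uid A)) a 0 x by [].
move: l => /(rot_elt (X := uid A)) /= l.
have l2 : elt (uid (op A)) a 0 x.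
  have [o es et] := l'; split=> //.
  by move=> j /leq1P[] -> /=; [have := o 0 isT | have := o 1 isT]; rewrite /= /rot_cat /= ?opK.
by case/leq1P: le_i => ->; rewrite /= /rot_tr /= /id_tr !guardT //; apply: l.
Qed.

Lemma iter_sh_val n i r : i <= n -> iter r (sh n) i = (i + r) %% n.+1.
Proof.
move=> le_i; elim: r => [|r IH]; first by rewrite addn0 modn_small.
rewrite iterS IH /sh addnS -[(i + r).+1]addn1 -[RHS]modnDml addn1.
have := ltn_pmod (i + r) (ltn0Sn n); rewrite ltnS leq_eqVlt => /orP[/eqP ->|lt].
  by rewrite ltnn modnn.
by rewrite lt [RHS]modn_small ?ltnS.
Qed.

Lemma iter_sh n i : i <= n -> iter n.+1 (sh n) i = i.
Proof. by move=> le_i; rewrite iter_sh_val // modnDr modn_small. Qed.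

Lemma iter_urot X r :
  [/\ uar (iter r urot X) = uar X,
      forall i, ucat (iter r urot X) i = ucat X (iter r (sh (uar X)) i),
      forall i w, ev (iter r urot X) i w =
         ev X (iter r (sh (uar X)) i) (fun j => w (iter r (unsh (uar X)) j)) &
      forall i j a x, tr (iter r urot X) i j a x =
         tr X (iter r (sh (uar X)) i) (iter r (sh (uar X)) j)
           (fun j => a (iter r (unsh (uar X)) j)) x].
Proof.
elim: r => [|r [en ec ee et]]; first by [].
split=> // [i|i w|i j a x]; rewrite iterS /=.
- by rewrite /rot_cat ec en -iterSr.
- by rewrite /rot_ev ee en -iterSr.
- by rewrite /rot_tr et en -!iterSr.
Qed.

Lemma iter_shK n r i : i <= n -> iter r (unsh n) (iter r (sh n) i) = i.
Proof.
elim: r => // r IH le_i; rewrite iterSr iterS shK ?IH //.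
by case: r {IH} => [|r] //; rewrite iterS sh_leq.
Qed.

Lemma urot_cycle X : ueq (iter (uar X).+1 urot X) X.
Proof.
have [en ec ee et] := iter_urot X (uar X).+1.
have eu j : j <= uar X -> iter (uar X).+1 (unsh (uar X)) j = j.
  by move=> le_j; rewrite -{1}(iter_sh le_j) iter_shK.
split=> // [i|i w|i j a x]; rewrite en => le_i.
- by rewrite ec iter_sh.
- by rewrite ee iter_sh //; apply: ev_ext => // j le_j _; rewrite eu.
- by move=> le_j; rewrite et !iter_sh //; apply: tr_ext => // l le_l; rewrite eu.
Qed.

Lemma unshD n a j : unsh n (a + j.+1) = a + j.
Proof. by rewrite addnS. Qed.

Section RotateNext.
Variables (G : uadj) (F F' : nat -> uadj) (k' : nat).
Local Notation k := (uar G).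
Local Notation m := (fun q => uar (F q)).
Local Notation m' := (fun q => uar (F' q)).
Hypothesis ek : k = k'.+1.
Hypothesis jF : forall q, q < k -> ucat G q.+1 = op (ucat (F q) 0).
Hypothesis jF' : forall q, q < uar (urot G) -> ucat (urot G) q.+1 = op (ucat (F' q) 0).
Hypothesis eF0 : F 0 = uid (ucat G 1).
Hypothesis eF' : forall q, q < k' -> F' q = F q.+1.
Hypothesis eFk : F' k' = uid (ucat G 0).

Lemma off_next q : q <= k' -> (off m' q).+1 = off m q.+1.
Proof.
elim: q => [|q IH] le_q; first by rewrite /= eF0.
by rewrite [off m' _]/= -addSn IH ?(ltnW le_q) // [in RHS]/= eF'.
Qed.

Lemma off_next_total : off m' k = off m k.
Proof. by rewrite ek -off_next //= eFk addn1. Qed.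

Local Notation N := (off m k).
Lemma lastN : N = off m' k' + 1.
Proof. by rewrite -off_next_total ek /= eFk. Qed.

Local Notation un w := (fun j => w (unsh N j)).

Lemma next_posP p : p <= N -> [\/ p = 0, p = N |
  exists q j, [/\ q < k', 0 < j, j <= m q.+1 & p = off m' q + j]].
Proof.
move=> le_p; have [->|/eqP ne0] := eqVneq p 0; first by constructor 1.
have [->|/eqP neN] := eqVneq p N; first by constructor 2.
constructor 3.
have [||q [j [lt_q lt0j le_j ->]]] := @offP m' k' p.
- by lia.
- have := lastN; lia.
by exists q, j; split; rewrite -?eF'.
Qed.

Lemma outer_next w s : s <= k ->
  (s = 0 -> ocat (w N) = Some (ucat G 0)) ->
  (s = 1 -> ocat (w 0) = Some (ucat G 1)) ->
  outer F' w (unsh k s) = outer F (un w) s.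
Proof.
case: s => [_ /(_ erefl) e _|[_ _ /(_ erefl) e|s lt_s _ _]].
- rewrite /= {1}ek /= eFk.
  by rewrite uid_ev0 -lastN.
- by rewrite /= eF0 uid_ev0.
rewrite [LHS]/= [RHS]/=; have lt_s' : s < k' by rewrite ek in lt_s.
rewrite eF' //; apply: ev_ext => // j le_j ne.
case: j ne {le_j} => // j _; rewrite -[off m s + _]/(off m s.+1) unshD.
by rewrite -off_next ?addSnnS // ltnW.
Qed.

Lemma ev_outer_next w i : i <= k ->
  (i <> 0 -> ocat (w N) = Some (ucat G 0)) ->
  (i <> 1 -> ocat (w 0) = Some (ucat G 1)) ->
  ev G i (fun j => outer F' w (unsh k j)) = ev G i (outer F (un w)).
Proof.
move=> le_i e0 e1; apply: ev_ext => // s le_s ne; apply: outer_next => // es.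
  by apply: e0; rewrite -es => e; apply: ne; rewrite e.
by apply: e1; rewrite -es => e; apply: ne; rewrite e.
Qed.

Lemma inner_next w q j : q < k' -> ocat (w N) = Some (ucat G 0) ->
  ocat (w 0) = Some (ucat G 1) ->
  inner (urot G) F' w q j = inner G F (un w) q.+1 j.
Proof.
move=> lt_q e0 e1; case: j => [|j]; last first.
  rewrite [LHS]/= [RHS]/= -[off m q + _]/(off m q.+1) unshD.
  by rewrite -off_next ?addSnnS // ltnW.
rewrite /= /rot_ev /sh ek ltnS lt_q -ek; apply: ev_outer_next => //.
by rewrite ek.
Qed.

Lemma sh_next q j : q < k' -> 0 < j -> j <= m q.+1 -> sh N (off m' q + j) = off m q.+1 + j.
Proof.
move=> lt_q lt0j le_j; rewrite /sh -off_next ?(ltnW lt_q) // addSn; case: ltnP => // le_N.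
have := @off_leq m' k' q j lt_q; rewrite eF' // => /(_ le_j).
have := lastN; lia.
Qed.

Lemma one_leN : 0 < N.
Proof. by rewrite lastN addn1. Qed.

Lemma shN : sh N N = 0. Proof. by rewrite /sh ltnn. Qed.
Lemma sh0 : sh N 0 = off m 0 + 1. Proof. by rewrite /sh one_leN. Qed.
Lemma lt0k : 0 < k. Proof. by rewrite ek. Qed.
Lemma ltkk : k' < k. Proof. by rewrite ek. Qed.

(** The transposes are compared from the old root, whose new position [N] is the input of the
    identity [F' k']: there the transpose of the right-hand side to the root of its argument only
    reverses arrows. *)
Lemma rotate_next : ueq (urot (ucomp jF)) (ucomp jF').
Proof.
have ecN : cat_of G F 0 = ucat G 0 by [].
have ec0 : cat_of G F (sh N 0) = ucat G 1.
  by rewrite sh0 cat_ofE ?lt0k ?eF0.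
have ec p : p <= N -> cat_of G F (sh N p) = cat_of (urot G) F' p.
  case/next_posP => [->|->|[q [j [lt_q lt0j le_j ->]]]].
  - by rewrite ec0 /= /rot_cat /sh lt0k.
  - by rewrite shN lastN (@cat_ofE (urot G) F') ?eFk ?ltkk.
  - have lt_q1 : q.+1 < k by rewrite ek.
    by rewrite sh_next // cat_ofE // (@cat_ofE (urot G) F') ?eF' // ek; lia.
have ee p w : p <= N -> typed N (fun j => cat_of G F (sh N j)) p w ->
    rot_ev (ucomp jF) p w = cev (urot G) F' p w.
  move=> le_p t; rewrite /rot_ev [uar _]/=.
  have tN : p <> N -> ocat (w N) = Some (ucat G 0).
    by move=> ne; rewrite t ?shN // => e; apply: ne; rewrite e.
  have t0 : p <> 0 -> ocat (w 0) = Some (ucat G 1).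
    by move=> ne; rewrite t ?ec0 // => e; apply: ne; rewrite e.
  case/next_posP: le_p t tN t0 => [->|->|[q [j [lt_q lt0j le_j ->]]]] t tN t0.
  - rewrite sh0 [LHS]cevE ?eF0 ?lt0k // cev0 /= /rot_ev /sh lt0k.
    rewrite ev_outer_next ?lt0k // => [|_]; last by apply: tN; have := one_leN; lia.
    have [t1|nt] := classic (typed k (ucat G) 1 (outer F (un w))).
      by rewrite guardT // ev_cat ?lt0k.
    have e1 : ev G 1 (outer F (un w)) = None.
      case e2 : (ev _ _ _) => [f|//]; case: nt; apply: ev_typed; rewrite ?lt0k // e2 //.
    by rewrite /guard e1; case: excluded_middle_informative.
  - rewrite shN [LHS]cev0 [in RHS]lastN cevE ?eFk ?ltkk //= /rot_ev /sh ek ltnn -ek.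
    rewrite ev_outer_next // => [|_]; last by apply: t0; have := one_leN; lia.
    have [t1|nt] := classic (typed k (ucat G) 0 (outer F (un w))).
      by rewrite guardT // ev_cat.
    have e1 : ev G 0 (outer F (un w)) = None.
      case e2 : (ev _ _ _) => [f|//]; case: nt; apply: ev_typed; rewrite // e2 //.
    by rewrite /guard e1; case: excluded_middle_informative.
  have lt_q1 : q.+1 < k by rewrite ek.
  rewrite sh_next // [LHS]cevE // cevE ?eF' //; last by rewrite ek; lia.
  apply: ev_ext => // i le_i ne; rewrite inner_next //.
    apply: tN => e; have := sh_next lt_q lt0j le_j; rewrite e shN; lia.
  by apply: t0; lia.
apply: (@ueq_intro N) => //.
  by rewrite /= -off_next_total.
move=> p a x le_p l.
have [o _ _] := l.
have oN : ocat (a N) = Some (ucat G 0) by have [-> _] := o N (leqnn _); rewrite /= /rot_cat shN.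
have o0 : ocat (a 0) = Some (ucat G 1) by have [-> _] := o 0 isT; rewrite /= /rot_cat ec0.
have l' : elt (ucomp jF') a N x.
  rewrite [uar _]/= off_next_total; apply: element_eq l => //.
  by move=> i v w le_i e; apply: (@ev_ext (ucomp jF')); rewrite [uar _]/= off_next_total.
have [o' _ _] := l'.
have lr : elt (ucomp jF) (un a) 0 x.
  by have := proj1 (@rot_elt (ucomp jF) N a x (leqnn _)) l; rewrite [uar _]/= shN.
have [o2 _ _] := lr.
have eo s : s <= k -> outer F' a (unsh k s) = outer F (un a) s.
  by move=> le_s; apply: outer_next.
have lG : elt G (outer F (un a)) 0 x by apply/(celt0 jF).
rewrite -[tr (urot _) N p a x]/(tr (ucomp jF) (sh N N) (sh N p) (un a) x).
rewrite shN ucomp_tr0 //.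
rewrite [tr (ucomp jF') _ _ _ _]/= /ctr (guardT _ l').
set y := to_root _ _ _ _ _.
have ey : y = tr G 0 1 (outer F (un a)) x.
  rewrite /y lastN to_rootE ?eFk ?ltkk // uid_tr //; last first.
    rewrite -eFk; apply/(celtE jF') => //; rewrite ?ltkk ?eFk //.
    by rewrite -lastN.
  rewrite oopK /= /rot_tr {1}ek -ek /sh ltnn lt0k; apply: tr_ext; rewrite ?lt0k //.
  by move=> s le_s; rewrite -lastN eo.
have eT s : s <= k -> tr (urot G) 0 s (outer F' a) y = tr G 0 (sh k s) (outer F (un a)) x.
  move=> le_s; rewrite /= /rot_tr [sh k 0]/sh lt0k.
  rewrite (@tr_ext G _ _ _ (outer F (un a))) ?lt0k ?sh_leq //.
  by rewrite ey tr_comp ?lt0k ?sh_leq.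
have ly : elt (urot G) (outer F' a) 0 y.
  by apply/(celt0 jF' _ o'); apply: to_root_elt => //; rewrite off_next_total.
case/next_posP: le_p => [->|->|[q [j [lt_q lt0j le_j ->]]]].
- rewrite sh0 from_rootE ?eF0 ?lt0k // uid_tr ?oopK //.
  rewrite -eF0; apply/(celt_turn jF); rewrite ?lt0k // ?oopK.
  by apply: tr_element; rewrite ?lt0k.
- rewrite shN [in RHS]lastN from_rootE ?eFk ?ltkk //.
  have ex : tr (urot G) 0 k'.+1 (outer F' a) y = x.
    by rewrite -ek eT // /sh ltnn tr_id.
  rewrite uid_tr ?oopK // -eFk; apply/(celt_turn jF'); rewrite ?ltkk // ?oopK.
  by apply: tr_element => //; exact: ltkk.
have lt_q1 : q.+1 < k by rewrite ek.
have lt_q' : q < k by rewrite ltnW.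
rewrite sh_next // from_rootE // from_rootE ?eF' // eT // /sh lt_q1.
apply: tr_ext => // r le_r; rewrite inner_next //.
Qed.

End RotateNext.

Lemma uid_ev1_ev X i v A w : i <= uar X -> ucat X i = A -> w 0 = ev X i v ->
  ev (uid A) 1 w = w 0.
Proof.
move=> le_i eA ew; have [t|nt] := classic (typed (uar X) (ucat X) i v).
  by rewrite uid_ev1 // ew ev_cat // eA.
have e0 : ev X i v = None.
  by case e : (ev X i v) => [f|//]; case: nt; apply: ev_typed; rewrite ?e.
by rewrite ew e0 /= ew e0 /guard; case: excluded_middle_informative.
Qed.

Section RotateFirst.
Variables (G Z : uadj) (F F' : nat -> uadj) (k' n' : nat).
Local Notation k := (uar G).
Local Notation n := (uar Z).
Local Notation m := (fun q => uar (F q)).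
Local Notation m' := (fun q => uar (F' q)).
Hypothesis ek : k = k'.+1.
Hypothesis en : n = n'.+1.
Hypothesis jF : forall q, q < k -> ucat G q.+1 = op (ucat (F q) 0).
Hypothesis jF' : forall q, q < uar (urot Z) -> ucat (urot Z) q.+1 = op (ucat (F' q) 0).
Hypothesis eF0 : F 0 = Z.
Hypothesis eF : forall q, q < k' -> F q.+1 = uid (ucat G q.+2).
Hypothesis eF' : forall q, q < n' -> F' q = uid (ucat Z q.+2).
Hypothesis eFn : F' n' = urot G.

Lemma off_first q : q <= k' -> off m q.+1 = n + q.
Proof.
elim: q => [|q IH] le_q; first by rewrite /= eF0 addn0.
by rewrite [LHS]/= -/(off m q.+1) IH ?(ltnW le_q) // eF // addn1 addnS.
Qed.

Lemma off_first' q : q <= n' -> off m' q = q.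
Proof. by move=> le_q; apply: off_ones le_q => r lt_r; rewrite eF'. Qed.

Lemma off_firstN : off m k = n' + k.
Proof. by rewrite ek off_first // en; lia. Qed.

Lemma off_firstN' : off m' n = n' + k.
Proof. by rewrite en /= off_first' // eFn. Qed.

Local Notation N := (n' + k).
Local Notation un w := (fun j => w (unsh N j)).

Lemma first_posP p : p <= N -> [\/ p = 0, exists2 q, q < n' & p = q.+1 |
  exists j, [/\ 0 < j, j <= k & p = n' + j]].
Proof.
move=> le_p; have [->|/eqP ne0] := eqVneq p 0; first by constructor 1.
have [le_pn|lt_np] := leqP p n'.
  by constructor 2; exists p.-1; lia.
by constructor 3; exists (p - n'); split; lia.
Qed.

Lemma arity_outer_pos : 0 < k. Proof. by rewrite ek. Qed.
Lemma arity_first_pos : 0 < n. Proof. by rewrite en. Qed.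
Lemma last_lt_arity : n' < n. Proof. by rewrite en. Qed.

Lemma outerF2 w s : s < k' -> ocat (w (n' + s.+1)) = Some (ucat G s.+2) ->
  outer F (un w) s.+2 = w (n' + s.+1).
Proof.
move=> lt_s; rewrite [outer _ _ _]/= -/(off m s.+1) eF // off_first ?(ltnW lt_s) // en.
have -> : n' + s.+1 = unsh N (n'.+1 + s + 1) by rewrite addn1 /= addnS.
by move=> e; rewrite uid_ev0.
Qed.

Lemma outerF1 w q : q < n' -> ocat (w q.+1) = Some (ucat Z q.+2) ->
  outer F' w q.+1 = w q.+1.
Proof.
move=> lt_q; rewrite [outer _ _ _]/= eF' // off_first' ?(ltnW lt_q) // -[q.+1]addn1.
by move=> e; rewrite uid_ev0.
Qed.

Lemma outerFn w :
  (forall s, s < k' -> ocat (w (n' + s.+1)) = Some (ucat G s.+2)) ->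
  outer F' w n = ev G 1 (outer F (un w)).
Proof.
move=> t; rewrite en /= eFn off_first' //= /rot_ev {1}/sh arity_outer_pos.
apply: ev_ext; first exact: arity_outer_pos.
case=> [_ _|[_ []//|s lt_s _]] //.
by rewrite outerF2 ?t //; rewrite ek in lt_s.
Qed.

Lemma ev_outer_first w i : i <= n ->
  (i <> 0 -> forall s, s < k' -> ocat (w (n' + s.+1)) = Some (ucat G s.+2)) ->
  (forall s, s <= n' -> s.+1 <> i -> ocat (w s) = Some (ucat Z s.+1)) ->
  ev Z i (fun j => outer F' w (unsh n j)) = ev Z i (inner G F (un w) 0).
Proof.
move=> le_i t t'; apply: ev_ext => // -[_ ne|[_ ne|s lt_s ne]] //.
  by rewrite [unsh _ _]/= outerFn //; apply: t => e; apply: ne; rewrite e.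
rewrite en in lt_s.
by rewrite [unsh _ _]/= outerF1 // t'.
Qed.

Lemma inner0_first w : (forall s, s <= n' -> ocat (w s) = Some (ucat Z s.+1)) ->
  inner (urot Z) F' w n' 0 = outer F (un w) 1.
Proof.
move=> t; rewrite /= /rot_ev; have -> : sh n n'.+1 = 0 by rewrite /sh en ltnn.
rewrite eF0.
apply: ev_ext => // -[_ []//|[|s] lt_s _] //=.
by rewrite en in lt_s; rewrite -/(outer F' w s.+1) outerF1 ?t.
Qed.

Lemma ev_inner_first w i : i <= k ->
  (i <> 1 -> forall s, s <= n' -> ocat (w s) = Some (ucat Z s.+1)) ->
  (forall s, s < k' -> s.+2 <> i -> ocat (w (n' + s.+1)) = Some (ucat G s.+2)) ->
  ev G i (fun j => inner (urot Z) F' w n' (unsh k j)) = ev G i (outer F (un w)).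
Proof.
move=> le_i t t'; apply: ev_ext => // -[_ ne|[_ ne|s lt_s ne]].
- by rewrite [unsh _ _]/= {1}ek /= off_first' // -ek.
- by rewrite [unsh _ _]/= inner0_first //; apply: t => e; apply: ne; rewrite e.
rewrite ek in lt_s.
by rewrite [unsh _ _]/= [LHS]/= off_first' // outerF2 // t'.
Qed.

Lemma outer_unsh w s : s <= n ->
  (forall s, s <= n' -> ocat (w s) = Some (ucat Z s.+1)) ->
  (forall s, s < k' -> ocat (w (n' + s.+1)) = Some (ucat G s.+2)) ->
  outer F' w (unsh n s) = inner G F (un w) 0 s.
Proof.
move=> le_s tZ tG; case: s le_s => [_|[_|s lt_s]] //; first by rewrite [unsh _ _]/= outerFn.
by rewrite en in lt_s; rewrite [unsh _ _]/= outerF1 // tZ.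
Qed.

Lemma inner_unsh w s : s <= k ->
  (forall s, s <= n' -> ocat (w s) = Some (ucat Z s.+1)) ->
  (forall s, s < k' -> ocat (w (n' + s.+1)) = Some (ucat G s.+2)) ->
  inner (urot Z) F' w n' (unsh k s) = outer F (un w) s.
Proof.
move=> le_s tZ tG; case: s le_s => [_|[_|s lt_s]].
- by rewrite [unsh _ _]/= {1}ek /= off_first' // -ek.
- by rewrite [unsh _ _]/= inner0_first.
by rewrite ek in lt_s; rewrite [unsh _ _]/= [LHS]/= off_first' // outerF2 // tG.
Qed.

(** Rotation exchanges the two adjunctions: the new root is the first input of [Z], and [G] is
    now reached from [Z] through its old root, the last input of [urot Z].  On both sides the
    transposes from the old root go first through [G] and then through [Z]. *)
Lemma rotate_first : ueq (urot (ucomp jF)) (ucomp jF').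
Proof.
have sh0 : sh N 0 = off m 0 + 1 by rewrite /sh ek addnS.
have shq q : q < n' -> sh N q.+1 = off m 0 + q.+2.
  by move=> lt_q; rewrite /sh; case: ltnP => //; rewrite ek; lia.
have shj j : 0 < j -> j < k -> sh N (n' + j) = off m j + 1.
  case: j => // j _ lt_j; rewrite off_first; last by rewrite ek in lt_j; lia.
  rewrite /sh; case: ltnP; rewrite en; lia.
have shN : sh N N = 0 by rewrite /sh ltnn.
have posq q : q < n' -> q.+1 = off m' q + 1.
  by move=> lt_q; rewrite off_first' ?addn1 // ltnW.
have posj j : n' + j = off m' n' + j by rewrite off_first'.
have m1 j : j < k -> 0 < j -> m j = 1.
  by case: j => // j lt_j _; rewrite eF //; rewrite ek in lt_j.
have mq q : q < n' -> m' q = 1 by move=> lt_q; rewrite eF'.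
have mn : m' n' = k by rewrite eFn.
have ec p : p <= N -> cat_of G F (sh N p) = cat_of (urot Z) F' p.
  case/first_posP => [->|[q lt_q ->]|[j [lt0j le_j ->]]].
  - by rewrite sh0 cat_ofE ?eF0 ?arity_outer_pos ?arity_first_pos //= /rot_cat /sh arity_first_pos.
  - rewrite shq // cat_ofE ?eF0 ?arity_outer_pos //; last by rewrite en.
    rewrite [in RHS](posq q) // (@cat_ofE (urot Z) F') ?mq ?eF' //=; rewrite en; lia.
  - rewrite [in RHS](posj j) (@cat_ofE (urot Z) F') ?mn ?eFn ?last_lt_arity //.
    move: le_j; rewrite leq_eqVlt => /orP[/eqP ->|lt_j].
      by rewrite shN /= /rot_cat /sh ltnn.
    rewrite shj // cat_ofE ?m1 //= /rot_cat /sh lt_j.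
    by case: j lt0j lt_j => // j _ lt_j; rewrite eF //; rewrite ek in lt_j.
have ee p w : p <= N -> typed N (fun j => cat_of G F (sh N j)) p w ->
    ev (ucomp jF) (sh N p) (un w) = cev (urot Z) F' p w.
  move=> le_p t.
  have tZ s : s <= n' -> s <> p -> ocat (w s) = Some (ucat Z s.+1).
    move=> le_s ne; rewrite t //; last by lia.
    case: s le_s ne => [|s] le_s ne.
      by rewrite sh0 cat_ofE ?eF0 ?arity_outer_pos ?arity_first_pos.
    by rewrite shq // cat_ofE ?eF0 ?arity_outer_pos // en.
  have tG s : s < k' -> n' + s.+1 <> p -> ocat (w (n' + s.+1)) = Some (ucat G s.+2).
    move=> lt_s ne; have lt_s' : s.+1 < k by rewrite ek.
    by rewrite t //; [rewrite shj // cat_ofE ?m1 // eF | lia].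
  case/first_posP: le_p t tZ tG => [->|[q lt_q ->]|[j [lt0j le_j ->]]] t tZ tG.
  - rewrite sh0 [LHS]cevE ?eF0 ?arity_outer_pos ?arity_first_pos // cev0 /= /rot_ev /sh arity_first_pos.
    rewrite ev_outer_first ?arity_first_pos // => [_ s lt_s|s le_s ne]; first by apply: tG => //; lia.
    by apply: tZ => // e; apply: ne; rewrite e.
  - rewrite shq // [LHS]cevE ?eF0 ?arity_outer_pos //; last by rewrite en.
    rewrite [in RHS](posq q) // cevE ?mq //; last by rewrite en; lia.
    have eq : inner (urot Z) F' w q 0 = ev Z q.+2 (inner G F (un w) 0).
      rewrite /= /rot_ev; have -> : sh n q.+1 = q.+2 by rewrite /sh en ltnS lt_q.
      apply: ev_outer_first.
      - by rewrite en.
      - by move=> _ s lt_s; apply: tG => //; lia.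
      by move=> s le_s ne; apply: tZ => // e; apply: ne; rewrite e.
    by rewrite eF' // (@uid_ev1_ev Z q.+2 (inner G F (un w) 0)) ?eq // en.
  rewrite [in RHS](posj j) [RHS]cevE ?mn ?eFn ?last_lt_arity // [RHS]/= /rot_ev.
  rewrite ev_inner_first ?sh_leq //; last 2 first.
  - move=> ne s le_s; apply: tZ => // e; lia.
  - move=> s lt_s ne; apply: tG => // e; apply: ne.
    have -> : j = s.+1 by lia.
    by rewrite /sh ek ltnS lt_s.
  move: le_j; rewrite leq_eqVlt => /orP[/eqP ->|lt_j].
    by rewrite shN [sh k k]/sh ltnn.
  rewrite shj // [LHS]cevE ?m1 // [sh k j]/sh lt_j.
  case: j lt0j lt_j {t tZ tG} => // j _ lt_j; rewrite eF; last by rewrite ek in lt_j.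
  by rewrite (@uid_ev1_ev G j.+2 (outer F (un w))).
have eU : uar (urot (ucomp jF)) = N := off_firstN.
have eU' : uar (ucomp jF') = N := off_firstN'.
apply: (@ueq_intro N) => //.
- by rewrite eU.
- by rewrite eU eU'.
- by move=> i; rewrite eU => le_i; rewrite -[RHS](ec _ le_i) /= /rot_cat /= off_firstN.
- move=> i w; rewrite eU => le_i t; rewrite -[RHS]ee //.
    by rewrite /= /rot_ev /= off_firstN.
  by move=> j le_j ne; rewrite t //= /rot_cat /= off_firstN.
move=> p a x le_p l; rewrite eU in le_p.
have [o _ _] := l.
have o' s : s <= N -> ocat (a s) = Some (cat_of G F (sh N s)).
  move=> le_s; have [|-> _] := o s; first by rewrite eU.
  by rewrite /= /rot_cat /= off_firstN.
have oZ s : s <= n' -> ocat (a s) = Some (ucat Z s.+1).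
  move=> le_s; rewrite o'; last by lia.
  case: s le_s => [|s] le_s.
    by rewrite sh0 cat_ofE ?eF0 ?arity_outer_pos ?arity_first_pos.
  by rewrite shq // cat_ofE ?eF0 ?arity_outer_pos // en.
have oG s : s < k' -> ocat (a (n' + s.+1)) = Some (ucat G s.+2).
  move=> lt_s; have lt_s' : s.+1 < k by rewrite ek.
  by rewrite o'; [rewrite shj // cat_ofE ?m1 // eF | lia].
have l' : elt (ucomp jF') a N x.
  move: l; rewrite eU eU'; apply: element_eq => //.
  - by move=> i le_i; rewrite -[RHS](ec _ le_i) /= /rot_cat /= off_firstN.
  - move=> i w le_i t; rewrite -[RHS]ee //.
      by rewrite /= /rot_ev /= off_firstN.
    by move=> j le_j ne; rewrite t //= /rot_cat /= off_firstN.
  by move=> i v w le_i e; apply: (@ev_ext (ucomp jF')); rewrite eU'.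
have [o3 _ _] := l'.
have lr : elt (ucomp jF) (un a) 0 x.
  have eU2 : uar (ucomp jF) = N := off_firstN.
  have ea : (fun j => a (unsh (uar (ucomp jF)) j)) = un a by rewrite eU2.
  have es : sh (uar (ucomp jF)) N = 0 by rewrite eU2.
  by rewrite -ea -es; apply/(@rot_elt (ucomp jF) N a x) => //; rewrite eU2.
have [o2 _ _] := lr.
have lG : elt G (outer F (un a)) 0 x by apply/(celt0 jF _ o2).
have eZ s : s <= n -> outer F' a (unsh n s) = inner G F (un a) 0 s.
  by move=> le_s; apply: outer_unsh.
have eG s : s <= k -> inner (urot Z) F' a n' (unsh k s) = outer F (un a) s.
  by move=> le_s; apply: inner_unsh.
have lZ : elt Z (inner G F (un a) 0) 0 (oop (tr G 0 1 (outer F (un a)) x)).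
  rewrite -eF0; apply/(celt_turn jF); rewrite ?oopK ?arity_outer_pos //.
  exact: (@tr_element G 0 1 _ _ isT arity_outer_pos lG).
have trZ i j z : i <= n -> j <= n -> tr (urot Z) i j (outer F' a) z =
    tr Z (sh n i) (sh n j) (inner G F (un a) 0) z.
  by move=> le_i le_j; apply: (@tr_ext Z (sh n i) (sh n j)); rewrite ?sh_leq.
have trG i j z : i <= k -> j <= k -> tr (urot G) i j (inner (urot Z) F' a n') z =
    tr G (sh k i) (sh k j) (outer F (un a)) z.
  by move=> le_i le_j; apply: (@tr_ext G (sh k i) (sh k j)); rewrite ?sh_leq.
have -> : tr (urot (ucomp jF)) N p a x = from_root G F (un a) (sh N p) x.
  rewrite -(ucomp_tr0 _ lr) -[LHS]/(rot_tr (ucomp jF) N p a x) /rot_tr.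
  by rewrite (_ : uar (ucomp jF) = N) ?shN // off_firstN.
rewrite [tr (ucomp jF') _ _ _ _]/= /ctr (guardT _ l').
set y := to_root _ _ _ _ _.
have ey : y = tr Z 0 1 (inner G F (un a) 0) (oop (tr G 0 1 (outer F (un a)) x)).
  have -> : y = tr (urot Z) n 0 (outer F' a)
      (oop (tr (urot G) k 0 (inner (urot Z) F' a n') x)).
    by rewrite /y posj to_rootE ?eFn ?last_lt_arity ?arity_outer_pos // {1}en.
  by rewrite trZ // trG // /sh !ltnn arity_outer_pos arity_first_pos.
have eTZ s : s <= n -> tr (urot Z) 0 s (outer F' a) y =
    tr Z 0 (sh n s) (inner G F (un a) 0) (oop (tr G 0 1 (outer F (un a)) x)).
  by move=> le_s; rewrite trZ // [sh n 0]/sh arity_first_pos ey tr_comp ?arity_first_pos ?sh_leq.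
have eTG s : s <= k -> tr (urot G) 0 s (inner (urot Z) F' a n')
    (oop (tr (urot Z) 0 n (outer F' a) y)) = tr G 0 (sh k s) (outer F (un a)) x.
  move=> le_s; rewrite eTZ // [sh n n]/sh ltnn tr_id // oopK trG // [sh k 0]/sh arity_outer_pos.
  by rewrite tr_comp ?arity_outer_pos ?sh_leq.
case/first_posP: le_p => [->|[q lt_q ->]|[j [lt0j le_j ->]]].
- by rewrite sh0 from_rootE ?eF0 ?arity_outer_pos ?arity_first_pos.
- rewrite shq // from_rootE ?eF0 ?arity_outer_pos //; last by rewrite en.
  have lt_qn : q.+1 <= n by rewrite en; lia.
  have lt_q2 : q.+2 <= n by rewrite en.
  have es : sh n q.+1 = q.+2 by rewrite /sh en ltnS lt_q.
  rewrite [in RHS](posq q) // from_rootE ?mq // eTZ // es eF' // uid_tr ?oopK //.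
  rewrite -eF' // -[tr Z _ _ _ _]oopK; apply/(celt_turn jF') => //.
  rewrite oopK -es -eTZ //; apply: tr_element => //.
  by apply/(celt0 jF' _ o3); apply: to_root_elt => //; rewrite off_firstN'.
- rewrite [in RHS](posj j) from_rootE ?mn ?last_lt_arity // eFn -en eTG //.
  move: le_j; rewrite leq_eqVlt => /orP[/eqP ->|lt_j].
    by rewrite shN [sh k k]/sh ltnn tr_id.
  rewrite shj // from_rootE ?m1 // [sh k j]/sh lt_j.
  case: j lt0j lt_j => // j _ lt_j.
  have lt_j' : j < k' by rewrite ek in lt_j.
  rewrite eF // uid_tr ?oopK // -eF //; apply/(celt_turn jF); rewrite ?oopK //.
  by apply: tr_element.
Qed.

End RotateFirst.

(** * The cyclic multicategory of multivariable adjunctions *)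

Section CyclicOf.
Variables (X : multigraph) (M : multicategory X) (inv : obj X -> obj X).
Variable (s : mmap X -> mmap X).
Hypothesis invK : involutive inv.
Hypothesis dom_s : forall f x l, dom f = x :: l -> dom (s f) = rcons l (inv (cod f)).
Hypothesis cod_s : forall f x l, dom f = x :: l -> cod (s f) = inv x.
Hypothesis s_nullary : forall f, dom f = [::] -> s f = f.
Hypothesis s_cycle : forall f, iter (size (dom f)).+1 s f = f.
Hypothesis s_id : forall x, s (mid M x) = mid M (inv x).
Hypothesis s_next : forall g x l fs (p : composable g (mid M x :: fs))
  (q : composable (s g) (rcons fs (mid M (inv (cod g))))),
  dom g = x :: l -> s (mcomp M p) = mcomp M q.
Hypothesis s_first : forall g f l l' y (p : composable g (f :: map (mid M) l))
  (q : composable (s f) (rcons (map (mid M) l') (s g))),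
  dom g = cod f :: l -> dom f = y :: l' -> s (mcomp M p) = mcomp M q.

Lemma s_bij : bijective s.
Proof.
exists (fun f => iter (size (dom f)) s f) => f; last by rewrite -iterS s_cycle.
have -> : size (dom (s f)) = size (dom f).
  case e : (dom f) => [|x l]; first by rewrite s_nullary // e.
  by rewrite (dom_s e) size_rcons.
by rewrite -iterSr s_cycle.
Qed.

Lemma s_comp_first (g f : mmap X) (p : composable g (insert_at M 0 g f))
    (q : composable (s f) (insert_at M (size (dom (s f))).-1 (s f) (s g))) :
  dom f <> [::] -> s (mcomp M p) = mcomp M q.
Proof.
case ef : (dom f) => [|y l'] // _; move: p q; rewrite /insert_at (dom_s ef).
rewrite (_ : (size _).-1 = size l') ?size_rcons // take0 cat0s.
case eg : (dom g) => [|x l] p.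
  by exfalso; have := congr1 size p; rewrite eg.
move: p; rewrite [drop 1 _]/= drop0 => p.
rewrite drop_oversize ?size_rcons // -cats1 take_size_cat // cats1 => q.
apply: (s_first (l := l) (l' := l') (y := y)) => //.
by have := p; rewrite /composable eg /= => -[->].
Qed.

Lemma s_comp_next (g f : mmap X) (i : nat) (p : composable g (insert_at M i.+1 g f))
    (q : composable (s g) (insert_at M i (s g) f)) :
  s (mcomp M p) = mcomp M q.
Proof.
have esz : size (insert_at M i.+1 g f) = size (dom g) by have := congr1 size p; rewrite !size_map.
case eg : (dom g) => [|x l]; first by exfalso; move: esz; rewrite /insert_at size_cat eg.
have lt_i : i < size l.
  move: esz; rewrite /insert_at eg size_cat /= !size_map size_take size_drop.
  by case: ltnP => //; lia.
move: p q; rewrite /insert_at eg (dom_s eg) [take _ (x :: l)]/= [drop _ (x :: l)]/=.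
rewrite drop_rcons // map_rcons -cats1 takel_cat; last exact: ltnW.
rewrite -cats1 -cat_cons catA cats1 => p q; exact: s_next eg.
Qed.

(** In a partial composite at an input other than the first, the first argument is an identity,
    which is the case of [s_next]; at the first input, all the other arguments are. *)
Definition cyclic_of : cyclic_multicategory X :=
  CyclicMulticategory invK s_bij dom_s cod_s s_nullary s_cycle s_id s_comp_first
    s_comp_next.

End CyclicOf.

Lemma dom_under (F : vcell) :
  @dom madj_graph F = mkseq (fun j => ucat (under F) j.+1) (varity F).
Proof.
rewrite /= /mkseq -val_enum_ord -map_comp; apply: eq_map => j /=.
by rewrite /ncat; congr (vcat _ _); apply: val_inj; rewrite /= inordK // ltnS ltn_ord.
Qed.

Lemma cod_under (F : vcell) : @cod madj_graph F = op (ucat (under F) 0).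
Proof. by rewrite /= /ncat; congr (op (vcat _ _)); apply: val_inj; rewrite /= inordK. Qed.

Lemma dom_ueq (F : vcell) X : ueq (under F) X ->
  @dom madj_graph F = mkseq (fun j => ucat X j.+1) (uar X).
Proof.
case=> en ec _ _; rewrite dom_under -en.
by apply/eq_in_map => j; rewrite mem_iota => /andP[_ lt_j]; apply: ec.
Qed.

Lemma cod_ueq (F : vcell) X : ueq (under F) X -> @cod madj_graph F = op (ucat X 0).
Proof. by case=> en ec _ _; rewrite cod_under ec. Qed.

Definition vid (A : category) : vcell := VCell (realize (uid A)).

Lemma composable_joint g fs d : @composable madj_graph g fs ->
  forall q, q < uar (under g) -> ucat (under g) q.+1 = op (ucat (under (nth d fs q)) 0).
Proof.
move=> p q lt_q.
have esz : size fs = varity g.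
  by have := congr1 size p; rewrite dom_under size_mkseq size_map.
have := congr1 (fun s => nth (cod (d : mmap madj_graph)) s q) p.
rewrite dom_under nth_mkseq // -cod_under => <-.
by rewrite (nth_map d) ?esz.
Qed.

Lemma composable_size g fs : @composable madj_graph g fs -> size fs = varity g.
Proof. by move=> p; have := congr1 size p; rewrite dom_under size_mkseq size_map. Qed.

Definition vcomp (g : vcell) (fs : seq vcell) (p : @composable madj_graph g fs) : vcell :=
  VCell (realize (ucomp (composable_joint g p))).

Lemma vcomp_ueq g fs p d G F
    (j : forall q, q < uar G -> ucat G q.+1 = op (ucat (F q) 0)) :
  ueq (under g) G -> (forall q, q < varity g -> ueq (under (nth d fs q)) (F q)) ->
  ueq (under (@vcomp g fs p)) (ucomp j).
Proof.
move=> eg ef; apply: ueq_trans (under_realize _) _; apply: ucomp_ueq => // q lt_q.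
by rewrite (set_nth_default d) ?(composable_size p) //; apply: ef.
Qed.

Lemma vcomp_congr g fs p d :
  ueq (under (@vcomp g fs p)) (ucomp (composable_joint d p)).
Proof. by apply: vcomp_ueq; [exact: ueq_refl | move=> q _; exact: ueq_refl]. Qed.

Lemma dom_vid x : @dom madj_graph (vid x) = [:: x].
Proof. by rewrite (dom_ueq (under_realize _)). Qed.

Lemma cod_vid x : @cod madj_graph (vid x) = x.
Proof. by rewrite (cod_ueq (under_realize _)) /= opK. Qed.

Lemma mkseq_off T (f : nat -> T) m k :
  mkseq f (off m k) = flatten (mkseq (fun q => mkseq (fun j => f (off m q + j)) (m q)) k).
Proof.
elim: k => [//|k IH]; rewrite [in RHS]mkseqS flatten_rcons -IH /mkseq iotaD map_cat; congr cat.
by rewrite addnC iotaDl -map_comp.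
Qed.

Lemma dom_vcomp g fs (p : composable g fs) :
  @dom madj_graph (vcomp p) = flatten [seq dom f | f <- fs].
Proof.
rewrite (dom_ueq (under_realize _)) [uar _]/= mkseq_off.
congr flatten; rewrite -[RHS](mkseq_nth [::]) size_map (composable_size p).
apply/eq_in_map => q; rewrite mem_iota => /andP[_ lt_q].
rewrite (nth_map g) ?(composable_size p) // dom_under.
apply/eq_in_map => j; rewrite mem_iota => /andP[_ lt_j].
by rewrite -addnS [LHS](@cat_ofE _ _ q).
Qed.

Lemma cod_vcomp g fs (p : composable g fs) : @cod madj_graph (vcomp p) = cod (g : mmap madj_graph).
Proof. by rewrite (cod_ueq (under_realize _)) cod_under. Qed.

Lemma vcomp_idl f (p : @composable madj_graph (vid (@cod madj_graph f)) [:: f]) : vcomp p = f.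
Proof.
apply: vcell_ext.
have j q : q < uar (uid (@cod madj_graph f)) ->
    ucat (uid (@cod madj_graph f)) q.+1 = op (ucat (under f) 0).
  by case: q => // _; rewrite /= -cod_under.
apply: ueq_trans (ucomp_idl j).
by apply: (@vcomp_ueq _ _ _ f); [exact: under_realize | case].
Qed.

Lemma vcomp_idr f (p : @composable madj_graph f [seq vid x | x <- @dom madj_graph f]) :
  vcomp p = f.
Proof.
apply: vcell_ext; pose F q := uid (ucat (under f) q.+1).
have j q : q < uar (under f) -> ucat (under f) q.+1 = op (ucat (F q) 0) by rewrite /= opK.
apply: ueq_trans (ucomp_idr j _) => //.
apply: (@vcomp_ueq _ _ _ f); first exact: ueq_refl.
move=> q lt_q; rewrite dom_under (nth_map (ucat (under f) 0)) ?size_mkseq // nth_mkseq //.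
exact: under_realize.
Qed.

Lemma off_recl m q : off m q.+1 = m 0 + off (fun q => m q.+1) q.
Proof. by elim: q => [|q IH]; rewrite ?addn0 //= addnA -IH. Qed.

(** Positions in a flattened list, in terms of the offsets that index the inputs of composites. *)
Lemma nth_flatten_off T (d : T) (ss : seq (seq T)) q l : q < size ss ->
  l < size (nth [::] ss q) ->
  nth d (flatten ss) (off (fun q => size (nth [::] ss q)) q + l) = nth d (nth [::] ss q) l.
Proof.
elim: ss q => // s ss IH [|q] lt_q lt_l; first by rewrite /= nth_cat lt_l.
rewrite off_recl.
by rewrite /= nth_cat -addnA ltnNge leq_addr /= addKn IH.
Qed.

Lemma vcomp_assoc (g : vcell) (bs : seq (block madj_graph))
    (p : @composable madj_graph g [seq btop b | b <- bs])
    (q : @composable madj_graph (vcomp p) (flatten [seq bargs b | b <- bs]))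
    (r : @composable madj_graph g [seq vcomp (bcomp b) | b <- bs]) :
  vcomp q = vcomp r.
Proof.
pose d := vid (@cod madj_graph g).
pose F i := under (nth d [seq btop b | b <- bs] i).
pose H i l := under (nth d (nth [::] [seq bargs b | b <- bs] i) l).
have szb : size bs = varity g by have := composable_size p; rewrite size_map.
have jF i : i < uar (under g) -> ucat (under g) i.+1 = op (ucat (F i) 0).
  exact: composable_joint.
have eP : ueq (under (vcomp p)) (ucomp jF).
  by apply: (@vcomp_ueq _ _ _ d) => [|? _]; exact: ueq_refl.
have blockP i : i < size bs -> exists b : block madj_graph,
    nth d [seq btop b | b <- bs] i = btop b /\
    nth [::] [seq bargs b | b <- bs] i = bargs b /\
    nth d [seq vcomp (bcomp b) | b <- bs] i = vcomp (bcomp b).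
  case: bs {p q r F H szb jF eP} => // b bs lt_i; exists (nth b (b :: bs) i).
  by rewrite !(nth_map b).
have jH i l : l < uar (F i) -> ucat (F i) l.+1 = op (ucat (H i l) 0).
  have [lt_i|le_i] := ltnP i (size bs).
    have [b [e1 [e2 _]]] := blockP i lt_i.
    rewrite /F /H e1 e2; apply: composable_joint; exact: bcomp.
  rewrite /F /H !nth_default ?size_map //.
  have [en ec _ _] := under_realize (uid (@cod madj_graph g)).
  case: l => //= _.
  by have := ec 0 isT; have := ec 1 isT; rewrite /= => -> ->; rewrite opK.
have szF i : i < size bs -> size (nth [::] [seq bargs b | b <- bs] i) = uar (F i).
  move=> lt_i; have [b [e1 [e2 _]]] := blockP i lt_i.
  by rewrite e2 /F e1 (composable_size (bcomp b)).
have eflat i : i < uar (ucomp jF) ->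
    ueq (under (nth d (flatten [seq bargs b | b <- bs]) i)) (flat (under g) F H i).
  move=> lt_i; have [i' [l [lt_i' lt0l le_l ei]]] := offP (ltn0Sn i) lt_i.
  case: l lt0l le_l ei => // l _ lt_l; rewrite addnS => -[->].
  rewrite flatE // /H -nth_flatten_off ?size_map ?szb ?szF ?szb //.
  rewrite (off_le_eq (k := i') (m' := fun i => size (nth [::] [seq bargs b | b <- bs] i))) //.
  by move=> s lt_s; rewrite szF // szb; apply: ltn_trans lt_s lt_i'.
have jP i : i < uar (ucomp jF) -> ucat (ucomp jF) i.+1 = op (ucat (flat (under g) F H i) 0).
  move=> lt_i; have [en ec _ _] := eP.
  have lt_i2 : i < varity (vcomp p) by rewrite [varity _]en.
  rewrite -[LHS]ec //.
  rewrite (composable_joint d q) //; congr op.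
  by have [_ ec' _ _] := eflat i lt_i; rewrite ec'.
have eC i : i < size bs -> ueq (under (nth d [seq vcomp (bcomp b) | b <- bs] i))
    (ucomp (jH i)).
  move=> lt_i; have [b [e1 [e2 e3]]] := blockP i lt_i.
  rewrite e3; apply: (@vcomp_ueq _ _ _ d); rewrite /F /H ?e1 ?e2 //.
have jC i : i < uar (under g) -> ucat (under g) i.+1 = op (ucat (ucomp (jH i)) 0).
  exact: jF.
apply: vcell_ext.
apply: ueq_trans (@vcomp_ueq _ _ q d _ _ jP eP _) _.
  by move=> i; have [en _ _ _] := eP; rewrite -[varity _]/(uar (under _)) en; apply: eflat.
apply: ueq_trans (ucomp_assoc jP jC) _; apply: ueq_sym.
by apply: (@vcomp_ueq _ _ _ d); [exact: ueq_refl | rewrite -szb].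
Qed.

Definition madj_multi : multicategory madj_graph :=
  @Multicategory madj_graph vid vcomp dom_vid cod_vid dom_vcomp cod_vcomp
    vcomp_idl vcomp_idr vcomp_assoc.

Definition vrot (F : vcell) : vcell := VCell (realize (urot (under F))).

Lemma under_vrot F : ueq (under (vrot F)) (urot (under F)).
Proof. exact: under_realize. Qed.

Lemma size_dom_vcell (F : vcell) : size (@dom madj_graph F) = varity F.
Proof. by rewrite dom_under size_mkseq. Qed.

Lemma dom_cons (F : vcell) x l : @dom madj_graph F = x :: l ->
  [/\ varity F = (size l).+1, x = ucat (under F) 1 &
      l = mkseq (fun j => ucat (under F) j.+2) (size l)].
Proof.
move=> e; have en : varity F = (size l).+1 by rewrite -size_dom_vcell e.
move: e; rewrite dom_under en /mkseq /= => -[-> e]; split=> //.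
by rewrite -{1}e (iotaDl 1) -map_comp.
Qed.

Lemma dom_vrot F x l : @dom madj_graph F = x :: l ->
  @dom madj_graph (vrot F) = rcons l (op (@cod madj_graph F)).
Proof.
move=> /dom_cons[]; move: (size l) => k en _ el.
rewrite (dom_ueq (under_vrot F)) -[uar _]/(varity F) en mkseqS cod_under opK el.
congr rcons; last first.
  have lastE X i : i = uar X -> rot_cat X i = ucat X 0 by move=> ->; rewrite /rot_cat /sh ltnn.
  by rewrite -[LHS]/(rot_cat (under F) _) lastE.
apply/eq_in_map => j; rewrite mem_iota => /andP[_ lt_j].
have lt_j' : j.+1 < uar (under F) by rewrite [uar _]en.
by rewrite /= /rot_cat /sh lt_j'.
Qed.

Lemma cod_vrot F x l : @dom madj_graph F = x :: l -> @cod madj_graph (vrot F) = op x.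
Proof.
move=> /dom_cons[en -> _]; rewrite (cod_ueq (under_vrot F)) /= /rot_cat /sh.
have lt0n : 0 < uar (under F) by rewrite [uar _]en.
by rewrite lt0n.
Qed.

Lemma urot_nullary X : uar X = 0 -> ueq (urot X) X.
Proof. by move=> e; have := urot_cycle X; rewrite e. Qed.

Lemma vrot_nullary F : @dom madj_graph F = [::] -> vrot F = F.
Proof.
move=> e; apply: vcell_ext; apply: ueq_trans (under_vrot F) _; apply: urot_nullary.
by rewrite -[uar _]/(varity F) -size_dom_vcell e.
Qed.

Lemma vrot_cycle F : iter (size (@dom madj_graph F)).+1 vrot F = F.
Proof.
rewrite size_dom_vcell; apply: vcell_ext; apply: ueq_trans (urot_cycle _).
rewrite -[uar _]/(varity F); elim: (varity F).+1 => [|r IH]; first exact: ueq_refl.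
by apply: ueq_trans (under_vrot _) _; apply: urot_ueq.
Qed.

Lemma vrot_id A : vrot (vid A) = vid (op A).
Proof.
apply: vcell_ext; apply: ueq_trans (under_vrot _) _.
apply: ueq_trans (urot_ueq (under_realize _)) _.
by apply: ueq_trans (urot_id A) _; apply/ueq_sym/under_realize.
Qed.

Lemma joint_ueq G G' F F' : ueq G G' -> (forall q, q < uar G -> ueq (F q) (F' q)) ->
  (forall q, q < uar G -> ucat G q.+1 = op (ucat (F q) 0)) ->
  forall q, q < uar G' -> ucat G' q.+1 = op (ucat (F' q) 0).
Proof.
move=> [en ec _ _] eF j q; rewrite -en => lt_q; rewrite -ec // j //.
by have [_ ->] := eF q lt_q.
Qed.

Lemma vrot_next g x l fs (p : @composable madj_graph g (vid x :: fs))
    (q : @composable madj_graph (vrot g) (rcons fs (vid (op (@cod madj_graph g))))) :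
  @dom madj_graph g = x :: l -> vrot (vcomp p) = vcomp q.
Proof.
move=> /dom_cons[en ex _]; set k' := size l in en.
have szf : size fs = k' by have := composable_size p; rewrite en => -[].
pose F i := if i is i'.+1 then under (nth g fs i') else uid x.
pose F' i := if i < k' then under (nth g fs i) else uid (ucat (under g) 0).
have eF i : i < varity g -> ueq (under (nth g (vid x :: fs) i)) (F i).
  by case: i => //= _; exact: under_realize.
have eF' i : i < varity (vrot g) ->
    ueq (under (nth g (rcons fs (vid (op (@cod madj_graph g)))) i)) (F' i).
  rewrite [varity _]en ltnS nth_rcons szf /F' => le_i; case: ltnP => //.
  move=> le_ki; have -> : i == k' by rewrite eqn_leq le_i.
  by rewrite cod_under opK; exact: under_realize.
have jF := @joint_ueq (under g) (under g) _ _ (ueq_refl _) eF (composable_joint g p).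
have jF' : forall i, i < uar (urot (under g)) ->
    ucat (urot (under g)) i.+1 = op (ucat (F' i) 0).
  exact: (@joint_ueq _ _ _ _ (under_vrot g) eF' (composable_joint g q)).
apply: vcell_ext; apply: ueq_trans (under_vrot _) _.
apply: ueq_trans (urot_ueq (@vcomp_ueq _ _ p g _ _ jF (ueq_refl _) eF)) _.
apply: ueq_trans (rotate_next (k' := k') (F := F) (F' := F') _ jF jF' _ _ _) _ => //.
- by rewrite /F ex.
- by move=> i lt_i; rewrite /F' lt_i.
- by rewrite /F' ltnn.
by apply: ueq_sym; apply: (@vcomp_ueq _ _ _ g); [exact: under_vrot | exact: eF'].
Qed.

Lemma vrot_first g f l l' y (p : @composable madj_graph g (f :: map vid l))
  (q : @composable madj_graph (vrot f) (rcons (map vid l') (vrot g))) :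
  @dom madj_graph g = @cod madj_graph f :: l -> @dom madj_graph f = y :: l' ->
  vrot (vcomp p) = vcomp q.
Proof.
move=> /dom_cons[ek _ el] /dom_cons[en _ el']; set k' := size l in ek el.
set n' := size l' in en el'.
pose F i := if i is i'.+1 then uid (ucat (under g) i'.+2) else under f.
pose F' i := if i < n' then uid (ucat (under f) i.+2) else urot (under g).
have eF i : i < varity g -> ueq (under (nth g (f :: map vid l) i)) (F i).
  case: i => [_|i] /=; first exact: ueq_refl.
  move=> lt_i0; have lt_i : i < k' by rewrite -ltnS -ek.
  rewrite (nth_map (ucat (under g) 0)) //.
  have -> : nth (ucat (under g) 0) l i = ucat (under g) i.+2 by rewrite el nth_mkseq.
  exact: under_realize.
have eF' i : i < varity (vrot f) ->
    ueq (under (nth g (rcons (map vid l') (vrot g)) i)) (F' i).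
  rewrite [varity _]en ltnS nth_rcons size_map /F' => le_i; case: ltnP => lt_i.
    rewrite (nth_map (ucat (under g) 0)) //.
    have -> : nth (ucat (under g) 0) l' i = ucat (under f) i.+2 by rewrite el' nth_mkseq.
    exact: under_realize.
  have -> : i == size l' by rewrite eqn_leq le_i.
  exact: under_vrot.
have jF := @joint_ueq (under g) (under g) _ _ (ueq_refl _) eF (composable_joint g p).
have jF' : forall i, i < uar (urot (under f)) ->
    ucat (urot (under f)) i.+1 = op (ucat (F' i) 0).
  exact: (@joint_ueq _ _ _ _ (under_vrot f) eF' (composable_joint g q)).
apply: vcell_ext; apply: ueq_trans (under_vrot _) _.
apply: ueq_trans (urot_ueq (@vcomp_ueq _ _ p g _ _ jF (ueq_refl _) eF)) _.
apply: ueq_trans (rotate_first (k' := k') (n' := n') (Z := under f) (F := F) (F' := F') _ _ jF jF' _ _ _ _) _ => //.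
- by move=> i lt_i; rewrite /F' lt_i.
- by rewrite /F' ltnn.
by apply: ueq_sym; apply: (@vcomp_ueq _ _ _ g); [exact: under_vrot | exact: eF'].
Qed.

Definition madj_cyclic : cyclic_multicategory madj_graph :=
  @cyclic_of madj_graph madj_multi op vrot opK dom_vrot cod_vrot vrot_nullary
    vrot_cycle vrot_id vrot_next vrot_first.

Lemma val_ordS n (i : 'I_n.+1) : ordS i = sh n i :> nat.
Proof.
rewrite /= /sh; case: ltnP => [lt|le]; first by rewrite modn_small.
have -> : i = n :> nat by apply/eqP; rewrite eqn_leq leq_ord.
exact: modnn.
Qed.

Lemma vcell_recast n (A B : 'I_n.+1 -> category) (F : madj A) : A = B ->
  exists F' : madj B, VCell F = VCell F'.
Proof. by move=> e; subst B; exists F. Qed.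

(** The positions of the two sides match because [ordS] is [sh n]. *)
Lemma rotation_ueq n (A : 'I_n.+1 -> category) (F : madj A)
    (F' : madj (fun i => A (ordS i))) :
  ueq (underlying F') (urot (underlying F)) -> is_rotation F F'.
Proof.
case=> _ _ ee et; split=> [i|a i x' x ex].
  apply: functor_ext => a b u.
  have eu (k : but i) : but_family u (sh n (val (val k))) = Some (Arrow (u (ordS_but k))).
    by rewrite -val_ordS -(but_familyE u).
  apply: Some_inj; rewrite -(ev_ord _ (but_familyE u)).
  rewrite -(@ev_ord _ _ F' i (fun j => but_family u (sh n j)) _ _ (fun k => u (ordS_but k))) //.
  rewrite [LHS](ee _ _ (leq_ord i)) val_ordS; apply: vev_ext; rewrite ?sh_leq //.
  by move=> j le_j _; rewrite unshK.
have h := tr_ord (full_familyE (fun k => idm (a k))) (corr_transpose x).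
have h' := tr_ord (full_familyE (fun k => idm (a (ordS k)))) (corr_transpose x').
apply: Some_inj; rewrite -[LHS]h' -[RHS]h -/(tr (underlying _) _ _ _ _).
rewrite [LHS](et _ _ _ _ (leq_ord _) (leq_ord _)) /rot_tr !val_ordS ex.
apply: vtr_ext; rewrite ?sh_leq // => k le_k.
have [k' ek] := leq_ordP (unsh_leq le_k).
by rewrite ek full_familyE -(unshK le_k) ek -val_ordS full_familyE.
Qed.

Lemma vrot_rotation n (A : 'I_n.+1 -> category) (F : madj A) :
  exists2 F' : madj (fun i => A (ordS i)), vrot (VCell F) = VCell F' & is_rotation F F'.
Proof.
have eA : (fun i : 'I_n.+1 => ucat (urot (underlying F)) i) = fun i => A (ordS i).
  apply: functional_extensionality => i.
  rewrite /= /rot_cat /= /ncat; congr A; apply: val_inj.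
  by rewrite /= inordK ?ltnS ?sh_leq // -val_ordS.
have [F' e] := vcell_recast (realize (urot (underlying F))) eA.
exists F' => //; apply: rotation_ueq.
by have := under_realize (urot (underlying F)); rewrite e.
Qed.

Section IsComposite.
Variables (G : vcell) (F : 'I_(varity G) -> vcell) (H : vcell).
Variable d : vcell.
Let Fn q := nth d [seq F q | q <- enum 'I_(varity G)] q.
Hypothesis joint : forall q, q < uar (under G) -> ucat (under G) q.+1 = op (ucat (under (Fn q)) 0).
Hypothesis eH : ueq (under H) (ucomp (F := fun q => under (Fn q)) joint).

Let U q := under (Fn q).
Let m q := uar (U q).

Lemma nth_args (q : 'I_(varity G)) : Fn q = F q.
Proof. by rewrite /Fn (nth_map q) ?size_enum_ord // nth_ord_enum. Qed.

Lemma input_posE (q : 'I_(varity G)) j : input_pos F q j = off m q + j.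
Proof.
rewrite /input_pos /flatten_index; congr addn.
have szf : size [seq varity (F q) | q <- enum 'I_(varity G)] = varity G.
  by rewrite size_map size_enum_ord.
have gen r : r <= varity G -> sumn (take r [seq varity (F q) | q <- enum 'I_(varity G)]) = off m r.
  elim: r => [|r IH] lt_r; first by rewrite take0.
  rewrite (take_nth 0) ?szf // sumn_rcons IH ?(ltnW lt_r) // [RHS]/=; congr addn.
  rewrite (nth_map (Ordinal lt_r)) ?size_enum_ord // /m /U.
  rewrite -[r]/(val (Ordinal lt_r)); set q' := Ordinal lt_r.
  by rewrite nth_ord_enum nth_args.
exact: gen (ltnW (ltn_ord q)).
Qed.

Lemma arity_comp : varity H = off m (varity G).
Proof. by case: eH. Qed.

Lemma pos_ord (q : 'I_(varity G)) (j : 'I_(varity (F q))) :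
  exists p : 'I_(varity H), p = input_pos F q j :> nat.
Proof.
have lt_p : input_pos F q j < varity H.
  rewrite arity_comp input_posE -addnS; apply: off_leq => //.
  by rewrite /m /U nth_args.
by exists (Ordinal lt_p).
Qed.

(** In a compatible triple, [v] and [u] are what [outer] and [inner] compute from [w]. *)
Lemma outer_compatible (c c' : forall p, vcat H p) (w : forall p, Hom (c p) (c' p))
    (a a' : forall q j, vcat (F q) j) (u : forall q j, Hom (a q j) (a' q j))
    (b b' : forall q, vcat G q) (v : forall q, Hom (b q) (b' q)) q :
  compatible w u v -> q <= varity G -> outer U (full_family w) q = full_family v q.
Proof.
move=> comp; have [c0 cw cv cu] := comp.
case: q => [_|q lt_q].
  rewrite /= /full_family; have -> : inord 0 = ord0 :> 'I_(varity H).+1 by apply: val_inj; rewrite /= inordK.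
  have -> : inord 0 = ord0 :> 'I_(varity G).+1 by apply: val_inj; rewrite /= inordK.
  by rewrite c0.
have -> : q.+1 = lift ord0 (Ordinal lt_q) :> nat by [].
set q' := Ordinal lt_q; rewrite full_familyE cv.
rewrite -[LHS]/(ev (under (Fn q')) 0 (fun j => full_family w (off m q + j))) nth_args.
apply: (@ev_ord _ _ (vadj (F q')) ord0) => k.
rewrite -[RHS](full_familyE (u q') (val k)).
case: (unliftP ord0 (val k)) (valP k) => [j ->|->] // _.
have [p ep] := pos_ord j.
have e : off m q + bump 0 j = lift ord0 p.
  by rewrite [RHS]/= ep input_posE /= /bump /= !add1n addnS.
by rewrite e !full_familyE -(cw q' j p ep).
Qed.

Lemma inner_compatible (c c' : forall p, vcat H p) (w : forall p, Hom (c p) (c' p))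
    (a a' : forall q j, vcat (F q) j) (u : forall q j, Hom (a q j) (a' q j))
    (b b' : forall q, vcat G q) (v : forall q, Hom (b q) (b' q))
    (q : 'I_(varity G)) j :
  compatible w u v -> j <= varity (F q) ->
  inner (under G) U (full_family w) q j = full_family (u q) j.
Proof.
move=> comp; have [c0 cw cv cu] := comp.
case: j => [_|j lt_j]; last first.
  have -> : j.+1 = lift ord0 (Ordinal lt_j) :> nat by [].
  have [p ep] := pos_ord (Ordinal lt_j).
  rewrite full_familyE (cw q (Ordinal lt_j) p ep) /=.
  have -> : off (fun q => uar (U q)) q + bump 0 j = lift ord0 p.
    by rewrite [RHS]/= ep input_posE /= /bump /= !add1n addnS.
  by rewrite full_familyE.
have -> : 0 = (ord0 : 'I_(varity (F q)).+1) by [].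
rewrite full_familyE cu [LHS]/=.
have -> : q.+1 = lift ord0 q :> nat by [].
apply: (@ev_ord _ _ (vadj G) (lift ord0 q)) => k.
rewrite -(full_familyE v); apply: outer_compatible comp _; exact: leq_ord.
Qed.

Lemma composite_functors_ueq : composite_functors F H.
Proof.
move=> c c' w a a' u b b' v cp; have [_ _ ee _] := eH.
have evw (p : 'I_(varity H).+1) : Some (Arrow (fmap (H p) (x := omit p c) (y := omit p c') (omit p w))) =
    cev (under G) U p (full_family w).
  rewrite -[RHS](ee p _ (leq_ord p)); symmetry; apply: (@ev_ord _ _ (vadj H)) => k.
  exact: full_familyE.
split=> [|q j p ep]; apply: Some_inj; rewrite evw.
  rewrite cev0; symmetry; rewrite -(@ev_ord _ _ (vadj G) ord0 (outer U (full_family w))) //.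
  by move=> k; rewrite (outer_compatible cp) ?leq_ord // full_familyE.
have -> : lift ord0 p = off m q + (lift ord0 j) :> nat.
  by rewrite [LHS]/= ep input_posE /= /bump /= !add1n addnS.
have le_j : lift ord0 j <= m q by rewrite /m /U nth_args leq_ord.
rewrite cevE // /U nth_args; apply: (@ev_ord _ _ (vadj (F q))) => k.
by rewrite (inner_compatible cp) ?leq_ord // full_familyE.
Qed.

Lemma composite_transpose_ueq : composite_transpose F H.
Proof.
move=> c a b cp q j p ep x x' y y' z z' cx ex cy ey cz; have [en ec ee et] := eH.
apply: Some_inj.
rewrite -(tr_ord (full_familyE (fun k => idm (c k))) cx).
have l : elt (under H) (full_family (fun k => idm (c k))) 0 (Some (Arrow x)).
  apply/velementP => //; exists c.
  have e0 : inord 0 = ord0 :> 'I_(varity H).+1 by apply: val_inj; rewrite /= inordK.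
  by rewrite e0; exists x; split=> // k; rewrite full_familyE.
have l' : elt (ucomp (F := fun q => under (Fn q)) joint) (full_family (fun k => idm (c k))) 0 (Some (Arrow x)).
  move: l; rewrite en; apply: element_eq => //.
  - by move=> i; rewrite -en; apply: ec.
  - by move=> i w'; rewrite -en => le_i _; apply: ee.
  by move=> i v' w' le_i; apply: (@ev_ext (ucomp joint)).
rewrite -[LHS]/(tr (under H) _ _ _ _) et ?leq_ord // [LHS](ucomp_tr0 _ l').
have -> : lift ord0 p = off m q + (lift ord0 j) :> nat.
  by rewrite [LHS]/= ep input_posE /= /bump /= !add1n addnS.
have le_j : lift ord0 j <= m q by rewrite /m /U nth_args leq_ord.
rewrite from_rootE //.
have -> : tr (under G) 0 q.+1 (outer (fun q => under (Fn q)) (full_family (fun k => idm (c k)))) (Some (Arrow x)) =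
    Some (Arrow y').
  rewrite ex -(tr_ord (full_familyE (fun k => idm (b k))) cy).
  by apply: tr_ext => // k le_k; rewrite (outer_compatible cp).
rewrite -[oop _]/(Some (aop (Arrow y'))) [aop _]/aop /=.
rewrite ey -(tr_ord (full_familyE (fun k => idm (a q k))) cz) nth_args.
by apply: (@tr_ext (under (F q))) => // k le_k; rewrite -(inner_compatible cp).
Qed.

Lemma is_composite_ueq : is_composite F H.
Proof. split; [exact: composite_functors_ueq | exact: composite_transpose_ueq]. Qed.

End IsComposite.

Lemma madj_is_MAdj : is_MAdj madj_cyclic.
Proof.
split=> // [n A F|G F p]; first exact: vrot_rotation.
exact: is_composite_ueq (vcomp_congr p G).
Qed.

(** * Components of 2-cells and their action on elements *)

Notation sU f := (under (cell_src f)).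
Notation tU f := (under (cell_tgt f)).

Definition side (f : cell) (i : nat) : hcell := HCell (cfun f (inord i)).

Definition side_map (f : cell) (w : nat -> parrow) (i : nat) : parrow := amap (side f i) (w i).

Definition inputs (n : nat) (A : nat -> category) (a : nat -> parrow) : Prop :=
  forall j, 0 < j -> j <= n -> ocat (a j) = Some (A j) /\ osrc (a j) = a j.

(** The component at the objects whose identities are the entries of [a]; it is an arrow of the
    opposite of the target category at the root. *)
Definition cell_at (f : cell) (a : nat -> parrow) : parrow :=
  the (fun g => exists b : prod_but (csrc_cat f) ord0,
    (forall k : but ord0, a (val (val k)) = Some (aid (b k))) /\
    g = Arrow (cnat f b)).

Lemma objects_inputs n A a : objects n A a -> inputs n A a.
Proof. by move=> o j _ le_j; apply: o. Qed.

Lemma inputs_typed n A a : inputs n A a -> typed n A 0 a.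
Proof. by move=> o j le_j ne; case: (o j) => //; lia. Qed.

Section Components.
Variable f : cell.
Local Notation n := (carity f).
Local Notation A := (ucat (sU f)).
Local Notation B := (ucat (tU f)).
Local Notation S0 := (hop (side f 0)).

Lemma inord0 m : inord 0 = ord0 :> 'I_m.+1.
Proof. by apply: val_inj; rewrite /= inordK. Qed.

Lemma side_ord (i : 'I_n.+1) : side f i = HCell (cfun f i).
Proof. by rewrite /side inord_val. Qed.

Lemma side0 : side f 0 = HCell (cfun f ord0).
Proof. by rewrite /side inord0. Qed.

Lemma cell_atE a (b : prod_but (csrc_cat f) ord0) :
  (forall k : but ord0, a (val (val k)) = Some (aid (b k))) ->
  cell_at f a = Some (Arrow (cnat f b)).
Proof.
move=> e; apply: theE => [|g [b' [e' ->]]]; first by exists b.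
have -> // : b' = b.
by apply: functional_extensionality_dep => k; apply/aid_inj/Some_inj; rewrite -e'.
Qed.

Lemma inputsP a : inputs n A a -> exists b : prod_but (csrc_cat f) ord0,
  forall k : but ord0, a (val (val k)) = Some (aid (b k)).
Proof.
move=> o.
have h (k : but (ord0 : 'I_n.+1)) : exists x : csrc_cat f (val k), a (val (val k)) = Some (aid x).
  have [||eo es] := o (val (val k)); last 2 first.
  - exact: leq_ord.
  - have ec : A (val (val k)) = csrc_cat f (val k) by rewrite /= /ncat inord_val.
    rewrite ec in eo; have [x [y [g eg]]] := ocatP eo.
    by exists x; rewrite -es eg.
  by have := valP k; rewrite -val_eqE /= lt0n.
pose z k := constructive_indefinite_description _ (h k).
by exists (fun k => proj1_sig (z k)) => k; exact: (proj2_sig (z k)).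
Qed.

Lemma cell_at_none a : ~ inputs n A a -> cell_at f a = None.
Proof.
move=> no; rewrite /cell_at; case e : (the _) => [g|//]; case: no => j lt0j le_j.
have [b [eb _]] := the_some e.
have [k ->] : exists k : but (ord0 : 'I_n.+1), j = val (val k).
  by apply: but_leqP le_j _ => /= e0; rewrite e0 in lt0j.
by rewrite eb /= /ncat inord_val.
Qed.

Lemma cell_at_ocat a : inputs n A a -> ocat (cell_at f a) = Some (op (B 0)).
Proof. by move=> /inputsP[b e]; rewrite (cell_atE e) /= /ncat inord0. Qed.

Lemma ev_inputs a (b : prod_but (csrc_cat f) ord0) :
  (forall k : but ord0, a (val (val k)) = Some (aid (b k))) ->
  ev (sU f) 0 a = Some (@aid (op (csrc_cat f ord0)) (csrc f ord0 b)).
Proof.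
move=> e; rewrite -[LHS]/(vev (csrc f) (ord0 : 'I_n.+1) a).
by rewrite (ev_ord _ (u := idm b)) ?fmap_id.
Qed.

Lemma cell_at_src a : inputs n A a -> osrc (cell_at f a) = amap S0 (ev (sU f) 0 a).
Proof.
move=> /inputsP[b e]; rewrite (cell_atE e) (ev_inputs e) side0 /hop /aid amapE /=.
by rewrite fmap_id.
Qed.

Lemma cell_at_tgt a : inputs n A a -> otgt (cell_at f a) = ev (tU f) 0 (side_map f a).
Proof.
move=> /inputsP[b e]; rewrite (cell_atE e) -[RHS]/(vev (ctgt f) (ord0 : 'I_n.+1) (side_map f a)).
rewrite (@ev_ord _ _ (ctgt f) ord0 _ _ _
  (@idm (prod_but (ctgt_cat f) ord0) (fun k => cfun f (val k) (b k)))).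
  by rewrite fmap_id.
by move=> k; rewrite /side_map e side_ord /aid amapE fmap_id.
Qed.

Lemma cell_at_nat w : typed n A 0 w ->
  ocomp (cell_at f (fun j => otgt (w j))) (amap S0 (ev (sU f) 0 w)) =
  ocomp (ev (tU f) 0 (side_map f w)) (cell_at f (fun j => osrc (w j))).
Proof.
move=> t; have [a [b [u e]]] := vtyped (leq0n n) t.
move: a b u e; rewrite inord0 => a b u e.
rewrite (cell_atE (b := b)); last by move=> k; rewrite e.
rewrite (cell_atE (b := a)); last by move=> k; rewrite e.
have -> : ev (sU f) 0 w = Some (Arrow (fmap (csrc f ord0) u)).
  by rewrite -[LHS]/(vev (csrc f) (ord0 : 'I_n.+1) w) (ev_ord _ e).
have -> : ev (tU f) 0 (side_map f w) = Some (Arrow (fmap (ctgt f ord0)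
    (x := fun k : but ord0 => cfun f (val k) (a k))
    (y := fun k : but ord0 => cfun f (val k) (b k)) (fun k => fmap (cfun f (val k)) (u k)))).
  rewrite -[LHS]/(vev (ctgt f) (ord0 : 'I_n.+1) (side_map f w)); apply: ev_ord => k.
  by rewrite /side_map e side_ord amapE.
rewrite side0 /hop amapE !ocompE; congr (Some (Arrow _)).
exact: (naturality (cnat f) u).
Qed.

Lemma cell_at_ext a b : (forall j, 0 < j -> j <= n -> a j = b j) -> cell_at f a = cell_at f b.
Proof.
move=> e; have [o|no] := classic (inputs n A a); last first.
  rewrite !cell_at_none // => o; apply: no => j lt0j le_j.
  by rewrite e //; apply: o.
have [c ec] := inputsP o; rewrite (cell_atE ec) (cell_atE (b := c)) // => k.
rewrite -ec e //; last exact: leq_ord.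
by have := valP k; rewrite -val_eqE /= lt0n.
Qed.

Lemma side_map_cat w i : ocat (w i) = Some (A i) -> ocat (side_map f w i) = Some (B i).
Proof. by move=> e; rewrite /side_map amap_some. Qed.

Lemma side_map_typed i w : typed n A i w -> typed n B i (side_map f w).
Proof. by move=> t j le_j ne; apply: side_map_cat; apply: t. Qed.

Lemma side_map_src w i : osrc (side_map f w i) = side_map f (fun j => osrc (w j)) i.
Proof. by rewrite /side_map osrc_map. Qed.

Lemma side_map_tgt w i : otgt (side_map f w i) = side_map f (fun j => otgt (w j)) i.
Proof. by rewrite /side_map otgt_map. Qed.

Lemma side_map_inputs a : inputs n A a -> inputs n B (side_map f a).
Proof.
move=> o j lt0j le_j; have [ec es] := o j lt0j le_j.
by rewrite side_map_src /side_map es amap_some.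
Qed.

Lemma side_map_objects a : objects n A a -> objects n B (side_map f a).
Proof.
move=> o j le_j; have [ec es] := o j le_j.
by rewrite side_map_src /side_map es amap_some.
Qed.

(** The action on the elements at the position [i]: S_0(x) o alpha at the root, and at the other
    positions its conjugate by transposition. *)
Definition cell_act (i : nat) (a : nat -> parrow) (x : parrow) : parrow :=
  tr (tU f) 0 i (side_map f a)
    (ocomp (amap (side f 0) (tr (sU f) i 0 a x)) (oop (cell_at f a))).

Lemma cell_act0_elt a x : elt (sU f) a 0 x ->
  elt (tU f) (side_map f a) 0 (ocomp (amap (side f 0) x) (oop (cell_at f a))).
Proof.
move=> [o es et]; have o' := objects_inputs o.
have e : osrc (amap (side f 0) x) = otgt (oop (cell_at f a)).
  by rewrite otgt_op cell_at_src // amap_hop oopK osrc_map es.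
split; first exact: side_map_objects.
  by rewrite osrc_comp // osrc_op cell_at_tgt.
by rewrite otgt_comp // otgt_map et.
Qed.

Lemma cell_act_elt i a x : i <= n -> elt (sU f) a i x -> elt (tU f) (side_map f a) i (cell_act i a x).
Proof.
by move=> le_i l; apply: tr_element => //; apply: cell_act0_elt; apply: tr_element.
Qed.

Lemma cell_act0 a x : elt (sU f) a 0 x -> cell_act 0 a x = ocomp (amap (side f 0) x) (oop (cell_at f a)).
Proof. by move=> l; rewrite /cell_act [tr (sU f) _ _ _ _]tr_id // tr_id //; apply: cell_act0_elt. Qed.

Lemma cell_act_tr i j a x : i <= n -> j <= n -> elt (sU f) a i x ->
  cell_act j a (tr (sU f) i j a x) = tr (tU f) i j (side_map f a) (cell_act i a x).
Proof. by move=> le_i le_j l; rewrite /cell_act !tr_comp. Qed.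

Lemma act_elt X u i x : i <= uar X ->
  (forall j, j <= uar X -> ocat (u j) = Some (ucat X j)) ->
  elt X (fun j => osrc (u j)) i x -> elt X (fun j => otgt (u j)) i (act (ev X) u i x).
Proof.
move=> le_i t [o es et].
have e1 : osrc x = otgt (oop (ev X i u)) by rewrite es otgt_op ev_src.
have e2 : osrc (u i) = otgt (ocomp x (oop (ev X i u))) by rewrite otgt_comp.
split; last by rewrite /act otgt_comp.
  by move=> q le_q; rewrite ocat_tgt osrc_tgt t.
by rewrite /act osrc_comp // osrc_comp // osrc_op ev_tgt.
Qed.

(** Transposition is natural, which leaves the root, where this is the naturality of the component. *)
Lemma cell_act_nat i u x : i <= n -> (forall j, j <= n -> ocat (u j) = Some (A j)) ->
  elt (sU f) (fun j => osrc (u j)) i x ->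
  cell_act i (fun j => otgt (u j)) (act (ev (sU f)) u i x) =
  act (ev (tU f)) (side_map f u) i (cell_act i (fun j => osrc (u j)) x).
Proof.
move=> le_i t l; rewrite /cell_act tr_nat //.
set y := tr (sU f) i 0 _ x.
have ly : elt (sU f) (fun j => osrc (u j)) 0 y by apply: tr_element.
have es : side_map f (fun j => osrc (u j)) = fun j => osrc (side_map f u j).
  by apply: functional_extensionality => j; rewrite side_map_src.
have et : side_map f (fun j => otgt (u j)) = fun j => otgt (side_map f u j).
  by apply: functional_extensionality => j; rewrite side_map_tgt.
have t0 : typed n A 0 u by move=> j le_j _; apply: t.
rewrite es et -tr_nat //; last 2 first.
- by move=> j le_j; apply: side_map_cat; apply: t.
- by rewrite -es; apply: cell_act0_elt.
congr tr; rewrite /act.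
have [o ey1 ey2] := ly.
have e1 : osrc y = otgt (oop (ev (sU f) 0 u)) by rewrite ey1 otgt_op ev_src.
have e2 : osrc (u 0) = otgt (ocomp y (oop (ev (sU f) 0 u))) by rewrite otgt_comp.
rewrite amap_comp // amap_comp // -[side_map f u 0]/(amap (side f 0) (u 0)) -!ocompA.
congr ocomp; congr ocomp.
apply: (inv_inj oopK); rewrite !oop_comp !oopK -amap_hop.
exact: cell_at_nat.
Qed.

Definition upd (a : nat -> parrow) (i : nat) (v : parrow) (j : nat) : parrow :=
  if j == i then v else a j.

Lemma upd_ev X a i v : i <= uar X -> ev X i (upd a i v) = ev X i a.
Proof. by move=> le_i; apply: ev_ext => // j _ ne; rewrite /upd; case: eqP. Qed.

(** The universal element at the position [i] is the identity of F_i(\hat a_i), an element at the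
    family in which F_i(\hat a_i) takes the place of a_i. *)
Lemma unit_element X a i : i <= uar X ->
  (forall j, j <= uar X -> j <> i -> ocat (a j) = Some (ucat X j) /\ osrc (a j) = a j) ->
  elt X (upd a i (oop (ev X i a))) i (oop (ev X i a)).
Proof.
move=> le_i o.
have es : osrc (ev X i a) = ev X i a.
  by rewrite ev_src //; apply: ev_ext => // j le_j ne; case: (o j le_j ne).
have et : otgt (ev X i a) = ev X i a.
  rewrite ev_tgt //; apply: ev_ext => // j le_j ne.
  by have [_ <-] := o j le_j ne; rewrite otgt_src.
split.
- move=> j le_j; rewrite /upd; case: eqP => [->|ne]; last exact: o.
  rewrite ocat_op ev_cat // => [|l le_l ne]; last by case: (o l le_l ne).
  by rewrite /= opK osrc_op et.
- by rewrite upd_ev // osrc_op et.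
- by rewrite /upd eqxx otgt_op es.
Qed.

(** The Yoneda lemma: naturality along [x] determines the action from its value at the universal
    element. *)
Lemma cell_act_unit i a x : i <= n -> elt (sU f) a i x ->
  cell_act i a x = ocomp (amap (side f i) x)
                (cell_act i (upd a i (oop (ev (sU f) i a))) (oop (ev (sU f) i a))).
Proof.
move=> le_i l; have [o es et] := l.
have oi j : j <= n -> j <> i -> ocat (a j) = Some (A j) /\ osrc (a j) = a j.
  by move=> le_j _; apply: o.
have lu := @unit_element (sU f) a i le_i oi.
pose u := upd a i x.
have eus : (fun j => osrc (u j)) = upd (fun j => osrc (a j)) i (oop (ev (sU f) i a)).
  by apply: functional_extensionality => j; rewrite /u /upd; case: eqP.
have tu j : j <= n -> ocat (u j) = Some (A j).
  move=> le_j; rewrite /u /upd; case: eqP => [->|_]; last by case: (o j le_j).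
  by rewrite -ocat_tgt et; case: (o i le_i).
have eobj j : j <= n -> osrc (a j) = a j by move=> /o[].
have eut j : j <= n -> otgt (u j) = a j.
  move=> le_j; rewrite /u /upd; case: eqP => [->//|_].
  by rewrite -[in LHS](eobj j) // otgt_src eobj.
have cell_act_ext b c y : (forall j, j <= n -> b j = c j) -> cell_act i b y = cell_act i c y.
  move=> e; rewrite /cell_act.
  rewrite (@tr_ext (sU f) i 0 b c) // (@tr_ext (tU f) 0 i (side_map f b) (side_map f c)) //; last first.
    by move=> j le_j; rewrite /side_map e.
  by rewrite (cell_at_ext (b := c)) // => j _; apply: e.
have lus : elt (sU f) (fun j => osrc (u j)) i (oop (ev (sU f) i a)).
  by rewrite eus; apply: elt_ext lu => // j le_j; rewrite /upd; case: eqP => // _; rewrite eobj.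
have e1 := cell_act_nat le_i tu lus.
have eu : ev (sU f) i u = ev (sU f) i a by apply: upd_ev.
have ei : otgt (oop (ev (sU f) i a)) = oop (ev (sU f) i a).
  rewrite otgt_op ev_src //; congr oop; apply: ev_ext => // j le_j _; exact: eobj.
have ex : act (ev (sU f)) u i (oop (ev (sU f) i a)) = x.
  rewrite /act eu -{1}ei ocomp_tgt /u /upd eqxx.
  by rewrite -[in RHS](ocomp_src x) es.
rewrite ex in e1; rewrite -(cell_act_ext (fun j => otgt (u j)) a) // e1.
rewrite (cell_act_ext _ (upd a i (oop (ev (sU f) i a)))); last first.
  by move=> j le_j; rewrite /u /upd; case: eqP => _; [exact: es | exact: eobj].
have [_ es2 _] := cell_act_elt le_i lu.
rewrite /act [side_map f u i]/side_map {1}/u /upd eqxx; congr ocomp.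
rewrite -[RHS]ocomp_src es2; congr (ocomp _ (oop _)).
apply: ev_ext => // j le_j ne; rewrite /side_map /u /upd; case: eqP => //.
Qed.

Lemma cell_act_ext i a b x : i <= n -> (forall j, j <= n -> a j = b j) -> cell_act i a x = cell_act i b x.
Proof.
move=> le_i e; rewrite /cell_act.
rewrite (@tr_ext (sU f) i 0 a b) // (@tr_ext (tU f) 0 i (side_map f a) (side_map f b)) //; last first.
  by move=> j le_j; rewrite /side_map e.
by rewrite (cell_at_ext (b := b)) // => j _; apply: e.
Qed.

Lemma cell_at_act a : inputs n A a ->
  cell_at f a = oop (cell_act 0 (upd a 0 (oop (ev (sU f) 0 a))) (oop (ev (sU f) 0 a))).
Proof.
move=> o.
have lu : elt (sU f) (upd a 0 (oop (ev (sU f) 0 a))) 0 (oop (ev (sU f) 0 a)).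
  by apply: unit_element => // j le_j ne; apply: o => //; lia.
rewrite cell_act0 // oop_comp oopK -amap_hop.
rewrite (cell_at_ext (b := a)); last by case.
by rewrite -cell_at_src // ocomp_src.
Qed.

End Components.

Lemma vcell_inj n (A A' : 'I_n.+1 -> category) (F : madj A) (F' : madj A') :
  VCell F = VCell F' -> existT (fun A => madj A) A F = existT _ A' F'.
Proof.
pose p (v : vcell) : {n & {A : 'I_n.+1 -> category & madj A}} :=
  existT _ (varity v) (existT _ (vcat v) (vadj v)).
by move=> /(congr1 p) e; exact: (EqdepTheory.inj_pair2 _ _ _ _ _ e).
Qed.

Lemma hcell_inj C D (S S' : functor C D) : HCell S = HCell S' -> S = S'.
Proof.
pose p (h : hcell) : {C & {D & functor C D}} :=
  existT _ (hcell_src h) (existT _ (hcell_tgt h) (hcell_functor h)).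
move=> /(congr1 p) e.
exact: (EqdepTheory.inj_pair2 _ _ _ _ _ (EqdepTheory.inj_pair2 _ _ _ _ _ e)).
Qed.

Lemma hcell_recast (h : hcell) C D : hcell_src h = C -> hcell_tgt h = D ->
  exists S : functor C D, HCell S = h.
Proof. by case: h => C' D' S /= <- <-; exists S. Qed.

Lemma nat_trans_ext C D (S T : functor C D) (s t : nat_trans S T) :
  (forall x, s x = t x) -> s = t.
Proof.
case: s t => s ns [t nt] /= e.
have {}e : s = t by apply: functional_extensionality_dep.
by subst t; congr NatTrans; apply: proof_irrelevance.
Qed.

Lemma cell_ext (f g : cell) : cell_src f = cell_src g -> cell_tgt f = cell_tgt g ->
  (forall i, i <= carity f -> side f i = side g i) ->
  (forall a, inputs (carity f) (ucat (sU f)) a -> cell_at f a = cell_at g a) -> f = g.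
Proof.
case: f g => n A B F G S al [n' A' B' F' G' S' be]; rewrite /cell_src /cell_tgt /= => e1 e2.
have en := congr1 varity e1; rewrite /= in en; subst n'.
have e1' := vcell_inj e1; have eA := congr1 (@projT1 _ _) e1'; rewrite /= in eA; subst A'.
have eF := EqdepTheory.inj_pair2 _ _ _ _ _ e1'; subst F'.
have e2' := vcell_inj e2; have eB := congr1 (@projT1 _ _) e2'; rewrite /= in eB; subst B'.
have eG := EqdepTheory.inj_pair2 _ _ _ _ _ e2'; subst G'.
move=> es ec.
have eS : S = S'.
  apply: functional_extensionality_dep => i.
  by have := es i (leq_ord i); rewrite /side /= inord_val => /hcell_inj.
subst S'; congr Cell; apply: nat_trans_ext => b; apply: Arrow_inj; apply: Some_inj.
pose a := but_family (idm b).
have ea (k : but (ord0 : 'I_n.+1)) : a (val (val k)) = Some (aid (b k)) by exact: but_familyE.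
rewrite -(@cell_atE (Cell al) a b ea) -(@cell_atE (Cell be) a b ea); apply: ec => j lt0j le_j.
have [|k ->] := @but_leqP n ord0 j le_j; first by move=> /= e0; rewrite e0 in lt0j.
by rewrite ea /= /ncat inord_val.
Qed.

(** The action at one position determines the actions at all the others by transposition, and the
    components are recovered from the universal elements at the root. *)
Lemma cell_ext_act r (f g : cell) : r <= carity f ->
  cell_src f = cell_src g -> cell_tgt f = cell_tgt g ->
  (forall i, i <= carity f -> side f i = side g i) ->
  (forall a x, elt (sU f) a r x -> cell_act f r a x = cell_act g r a x) -> f = g.
Proof.
move=> le_r es et eS ep.
have en : carity f = carity g by exact: (congr1 varity es).
apply: cell_ext => // a o.
have o' : inputs (carity g) (ucat (sU g)) a by rewrite -en -es.
rewrite (cell_at_act o) (cell_at_act o'); congr oop; rewrite -es.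
set b := upd _ _ _; set x := oop _.
have l : elt (sU f) b 0 x by apply: unit_element => // j le_j ne; apply: o => //; lia.
have l' : elt (sU g) b 0 x by rewrite -es.
have l2 : elt (sU f) b r (tr (sU f) 0 r b x) by apply: tr_element.
have e : x = tr (sU f) r 0 b (tr (sU f) 0 r b x) by rewrite tr_comp // tr_id.
have l3 : elt (sU g) b r (tr (sU f) 0 r b x) by rewrite -es.
have e2 := @cell_act_tr g r 0 b (tr (sU f) 0 r b x).
rewrite -en -es -et in e2.
rewrite e cell_act_tr // ep // e2 //; apply: tr_ext => // j le_j; by rewrite /side_map eS.
Qed.

(** A construction of 2-cells in which the types of the components are not mentioned: they are
    recovered from the equations on their sources and targets. *)
Lemma cell_of_components (F G : vcell) (S : nat -> hcell) (C : (nat -> parrow) -> parrow) :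
  varity F = varity G ->
  (forall i, i <= varity F -> hcell_src (S i) = ucat (under F) i) ->
  (forall i, i <= varity F -> hcell_tgt (S i) = ucat (under G) i) ->
  (forall a, inputs (varity F) (ucat (under F)) a ->
     [/\ C a <> None, osrc (C a) = amap (hop (S 0)) (ev (under F) 0 a) &
         otgt (C a) = ev (under G) 0 (fun j => amap (S j) (a j))]) ->
  (forall w, typed (varity F) (ucat (under F)) 0 w ->
     ocomp (C (fun j => otgt (w j))) (amap (hop (S 0)) (ev (under F) 0 w)) =
     ocomp (ev (under G) 0 (fun j => amap (S j) (w j))) (C (fun j => osrc (w j)))) ->
  (forall a b, inputs (varity F) (ucat (under F)) a ->
     (forall j, 0 < j -> j <= varity F -> a j = b j) -> C a = C b) ->
  exists f : cell, [/\ cell_src f = F, cell_tgt f = G,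
    forall i, i <= carity f -> side f i = S i &
    forall a, inputs (carity f) (ucat (sU f)) a -> cell_at f a = C a].
Proof.
case: F G => n A F [m B G] /= en; subst m => esS esT ct cn cext.
have hS (i : 'I_n.+1) : exists S' : functor (A i) (B i), HCell S' = S i.
  apply: hcell_recast; rewrite ?esS ?esT ?leq_ord //= /ncat inord_val //.
pose S' i := proj1_sig (constructive_indefinite_description _ (hS i)).
have eS' i : HCell (S' i) = S i.
  exact: (proj2_sig (constructive_indefinite_description _ (hS i))).
pose T1 := comp_functor (op_functor (S' ord0)) (F ord0).
pose T2 := comp_functor (G ord0) (prod_functor (fun j : but (ord0 : 'I_n.+1) => S' (val j))).
have eT1 a b (u : Hom a b) : amap (hop (S 0)) (vev F 0 (but_family u)) = Some (Arrow (fmap T1 u)).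
  rewrite -[0]/(val (ord0 : 'I_n.+1)) (ev_ord _ (but_familyE u)) -eS'.
  by rewrite /hop amapE.
have eT2 a b (u : Hom a b) : vev G 0 (fun j => amap (S j) (but_family u j)) = Some (Arrow (fmap T2 u)).
  rewrite -[0]/(val (ord0 : 'I_n.+1)); apply: ev_ord => k.
  by rewrite but_familyE -eS' amapE.
have inp (b : prod_but A ord0) : inputs n (ncat A) (but_family (idm b)).
  move=> j lt0j le_j; have [|k ->] := @but_leqP n ord0 j le_j.
    by move=> /= e0; rewrite e0 in lt0j.
  by rewrite but_familyE /= /ncat inord_val.
have hc (b : prod_but A ord0) : exists g : Hom (T1 b) (T2 b),
    C (but_family (idm b)) = Some (Arrow g).
  have [ne es et] := ct _ (inp b).
  apply: homP.
  - have : osrc (C (but_family (idm b))) = Some (Arrow (fmap T1 (idm b))) by rewrite es eT1.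
    by case: (C _) => //= h /Some_inj e; rewrite (congr1 arrow_cat e).
  - by rewrite es eT1 fmap_id.
  - by rewrite et eT2 fmap_id.
pose c b := proj1_sig (constructive_indefinite_description _ (hc b)).
have ec b : C (but_family (idm b)) = Some (Arrow (c b)).
  exact: (proj2_sig (constructive_indefinite_description _ (hc b))).
have nc (a b : prod_but A ord0) (u : Hom a b) :
    compm (c b) (fmap T1 u) = compm (fmap T2 u) (c a).
  apply: Arrow_inj; apply: Some_inj; rewrite -!ocompE -eT1 -eT2 -!ec.
  have tu : typed n (ncat A) 0 (but_family u).
    move=> j le_j ne; have [//|k ->] := @but_leqP n ord0 j le_j.
    by rewrite but_familyE /= /ncat inord_val.
  have := cn _ tu; congr (ocomp _ _ = ocomp _ _).
    by congr C; apply: functional_extensionality => j; rewrite /but_family; case: (insub _).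
  by congr C; apply: functional_extensionality => j; rewrite /but_family; case: (insub _).
pose al : square F G S' := NatTrans nc.
exists (Cell al); split=> // [i le_i|a o].
  by rewrite /side /= eS' inordK.
have [b eb] := inputsP o; rewrite (cell_atE eb) /= -ec; symmetry; apply: cext => // j lt0j le_j.
have [|k ->] := @but_leqP n ord0 j le_j; first by move=> /= e0; rewrite e0 in lt0j.
by rewrite eb but_familyE.
Qed.

Lemma ocomp_some g f : osrc g = otgt f -> f <> None -> ocomp g f <> None.
Proof.
by case/fitP => [[_ ->]|[C [x [y [z [g' [f' [-> ->]]]]]]]] //; rewrite ocompE.
Qed.

(** * Identities, composites and mates of 2-cells *)

Lemma id_cell_exists (S : hcell) : exists f : cell,
  [/\ cell_src f = vid (hcell_src S), cell_tgt f = vid (hcell_tgt S),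
      side f 0 = hop S, side f 1 = S &
      forall a, inputs 1 (ucat (sU f)) a -> cell_at f a = amap S (a 1)].
Proof.
have [_ ecs ees _] := under_realize (uid (hcell_src S)).
have [_ ect eet _] := under_realize (uid (hcell_tgt S)).
have inp a : inputs 1 (ucat (under (vid (hcell_src S)))) a ->
    ocat (a 1) = Some (hcell_src S) /\ osrc (a 1) = a 1.
  by move=> o; have [] := o 1 isT isT; rewrite [ucat _ _](ecs 1).
pose T i := if i is 0 then hop S else S.
have ev1 h w : ocat (w 1) = Some (hcell_src h) ->
    ev (under (vid (hcell_src h))) 0 w = w 1.
  by move=> e; have [_ _ -> // _] := under_realize (uid (hcell_src h)); rewrite uid_ev0.
have ev1' w : ocat (w 1) = Some (hcell_tgt S) ->
    ev (under (vid (hcell_tgt S))) 0 w = w 1.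
  by move=> e; rewrite eet // uid_ev0.
have [|i|i|a o|w t|a b o e|f [e1 e2 e3 e4]] :=
  @cell_of_components (vid (hcell_src S)) (vid (hcell_tgt S)) T (fun a => amap S (a 1)).
- by [].
- by move=> /leq1P[] ->; [rewrite (ecs 0) | rewrite (ecs 1)].
- by move=> /leq1P[] ->; [rewrite (ect 0) | rewrite (ect 1)].
- have [oc os] := inp a o; split; first by apply/amapP.
    by rewrite osrc_map os ev1 // [T 0]/= hopK.
  rewrite ev1' ?amap_some //= otgt_map; congr amap.
  by rewrite -os otgt_src.
- have e1 : ocat (w 1) = Some (hcell_src S).
    by rewrite (t 1) // [ucat _ _](ecs 1).
  rewrite ev1 // ev1' ?amap_some //= hopK -otgt_map ocomp_tgt.
  by rewrite -osrc_map ocomp_src.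
- by rewrite e.
have en : carity f = 1 by exact: (congr1 varity e1).
exists f; split=> //; rewrite ?e3 ?en // => a o.
by apply: e4; rewrite en.
Qed.

Section ComposeCells.
Variables (g : cell) (F : nat -> cell).
Local Notation k := (carity g).
Local Notation m := (fun q => carity (F q)).
Local Notation N := (off m k).
Local Notation sF := (fun q => sU (F q)).
Local Notation tF := (fun q => tU (F q)).
Hypothesis joint : forall q, q < k -> side g q.+1 = hop (side (F q) 0).

Lemma joint_src q : q < uar (sU g) -> ucat (sU g) q.+1 = op (ucat (sU (F q)) 0).
Proof. by move=> lt_q; rewrite -[LHS]/(hcell_src (side g q.+1)) joint. Qed.

Lemma joint_tgt q : q < uar (tU g) -> ucat (tU g) q.+1 = op (ucat (tU (F q)) 0).
Proof. by move=> lt_q; rewrite -[LHS]/(hcell_tgt (side g q.+1)) joint. Qed.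

Definition side_pos (p : nat) : hcell :=
  if p is 0 then side g 0 else
  let q := blk m k p in side (F q) (p - off m q).

Lemma side_posE q j : q < k -> 0 < j -> j <= m q -> side_pos (off m q + j) = side (F q) j.
Proof.
move=> lt_qk lt0j le_jm; rewrite /side_pos blkE // addKn.
by case: (off m q + j) (ltn_addl (off m q) lt0j).
Qed.

Lemma side_pos_src p : p <= N -> hcell_src (side_pos p) = cat_of (sU g) sF p.
Proof.
case: p => [//|p] le_p; have [q [j [lt_q lt0j le_j ->]]] := offP (ltn0Sn p) le_p.
by rewrite side_posE // (@cat_ofE (sU g) sF).
Qed.

Lemma side_pos_tgt p : p <= N -> hcell_tgt (side_pos p) = cat_of (tU g) tF p.
Proof.
case: p => [//|p] le_p; have [q [j [lt_q lt0j le_j ->]]] := offP (ltn0Sn p) le_p.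
by rewrite side_posE // (@cat_ofE (tU g) tF).
Qed.

Definition side_map_pos (w : nat -> parrow) (p : nat) : parrow := amap (side_pos p) (w p).

(** The components of the arguments, as a family of arrows for the outer 2-cell; the entry at the
    root is an identity. *)
Definition arg_cells (a : nat -> parrow) (s : nat) : parrow :=
  if s is q.+1 then cell_at (F q) (inner (sU g) sF a q) else amap (side g 0) (a 0).

Definition pasting_at (a : nat -> parrow) : parrow :=
  ocomp (ev (tU g) 0 (arg_cells a)) (cell_at g (outer sF a)).

Local Notation C := (cat_of (sU g) sF).

Lemma inner_inputs a q : q < k -> inputs N C a ->
  inputs (m q) (ucat (sF q)) (inner (sU g) sF a q).
Proof.
move=> lt_q o [//|j] _ le_j /=.
have := o (off m q + j.+1) _ (off_leq lt_q le_j).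
by rewrite (@cat_ofE (sU g) sF) //; apply; lia.
Qed.

Lemma outer_inputs a : inputs N C a -> inputs k (ucat (sU g)) (outer sF a).
Proof.
move=> o [//|q] _ lt_q; split.
  rewrite joint_src //; apply: (@ev_cat (sF q) 0) => // j le_j ne.
  have := o (off m q + j) _ (off_leq lt_q le_j).
  by rewrite (@cat_ofE (sU g) sF) //; [case=> //; lia | lia].
rewrite outer_src; apply: (@ev_ext (sF q) 0) => // j le_j ne.
by have [|_ e] := o (off m q + j) _ (off_leq lt_q le_j); [lia | exact: e].
Qed.

Lemma arg_cells_src a q : q < k -> inputs N C a ->
  osrc (arg_cells a q.+1) = side_map g (outer sF a) q.+1.
Proof.
move=> lt_q o; rewrite /= cell_at_src; last exact: inner_inputs.
by rewrite /side_map joint //; congr amap; apply: ev_inner0.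
Qed.

Lemma outer_side_map a q : q < k ->
  ev (tU (F q)) 0 (side_map (F q) (inner (sU g) sF a q)) = outer tF (side_map_pos a) q.+1.
Proof.
move=> lt_q; apply: ev_ext => // -[//|j] le_j _.
by rewrite /side_map /side_map_pos -(side_posE lt_q (ltn0Sn j) le_j).
Qed.

Lemma arg_cells_tgt a q : q < k -> inputs N C a ->
  otgt (arg_cells a q.+1) = outer tF (side_map_pos a) q.+1.
Proof. by move=> lt_q o; rewrite /= cell_at_tgt ?outer_side_map //; exact: inner_inputs. Qed.

Lemma arg_cells_cat a q : q < k -> inputs N C a -> ocat (arg_cells a q.+1) = Some (ucat (tU g) q.+1).
Proof. by move=> lt_q o; rewrite joint_tgt //= cell_at_ocat //; exact: inner_inputs. Qed.

Lemma ev_arg_cells_src a : inputs N C a ->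
  osrc (ev (tU g) 0 (arg_cells a)) = otgt (cell_at g (outer sF a)).
Proof.
move=> o; rewrite ev_src // cell_at_tgt; last exact: outer_inputs.
by apply: ev_ext => // -[//|q] lt_q _; apply: arg_cells_src.
Qed.

Lemma comp_cell_exists (hs ht : vcell) : ueq (under hs) (ucomp joint_src) ->
  ueq (under ht) (ucomp joint_tgt) -> exists h : cell,
  [/\ cell_src h = hs, cell_tgt h = ht, forall p, p <= N -> side h p = side_pos p &
      forall a, inputs N C a -> cell_at h a = pasting_at a].
Proof.
move=> es et; have [ens ecs ees _] := es; have [ent ect eet _] := et.
have en : varity hs = N by exact: ens.
have inpE a : inputs (varity hs) (ucat (under hs)) a <-> inputs N C a.
  rewrite en; split=> o j lt0j le_j; have := o j lt0j le_j;
    by rewrite (ecs j) // [uar _]ens.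
have [|i|i|a o|w t|a b o e|f [e1 e2 e3 e4]] := @cell_of_components hs ht side_pos pasting_at.
- by rewrite en -[varity ht]/(uar (under ht)) ent.
- by rewrite en => le_i; rewrite side_pos_src // ecs // [uar _]ens.
- by rewrite en => le_i; rewrite side_pos_tgt // ect // [uar _]ent.
- move/inpE: o => o; have og := outer_inputs o.
  have fit := ev_arg_cells_src o.
  split.
  + apply: ocomp_some => // e0; have := cell_at_ocat og; by rewrite e0.
  + rewrite /pasting_at osrc_comp // cell_at_src //; congr amap.
    by rewrite ees.
  + rewrite /pasting_at otgt_comp // ev_tgt // eet //.
    by apply: (@ev_ext (tU g) 0) => // -[//|q] lt_q _; apply: arg_cells_tgt.
- have t' p : p <= N -> p <> 0 -> ocat (w p) = Some (C p).
    by move=> le_p ne; rewrite t ?en // ecs // [uar _]ens.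
  have os : inputs N C (fun j => osrc (w j)).
    by move=> j lt0j le_j; rewrite ocat_src osrc_src t' //; lia.
  have ot : inputs N C (fun j => otgt (w j)).
    by move=> j lt0j le_j; rewrite ocat_tgt osrc_tgt t' //; lia.
  have tg : typed k (ucat (sU g)) 0 (outer sF w).
    by apply/(outer_typed joint_src) => //; split=> // q j lt_q _ lt0j le_j;
       rewrite t' ?(@cat_ofE (sU g) sF) //; [exact: off_leq | lia].
  have ti q : q < k -> typed (m q) (ucat (sF q)) 0 (inner (sU g) sF w q).
    by move=> lt_q [//|j] le_j _; rewrite /= t' ?(@cat_ofE (sU g) sF) //;
       [exact: off_leq | lia].
  rewrite /pasting_at ees // -[ev (ucomp _) 0 w]/(ev (sU g) 0 (outer sF w)) -ocompA.
  have eo : outer sF (fun j => otgt (w j)) = fun q => otgt (outer sF w q).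
    by apply: functional_extensionality => q; rewrite outer_tgt.
  have eo' : outer sF (fun j => osrc (w j)) = fun q => osrc (outer sF w q).
    by apply: functional_extensionality => q; rewrite outer_src.
  rewrite eo eo' [side_pos 0]/= cell_at_nat // !ocompA; congr ocomp.
  rewrite eet // -[ev (ucomp _) 0 _]/(ev (tU g) 0 (outer tF (side_map_pos w))).
  have ei q : q < k -> inner (sU g) sF (fun j => otgt (w j)) q = fun j => otgt (inner (sU g) sF w q j).
    by move=> lt_q; apply: functional_extensionality => j; rewrite inner_tgt.
  have ei' q : q < k -> inner (sU g) sF (fun j => osrc (w j)) q = fun j => osrc (inner (sU g) sF w q j).
    by move=> lt_q; apply: functional_extensionality => j; rewrite inner_src.
  have fitL q : q < k -> osrc (arg_cells (fun j => otgt (w j)) q.+1) = otgt (side_map g (outer sF w) q.+1).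
    by move=> lt_q; rewrite arg_cells_src // side_map_tgt eo.
  have fitR q : q < k -> osrc (outer tF (side_map_pos w) q.+1) = otgt (arg_cells (fun j => osrc (w j)) q.+1).
    move=> lt_q; rewrite arg_cells_tgt // outer_src.
    by congr (outer tF _ _); apply: functional_extensionality => j; rewrite /side_map_pos osrc_map.
  rewrite -ev_comp //; last by case=> // q lt_q _; apply: fitL.
  rewrite -ev_comp //; last by case=> // q lt_q _; apply: fitR.
  apply: ev_ext => // -[//|q] lt_q _.
  have -> : side_map g (outer sF w) q.+1 = amap (hop (side (F q) 0)) (ev (sF q) 0 (inner (sU g) sF w q)).
    by rewrite /side_map joint // ev_inner0.
  rewrite [arg_cells _ q.+1]/= ei // cell_at_nat; last exact: ti.
  by rewrite [arg_cells _ q.+1]/= ei' // outer_side_map.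
- move/inpE: o => o.
  have e' p : p <= N -> p <> 0 -> a p = b p by move=> le_p ne; apply: e; rewrite ?en //; lia.
  rewrite /pasting_at; congr ocomp.
    apply: ev_ext => // -[//|q] lt_q _ /=; apply: cell_at_ext => -[//|j] _ le_j /=.
    by apply: e'; [exact: off_leq | lia].
  apply: cell_at_ext => -[//|q] _ lt_q; apply: ev_ext => // j le_j ne.
  by apply: e'; [exact: off_leq | lia].
have enf : carity f = N by rewrite -en -e1.
exists f; split=> // [p le_p|a o]; first by apply: e3; rewrite enf.
by apply: e4; rewrite enf -en e1; apply/inpE.
Qed.

End ComposeCells.

Section RotateCell.
Variable f : cell.
Local Notation n := (carity f).
Local Notation one := (sh n 0).
Local Notation un a := (fun j => a (unsh n j)).

(** By the Yoneda lemma, the component of the mate is the value of the action at the universal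
    element at the position 1; this is the transpose of S_0(epsilon) o alpha. *)
Definition mate_at (a : nat -> parrow) : parrow :=
  let e := oop (ev (sU f) one (un a)) in oop (cell_act f one (upd (un a) one e) e).

Lemma one_leq : one <= n. Proof. exact: sh_leq. Qed.

Lemma un_inputs a : inputs n (rot_cat (sU f)) a -> forall j, j <= n -> j <> one ->
  ocat (un a j) = Some (ucat (sU f) j) /\ osrc (un a j) = un a j.
Proof.
move=> o j le_j ne.
have [|ec es] := o (unsh n j) _ (unsh_leq le_j).
  by have := unsh_neq le_j (leq0n n) ne; lia.
by rewrite ec /rot_cat unshK.
Qed.

(** For the naturality of the mate, the value of the action at F_1(u) is computed twice: from its
    value at the universal element ([cell_act_unit]), and by naturality, F_1(u) being the image of the
    universal element under u. *)
Lemma mate_cell_exists : exists h : cell,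
  [/\ cell_src h = vrot (cell_src f), cell_tgt h = vrot (cell_tgt f),
      forall i, i <= n -> side h i = side f (sh n i) &
      forall a, inputs n (rot_cat (sU f)) a -> cell_at h a = mate_at a].
Proof.
have [_ ecs ees _] := under_vrot (cell_src f).
have [_ ect eet _] := under_vrot (cell_tgt f).
have inpE a : inputs n (ucat (under (vrot (cell_src f)))) a <-> inputs n (rot_cat (sU f)) a.
  by split=> o j lt0j le_j; have := o j lt0j le_j; rewrite (ecs j).
have l1 := one_leq.
have [|i|i|a o|w t|a b o e|h [e1 e2 e3 e4]] :=
  @cell_of_components (vrot (cell_src f)) (vrot (cell_tgt f)) (fun i => side f (sh n i)) mate_at.
- by [].
- by move=> le_i; rewrite ecs.
- by move=> le_i; rewrite ect.
- move/inpE: o => o; have o' := un_inputs o.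
  have l : elt (sU f) _ one _ := @unit_element (sU f) (un a) one l1 o'.
  have [oz esz etz] := cell_act_elt l1 l.
  split.
  + move=> e0; have [_ _ et] := cell_act_elt l1 l.
    have [ec _] := oz one l1; move: et; rewrite -[cell_act _ _ _ _]oopK.
    by rewrite -/(mate_at a) e0 /= => et; rewrite -et in ec.
  + by rewrite /mate_at osrc_op etz /side_map /upd eqxx amap_hop ees.
  rewrite /mate_at otgt_op esz oopK eet //.
  apply: (@ev_ext (tU f) one) => // j le_j ne; rewrite /side_map /upd; case: eqP => // _.
  by rewrite unshK.
- have t' j : j <= n -> j <> one -> ocat (un w j) = Some (ucat (sU f) j).
    move=> le_j ne; rewrite t ?unsh_leq //; last exact: unsh_neq.
    by rewrite ecs ?unsh_leq //= /rot_cat unshK.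
  pose b := fun j => otgt (un w j); pose c := fun j => osrc (un w j).
  have ob j : j <= n -> j <> one -> ocat (b j) = Some (ucat (sU f) j) /\ osrc (b j) = b j.
    by move=> le_j ne; rewrite /b ocat_tgt osrc_tgt t'.
  have oc j : j <= n -> j <> one -> ocat (c j) = Some (ucat (sU f) j) /\ osrc (c j) = c j.
    by move=> le_j ne; rewrite /c ocat_src osrc_src t'.
  pose eb := oop (ev (sU f) one b); pose ec := oop (ev (sU f) one c).
  pose x := oop (ev (sU f) one (un w)).
  have lb : elt (sU f) (upd b one eb) one eb := @unit_element (sU f) b one l1 ob.
  have lc : elt (sU f) (upd c one ec) one ec := @unit_element (sU f) c one l1 oc.
  have tw : typed n (ucat (sU f)) one (un w) := t'.
  have es_x : osrc x = eb by rewrite /x osrc_op ev_tgt.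
  have et_x : otgt x = ec by rewrite /x otgt_op ev_src.
  have [oc2 esc etc] := lc; have [ob2 esb etb] := lb.
  have lx : elt (sU f) (upd b one ec) one x.
    split.
    - move=> j le_j; rewrite /upd; case: eqP => [->|ne]; last exact: ob.
      by have := oc2 one l1; rewrite /upd eqxx.
    - by rewrite es_x upd_ev.
    - by rewrite et_x /upd eqxx.
  (* the Yoneda lemma for x, which is F_1(w) reversed *)
  have h1 : cell_act f one (upd b one ec) x =
      ocomp (amap (side f one) x) (cell_act f one (upd b one eb) eb).
    rewrite cell_act_unit // upd_ev //; congr ocomp; apply: cell_act_ext => // j le_j.
    by rewrite /upd; case: eqP.
  pose u := upd (un w) one ec.
  have tu j : j <= n -> ocat (u j) = Some (ucat (sU f) j).
    move=> le_j; rewrite /u /upd; case: eqP => [->|ne]; last exact: t'.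
    by have [] := oc2 one l1; rewrite /upd eqxx.
  have srcec : osrc ec = ec by have [_] := oc2 one l1; rewrite /upd eqxx.
  have tgtec : otgt ec = ec by rewrite -srcec otgt_src.
  have eus j : osrc (u j) = upd c one ec j by rewrite /u /upd; case: eqP.
  have eut j : otgt (u j) = upd b one ec j by rewrite /u /upd; case: eqP.
  have lus : elt (sU f) (fun j => osrc (u j)) one ec.
    by apply: elt_ext lc => // j le_j.
  (* [u] is [w] with an identity at the position 1, and carries the universal element to x *)
  have h2 := cell_act_nat l1 tu lus.
  have ex : act (ev (sU f)) u one ec = x.
    rewrite /act {1}/u /upd eqxx upd_ev // -/x -et_x.
    by rewrite ocomp_tgt -[in RHS](ocomp_tgt x) et_x.
  rewrite ex in h2.
  have [o3 es3 et3] := cell_act_elt l1 lc.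
  have h3 : cell_act f one (upd b one ec) x =
      ocomp (cell_act f one (upd c one ec) ec) (oop (ev (tU f) one (side_map f (un w)))).
    rewrite -(cell_act_ext (a := fun j => otgt (u j))) // h2 /act.
    rewrite (cell_act_ext (b := upd c one ec)) // /side_map {1}/u {1}/upd eqxx.
    rewrite ocompA; congr ocomp; last first.
      congr oop; apply: ev_ext => // j le_j ne; rewrite /u /upd; case: eqP => //.
    have -> : amap (side f one) ec = otgt (cell_act f one (upd c one ec) ec).
      by rewrite et3 /side_map /upd eqxx.
    by rewrite ocomp_tgt.
  have eeS : ev (under (vrot (cell_src f))) 0 w = ev (sU f) one (un w) by rewrite ees.
  have eeT : ev (under (vrot (cell_tgt f))) 0 (fun j => amap (side f (sh n j)) (w j)) =
      ev (tU f) one (side_map f (un w)).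
    rewrite eet //; apply: (@ev_ext (tU f) one) => // j le_j _.
    by rewrite /side_map unshK.
  rewrite eeS eeT; apply: (inv_inj oopK); rewrite !oop_comp !oopK amap_hop !oopK.
  by rewrite -h1 h3.
- have e' j : j <= n -> j <> one -> un a j = un b j.
    move=> le_j ne; apply: e; last exact: unsh_leq.
    by have := unsh_neq le_j (leq0n n) ne; lia.
  have ev_e : ev (sU f) one (un a) = ev (sU f) one (un b) by apply: ev_ext.
  rewrite /mate_at ev_e; congr oop; apply: cell_act_ext => // j le_j.
  by rewrite /upd; case: eqP => // ne; apply: e'.
have en : carity h = n by exact: (congr1 varity e1).
exists h; split=> // [i le_i|a o]; first by apply: e3; rewrite en.
by apply: e4; rewrite en e1; apply/inpE.
Qed.

End RotateCell.

Lemma hcomp_cell_exists (f g : cell) (S : nat -> hcell) : cell_tgt f = cell_src g ->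
  (forall i, i <= carity f -> [/\ hcell_src (S i) = hcell_src (side f i),
     hcell_tgt (S i) = hcell_tgt (side g i) &
     forall x, amap (S i) x = amap (side g i) (amap (side f i) x)]) ->
  exists h : cell,
  [/\ cell_src h = cell_src f, cell_tgt h = cell_tgt g,
      forall i, i <= carity f -> side h i = S i &
      forall a, inputs (carity f) (ucat (sU f)) a ->
        cell_at h a = ocomp (cell_at g (side_map f a)) (amap (hop (side g 0)) (cell_at f a))].
Proof.
move=> e eS; have en : carity g = carity f by exact: esym (congr1 varity e).
pose C a := ocomp (cell_at g (side_map f a)) (amap (hop (side g 0)) (cell_at f a)).
have inp a : inputs (carity f) (ucat (sU f)) a -> inputs (carity g) (ucat (sU g)) (side_map f a).
  by move=> o; rewrite en -e; exact: side_map_inputs.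
have hopS x : amap (hop (S 0)) x = amap (hop (side g 0)) (amap (hop (side f 0)) x).
  by have [_ _ e0] := eS 0 isT; rewrite !amap_hop e0 oopK.
have fit a : inputs (carity f) (ucat (sU f)) a ->
    osrc (cell_at g (side_map f a)) = otgt (amap (hop (side g 0)) (cell_at f a)).
  by move=> o; rewrite cell_at_src; [rewrite otgt_map cell_at_tgt // e | exact: inp].
have [|i|i|a o|w t|a b o eab|h [e1 e2 e3 e4]] := @cell_of_components (cell_src f) (cell_tgt g) S C.
- by rewrite -[varity (cell_tgt g)]/(carity g) en.
- by move=> le_i; have [-> _ _] := eS i le_i.
- by move=> le_i; have [_ -> _] := eS i le_i.
- have f1 := fit a o; split.
  + apply: ocomp_some => //; apply/amapP; rewrite cell_at_ocat //= .
    by rewrite -[csrc_cat g _]/(ucat (sU g) 0) -e.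
  + by rewrite /C osrc_comp // osrc_map cell_at_src // hopS.
  rewrite /C otgt_comp // cell_at_tgt; last exact: inp.
  apply: ev_ext => // j; rewrite [uar _]en => le_j _.
  by have [_ _ ->] := eS j le_j.
- have os : inputs (carity f) (ucat (sU f)) (fun j => osrc (w j)).
    by move=> j lt0j le_j; rewrite ocat_src osrc_src t //; lia.
  have ot : inputs (carity f) (ucat (sU f)) (fun j => otgt (w j)).
    by move=> j lt0j le_j; rewrite ocat_tgt osrc_tgt t //; lia.
  have tg : typed (carity g) (ucat (sU g)) 0 (side_map f w) by rewrite en -e; exact: side_map_typed.
  have st : side_map f (fun j => otgt (w j)) = fun j => otgt (side_map f w j).
    by apply: functional_extensionality => j; rewrite side_map_tgt.
  have ss : side_map f (fun j => osrc (w j)) = fun j => osrc (side_map f w j).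
    by apply: functional_extensionality => j; rewrite side_map_src.
  rewrite /C hopS -ocompA -amap_comp; last first.
    by rewrite cell_at_src // otgt_map; congr amap; rewrite ev_tgt.
  rewrite cell_at_nat // amap_comp; last first.
    by rewrite cell_at_tgt // ev_src //; congr ev; rewrite ss.
  rewrite !ocompA st e cell_at_nat // ss; congr ocomp; congr ocomp.
  apply: ev_ext => // j; rewrite [uar _]en => le_j _.
  by have [_ _ ->] := eS j le_j.
- rewrite /C (@cell_at_ext f a b) // (@cell_at_ext g (side_map f a) (side_map f b)) //.
  by move=> j lt0j; rewrite en => le_j; rewrite /side_map eab.
have enf : carity h = carity f by exact: (congr1 varity e1).
exists h; split=> // [i le_i|a o]; first by apply: e3; rewrite enf.
by apply: e4; rewrite enf e1.
Qed.

(** * The multicategory of 2-cells *)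

Notation sV F := (fun q => sU (F q)).
Notation tV F := (fun q => tU (F q)).
Notation arities F := (fun q => carity (F q)).

(** A characterization of composites that makes sense for any family of arguments, the arguments
    at 0, ..., [carity g - 1] being those that enter ([is_ccomp_congr]). *)
Record is_ccomp (g : cell) (F : nat -> cell) (h : cell) : Prop := IsCcomp {
  ic_joint : forall q, q < carity g -> side g q.+1 = hop (side (F q) 0);
  ic_src : ueq (sU h) (ucomp (joint_src ic_joint));
  ic_tgt : ueq (tU h) (ucomp (joint_tgt ic_joint));
  ic_side : forall p, p <= off (arities F) (carity g) -> side h p = side_pos g F p;
  ic_at : forall a, inputs (off (arities F) (carity g)) (cat_of (sU g) (sV F)) a ->
    cell_at h a = pasting_at g F a }.

Section IsCcomp.
Variables (g : cell) (F : nat -> cell) (h : cell).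
Hypothesis ic : is_ccomp g F h.
Local Notation k := (carity g).
Local Notation m := (arities F).
Local Notation N := (off m k).

Lemma ic_arity : carity h = N.
Proof. by have [en _ _ _] := ic_src ic; exact: en. Qed.

Lemma ic_cat p : p <= N -> ucat (sU h) p = cat_of (sU g) (sV F) p.
Proof.
by move=> le_p; have [en ec _ _] := ic_src ic; rewrite ec // [uar _]ic_arity.
Qed.

Lemma ic_inputs a : inputs (carity h) (ucat (sU h)) a <->
  inputs N (cat_of (sU g) (sV F)) a.
Proof.
rewrite ic_arity; split=> o j lt0j le_j; have := o j lt0j le_j; by rewrite ic_cat.
Qed.

Lemma ic_side_map a p : p <= N -> side_map h a p = side_map_pos g F a p.
Proof. by move=> le_p; rewrite /side_map (ic_side ic). Qed.

End IsCcomp.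

Lemma is_ccomp_congr g F F' h : (forall q, q < carity g -> F q = F' q) ->
  is_ccomp g F h -> is_ccomp g F' h.
Proof.
move=> e ic.
have j' q : q < carity g -> side g q.+1 = hop (side (F' q) 0).
  by move=> lt_q; rewrite -e //; apply: (ic_joint ic).
have em q : q <= carity g -> off (arities F) q = off (arities F') q.
  by move=> le_q; apply: off_le_eq le_q _ => r lt_r; rewrite e.
have eo a q : q <= carity g -> outer (sV F) a q = outer (sV F') a q.
  by case: q => //= q lt_q; rewrite -(em q (ltnW lt_q)) e.
have ei a q j : q < carity g -> inner (sU g) (sV F) a q j = inner (sU g) (sV F') a q j.
  move=> lt_q; case: j => [|j] /=; last by rewrite (em q (ltnW lt_q)).
  by apply: (@ev_ext (sU g)) => // r le_r _; apply: eo.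
have u : ueq (ucomp (joint_src (ic_joint ic))) (ucomp (joint_src j')).
  by apply: ucomp_ueq => // q lt_q; rewrite e //; exact: ueq_refl.
exists j' => //.
- exact: ueq_trans (ic_src ic) u.
- apply: ueq_trans (ic_tgt ic) _.
  by apply: ucomp_ueq => // q lt_q; rewrite e //; exact: ueq_refl.
- move=> p; rewrite -em // => le_p; rewrite (ic_side ic) //.
  case: p le_p => // p le_p; have [q [j [lt_q lt0j le_j ->]]] := offP (ltn0Sn p) le_p.
  rewrite side_posE // em ?(ltnW lt_q) // side_posE ?e // -?e //.
move=> a o; have o' : inputs (off (arities F) (carity g)) (cat_of (sU g) (sV F)) a.
  have [en ec _ _] := u; rewrite em // => i lt0i le_i.
  have := o i lt0i le_i; rewrite -[cat_of _ (sV F') i]/(ucat (ucomp (joint_src j')) i).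
  by rewrite -ec // [uar _]/= em.
rewrite (ic_at ic) // /pasting_at; congr ocomp.
  apply: ev_ext => // -[//|q] lt_q _ /=; rewrite -e //; apply: cell_at_ext => i _ _; exact: ei.
by apply: cell_at_ext => q _ le_q; apply: eo.
Qed.

Lemma dom_cell (f : cell) : @dom cell_graph f = mkseq (fun j => side f j.+1) (carity f).
Proof.
rewrite /= /mkseq -val_enum_ord -map_comp; apply: eq_map => j /=.
by have := side_ord (lift ord0 j) => <-; rewrite /= /bump /= add1n.
Qed.

Lemma cod_cell (f : cell) : @cod cell_graph f = hop (side f 0).
Proof. by rewrite side0. Qed.

Lemma side_dom (f g : cell) : @dom cell_graph f = @dom cell_graph g ->
  @cod cell_graph f = @cod cell_graph g ->
  carity f = carity g /\ forall i, i <= carity f -> side f i = side g i.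
Proof.
rewrite !dom_cell !cod_cell => ed ec.
have en : carity f = carity g by have := congr1 size ed; rewrite !size_mkseq.
split=> // -[_|i lt_i]; first by apply: (inv_inj hopK).
have := congr1 (fun s => nth (side f 0) s i) ed; rewrite !nth_mkseq // -?en //.
Qed.

Lemma cell_ext_dom (f g : cell) : cell_src f = cell_src g -> cell_tgt f = cell_tgt g ->
  @dom cell_graph f = @dom cell_graph g -> @cod cell_graph f = @cod cell_graph g ->
  (forall a, inputs (carity f) (ucat (sU f)) a -> cell_at f a = cell_at g a) -> f = g.
Proof. by move=> es et ed ec; apply: cell_ext => //; case: (side_dom ed ec). Qed.

Lemma dom_src (f : cell) : @dom madj_graph (cell_src f) = map hcell_src (@dom cell_graph f).
Proof. by rewrite /= -map_comp. Qed.
Lemma dom_tgt (f : cell) : @dom madj_graph (cell_tgt f) = map hcell_tgt (@dom cell_graph f).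
Proof. by rewrite /= -map_comp. Qed.

Lemma composable_src g fs : @composable cell_graph g fs ->
  @composable madj_graph (cell_src g) (map cell_src fs).
Proof. by move=> p; rewrite /composable dom_src -p -!map_comp. Qed.

Lemma composable_tgt g fs : @composable cell_graph g fs ->
  @composable madj_graph (cell_tgt g) (map cell_tgt fs).
Proof. by move=> p; rewrite /composable dom_tgt -p -!map_comp. Qed.

Lemma ccomposable_size g fs : @composable cell_graph g fs -> size fs = carity g.
Proof. by move=> p; have := congr1 size p; rewrite dom_cell size_mkseq size_map. Qed.

Lemma composable_side g fs d : @composable cell_graph g fs ->
  forall q, q < carity g -> side g q.+1 = hop (side (nth d fs q) 0).
Proof.
move=> p q lt_q; have := congr1 (fun s => nth (@cod cell_graph d) s q) p.
rewrite dom_cell nth_mkseq // -cod_cell => <-.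
by rewrite (nth_map d) ?(ccomposable_size p).
Qed.

Lemma ccomp_ex g fs (p : @composable cell_graph g fs) : exists h : cell,
  [/\ cell_src h = vcomp (composable_src p), cell_tgt h = vcomp (composable_tgt p) &
      is_ccomp g (fun q => nth g fs q) h].
Proof.
have j := composable_side g p.
have us : ueq (under (vcomp (composable_src p))) (ucomp (joint_src j)).
  apply: (@vcomp_ueq _ _ _ (cell_src g)); first exact: ueq_refl.
  move=> q lt_q; rewrite (nth_map g) ?(ccomposable_size p) //; exact: ueq_refl.
have ut : ueq (under (vcomp (composable_tgt p))) (ucomp (joint_tgt j)).
  apply: (@vcomp_ueq _ _ _ (cell_tgt g)); first exact: ueq_refl.
  move=> q lt_q; rewrite (nth_map g) ?(ccomposable_size p) //; exact: ueq_refl.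
have [h [e1 e2 e3 e4]] := comp_cell_exists us ut.
by exists h; split=> //; exists j => //; rewrite ?e1 ?e2.
Qed.

Definition ccomp g fs (p : @composable cell_graph g fs) : cell :=
  proj1_sig (constructive_indefinite_description _ (ccomp_ex p)).

Lemma ccompP g fs (p : @composable cell_graph g fs) :
  [/\ cell_src (ccomp p) = vcomp (composable_src p),
      cell_tgt (ccomp p) = vcomp (composable_tgt p) &
      is_ccomp g (fun q => nth g fs q) (ccomp p)].
Proof. exact: (proj2_sig (constructive_indefinite_description _ (ccomp_ex p))). Qed.

Lemma ccomp_is g fs (p : @composable cell_graph g fs) d :
  is_ccomp g (fun q => nth d fs q) (ccomp p).
Proof.
have [_ _ ic] := ccompP p; apply: is_ccomp_congr ic => q lt_q.
by apply: set_nth_default; rewrite (ccomposable_size p).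
Qed.

Lemma dom_ccomp g fs (p : @composable cell_graph g fs) :
  @dom cell_graph (ccomp p) = flatten [seq dom f | f <- fs].
Proof.
have ic := ccomp_is p g; rewrite dom_cell (ic_arity ic) mkseq_off.
congr flatten; rewrite -[RHS](mkseq_nth [::]) size_map (ccomposable_size p).
apply/eq_in_map => q; rewrite mem_iota => /andP[_ lt_q].
rewrite (nth_map g) ?(ccomposable_size p) // dom_cell.
apply/eq_in_map => j; rewrite mem_iota => /andP[_ lt_j].
by rewrite -addnS (ic_side ic) ?side_posE //; apply: off_leq.
Qed.

Lemma cod_ccomp g fs (p : @composable cell_graph g fs) :
  @cod cell_graph (ccomp p) = @cod cell_graph g.
Proof. by rewrite !cod_cell (ic_side (ccomp_is p g)). Qed.

Definition cid (S : hcell) : cell :=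
  proj1_sig (constructive_indefinite_description _ (id_cell_exists S)).

Lemma cidP (S : hcell) :
  [/\ cell_src (cid S) = vid (hcell_src S), cell_tgt (cid S) = vid (hcell_tgt S),
      side (cid S) 0 = hop S, side (cid S) 1 = S &
      forall a, inputs 1 (ucat (sU (cid S))) a -> cell_at (cid S) a = amap S (a 1)].
Proof. exact: (proj2_sig (constructive_indefinite_description _ (id_cell_exists S))). Qed.

Lemma cid_arity S : carity (cid S) = 1.
Proof. by have [e _ _ _ _] := cidP S; exact: (congr1 varity e). Qed.

Lemma cid_src S : ueq (sU (cid S)) (uid (hcell_src S)).
Proof. by have [-> _ _ _ _] := cidP S; exact: under_realize. Qed.
Lemma cid_tgt S : ueq (tU (cid S)) (uid (hcell_tgt S)).
Proof. by have [_ -> _ _ _] := cidP S; exact: under_realize. Qed.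

Lemma cell_at_cid S a : ocat (a 1) = Some (hcell_src S) -> osrc (a 1) = a 1 ->
  cell_at (cid S) a = amap S (a 1).
Proof.
move=> ec es; have [_ _ _ _ e] := cidP S; apply: e => j lt0j le_j.
have -> : j = 1 by lia.
have [_ e1 _ _] := cid_src S; rewrite e1 ?ec //.
by rewrite [uar _]cid_arity.
Qed.

Lemma dom_cid S : @dom cell_graph (cid S) = [:: S].
Proof. by rewrite dom_cell cid_arity /mkseq /=; have [_ _ _ -> _] := cidP S. Qed.

Lemma cod_cid S : @cod cell_graph (cid S) = S.
Proof. by rewrite cod_cell; have [_ _ -> _ _] := cidP S; rewrite hopK. Qed.

Lemma vcomp_congr2 g g' fs fs' (p : @composable madj_graph g fs)
    (p' : @composable madj_graph g' fs') : g = g' -> fs = fs' -> vcomp p = vcomp p'.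
Proof. exact: (@mcomp_congr madj_graph madj_multi). Qed.

Lemma ccomp_idl f (p : @composable cell_graph (cid (@cod cell_graph f)) [:: f]) : ccomp p = f.
Proof.
have [es et _] := ccompP p; have ic := ccomp_is p f.
move: (cod_cell f) (cidP (@cod cell_graph f)) (cell_at_cid (S := @cod cell_graph f)) (cid_tgt (@cod cell_graph f)).
have edom := dom_ccomp p; have ecod := cod_ccomp p; rewrite cod_cid in ecod.
move: p es et ic edom ecod; set S := cod _ => p es et ic edom ecod eS [cs ct _ _ _] ccm_S ueqT.
apply: cell_ext_dom => //.
- have p1 : @composable madj_graph (vid (hcell_src S)) [:: cell_src f].
    by rewrite -cs; exact: composable_src p.
  rewrite es (vcomp_congr2 _ p1 cs erefl).
  exact: (@mcomp_idl' madj_graph madj_multi (hcell_src S) (cell_src f) _ p1 erefl erefl).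
- have p1 : @composable madj_graph (vid (hcell_tgt S)) [:: cell_tgt f].
    by rewrite -ct; exact: composable_tgt p.
  rewrite et (vcomp_congr2 _ p1 ct erefl).
  exact: (@mcomp_idl' madj_graph madj_multi (hcell_tgt S) (cell_tgt f) _ p1 erefl erefl).
- by rewrite edom /= cats0.
move=> a o; have o' := proj1 (ic_inputs ic a) o.
have en : carity (cid S) = 1 := cid_arity S.
have lt01 : 0 < carity (cid S) by rewrite en.
have of_ : inputs (carity f) (ucat (sU f)) a.
  have h := @inner_inputs (cid S) (fun q => nth f [:: f] q) a 0 lt01 o'.
  by case=> // j; exact: (h j.+1).
rewrite (ic_at ic) // /pasting_at.
have [_ _ eeT _] := ueqT.
have eo : outer (sV (fun q => nth f [:: f] q)) a 1 = ev (sU f) 0 a by [].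
have ek : arg_cells (cid S) (fun q => nth f [:: f] q) a 1 = cell_at f a.
  by apply: cell_at_ext => -[].
have ocS : ocat (cell_at f a) = Some (hcell_tgt S) by rewrite cell_at_ocat // eS.
rewrite eeT // uid_ev0 ek // ccm_S eo; last 2 first.
- by rewrite ev_cat ?eS //; exact: inputs_typed.
- rewrite ev_src //; apply: ev_ext => // j le_j ne; case: (of_ j) => //; lia.
by rewrite eS -cell_at_src // ocomp_src.
Qed.

Lemma ccomp_idr f (p : @composable cell_graph f [seq cid x | x <- @dom cell_graph f]) :
  ccomp p = f.
Proof.
have [es et _] := ccompP p; have ic := ccomp_is p f.
have edom := dom_ccomp p; have ecod := cod_ccomp p.
have esz : size (@dom cell_graph f) = carity f by rewrite dom_cell size_mkseq.
have eF q : q < carity f -> nth f [seq cid x | x <- @dom cell_graph f] q = cid (side f q.+1).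
  by move=> lt_q; rewrite (nth_map (side f 0)) ?esz // dom_cell nth_mkseq.
apply: cell_ext_dom => //.
- rewrite es; apply: (@mcomp_idr' madj_graph madj_multi).
  by rewrite dom_src; elim: (@dom cell_graph f) => // S l IH; have [e _ _ _ _] := cidP S;
    rewrite !map_cons IH e.
- rewrite et; apply: (@mcomp_idr' madj_graph madj_multi).
  by rewrite dom_tgt; elim: (@dom cell_graph f) => // S l IH; have [_ e _ _ _] := cidP S;
    rewrite !map_cons IH e.
- rewrite edom; elim: (@dom cell_graph f) => // S l IH.
  rewrite -[LHS]/(@dom cell_graph (cid S) ++ flatten [seq @dom cell_graph f | f <- [seq cid x | x <- l]]).
  by rewrite IH dom_cid.
move=> a o; have o' := proj1 (ic_inputs ic a) o.
set F := (fun q => nth f _ q) in ic o'.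
have m1 q : q < carity f -> carity (F q) = 1 by move=> lt_q; rewrite /F eF // cid_arity.
have eo q : q <= carity f -> off (arities F) q = q.
  by move=> le_q; apply: off_ones m1 _ le_q.
have eN : carity (ccomp p) = carity f by rewrite (ic_arity ic) eo.
have oa q : q < carity f -> ocat (a q.+1) = Some (ucat (sU f) q.+1) /\ osrc (a q.+1) = a q.+1.
  move=> lt_q; have le1 : 1 <= carity (F q) by rewrite m1.
  have := o' (off (arities F) q + 1) _ (off_leq lt_q le1).
  rewrite (@cat_ofE (sU f) (sV F)) // eo ?(ltnW lt_q) // addn1.
  have -> : ucat (sU (F q)) 1 = ucat (sU f) q.+1.
    rewrite /F eF //; have [_ e1 _ _] := cid_src (side f q.+1).
    by rewrite e1 // [uar _]cid_arity.
  by apply; lia.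
have of_ : inputs (carity f) (ucat (sU f)) a by case=> // q _; exact: oa.
have eoa q : q < carity f -> outer (sV F) a q.+1 = a q.+1.
  move=> lt_q; have [ec _] := oa q lt_q; rewrite /= /F eF //.
  have [_ _ e1 _] := cid_src (side f q.+1).
  rewrite -[LHS]/(ev (sU (cid (side f q.+1))) 0 (fun j => a (off (arities F) q + j))) e1 //.
  by rewrite uid_ev0 eo ?addn1 // ltnW.
have ek q : q < carity f -> arg_cells f F a q.+1 = side_map f a q.+1.
  move=> lt_q; have [ec eis] := oa q lt_q.
  have e1 : inner (sU f) (sV F) a q 1 = a q.+1 by rewrite /= eo ?addn1 // ltnW.
  by rewrite /arg_cells {1}/F eF // cell_at_cid e1.
rewrite (ic_at ic) // /pasting_at (cell_at_ext (b := a)); last by case=> // q _; exact: eoa.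
have -> : ev (tU f) 0 (arg_cells f F a) = ev (tU f) 0 (side_map f a).
  by apply: ev_ext => // -[//|q] lt_q _; exact: ek.
by rewrite -cell_at_tgt // ocomp_tgt.
Qed.

Section AssocCells.
Variables (g P : cell) (T Cc Ff : nat -> cell) (H : nat -> nat -> cell).
Local Notation k := (carity g).
Local Notation m := (arities T).
Hypothesis icP : is_ccomp g T P.
Hypothesis icC : forall q, q < k -> is_ccomp (T q) (H q) (Cc q).
Hypothesis eFf : forall q l, q < k -> l < m q -> Ff (off m q + l) = H q l.
Local Notation M := (arities Ff).
Local Notation mm q := (arities (H q)).
Local Notation mC := (arities Cc).

Lemma mCE q : q < k -> mC q = off (mm q) (m q).
Proof. by move=> lt_q; exact: ic_arity (icC lt_q). Qed.

Lemma coff_flat q l : q < k -> l <= m q ->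
  off M (off m q + l) = off mC q + off (mm q) l.
Proof.
elim: q l => [|q IHq] l lt_q.
  elim: l => [//|l IHl] lt_l; rewrite addnS /= IHl ?(ltnW lt_l) //.
  by rewrite [Ff l](eFf lt_q lt_l) addnA.
elim: l => [|l IHl] lt_l; last first.
  by rewrite addnS [in LHS]/= IHl ?(ltnW lt_l) // [Ff _](eFf lt_q lt_l) -addnA.
rewrite addn0 addn0 [in LHS]/= IHq ?(ltnW lt_q) // [RHS]/= mCE ?(ltnW lt_q) //.
Qed.

Lemma couter_flat w q l : q < k -> l < m q ->
  outer (sV Ff) w (off m q + l).+1 =
  ev (sU (H q l)) 0 (fun j => w (off mC q + (off (mm q) l + j))).
Proof.
move=> lt_q lt_l; rewrite -[LHS]/(ev (sU (Ff (off m q + l))) 0 _) eFf //.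
apply: (@ev_ext (sU (H q l)) 0) => // j le_j _.
by rewrite coff_flat ?(ltnW lt_l) // addnA.
Qed.

Lemma couter_outer w q : q <= k ->
  outer (sV T) (outer (sV Ff) w) q = outer (sV Cc) w q.
Proof.
case: q => [//|q] lt_q; have [_ _ ee _] := ic_src (icC lt_q).
rewrite -[RHS]/(ev (sU (Cc q)) 0 _) ee //; apply: (@ev_ext (sU (T q)) 0) => // -[//|l] lt_l _.
by rewrite addnS couter_flat.
Qed.

Lemma cinner_outer w q l : q < k -> l < m q ->
  inner (sU g) (sV T) (outer (sV Ff) w) q l.+1 =
  outer (sV (H q)) (inner (sU g) (sV Cc) w q) l.+1.
Proof.
move=> lt_q lt_l; rewrite -[LHS]/(outer (sV Ff) w (off m q + l.+1)) addnS couter_flat //.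
by apply: (@ev_ext (sU (H q l)) 0) => // -[|j] //= _ _; rewrite addnS.
Qed.

(** The functor of the target of [g] at its root preserves composition, which splits off the
    components of the innermost 2-cells from the pastings inside its arguments. *)
Lemma pasting_assoc a : inputs (off (mC) k) (cat_of (sU g) (sV Cc)) a ->
  inputs (off M (carity P)) (cat_of (sU P) (sV Ff)) a ->
  (forall q, q < carity P -> side P q.+1 = hop (side (Ff q) 0)) ->
  (forall q, q < k -> side g q.+1 = hop (side (Cc q) 0)) ->
  pasting_at P Ff a = pasting_at g Cc a.
Proof.
move=> oR oL jP jC.
have oP := outer_inputs jP oL.
have og := proj1 (ic_inputs icP _) oP.
set b := outer (sV Ff) a in oP og *.
rewrite {1}/pasting_at -/b (ic_at icP) // /pasting_at.
have [_ _ eeP _] := ic_tgt icP.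
rewrite eeP // -[ev (ucomp _) 0 _]/(ev (tU g) 0 (outer (tV T) (arg_cells P Ff a))) ocompA.
rewrite (cell_at_ext (f := g) (b := outer (sV Cc) a)); last by move=> q _; exact: couter_outer.
congr ocomp; rewrite -ev_comp //.
  apply: ev_ext => // -[//|q] lt_q _; symmetry.
  have oq := inner_inputs lt_q oR.
  have oq' := proj1 (ic_inputs (icC lt_q) _) oq.
  rewrite [LHS]/= (ic_at (icC lt_q)) // /pasting_at; congr ocomp; last first.
    by apply: cell_at_ext => -[//|l] _ lt_l; rewrite cinner_outer.
  apply: (@ev_ext (tU (T q))) => // -[//|l] lt_l _.
  rewrite addnS [LHS]/= [RHS]/= eFf //.
  apply: cell_at_ext => -[//|j] _ le_j /=.
  by rewrite [off (mm q) l + _]addnS /= coff_flat ?(ltnW lt_l) // -addnA [off (mm q) l + _.+1]addnS.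
case=> [//|q] lt_q _; rewrite arg_cells_tgt // outer_src.
apply: (@ev_ext (tU (T q))) => // -[//|l] lt_l _.
have lt_P : off m q + l < carity P by rewrite (ic_arity icP) -addnS; exact: off_leq.
by rewrite addnS (arg_cells_src jP) // (ic_side_map icP) // -addnS; exact: off_leq.
Qed.

End AssocCells.

Lemma block_src (b : block cell_graph) :
  @composable madj_graph (cell_src (btop b)) (map cell_src (bargs b)).
Proof. exact: composable_src (bcomp b). Qed.
Lemma block_tgt (b : block cell_graph) :
  @composable madj_graph (cell_tgt (btop b)) (map cell_tgt (bargs b)).
Proof. exact: composable_tgt (bcomp b). Qed.

Lemma ccomp_assoc (g : cell) (bs : seq (block cell_graph))
    (p : @composable cell_graph g [seq btop b | b <- bs])
    (q : @composable cell_graph (ccomp p) (flatten [seq bargs b | b <- bs]))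
    (r : @composable cell_graph g [seq ccomp (bcomp b) | b <- bs]) :
  ccomp q = ccomp r.
Proof.
have [esp etp _] := ccompP p; have [esq etq _] := ccompP q; have [esr etr _] := ccompP r.
pose d := cid (@cod cell_graph g).
have icp := ccomp_is p d; have icq := ccomp_is q d; have icr := ccomp_is r d.
pose T i := nth d [seq btop b | b <- bs] i.
pose H i l := nth d (nth [::] [seq bargs b | b <- bs] i) l.
have szb : size bs = carity g by have := ccomposable_size p; rewrite size_map.
have blockP i : i < size bs -> exists b : block cell_graph,
    nth d [seq btop b | b <- bs] i = btop b /\
    nth [::] [seq bargs b | b <- bs] i = bargs b /\
    nth d [seq ccomp (bcomp b) | b <- bs] i = ccomp (bcomp b).
  case: (bs) => // b bs' lt_i; exists (nth b (b :: bs') i).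
  by rewrite !(nth_map b).
have eNN : cell_src (ccomp q) = cell_src (ccomp r).
  rewrite esq esr.
  apply: (@mcomp_assoc' madj_graph madj_multi (cell_src g)
    (map (fun b => Block (block_src b)) bs) _ _ _ _ (composable_src p)) => //.
  + by rewrite -!map_comp.
  + by rewrite map_flatten -!map_comp.
  + rewrite -!map_comp; apply: eq_map => b /=; have [-> _ _] := ccompP (bcomp b).
    exact: vcomp_congr2.
apply: cell_ext_dom.
- exact: eNN.
- rewrite etq etr.
  apply: (@mcomp_assoc' madj_graph madj_multi (cell_tgt g)
    (map (fun b => Block (block_tgt b)) bs) _ _ _ _ (composable_tgt p)) => //.
  + by rewrite -!map_comp.
  + by rewrite map_flatten -!map_comp.
  + rewrite -!map_comp; apply: eq_map => b /=; have [_ -> _] := ccompP (bcomp b).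
    exact: vcomp_congr2.
- rewrite !dom_ccomp; elim: (bs) => // b bs' IH.
  rewrite -[RHS]/(@dom cell_graph (ccomp (bcomp b)) ++
    flatten [seq @dom cell_graph f | f <- [seq ccomp (bcomp b) | b <- bs']]).
  by rewrite -IH dom_ccomp -flatten_cat -map_cat.
- by rewrite !cod_ccomp.
move=> a oq; have oL := proj1 (ic_inputs icq a) oq.
have enn : carity (ccomp q) = carity (ccomp r) := congr1 varity eNN.
have oR : inputs (off (arities (fun i => nth d [seq ccomp (bcomp b) | b <- bs] i)) (carity g))
    (cat_of (sU g) (sV (fun i => nth d [seq ccomp (bcomp b) | b <- bs] i))) a.
  by apply/(ic_inputs icr); rewrite -enn -eNN.
rewrite (ic_at icq) // (ic_at icr) //.
apply: (@pasting_assoc g (ccomp p) T _ _ H icp) => //.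
- move=> i lt_i; rewrite -szb in lt_i; have [b [e1 [e2 e3]]] := blockP i lt_i.
  rewrite /T e1 e3; apply: is_ccomp_congr (ccomp_is (bcomp b) d) => l _.
  by rewrite /H e2.
- move=> i l lt_i lt_l; rewrite /H -nth_flatten_off ?size_map ?szb //; last first.
    have lt_i' : i < size bs by rewrite szb.
    have [b [e1 [e2 _]]] := blockP i lt_i'.
    by move: lt_l; rewrite /T e1 e2 (ccomposable_size (bcomp b)).
  congr (nth _ _ (_ + _)); apply: (@off_le_eq _ _ i) => // s lt_s.
  have lt_s' : s < size bs by rewrite szb; apply: ltn_trans lt_s lt_i.
  have [b [e1 [e2 _]]] := blockP s lt_s'.
  by rewrite /T e1 e2 (ccomposable_size (bcomp b)).
- exact: (ic_joint icq).
- exact: (ic_joint icr).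
Qed.

Definition cell_multi : multicategory cell_graph :=
  @Multicategory cell_graph cid ccomp dom_cid cod_cid dom_ccomp cod_ccomp
    ccomp_idl ccomp_idr ccomp_assoc.

(** * The cyclic multicategory of 2-cells *)

Definition crot (f : cell) : cell :=
  proj1_sig (constructive_indefinite_description _ (mate_cell_exists f)).

Lemma crotP (f : cell) :
  [/\ cell_src (crot f) = vrot (cell_src f), cell_tgt (crot f) = vrot (cell_tgt f),
      forall i, i <= carity f -> side (crot f) i = side f (sh (carity f) i) &
      forall a, inputs (carity f) (rot_cat (sU f)) a -> cell_at (crot f) a = mate_at f a].
Proof. exact: (proj2_sig (constructive_indefinite_description _ (mate_cell_exists f))). Qed.

Lemma elt_ueq X Y a i x : ueq X Y -> i <= uar X -> elt X a i x -> elt Y a i x.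
Proof.
move=> [en ec ee et] le_i; rewrite -en; apply: element_eq => // [j w le_j _|j v w le_j].
  exact: ee.
by rewrite en in le_j *; apply: ev_ext.
Qed.

Section ActionOfMate.
Variable f : cell.
Local Notation n := (carity f).
Local Notation un a := (fun j => a (unsh n j)).

Lemma crot_arity : carity (crot f) = n.
Proof. by have [e _ _ _] := crotP f; exact: (congr1 varity e). Qed.

Lemma crot_src : ueq (sU (crot f)) (urot (sU f)).
Proof. by have [-> _ _ _] := crotP f; exact: under_vrot. Qed.

Lemma crot_tgt : ueq (tU (crot f)) (urot (tU f)).
Proof. by have [_ -> _ _] := crotP f; exact: under_vrot. Qed.

Lemma crot_elt a i x : i <= n ->
  elt (sU (crot f)) a i x <-> elt (sU f) (un a) (sh n i) x.
Proof.
move=> le_i; rewrite -(rot_elt (X := sU f)) //; have [en ec ee _] := crot_src.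
have en' : uar (sU (crot f)) = n := en.
split=> -[o es et]; split=> //.
- by move=> j le_j; rewrite -[rot_cat _ _]ec ?en' //; apply: o; rewrite en'.
- by rewrite es ee ?en'.
- by move=> j; rewrite en' => le_j; rewrite ec ?en' //; apply: o.
- by rewrite es ee ?en'.
Qed.

(** The mate has the same action on elements, with the positions renumbered.  All that is proved
    about mates below rests on this description. *)
Lemma cell_act_rot i a x : i <= n -> elt (sU (crot f)) a i x ->
  cell_act (crot f) i a x = cell_act f (sh n i) (un a) x.
Proof.
have [es et eS ecm] := crotP f; have [ens ecs ees ets] := crot_src.
have en : carity (crot f) = n := crot_arity.
have ens' : uar (sU (crot f)) = n := en.
have case0 y : elt (sU (crot f)) a 0 y -> cell_act (crot f) 0 a y = cell_act f (sh n 0) (un a) y.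
  move=> l; have [o _ _] := l; rewrite cell_act0 // ecm; last first.
    move=> j lt0j le_j; have [|oc oi] := o j; first by rewrite ens'.
    by split=> //; rewrite oc ecs // ens'.
  rewrite oopK eS // -cell_act_unit ?sh_leq //; exact: (proj1 (crot_elt _ _ (leq0n _))).
move=> le_i l.
have l0 : elt (sU (crot f)) a 0 (tr (sU (crot f)) i 0 a x).
  by apply: tr_element l; rewrite ens'.
have ex : x = tr (sU (crot f)) 0 i a (tr (sU (crot f)) i 0 a x).
  by rewrite tr_comp ?tr_id // ens'.
set y := tr _ i 0 a x in l0 ex; rewrite ex cell_act_tr ?en // case0 //.
have ent' : uar (tU (crot f)) = n := en.
have [_ _ _ ->] := crot_tgt; rewrite ?ent' //.
rewrite [tr (urot _) _ _ _ _]/= /rot_tr ets ?ens' // [tr (urot _) _ _ _ _]/= /rot_tr.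
rewrite cell_act_tr ?sh_leq //; last exact: (proj1 (crot_elt _ _ (leq0n _))).
apply: (@tr_ext (tU f) (sh n 0) (sh n i)); rewrite ?sh_leq // => j le_j.
by rewrite /side_map eS ?unsh_leq // unshK.
Qed.

End ActionOfMate.

Lemma iter_crot f r : let h := iter r crot f in
  [/\ cell_src h = iter r vrot (cell_src f), cell_tgt h = iter r vrot (cell_tgt f),
      carity h = carity f,
      forall i, i <= carity f -> side h i = side f (iter r (sh (carity f)) i) &
      forall i a x, i <= carity f -> elt (sU h) a i x ->
        cell_act h i a x = cell_act f (iter r (sh (carity f)) i)
           (fun j => a (iter r (unsh (carity f)) j)) x].
Proof.
elim: r => [//|r [es et en eS ep]]; set h := iter r crot f in es et en eS ep.
rewrite iterS -/h; have [es' et' eS' _] := crotP h.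
split; first by rewrite es' es.
- by rewrite et' et.
- by rewrite crot_arity.
- by move=> i le_i; rewrite eS' ?en // eS ?sh_leq // -iterSr.
move=> i a x le_i l; rewrite cell_act_rot ?en // ep ?sh_leq ?iterSr //.
by have := proj1 (crot_elt a x (f := h) (i := i) _) l; rewrite en; apply.
Qed.

Lemma crot_cycle f : iter (size (@dom cell_graph f)).+1 crot f = f.
Proof.
rewrite dom_cell size_mkseq; have [es et en eS ep] := iter_crot f (carity f).+1.
have eu j : j <= carity f -> iter (carity f).+1 (unsh (carity f)) j = j.
  by move=> le_j; rewrite -{1}(iter_sh le_j) iter_shK.
apply: (@cell_ext_act 0); rewrite ?en //.
- by rewrite es; have := vrot_cycle (cell_src f); rewrite size_dom_vcell.
- by rewrite et; have := vrot_cycle (cell_tgt f); rewrite size_dom_vcell.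
- by move=> i le_i; rewrite eS // iter_sh.
move=> a x l; rewrite ep // iter_sh //; apply: cell_act_ext => // j le_j; by rewrite eu.
Qed.

Lemma crot_nullary f : @dom cell_graph f = [::] -> crot f = f.
Proof. by move=> e; rewrite -[RHS]crot_cycle e. Qed.

Lemma cdom_cons (f : cell) S l : @dom cell_graph f = S :: l ->
  [/\ carity f = (size l).+1, S = side f 1 & l = mkseq (fun j => side f j.+2) (size l)].
Proof.
move=> e; have en : carity f = (size l).+1 by have := congr1 size e; rewrite dom_cell size_mkseq.
move: e; rewrite dom_cell en /mkseq /= => -[-> e]; split=> //.
by rewrite -{1}e (iotaDl 1) -map_comp.
Qed.

Lemma dom_crot f S l : @dom cell_graph f = S :: l ->
  @dom cell_graph (crot f) = rcons l (hop (@cod cell_graph f)).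
Proof.
move=> /cdom_cons[]; move: (size l) => k en _ el.
have [_ _ eS _] := crotP f.
rewrite dom_cell crot_arity en mkseqS cod_cell hopK el; congr rcons; last first.
  by rewrite eS ?en // /sh ltnn.
apply/eq_in_map => j; rewrite mem_iota => /andP[_ lt_j].
by rewrite eS en /sh ?ltnS ?lt_j // ltnW.
Qed.

Lemma cod_crot f S l : @dom cell_graph f = S :: l -> @cod cell_graph (crot f) = hop S.
Proof.
move=> /cdom_cons[en -> _]; have [_ _ eS _] := crotP f.
by rewrite cod_cell eS // /sh en.
Qed.

Lemma cell_act_cid S i a x : i <= 1 -> elt (sU (cid S)) a i x ->
  cell_act (cid S) i a x = amap (side (cid S) i) x.
Proof.
have [_ _ eS0 _ _] := cidP S; have en := cid_arity S.
have ens : uar (sU (cid S)) = 1 := en; have ent : uar (tU (cid S)) = 1 := en.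
have [_ ecs ees ets] := cid_src S; have [_ ect eet ett] := cid_tgt S.
have case0 y : elt (sU (cid S)) a 0 y -> cell_act (cid S) 0 a y = amap (side (cid S) 0) y.
  move=> l; have [o es _] := l.
  have [oc oi] := o 1 (eq_leq (esym ens)).
  have ec1 : ocat (a 1) = Some (hcell_src S) by rewrite oc ecs ?ens.
  have e1 : osrc y = oop (a 1) by rewrite es ees ?ens // uid_ev0.
  rewrite cell_act0 // cell_at_cid // eS0.
  have -> : oop (amap S (a 1)) = osrc (amap (hop S) y) by rewrite osrc_map e1 amap_hop oopK.
  by rewrite ocomp_src.
move=> le_i l; have [i0|ne] := eqVneq i 0; first by rewrite i0 in l *; exact: case0.
have {le_i ne} i1 : i = 1 by case/leq1P: le_i => // i0; rewrite i0 in ne.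
subst i; have [_ eS1] : side (cid S) 0 = hop S /\ side (cid S) 1 = S by have [_ _ -> ->] := cidP S.
have l0 : elt (sU (cid S)) a 0 (tr (sU (cid S)) 1 0 a x) by apply: tr_element l; rewrite ens.
have ex : x = tr (sU (cid S)) 0 1 a (tr (sU (cid S)) 1 0 a x).
  by rewrite tr_comp ?tr_id // ens.
set y := tr _ 1 0 a x in l0 ex; rewrite ex cell_act_tr ?en // case0 //.
have l1 := cell_act_elt (leq0n _) l0; rewrite case0 // in l1.
rewrite ets ?ens // uid_tr //; last by apply: elt_ueq l0; first exact: cid_src.
rewrite ett ?ent // uid_tr //; last by apply: elt_ueq l1; first exact: cid_tgt.
by rewrite eS0 eS1 amap_hop oopK.
Qed.

Lemma crot_id S : crot (cid S) = cid (hop S).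
Proof.
have [es et eS _] := crotP (cid S); have en := cid_arity S.
have [cs ct c0 c1 _] := cidP S; have [cs' ct' c0' c1' _] := cidP (hop S).
have en' : carity (crot (cid S)) = 1 by rewrite crot_arity.
have eSi i : i <= 1 -> side (crot (cid S)) i = side (cid (hop S)) i.
  by move=> le_i; rewrite eS ?en //; case/leq1P: le_i => ->; rewrite /sh /= ?c0 ?c1 ?c0' ?c1' ?hopK.
have esrc : cell_src (crot (cid S)) = cell_src (cid (hop S)) by rewrite es cs vrot_id cs'.
apply: (@cell_ext_act 0); rewrite ?en' //.
  by rewrite et ct vrot_id ct'.
move=> a x l; have l' : elt (sU (cid (hop S))) a 0 x by rewrite -esrc.
have l1 := proj1 (crot_elt a x (leq0n (carity (cid S)))) l.
rewrite cell_act_rot // cell_act_cid //; last by rewrite en.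
by rewrite cell_act_cid // -eSi // eS.
Qed.

Section ActionOfComposite.
Variables (g : cell) (F : nat -> cell) (h : cell).
Hypothesis ic : is_ccomp g F h.
Local Notation k := (carity g).
Local Notation m := (arities F).
Local Notation N := (off m k).
Variable a : nat -> parrow.
Hypothesis oa : objects (carity h) (ucat (sU h)) a.
Local Notation kp := (arg_cells g F a).
Local Notation oS := (outer (sV F) a).

Lemma objects_pos : inputs N (cat_of (sU g) (sV F)) a.
Proof. by apply/(ic_inputs ic); exact: objects_inputs. Qed.

Lemma root_object : ocat (a 0) = Some (ucat (sU g) 0) /\ osrc (a 0) = a 0.
Proof. by have [-> ->] := oa (leq0n _); rewrite (ic_cat ic). Qed.

Lemma arg_cells_osrc s : s <= k -> osrc (kp s) = side_map g oS s.
Proof.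
case: s => [_|s lt_s]; last exact: (arg_cells_src (ic_joint ic) lt_s objects_pos).
by rewrite /= osrc_map; have [_ ->] := root_object.
Qed.

Lemma arg_cells_otgt s : s <= k -> otgt (kp s) = outer (tV F) (side_map h a) s.
Proof.
have o := objects_pos.
case: s => [_|s lt_s].
  rewrite /= otgt_map; have [_ <-] := root_object.
  by rewrite otgt_src /side_map (ic_side ic) //; have [_ ->] := root_object.
rewrite (arg_cells_tgt lt_s o); apply: (@outer_ext (tU g) (tV F)) => // j le_j.
by rewrite -(ic_side_map ic).
Qed.

Lemma arg_cells_ocat s : s <= k -> ocat (kp s) = Some (ucat (tU g) s).
Proof.
case: s => [_|s lt_s]; last exact: (arg_cells_cat (ic_joint ic) lt_s objects_pos).
by have [e _] := root_object; rewrite /= amap_some.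
Qed.

Lemma outer_elt x : elt (sU h) a 0 x -> elt (sU g) oS 0 x.
Proof.
move=> l; have l' := elt_ueq (ic_src ic) (leq0n _) l; have [o _ _] := l'.
by apply/(celt0 (joint_src (ic_joint ic))).
Qed.

(** The component of a composite is a component of [g] followed by those of the arguments, and the
    latter act through the functoriality of the hom-sets of the target of [g]. *)
Lemma cell_act_comp0 x : elt (sU h) a 0 x ->
  cell_act h 0 a x = act (ev (tU g)) kp 0 (cell_act g 0 oS x).
Proof.
move=> l; have l' := outer_elt l.
rewrite cell_act0 // cell_act0 // (ic_at ic); last exact: objects_pos.
rewrite (ic_side ic) // /pasting_at oop_comp /act -[side_pos g F 0]/(side g 0) ocompA.
have [_ _ et] := cell_act0_elt l'.
rewrite -arg_cells_osrc // in et; rewrite [in RHS]ocompA.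
have -> : kp 0 = osrc (kp 0) by rewrite [in RHS]/= osrc_map; have [_ ->] := root_object.
by rewrite -et ocomp_tgt.
Qed.

Lemma inner_elt q j x : q < k -> 0 < j -> j <= m q -> elt (sU h) a (off m q + j) x ->
  elt (sU (F q)) (inner (sU g) (sV F) a q) j x.
Proof.
move=> lt_q lt0j le_j l.
have le_p : off m q + j <= uar (sU h).
  by rewrite -[uar _]/(carity h) (ic_arity ic); exact: off_leq.
have l' := elt_ueq (ic_src ic) le_p l; have [o _ _] := l'.
exact: (proj1 (celtE (joint_src (ic_joint ic)) _ lt_q lt0j le_j o)).
Qed.

Lemma turn_elt q x : q < k ->
  elt (sU g) oS q.+1 x <-> elt (sU (F q)) (inner (sU g) (sV F) a q) 0 (oop x).
Proof.
move=> lt_q; apply: (celt_turn (joint_src (ic_joint ic)) _ lt_q).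
move=> p le_p; have le_p' : p <= carity h by rewrite (ic_arity ic).
by rewrite -(ic_cat ic) //; apply: oa.
Qed.

Lemma act_arg_cells_elt q z : q < k -> elt (sU g) oS q.+1 z ->
  elt (tU (F q)) (inner (tU g) (tV F) (side_map h a) q) 0
    (oop (act (ev (tU g)) kp q.+1 (cell_act g q.+1 oS z))).
Proof.
move=> lt_q l; have ot := side_map_objects oa.
have [ent ect _ _] := ic_tgt ic.
have ent' : uar (tU h) = N := ic_arity ic.
have ec p : p <= N -> cat_of (tU g) (tV F) p = ucat (tU h) p.
  by move=> le_p; rewrite ect ?ent'.
apply/(celt_turn (joint_tgt (ic_joint ic)) _ lt_q).
  by move=> p le_p; rewrite ec //; apply: ot; rewrite (ic_arity ic).
have lp := cell_act_elt lt_q l.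
have lk : elt (tU g) (fun s => osrc (kp s)) q.+1 (cell_act g q.+1 oS z).
  by apply: elt_ext lp => // s le_s; rewrite arg_cells_osrc.
apply: (@elt_ext (tU g) (fun s => otgt (kp s))) => //; last first.
  by apply: act_elt => //; exact: arg_cells_ocat.
by move=> s le_s; exact: arg_cells_otgt.
Qed.

(** Transposing to the root and back goes through [g], where [cell_act_comp0] applies; the transposes
    inside [g] cancel by naturality, and the transposes inside the argument remain. *)
Lemma cell_act_compE q j x : q < k -> 0 < j -> j <= m q -> elt (sU h) a (off m q + j) x ->
  cell_act h (off m q + j) a x =
  tr (tU (F q)) 0 j (inner (tU g) (tV F) (side_map h a) q)
    (oop (act (ev (tU g)) kp q.+1
      (cell_act g q.+1 oS (oop (tr (sU (F q)) j 0 (inner (sU g) (sV F) a q) x))))).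
Proof.
move=> lt_q lt0j le_j l; set p := off m q + j in l *.
have en : carity h = N := ic_arity ic.
have ens : uar (sU h) = N := en; have ent : uar (tU h) = N := en.
have le_p : p <= N by apply: off_leq.
have [_ _ _ ets] := ic_src ic; have [_ _ _ ett] := ic_tgt ic.
have l0 : elt (sU h) a 0 (tr (sU h) p 0 a x) by apply: tr_element l; rewrite ens.
have ex : x = tr (sU h) 0 p a (tr (sU h) p 0 a x).
  by rewrite tr_comp ?tr_id // ens.
have ey : tr (sU h) p 0 a x = tr (sU g) q.+1 0 oS
    (oop (tr (sU (F q)) j 0 (inner (sU g) (sV F) a q) x)).
  rewrite ets ?ens //.
  have lc : elt (ucomp (joint_src (ic_joint ic))) a p x.
    by apply: elt_ueq (ic_src ic) _ l; rewrite ens.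
  by rewrite [tr (ucomp _) _ _ _ _]/= /ctr (guardT _ lc) /= (@to_rootE (sU g) (sV F)).
set z := oop _ in ey *; set y := tr _ p 0 a x in l0 ex ey.
have lg : elt (sU g) oS 0 y := outer_elt l0.
have ez : z = tr (sU g) 0 q.+1 oS y.
  have lz : elt (sU g) oS q.+1 z.
    apply/turn_elt => //; rewrite /z oopK; apply: (@tr_element (sU (F q))) => //.
    exact: inner_elt.
  by rewrite ey tr_comp // tr_id.
rewrite ex cell_act_tr ?en // cell_act_comp0 //.
have lt : elt (tU h) (side_map h a) 0 (cell_act h 0 a y) by apply: cell_act_elt.
rewrite cell_act_comp0 // in lt.
rewrite ett ?ent // (ucomp_tr0 _ (elt_ueq (ic_tgt ic) (leq0n _) lt)).
rewrite (@from_rootE (tU g) (tV F)) //; congr (tr _ _ _ _ (oop _)).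
have ek : forall s, s <= k -> outer (tV F) (side_map h a) s = (fun s => otgt (kp s)) s.
  by move=> s le_s; rewrite arg_cells_otgt.
rewrite (@tr_ext (tU g) 0 q.+1 _ _ _ isT lt_q ek).
have ek' : forall s, s <= k -> osrc (kp s) = side_map g oS s := arg_cells_osrc.
have lp := cell_act_elt (leq0n _) lg.
have lp' : elt (tU g) (fun s => osrc (kp s)) 0 (cell_act g 0 oS y).
  by apply: elt_ext lp => // s le_s; rewrite ek'.
rewrite tr_nat //; last exact: arg_cells_ocat.
by rewrite (@tr_ext (tU g) 0 q.+1 _ _ _ isT lt_q ek') -cell_act_tr // -ez.
Qed.

End ActionOfComposite.

Lemma ev_cid_src S w : ocat (w 1) = Some (hcell_src S) -> ev (sU (cid S)) 0 w = w 1.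
Proof. by move=> e; have [_ _ -> // _] := cid_src S; rewrite uid_ev0. Qed.

Lemma ev_cid_tgt S w : ocat (w 1) = Some (hcell_tgt S) -> ev (tU (cid S)) 0 w = w 1.
Proof. by move=> e; have [_ _ -> // _] := cid_tgt S; rewrite uid_ev0. Qed.

Lemma tr_cid_src S a i j x : i <= 1 -> j <= 1 -> i <> j -> elt (sU (cid S)) a i x ->
  tr (sU (cid S)) i j a x = oop x.
Proof.
have ens : uar (sU (cid S)) = 1 := cid_arity S.
move=> le_i le_j ne l; have [_ _ _ ->] := cid_src S; rewrite ?ens // uid_tr //.
by apply: elt_ueq (cid_src S) _ l; rewrite ens.
Qed.

Lemma tr_cid_tgt S a i j x : i <= 1 -> j <= 1 -> i <> j -> elt (tU (cid S)) a i x ->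
  tr (tU (cid S)) i j a x = oop x.
Proof.
have ens : uar (tU (cid S)) = 1 := cid_arity S.
move=> le_i le_j ne l; have [_ _ _ ->] := cid_tgt S; rewrite ?ens // uid_tr //.
by apply: elt_ueq (cid_tgt S) _ l; rewrite ens.
Qed.

Lemma act_rot X w x : act (ev (urot X)) w (uar X) x =
  act (ev X) (fun j => w (unsh (uar X) j)) 0 x.
Proof. by rewrite /act /= /rot_ev /sh ltnn. Qed.

Section CellNext.
Variables (g h h' : cell) (F F' : nat -> cell) (k' : nat).
Local Notation k := (carity g).
Local Notation m := (arities F).
Local Notation m' := (arities F').
Local Notation N := (off m k).
Local Notation un w := (fun j => w (unsh N j)).
Hypothesis ek : k = k'.+1.
Hypothesis ic : is_ccomp g F h.
Hypothesis ic' : is_ccomp (crot g) F' h'.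
Hypothesis eF0 : F 0 = cid (side g 1).
Hypothesis eF' : forall q, q < k' -> F' q = F q.+1.
Hypothesis eFk : F' k' = cid (side g 0).
Hypothesis es : cell_src (crot h) = cell_src h'.
Hypothesis et : cell_tgt (crot h) = cell_tgt h'.
Hypothesis eS : forall i, i <= carity (crot h) -> side (crot h) i = side h' i.

Lemma coff_next q : q <= k' -> off m q.+1 = (off m' q).+1.
Proof.
elim: q => [|q IH] le_q; first by rewrite /= eF0 cid_arity.
by rewrite [LHS]/= -/(off m q.+1) IH ?(ltnW le_q) // [in RHS]/= eF'.
Qed.

Lemma coff_next_total : N = off m' k' + 1.
Proof. by rewrite ek coff_next // addn1. Qed.

(** The actions are compared at the old root, whose new position is [N].  On the left this is the
    action of [h] at its root, and on the right the action of [h'] at the input of an identity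
    2-cell, where the transposes of [cell_act_compE] only reverse arrows. *)
Lemma crot_comp_next : crot h = h'.
Proof.
have enh : carity h = N := ic_arity ic.
have en : carity (crot h) = N by rewrite crot_arity.
have eN := coff_next_total.
have ekc : carity (crot g) = k := crot_arity g.
apply: (@cell_ext_act N) => //; first by rewrite en.
move=> a x l.
have l0 : elt (sU h) (un a) 0 x.
  have := proj1 (@crot_elt h a N x _) l.
  by rewrite enh /sh ltnn; apply.
have l' : elt (sU h') a (off m' k' + 1) x by rewrite -es -eN.
have [o _ _] := l0; have [o' _ _] := l'.
have op := objects_pos ic o; have op' := objects_pos ic' o'.
have lt0k : 0 < k by rewrite ek.
have ltk : k' < k by rewrite ek.
have mk : m' k' = 1 by rewrite eFk cid_arity.
have m0 : m 0 = 1 by rewrite eF0 cid_arity.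
have [_ _ eSg _] := crotP g.
have lt0N : 0 < N by rewrite eN addn1.
have oN : ocat (a N) = Some (ucat (sU g) 0).
  by have [e _] := root_object ic o; rewrite /= in e.
have o0 : ocat (a 0) = Some (ucat (sU g) 1) /\ osrc (a 0) = a 0.
  have le1 : 1 <= m 0 by rewrite m0.
  have := op (off m 0 + 1) isT lt0N.
  rewrite (@cat_ofE (sU g) (sV F) 0 1 lt0k isT le1) eF0.
  have [_ ec _ _] := cid_src (side g 1).
  have ens1 : uar (sU (cid (side g 1))) = 1 := cid_arity _.
  by rewrite ec ?ens1.
have eout s : s <= k -> outer (sV F') a (unsh k s) = outer (sV F) (un a) s.
  case: s => [_|[_|s lt_s]].
  - have -> : outer (sV F') a (unsh k 0) = ev (sU (F' k')) 0 (fun j => a (off m' k' + j)).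
      by rewrite ek.
    by rewrite eFk ev_cid_src -eN.
  - rewrite -[RHS]/(ev (sU (F 0)) 0 (fun j => un a (0 + j))) eF0 ev_cid_src //.
    exact: (proj1 o0).
  rewrite ek ltnS in lt_s; rewrite [unsh _ _]/= [LHS]/= [RHS]/= eF' //.
  apply: (@ev_ext (sU (F s.+1)) 0) => // -[//|j] _ _.
  by rewrite -/(off m s.+1) coff_next ?(ltnW lt_s) // addSnnS [off m' s + j.+2]addnS.
have ekap s : s <= k -> arg_cells (crot g) F' a (unsh k s) = arg_cells g F (un a) s.
  case: s => [_|[_|s lt_s]].
  - have -> : arg_cells (crot g) F' a (unsh k 0) = cell_at (F' k') (inner (sU (crot g)) (sV F') a k').
      by rewrite ek.
    by rewrite eFk cell_at_cid /= -eN //; have [_] := root_object ic o.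
  - rewrite -[RHS]/(cell_at (F 0) (inner (sU g) (sV F) (un a) 0)) eF0 cell_at_cid /=; [|exact: (proj1 o0)|exact: (proj2 o0)].
    by rewrite eSg // /sh lt0k.
  rewrite ek ltnS in lt_s; rewrite [unsh _ _]/= [LHS]/= [RHS]/= eF' //.
  apply: cell_at_ext => -[//|j] _ _ /=.
  by rewrite -/(off m s.+1) coff_next ?(ltnW lt_s) // addSnnS [off m' s + j.+2]addnS.
rewrite cell_act_rot ?enh // [sh N N]/sh ltnn (cell_act_comp0 ic o l0).
have -> : cell_act h' N a x = cell_act h' (off m' k' + 1) a x by rewrite -eN.
have ltkc : k' < carity (crot g) by rewrite ekc.
have le1 : 1 <= m' k' by rewrite mk.
rewrite (cell_act_compE ic' o' ltkc) //.
have lx := inner_elt ic' ltkc (ltn0Sn 0) le1 l'.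
set z := oop (tr _ 1 0 _ _).
have ez : z = x by rewrite /z eFk tr_cid_src ?oopK // -eFk.
have lz : elt (sU (crot g)) (outer (sV F') a) k'.+1 x.
  apply/(turn_elt ic' o' _ ltkc); rewrite -ez oopK.
  exact: (@tr_element (sU (F' k')) 1 0 _ _ le1 isT lx).
have lt := act_arg_cells_elt ic' o' ltkc lz.
rewrite ez eFk tr_cid_tgt // -?eFk // oopK.
have lzk : elt (sU (crot g)) (outer (sV F') a) k x by rewrite ek.
have -> : k'.+1 = k by rewrite ek.
rewrite cell_act_rot // [sh k k]/sh ltnn.
have -> w y : act (ev (tU (crot g))) w k y = act (ev (tU g)) (fun j => w (unsh k j)) 0 y.
  have [_ _ ee _] := crot_tgt g.
  by rewrite -act_rot /act ee // [uar _]ekc.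
rewrite (cell_act_ext (b := outer (sV F) (un a))) //.
rewrite /act ekap //; congr (ocomp _ (ocomp _ (oop _))).
by apply: (@ev_ext (tU g) 0) => // s le_s _; rewrite ekap.
Qed.

End CellNext.

Section CellFirst.
Variables (g f h h' : cell) (F F' : nat -> cell) (k' n' : nat).
Local Notation k := (carity g).
Local Notation n := (carity f).
Local Notation m := (arities F).
Local Notation m' := (arities F').
Local Notation N := (n' + k).
Local Notation un w := (fun j => w (unsh N j)).
Hypothesis ek : k = k'.+1.
Hypothesis en : n = n'.+1.
Hypothesis ic : is_ccomp g F h.
Hypothesis ic' : is_ccomp (crot f) F' h'.
Hypothesis eF0 : F 0 = f.
Hypothesis eF : forall q, q < k' -> F q.+1 = cid (side g q.+2).
Hypothesis eF' : forall q, q < n' -> F' q = cid (side f q.+2).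
Hypothesis eFn : F' n' = crot g.
Hypothesis es : cell_src (crot h) = cell_src h'.
Hypothesis et : cell_tgt (crot h) = cell_tgt h'.
Hypothesis eS : forall i, i <= carity (crot h) -> side (crot h) i = side h' i.

Lemma coff_first q : q <= k' -> off m q.+1 = n + q.
Proof.
elim: q => [|q IH] le_q; first by rewrite /= eF0 addn0.
by rewrite [LHS]/= -/(off m q.+1) IH ?(ltnW le_q) // eF // cid_arity addn1 addnS.
Qed.

Lemma coff_first' q : q <= n' -> off m' q = q.
Proof. by move=> le_q; apply: off_ones le_q => r lt_r; rewrite eF' // cid_arity. Qed.

Lemma coff_firstN : off m k = N.
Proof. by rewrite ek coff_first // en; lia. Qed.

(** The actions are compared at the old root, whose new position [N] is the last input of the rotated
    [g], which is now an argument.  On the right, the component of the mate of [g] enters as the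
    value of its action at a universal element, and [cell_act_unit] turns it into the action of [g] at
    its first input. *)
Lemma crot_comp_first : crot h = h'.
Proof.
have eN := coff_firstN.
have enh : carity h = N by rewrite (ic_arity ic).
have enr : carity (crot h) = N by rewrite crot_arity.
have enc : carity (crot f) = n := crot_arity f.
have lt0k : 0 < k by rewrite ek.
have lt0n : 0 < n by rewrite en.
have ltn' : n' < carity (crot f) by rewrite enc en.
have m0 : m 0 = n by rewrite eF0.
have mn : m' n' = k by rewrite eFn crot_arity.
have m1 q : q < k' -> m q.+1 = 1 by move=> lt_q; rewrite eF // cid_arity.
apply: (@cell_ext_act N) => //; first by rewrite enr.
move=> a x l.
have l0 : elt (sU h) (un a) 0 x.
  have := proj1 (@crot_elt h a N x _) l.
  by rewrite enh /sh ltnn; apply.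
have l' : elt (sU h') a (off m' n' + k) x by rewrite -es coff_first'.
have [o _ _] := l0; have [o' _ _] := l'.
have op := objects_pos ic o.
have [_ _ eSg _] := crotP g; have [_ _ eSf _] := crotP f.
have oZ s : s <= n' -> ocat (a s) = Some (ucat (sU f) s.+1) /\ osrc (a s) = a s.
  move=> le_s; have le1 : s.+1 <= m 0 by rewrite m0 en.
  have le2 : s < off m k by rewrite eN; lia.
  have := op (off m 0 + s.+1) isT le2.
  by rewrite (@cat_ofE (sU g) (sV F) 0 s.+1 lt0k isT le1) eF0.
have oG s : s < k' -> ocat (a (n' + s.+1)) = Some (ucat (sU g) s.+2) /\
    osrc (a (n' + s.+1)) = a (n' + s.+1).
  move=> lt_s; have le1 : 1 <= m s.+1 by rewrite m1.
  have lt_s1 : s.+1 < k by rewrite ek.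
  have le2 : off m s.+1 + 1 <= off m k by apply: off_leq.
  have lt02 : 0 < off m s.+1 + 1 by rewrite addn1.
  have := op _ lt02 le2.
  rewrite (@cat_ofE (sU g) (sV F) s.+1 1 lt_s1 isT le1) eF //.
  have ens1 : uar (sU (cid (side g s.+2))) = 1 := cid_arity _.
  have [_ ec _ _] := cid_src (side g s.+2); rewrite ec ?ens1 // coff_first; last exact: ltnW.
  by rewrite addn1 [unsh _ _]/= en addSn addnS.
have oN : ocat (a N) = Some (ucat (sU g) 0) /\ osrc (a N) = a N.
  by have := root_object ic o.
pose b := outer (sV F) (un a).
pose c := inner (sU g) (sV F) (un a) 0.
have eb2 s : s < k' -> b s.+2 = a (n' + s.+1).
  move=> lt_s; rewrite -[LHS]/(ev (sU (F s.+1)) 0 (fun j => un a (off m s.+1 + j))) eF //.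
  have eun : un a (off m s.+1 + 1) = a (n' + s.+1).
    by rewrite coff_first ?(ltnW lt_s) // addn1 [unsh _ _]/= en addSn addnS.
  by rewrite ev_cid_src eun //; exact: (proj1 (oG s lt_s)).
have eout s : s <= n -> outer (sV F') a (unsh n s) = c s.
  case: s => [_|[_|s]] //; last first.
    rewrite en ltnS => lt_s.
    rewrite -[LHS]/(ev (sU (F' s)) 0 (fun j => a (off m' s + j))) eF' //.
    by rewrite ev_cid_src coff_first' ?(ltnW lt_s) // addn1 //; exact: (proj1 (oZ s.+1 lt_s)).
  have -> : outer (sV F') a (unsh n 0) = ev (sU (F' n')) 0 (fun j => a (off m' n' + j)).
    by rewrite en.
  rewrite eFn; have [_ _ ee _] := crot_src g.
  rewrite ee // -[LHS]/(ev (sU g) (sh k 0) _) {1}/sh lt0k.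
  apply: (@ev_ext (sU g) 1) => // -[_ _|[_ []//|s lt_s _]].
    by rewrite [unsh _ _]/= coff_first'.
  have lt_s' : s < k' by move: lt_s; rewrite [uar _]ek.
  by rewrite [unsh _ _]/= coff_first' //; rewrite -[RHS]/(b s.+2) eb2.
have ein s : s <= k -> inner (sU (crot f)) (sV F') a n' (unsh k s) = b s.
  case: s => [_|[_|s]].
  - by rewrite [unsh _ _]/= {1}ek /= coff_first' // -ek.
  - rewrite [unsh _ _]/= -[LHS]/(ev (sU (crot f)) n'.+1 (outer (sV F') a)).
    have [_ _ ee _] := crot_src f; rewrite ee ?[uar _]enc ?en //.
    rewrite -[LHS]/(ev (sU f) (sh n n'.+1) _) -en /sh ltnn.
    rewrite -[RHS]/(ev (sU (F 0)) 0 (fun j => un a (0 + j))) eF0.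
    by apply: (@ev_ext (sU f) 0) => // -[//|s] le_s _; rewrite eout.
  rewrite ek ltnS => lt_s.
  by rewrite [unsh _ _]/= -[LHS]/(a (off m' n' + s.+1)) coff_first' // eb2.
have ekf s : 0 < s -> s <= n -> arg_cells (crot f) F' a (unsh n s) = side_map f c s.
  case: s => [|[_ _|s _]] //; first by rewrite [unsh _ _]/= /= eSf // /sh lt0n.
  rewrite en ltnS => lt_s; rewrite [unsh _ _]/= -[LHS]/(cell_at (F' s) (inner _ _ a s)) eF' //.
  have ea1 : inner (sU (crot f)) (sV F') a s 1 = a s.+1.
    by rewrite -[LHS]/(a (off m' s + 1)) coff_first' ?(ltnW lt_s) // addn1.
  by have [e1 e2] := oZ s.+1 lt_s; rewrite cell_at_cid ea1.
have ekfn : arg_cells (crot f) F' a n'.+1 =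
    oop (cell_act g 1 (upd b 1 (oop (ev (sU g) 1 b))) (oop (ev (sU g) 1 b))).
  rewrite -[LHS]/(cell_at (F' n') (inner _ _ a n')) eFn.
  have [_ _ _ ecm] := crotP g; rewrite ecm; last first.
    have [oi _ _] := inner_elt ic' ltn' lt0k (eq_leq (esym mn)) l'.
    move=> j lt0j le_j; have le_j' : j <= uar (sU (F' n')) by rewrite [uar _]mn.
    have [eo es'] := oi j le_j'; rewrite eFn in eo le_j'; split=> //.
    by have [_ ec _ _] := crot_src g; rewrite -[RHS](congr1 Some (ec _ le_j')).
  rewrite /mate_at [sh k 0]/sh lt0k.
  rewrite (@ev_ext (sU g) 1 _ b) //; last by move=> s le_s _; rewrite ein.
  congr oop; apply: cell_act_ext => // s le_s; rewrite /upd; case: eqP => // _; exact: ein.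
have ekg s : s <= k -> s <> 1 -> arg_cells g F (un a) s = side_map g b s.
  case: s => [//|[//|s]] le_s _; have lt_s : s < k' by rewrite ek in le_s.
  have eun : inner (sU g) (sV F) (un a) s.+1 1 = a (n' + s.+1).
    rewrite -[LHS]/(un a (off m s.+1 + 1)) coff_first ?(ltnW lt_s) //.
    by rewrite addn1 [unsh _ _]/= en addSn addnS.
  rewrite -[LHS]/(cell_at (F s.+1) (inner _ _ (un a) s.+1)) eF //.
  by have [e1 e2] := oG s lt_s; rewrite cell_at_cid eun // /side_map eb2.
have ekg1 : arg_cells g F (un a) 1 = cell_at f c by rewrite /= eF0.
rewrite cell_act_rot ?enh // [sh N N]/sh ltnn (cell_act_comp0 ic o l0) -/b.
have -> : cell_act h' N a x = cell_act h' (off m' n' + k) a x by rewrite coff_first'.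
have lx := inner_elt ic' ltn' lt0k (eq_leq (esym mn)) l'.
have lg : elt (sU g) b 0 x := outer_elt ic l0.
set d := inner (tU (crot f)) (tV F') (side_map h' a) n'.
pose x1 := tr (sU g) 0 1 b x.
have lg1 : elt (sU g) b 1 x1 by apply: tr_element.
have ex1 : tr (sU (F' n')) k 0 (inner (sU (crot f)) (sV F') a n') x = x1.
  rewrite eFn; have [_ _ _ etr] := crot_src g; rewrite etr ?[uar _]crot_arity //.
  rewrite -[LHS]/(tr (sU g) (sh k k) (sh k 0) _ x) /sh ltnn lt0k.
  exact: tr_ext.
have lf : elt (sU f) c 0 (oop x1) by rewrite -eF0; apply/(turn_elt ic o).
have lf' : elt (sU (crot f)) (outer (sV F') a) n (oop x1).
  by apply/crot_elt => //; rewrite /sh ltnn; apply: elt_ext lf => // s le_s; rewrite eout.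
have ephi : cell_act (crot f) n'.+1 (outer (sV F') a) (oop x1) = cell_act f 0 c (oop x1).
  by rewrite -en cell_act_rot // /sh ltnn; exact: cell_act_ext.
have eact : oop (act (ev (tU (crot f))) (arg_cells (crot f) F' a) n'.+1 (cell_act f 0 c (oop x1))) =
    act (ev (tU g)) (arg_cells g F (un a)) 1 (cell_act g 1 b x1).
  have [_ es1 _] := cell_act_elt (leq0n _) lf; have [_ es2 _] := cell_act_elt lt0k lg1.
  have -> : act (ev (tU (crot f))) (arg_cells (crot f) F' a) n'.+1 (cell_act f 0 c (oop x1)) =
      ocomp (arg_cells (crot f) F' a n'.+1) (cell_act f 0 c (oop x1)).
    rewrite /act; congr ocomp; rewrite -[RHS]ocomp_src es1; congr (ocomp _ (oop _)).
    have [_ _ ee _] := crot_tgt f; rewrite ee ?[uar _]enc ?en //.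
    rewrite -[LHS]/(ev (tU f) (sh n n'.+1) _) -en /sh ltnn.
    by apply: (@ev_ext (tU f) 0) => // s le_s ne; apply: ekf => //; lia.
  have -> : act (ev (tU g)) (arg_cells g F (un a)) 1 (cell_act g 1 b x1) = ocomp (cell_at f c) (cell_act g 1 b x1).
    rewrite /act ekg1; congr ocomp; rewrite -[RHS]ocomp_src es2; congr (ocomp _ (oop _)).
    by apply: (@ev_ext (tU g) 1) => // s le_s ne; apply: ekg.
  rewrite ekfn cell_act0 // !oop_comp !oopK -amap_hop -ocompA (cell_act_unit lt0k lg1).
  by rewrite (ic_joint ic lt0k) eF0.
rewrite (cell_act_compE ic' o' ltn') ?mn // ex1 ephi eact.
have -> : cell_act g 1 b x1 = tr (tU g) 0 1 (fun s => osrc (arg_cells g F (un a) s)) (cell_act g 0 b x).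
  rewrite /x1 cell_act_tr //; apply: tr_ext => // s le_s.
  by rewrite (arg_cells_osrc ic o).
rewrite -tr_nat //; last 2 first.
- by move=> s le_s; apply: (arg_cells_ocat ic o).
- have lp := cell_act_elt (leq0n _) lg; apply: elt_ext lp => // s le_s.
  by rewrite (arg_cells_osrc ic o).
have la : elt (tU g) (fun s => otgt (arg_cells g F (un a) s)) 0
    (act (ev (tU g)) (arg_cells g F (un a)) 0 (cell_act g 0 b x)).
  apply: act_elt => //; first by move=> s le_s; apply: (arg_cells_ocat ic o).
  have lp := cell_act_elt (leq0n _) lg; apply: elt_ext lp => // s le_s.
  by rewrite (arg_cells_osrc ic o).
have ed s : s <= k -> d (unsh k s) = otgt (arg_cells g F (un a) s).
  have esh t : t <= N -> side_map h' a t = amap (side_pos g F (sh N t)) (a t).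
    move=> le_t; have [_ _ eSh _] := crotP h.
    rewrite /side_map -eS ?enr // eSh ?enh // (ic_side ic) //.
    by rewrite eN; exact: sh_leq.
  have eh1 t : t <= n' -> side_map h' a t = side_map f c t.+1.
    move=> le_t; have le1 : t.+1 <= m 0 by rewrite m0 en.
    have le2 : t < N by lia.
    by rewrite esh ?(ltnW le2) // /sh le2 -[t.+1]/(off m 0 + t.+1) side_posE // eF0.
  have eh2 t : t < k' -> side_map h' a (n' + t.+1) = side_map g b t.+2.
    move=> lt_t; have le2 : n' + t.+1 < N by lia.
    have le1 : 1 <= m t.+1 by rewrite m1.
    have lt_t1 : t.+1 < k by rewrite ek.
    rewrite esh ?(ltnW le2) // /sh le2 /side_map eb2 //; congr amap.
    have -> : (n' + t.+1).+1 = off m t.+1 + 1 by rewrite coff_first ?(ltnW lt_t) // en; lia.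
    by rewrite side_posE // eF //; have [_ _ _ -> _] := cidP (side g t.+2).
  case: s => [_|[_|s]].
  - have -> : d (unsh k 0) = side_map h' a N by rewrite /d [unsh _ _]/= {1}ek /= coff_first' // -ek.
    rewrite esh // /sh ltnn [RHS]/= otgt_map; congr amap.
    by have [_ <-] := oN; rewrite otgt_src; have [_ ->] := oN.
  - rewrite ekg1 cell_at_tgt; last by have [oc _ _] := lf; exact: objects_inputs.
    rewrite [unsh _ _]/= -[LHS]/(ev (tU (crot f)) n'.+1 (outer (tV F') (side_map h' a))).
    have [_ _ ee _] := crot_tgt f; rewrite ee ?[uar _]enc ?en //.
    rewrite -[LHS]/(ev (tU f) (sh n n'.+1) _) -en /sh ltnn.
    apply: (@ev_ext (tU f) 0) => // -[//|[_ _|t lt_t _]]; first exact: eh1 0 isT.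
    have lt_t' : t < n' by move: lt_t; rewrite [uar _]en.
    rewrite [unsh _ _]/= -[LHS]/(ev (tU (F' t)) 0 (fun j => side_map h' a (off m' t + j))) eF' //.
    have et1 : side_map h' a (off m' t + 1) = side_map f c t.+2.
      by rewrite coff_first' ?(ltnW lt_t') // addn1 eh1.
    rewrite ev_cid_tgt et1 //; apply: amap_some; exact: (proj1 (oZ t.+1 lt_t')).
  move=> le_s; have lt_s : s < k' by rewrite ek in le_s.
  rewrite ekg // side_map_tgt [unsh _ _]/= -[LHS]/(side_map h' a (off m' n' + s.+1)).
  rewrite coff_first' // eh2 // /side_map eb2 //; congr amap.
  by have [_ <-] := oG s lt_s; rewrite otgt_src; have [_ ->] := oG s lt_s.
rewrite eFn -/d; have [_ _ _ etr] := crot_tgt g; rewrite etr ?[uar _]crot_arity //.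
rewrite -[tr (urot _) 0 k d _]/(tr (tU g) (sh k 0) (sh k k) (fun s => d (unsh k s)) _).
rewrite /sh ltnn lt0k (@tr_ext (tU g) 1 0 _ _ _ lt0k isT ed) tr_comp // tr_id //.
Qed.

End CellFirst.

Lemma src_cid S : cell_src (cid S) = vid (hcell_src S).
Proof. by have [] := cidP S. Qed.
Lemma tgt_cid S : cell_tgt (cid S) = vid (hcell_tgt S).
Proof. by have [] := cidP S. Qed.
Lemma src_crot f : cell_src (crot f) = vrot (cell_src f).
Proof. by have [] := crotP f. Qed.
Lemma tgt_crot f : cell_tgt (crot f) = vrot (cell_tgt f).
Proof. by have [] := crotP f. Qed.
Lemma src_ccomp g fs (p : @composable cell_graph g fs) :
  cell_src (ccomp p) = vcomp (composable_src p).
Proof. by have [] := ccompP p. Qed.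
Lemma tgt_ccomp g fs (p : @composable cell_graph g fs) :
  cell_tgt (ccomp p) = vcomp (composable_tgt p).
Proof. by have [] := ccompP p. Qed.

Lemma vcomp_recast g g' fs fs' (p : @composable madj_graph g fs) (eg : g = g') (ef : fs = fs') :
  exists p' : @composable madj_graph g' fs', vcomp p = vcomp p'.
Proof. by subst g' fs'; exists p. Qed.

Lemma crot_next g S l fs (p : @composable cell_graph g (cid S :: fs))
    (q : @composable cell_graph (crot g) (rcons fs (cid (hop (@cod cell_graph g))))) :
  @dom cell_graph g = S :: l -> crot (ccomp p) = ccomp q.
Proof.
move=> eg; have [ek eS _] := cdom_cons eg; set k' := size l in ek.
have szf : size fs = k' by have := ccomposable_size p; rewrite ek => -[].
have edom : @dom cell_graph (ccomp p) = S :: flatten [seq @dom cell_graph f | f <- fs].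
  by rewrite dom_ccomp [map _ _]/= [flatten _]/= -[X in X ++ _]/(@dom cell_graph (cid S)) dom_cid.
have ed : @dom cell_graph (crot (ccomp p)) = @dom cell_graph (ccomp q).
  rewrite (dom_crot edom) cod_ccomp dom_ccomp map_rcons flatten_rcons.
  by rewrite -[X in _ ++ X]/(@dom cell_graph (cid _)) dom_cid cats1.
have ec : @cod cell_graph (crot (ccomp p)) = @cod cell_graph (ccomp q).
  by rewrite (cod_crot edom) cod_ccomp (cod_crot eg).
have [_ esf] := side_dom ed ec.
apply: (crot_comp_next (k' := k') ek (ccomp_is p g) (ccomp_is q g)) => //.
- by rewrite eS.
- by move=> i lt_i; rewrite nth_rcons szf lt_i.
- by rewrite nth_rcons szf ltnn eqxx cod_cell hopK.
- rewrite src_crot !src_ccomp.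
  have [|p' ->] := @vcomp_recast _ _ _ (vid (hcell_src S) :: map cell_src fs)
    (composable_src p) erefl; first by rewrite map_cons src_cid.
  have [|q' ->] := @vcomp_recast _ _ _ (rcons (map cell_src fs)
    (vid (op (@cod madj_graph (cell_src g))))) (composable_src q) (src_crot g).
    by rewrite map_rcons src_cid.
  by apply: (vrot_next (l := map hcell_src l)); rewrite dom_src eg.
- rewrite tgt_crot !tgt_ccomp.
  have [|p' ->] := @vcomp_recast _ _ _ (vid (hcell_tgt S) :: map cell_tgt fs)
    (composable_tgt p) erefl; first by rewrite map_cons tgt_cid.
  have [|q' ->] := @vcomp_recast _ _ _ (rcons (map cell_tgt fs)
    (vid (op (@cod madj_graph (cell_tgt g))))) (composable_tgt q) (tgt_crot g).
    by rewrite map_rcons tgt_cid.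
  by apply: (vrot_next (l := map hcell_tgt l)); rewrite dom_tgt eg.
Qed.

Lemma map_src_cid l : map cell_src (map cid l) = map vid (map hcell_src l).
Proof. by rewrite -!map_comp; apply: eq_map => S; exact: src_cid. Qed.
Lemma map_tgt_cid l : map cell_tgt (map cid l) = map vid (map hcell_tgt l).
Proof. by rewrite -!map_comp; apply: eq_map => S; exact: tgt_cid. Qed.
Lemma flatten_dom_cid l : flatten [seq @dom cell_graph f | f <- map cid l] = l.
Proof. by elim: l => //= S l IH; rewrite IH -[X in X ++ _]/(@dom cell_graph (cid S)) dom_cid. Qed.

Lemma crot_first g f l l' y (p : @composable cell_graph g (f :: map cid l))
    (q : @composable cell_graph (crot f) (rcons (map cid l') (crot g))) :
  @dom cell_graph g = @cod cell_graph f :: l -> @dom cell_graph f = y :: l' ->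
  crot (ccomp p) = ccomp q.
Proof.
move=> eg ef; have [ek _ el] := cdom_cons eg; have [en _ el'] := cdom_cons ef.
set k' := size l in ek el; set n' := size l' in en el'.
have edom : @dom cell_graph (ccomp p) = y :: (l' ++ l).
  rewrite dom_ccomp [map _ _]/= [flatten _]/= -[X in X ++ _]/(@dom cell_graph f) ef.
  by rewrite flatten_dom_cid.
have ed : @dom cell_graph (crot (ccomp p)) = @dom cell_graph (ccomp q).
  rewrite (dom_crot edom) cod_ccomp dom_ccomp map_rcons flatten_rcons flatten_dom_cid.
  by rewrite (dom_crot eg) -rcons_cat.
have ec : @cod cell_graph (crot (ccomp p)) = @cod cell_graph (ccomp q).
  by rewrite (cod_crot edom) cod_ccomp (cod_crot ef).
have [_ esf] := side_dom ed ec.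
apply: (crot_comp_first (k' := k') (n' := n') ek en (ccomp_is p g) (ccomp_is q g)) => //.
- by move=> i lt_i; rewrite /= (nth_map (side g 0)) // el nth_mkseq.
- move=> i lt_i; rewrite nth_rcons size_map lt_i (nth_map (side g 0)) // el' nth_mkseq //.
- by rewrite nth_rcons size_map ltnn eqxx.
- rewrite src_crot !src_ccomp.
  have [|p' ->] := @vcomp_recast _ _ _ (cell_src f :: map vid (map hcell_src l))
    (composable_src p) erefl; first by rewrite map_cons map_src_cid.
  have [|q' ->] := @vcomp_recast _ _ _ (rcons (map vid (map hcell_src l')) (vrot (cell_src g)))
    (composable_src q) (src_crot f); first by rewrite map_rcons map_src_cid src_crot.
  by apply: (vrot_first (y := hcell_src y)); rewrite dom_src ?eg ?ef.
- rewrite tgt_crot !tgt_ccomp.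
  have [|p' ->] := @vcomp_recast _ _ _ (cell_tgt f :: map vid (map hcell_tgt l))
    (composable_tgt p) erefl; first by rewrite map_cons map_tgt_cid.
  have [|q' ->] := @vcomp_recast _ _ _ (rcons (map vid (map hcell_tgt l')) (vrot (cell_tgt g)))
    (composable_tgt q) (tgt_crot f); first by rewrite map_rcons map_tgt_cid tgt_crot.
  by apply: (vrot_first (y := hcell_tgt y)); rewrite dom_tgt ?eg ?ef.
Qed.

Definition cell_cyclic : cyclic_multicategory cell_graph :=
  @cyclic_of cell_graph cell_multi hop crot hopK dom_crot cod_crot crot_nullary
    crot_cycle crot_id crot_next crot_first.

(** * Horizontal identities and composition *)

Lemma src_comp_map g fs (p : @composable cell_graph g fs)
    (q : @composable madj_graph (cell_src g) [seq cell_src f | f <- fs]) :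
  cell_src (ccomp p) = vcomp q.
Proof. by rewrite src_ccomp; apply: vcomp_congr2. Qed.

Lemma tgt_comp_map g fs (p : @composable cell_graph g fs)
    (q : @composable madj_graph (cell_tgt g) [seq cell_tgt f | f <- fs]) :
  cell_tgt (ccomp p) = vcomp q.
Proof. by rewrite tgt_ccomp; apply: vcomp_congr2. Qed.

Definition src_map : cyclic_map cell_cyclic madj_cyclic :=
  @CyclicMap cell_graph madj_graph cell_cyclic madj_cyclic hcell_src cell_src dom_src
    (fun _ => erefl) src_cid src_comp_map (fun _ => erefl) src_crot.

Definition tgt_map : cyclic_map cell_cyclic madj_cyclic :=
  @CyclicMap cell_graph madj_graph cell_cyclic madj_cyclic hcell_tgt cell_tgt dom_tgt
    (fun _ => erefl) tgt_cid tgt_comp_map (fun _ => erefl) tgt_crot.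

Definition hid_square n (A : 'I_n.+1 -> category) (F : madj A) :
    square F F (fun i => id_functor (A i)).
Proof.
refine (@NatTrans _ _ (comp_functor (op_functor (id_functor (A ord0))) (F ord0))
  (comp_functor (F ord0) (prod_functor (fun j : but ord0 => id_functor (A (val j)))))
  (fun a => @idm (op (A ord0)) (F ord0 a)) _).
by move=> a b u; exact: etrans (compm_idl _) (esym (compm_idr _)).
Defined.

Definition hid_cell (F : vcell) : cell := Cell (hid_square F).

Lemma src_hid F : cell_src (hid_cell F) = F. Proof. by case: F. Qed.
Lemma tgt_hid F : cell_tgt (hid_cell F) = F. Proof. by case: F. Qed.

Lemma side_hid F i : side (hid_cell F) i = hidt (ucat (under F) i).
Proof. by []. Qed.

Lemma cell_at_hid F a : inputs (varity F) (ucat (under F)) a ->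
  cell_at (hid_cell F) a = ev (under F) 0 a.
Proof.
case: F => n A F o; have [b eb] := @inputsP (hid_cell (VCell F)) a o.
by rewrite (cell_atE eb) -[RHS]/(ev (sU (hid_cell (VCell F))) 0 a) (ev_inputs eb).
Qed.

Lemma hidt_op A : hop (hidt A) = hidt (op A).
Proof. by apply: (congr1 (@HCell (op A) (op A))); apply: functor_ext. Qed.

Lemma inputs_ev_src X a : inputs (uar X) (ucat X) a -> osrc (ev X 0 a) = ev X 0 a.
Proof.
by move=> o; rewrite ev_src //; apply: ev_ext => // j le_j ne; case: (o j) => //; lia.
Qed.

Lemma dom_hid F : @dom cell_graph (hid_cell F) = map hidt (@dom madj_graph F).
Proof. by rewrite /= -map_comp. Qed.

Lemma hid_id A : hid_cell (vid A) = cid (hidt A).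
Proof.
have [_ ec ee _] := under_realize (uid A).
apply: cell_ext_dom.
- by rewrite src_hid src_cid.
- by rewrite tgt_hid tgt_cid.
- by rewrite dom_hid dom_vid dom_cid.
- rewrite cod_cid -[LHS]/(hop (hidt (vcat (vid A) ord0))) hidt_op; congr hidt; exact: cod_vid.
move=> a o; rewrite src_hid in o; rewrite cell_at_hid //.
have [o1 o2] := o 1 isT isT; rewrite (ec 1) // in o1.
by rewrite cell_at_cid // amap_id // ee // uid_ev0.
Qed.

Lemma hid_comp g fs (p : @composable madj_graph g fs)
    (q : @composable cell_graph (hid_cell g) [seq hid_cell f | f <- fs]) :
  hid_cell (vcomp p) = ccomp q.
Proof.
have esrc : cell_src (ccomp q) = vcomp p.
  rewrite src_ccomp; apply: vcomp_congr2; rewrite ?src_hid //.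
  by rewrite -map_comp -[RHS]map_id; apply: eq_map => f; exact: src_hid.
apply: cell_ext_dom.
- by rewrite src_hid esrc.
- rewrite tgt_hid tgt_ccomp; apply: vcomp_congr2; rewrite ?tgt_hid //.
  by rewrite -map_comp -[LHS]map_id; apply: eq_map => f; rewrite /= tgt_hid.
- rewrite dom_hid dom_vcomp dom_ccomp map_flatten -!map_comp; congr flatten.
  by apply: eq_map => f /=; rewrite -map_comp.
- rewrite cod_ccomp -[LHS]/(hop (hidt (vcat (vcomp p) ord0))).
  by rewrite -[RHS]/(hop (hidt (vcat g ord0))) !hidt_op; congr hidt; exact: cod_vcomp.
move=> a o; rewrite src_hid in o; rewrite cell_at_hid //.
have ic := ccomp_is q (hid_cell g).
have [_ _ ee _] := ic_src ic; rewrite -esrc ee //.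
rewrite (ic_at ic); last by apply/(ic_inputs ic); rewrite -[carity _]/(varity (cell_src (ccomp q))) esrc.
have oi : inputs (off (arities (fun i => nth (hid_cell g) [seq hid_cell f | f <- fs] i))
   (carity (hid_cell g))) (cat_of (sU (hid_cell g))
   (sV (fun i => nth (hid_cell g) [seq hid_cell f | f <- fs] i))) a.
  by apply/(ic_inputs ic); rewrite -[carity _]/(varity (cell_src (ccomp q))) esrc.
have oo := outer_inputs (ic_joint ic) oi.
rewrite -[LHS]/(ev (sU (hid_cell g)) 0 (outer _ a)) /pasting_at.
have esg := src_hid g; have etg := tgt_hid g.
rewrite cell_at_hid; last by move: oo; rewrite esg.
have -> : ev (tU (hid_cell g)) 0 (arg_cells (hid_cell g) (fun i => nth (hid_cell g) [seq hid_cell f | f <- fs] i) a)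
    = ev (under g) 0 (outer (sV (fun i => nth (hid_cell g) [seq hid_cell f | f <- fs] i)) a).
  rewrite etg; apply: (@ev_ext (under g) 0) => // -[//|i] lt_i _.
  have lt_fs : i < size fs by rewrite (composable_size p).
  have lt_i' : i < carity (hid_cell g) by [].
  have := inner_inputs lt_i' oi.
  rewrite -[arg_cells _ _ _ _]/(cell_at (nth (hid_cell g) [seq hid_cell f | f <- fs] i) (inner _ _ a i)).
  rewrite -[outer _ _ _]/(ev (sU (nth (hid_cell g) [seq hid_cell f | f <- fs] i)) 0 _).
  rewrite (nth_map g) // src_hid => oj; rewrite cell_at_hid //.
  by apply: (@ev_ext (under (nth g fs i)) 0) => // -[].
rewrite esg; have {}oo : inputs (uar (under g)) (ucat (under g))
    (outer (sV (fun i => nth (hid_cell g) [seq hid_cell f | f <- fs] i)) a).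
  by move: oo; rewrite esg.
by rewrite -[RHS](congr1 (ocomp _) (inputs_ev_src oo)) ocomp_src.
Qed.

Lemma cell_act_hid F i a x : i <= varity F -> elt (under F) a i x -> cell_act (hid_cell F) i a x = x.
Proof.
case: F => n A F; set f := hid_cell _ => le_i l.
have ea : forall j, j <= uar (tU f) -> side_map f a j = a j.
  by move=> j le_j; have [o _ _] := l; apply: amap_id; case: (o j le_j).
have case0 y : elt (sU f) a 0 y -> cell_act f 0 a y = y.
  move=> l0; have [o ey _] := l0; rewrite cell_act0 // cell_at_hid; last exact: objects_inputs.
  rewrite -[RHS]ocomp_src ey; congr ocomp; apply: amap_id.
  rewrite -ocat_src ey ocat_op (@ev_cat (sU f)) //; first by rewrite /= opK.
  exact: (objectsT (i := 0) o).
have l0 : elt (sU f) a 0 (tr (sU f) i 0 a x) by apply: (@tr_element (sU f)) l.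
have -> : x = tr (sU f) 0 i a (tr (sU f) i 0 a x).
  by rewrite tr_comp ?(@tr_id (sU f)).
rewrite cell_act_tr // case0 // (@tr_ext (tU f) 0 i _ _ _ isT le_i ea) -[tU f]/(sU f).
by rewrite tr_comp.
Qed.

Lemma hid_rot F : hid_cell (vrot F) = crot (hid_cell F).
Proof.
have [en ec ee et] := under_vrot F.
apply: (@cell_ext_act 0) => //.
- by rewrite src_hid src_crot src_hid.
- by rewrite tgt_hid tgt_crot tgt_hid.
- move=> i le_i; have [_ _ eS _] := crotP (hid_cell F).
  by rewrite eS // !side_hid ec.
move=> a x; rewrite src_hid => l; rewrite cell_act_hid //.
have l' : elt (sU (crot (hid_cell F))) a 0 x by rewrite src_crot src_hid.
rewrite cell_act_rot // cell_act_hid ?sh_leq //.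
by have := proj1 (crot_elt a x (leq0n _)) l'; rewrite src_hid.
Qed.

Definition hid_map : cyclic_map madj_cyclic cell_cyclic :=
  @CyclicMap madj_graph cell_graph madj_cyclic cell_cyclic hidt hid_cell dom_hid
    (fun F => hidt_op _) hid_id hid_comp (fun A => esym (hidt_op A)) hid_rot.

(** Horizontal composites are total functions, so that they do not depend on a proof of
    composability; they are meaningful for composable arguments. *)
Lemma hcomp_fun_ex (S T : hcell) : exists H : hcell, hcell_tgt S = hcell_src T ->
  [/\ hcell_src H = hcell_src S, hcell_tgt H = hcell_tgt T &
      forall x, amap H x = amap T (amap S x)].
Proof.
case: S T => C D S [D' E T].
have [e|ne] := classic (hcell_tgt (HCell S) = hcell_src (HCell T)); last by exists (HCell S).
rewrite /= in e; subst D'; exists (HCell (comp_functor T S)) => _; split=> // x.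
have [|n] := classic (ocat x = Some C).
  by case/ocatP=> [x1 [y [f ->]]]; rewrite !amapE.
rewrite (@amap_none (HCell (comp_functor T S))) // (@amap_none (HCell S)) //.
by rewrite amap_none.
Qed.

Definition hcomp_fun (S T : hcell) : hcell :=
  proj1_sig (constructive_indefinite_description _ (hcomp_fun_ex S T)).

Lemma hcomp_funP S T : hcell_tgt S = hcell_src T ->
  [/\ hcell_src (hcomp_fun S T) = hcell_src S, hcell_tgt (hcomp_fun S T) = hcell_tgt T &
      forall x, amap (hcomp_fun S T) x = amap T (amap S x)].
Proof. exact: (proj2_sig (constructive_indefinite_description _ (hcomp_fun_ex S T))). Qed.

Lemma hcomp_fun_uniq S T H : hcell_tgt S = hcell_src T ->
  hcell_src H = hcell_src S -> hcell_tgt H = hcell_tgt T ->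
  (forall x, amap H x = amap T (amap S x)) -> hcomp_fun S T = H.
Proof.
move=> /hcomp_funP[es et em] es' et' em'; apply: hcell_ext; rewrite ?es ?et //.
by move=> x; rewrite em em'.
Qed.

Lemma hcomp_funE C D E (S : functor C D) (T : functor D E) :
  hcomp_fun (HCell S) (HCell T) = HCell (comp_functor T S).
Proof.
apply: hcomp_fun_uniq => // x; have [|n] := classic (ocat x = Some C).
  by case/ocatP=> [x1 [y [f ->]]]; rewrite !amapE.
rewrite (@amap_none (HCell (comp_functor T S))) // (@amap_none (HCell S)) //.
by rewrite amap_none.
Qed.

Lemma hcomp_fun_op S T : hcell_tgt S = hcell_src T -> hcomp_fun (hop S) (hop T) = hop (hcomp_fun S T).
Proof.
move=> e; have [es et em] := hcomp_funP e.
apply: hcomp_fun_uniq; rewrite /= ?e ?es ?et // => x.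
by rewrite !amap_hop em oopK.
Qed.

Lemma hcomp_fun_idl S : hcomp_fun (hidt (hcell_src S)) S = S.
Proof.
apply: hcomp_fun_uniq => // x; have [e|n] := classic (ocat x = Some (hcell_src S)).
  by rewrite amap_id.
by rewrite (amap_none n) (@amap_none (hidt _)) // amap_none.
Qed.

Lemma hcomp_fun_idr S : hcomp_fun S (hidt (hcell_tgt S)) = S.
Proof.
apply: hcomp_fun_uniq => // x; have [e|n] := classic (ocat x = Some (hcell_src S)).
  by rewrite amap_id // amap_some.
by rewrite (amap_none n) amap_none.
Qed.

Lemma hcomp_fun_assoc S T U : hcell_tgt S = hcell_src T -> hcell_tgt T = hcell_src U ->
  hcomp_fun (hcomp_fun S T) U = hcomp_fun S (hcomp_fun T U).
Proof.
move=> e e'; have [es et em] := hcomp_funP e; have [es' et' em'] := hcomp_funP e'.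
have e1 : hcell_tgt (hcomp_fun S T) = hcell_src U by rewrite et.
have e2 : hcell_tgt S = hcell_src (hcomp_fun T U) by rewrite es'.
have [es2 et2 em2] := hcomp_funP e2.
apply: hcomp_fun_uniq; rewrite ?es2 ?et2 // => x.
by rewrite em2 em' em.
Qed.

Lemma hcell_comp_ex (f g : cell) : exists h : cell, cell_tgt f = cell_src g ->
  [/\ cell_src h = cell_src f, cell_tgt h = cell_tgt g,
      forall i, i <= carity f -> side h i = hcomp_fun (side f i) (side g i) &
      forall a, inputs (carity f) (ucat (sU f)) a ->
        cell_at h a = ocomp (cell_at g (side_map f a)) (amap (hop (side g 0)) (cell_at f a))].
Proof.
have [e|ne] := classic (cell_tgt f = cell_src g); last by exists f.
have [|h hP] := @hcomp_cell_exists f g (fun i => hcomp_fun (side f i) (side g i)) e; last by exists h.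
move=> i le_i; apply: hcomp_funP.
by rewrite -[LHS]/(ucat (tU f) i) e.
Qed.

Definition hcell_comp (f g : cell) : cell :=
  proj1_sig (constructive_indefinite_description _ (hcell_comp_ex f g)).

Section HCellComp.
Variables f g : cell.
Hypothesis e : cell_tgt f = cell_src g.
Local Notation h := (hcell_comp f g).

Lemma hcell_compP :
  [/\ cell_src h = cell_src f, cell_tgt h = cell_tgt g,
      forall i, i <= carity f -> side h i = hcomp_fun (side f i) (side g i) &
      forall a, inputs (carity f) (ucat (sU f)) a ->
        cell_at h a = ocomp (cell_at g (side_map f a)) (amap (hop (side g 0)) (cell_at f a))].
Proof. exact: (proj2_sig (constructive_indefinite_description _ (hcell_comp_ex f g))). Qed.

Lemma hcomp_arity : carity g = carity f /\ carity h = carity f.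
Proof.
have [es _ _ _] := hcell_compP; split; first exact: esym (congr1 varity e).
exact: (congr1 varity es).
Qed.

Lemma side_joint i : hcell_tgt (side f i) = hcell_src (side g i).
Proof. by rewrite -[LHS]/(ucat (tU f) i) e. Qed.

(** Horizontal composition composes the actions, because S_0 preserves composition at the root and
    the action of [g] commutes with transposition. *)
Lemma cell_act_hcomp i a x : i <= carity f -> elt (sU f) a i x ->
  cell_act h i a x = cell_act g i (side_map f a) (cell_act f i a x).
Proof.
have [es et eS ec] := hcell_compP; have [eng enh] := hcomp_arity.
have case0 y : elt (sU f) a 0 y -> cell_act h 0 a y = cell_act g 0 (side_map f a) (cell_act f 0 a y).
  move=> l; have lf := cell_act_elt (leq0n _) l; have [o ey _] := l.
  have lg : elt (sU g) (side_map f a) 0 (cell_act f 0 a y) by rewrite -e.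
  have lh : elt (sU h) a 0 y by rewrite es.
  rewrite cell_act0 // (cell_act0 lg) cell_act0 // ec; last exact: objects_inputs.
  have [_ _ em] := hcomp_funP (side_joint 0); rewrite eS // em oop_comp amap_hop oopK.
  rewrite ocompA -amap_comp // osrc_map ey otgt_op cell_at_src; last exact: objects_inputs.
  by rewrite amap_hop oopK.
move=> le_i l.
have l0 : elt (sU f) a 0 (tr (sU f) i 0 a x) by apply: (@tr_element (sU f)) l.
have -> : x = tr (sU f) 0 i a (tr (sU f) i 0 a x) by rewrite tr_comp ?(@tr_id (sU f)).
set y := tr _ i 0 a x in l0 *.
have lf := cell_act_elt (leq0n _) l0.
have lg : elt (sU g) (side_map f a) 0 (cell_act f 0 a y) by rewrite -e.
rewrite cell_act_tr //.
have -> : tr (sU f) 0 i a y = tr (sU h) 0 i a y by rewrite es.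
rewrite cell_act_tr ?enh //; last by rewrite es.
rewrite e cell_act_tr ?eng // case0 // et; apply: tr_ext; rewrite ?[uar _]eng // => j le_j.
by rewrite /side_map eS //; have [_ _ ->] := hcomp_funP (side_joint j).
Qed.

End HCellComp.

Lemma zip_mkseq (S T : Type) (f : nat -> S) (g : nat -> T) n :
  zip (mkseq f n) (mkseq g n) = mkseq (fun i => (f i, g i)) n.
Proof. exact: zip_map. Qed.

Local Notation pobj := (@pb_graph _ _ _ _ _ _ tgt_map src_map).
Local Notation pM := (pb_cyclic tgt_map src_map).

Definition hcomp_obj (x : obj pobj) : hcell := hcomp_fun (pb1 x) (pb2 x).
Definition hcomp_mmap (x : mmap pobj) : cell := hcell_comp (pb1 x) (pb2 x).

Lemma map_hcomp_obj (l : seq (obj pobj)) :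
  map hcomp_obj l = [seq hcomp_fun p.1 p.2 | p <- zip (map (fun x : obj pobj => pb1 x) l)
                                          (map (fun x : obj pobj => pb2 x) l)].
Proof. by elim: l => //= x l ->. Qed.

Lemma dom_hcomp (x : mmap pobj) : @dom cell_graph (hcomp_mmap x) = map hcomp_obj (dom x).
Proof.
have [es et eS _] := hcell_compP (pb_eq x : cell_tgt _ = cell_src _).
have [eng enh] := hcomp_arity (pb_eq x : cell_tgt _ = cell_src _).
rewrite map_hcomp_obj pb_dom1 pb_dom2 !dom_cell eng enh zip_mkseq -map_comp.
apply/eq_in_map => j; rewrite mem_iota => /andP[_ lt_j] /=.
by rewrite eS.
Qed.

Lemma cod_hcomp (x : mmap pobj) : @cod cell_graph (hcomp_mmap x) = hcomp_obj (cod x).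
Proof.
have e : cell_tgt (pb1 x) = cell_src (pb2 x) := pb_eq x.
have [_ _ eS _] := hcell_compP e.
rewrite cod_cell eS // -hcomp_fun_op; last exact: side_joint.
by rewrite -!cod_cell.
Qed.

Lemma src_hcomp (x : mmap pobj) : cell_src (hcomp_mmap x) = cell_src (pb1 x).
Proof. by have [] := hcell_compP (pb_eq x : cell_tgt _ = cell_src _). Qed.
Lemma tgt_hcomp (x : mmap pobj) : cell_tgt (hcomp_mmap x) = cell_tgt (pb2 x).
Proof. by have [] := hcell_compP (pb_eq x : cell_tgt _ = cell_src _). Qed.

Lemma hcomp_inv (x : obj pobj) : hcomp_obj (invol pM x) = hop (hcomp_obj x).
Proof. by apply: hcomp_fun_op; exact: (pb_eq x). Qed.

Lemma hcomp_id (x : obj pobj) : hcomp_mmap (mid pM x) = cid (hcomp_obj x).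
Proof.
have ex : hcell_tgt (pb1 x) = hcell_src (pb2 x) := pb_eq x.
have e : cell_tgt (cid (pb1 x)) = cell_src (cid (pb2 x)) by rewrite tgt_cid src_cid ex.
have [hs ht hm] := hcomp_funP ex; have [_ _ _ ec] := hcell_compP e.
apply: cell_ext_dom.
- by rewrite src_hcomp !src_cid hs.
- by rewrite tgt_hcomp !tgt_cid ht.
- by rewrite dom_hcomp dom_cid (@dom_id _ pM).
- by rewrite cod_hcomp cod_cid (@cod_id _ pM).
move=> a; rewrite src_hcomp => o.
have en := cid_arity (pb1 x).
have o' : inputs (carity (cid (pb1 x))) (ucat (sU (cid (pb1 x)))) a.
  by have [_ e1] := hcomp_arity e; move: o; rewrite [carity _]e1.
have [o1 o2] := o' 1 isT (eq_leq (esym en)).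
have ens : uar (sU (cid (pb1 x))) = 1 := en.
have [_ ecs _ _] := cid_src (pb1 x); rewrite ecs ?ens // in o1.
have [_ _ c0 c1 _] := cidP (pb1 x); have [_ _ d0 d1 _] := cidP (pb2 x).
rewrite -[LHS]/(cell_at (hcell_comp (cid (pb1 x)) (cid (pb2 x))) a) ec //.
rewrite -[RHS]/(cell_at (cid (hcomp_fun (pb1 x) (pb2 x))) a) [RHS]cell_at_cid ?hs // (cell_at_cid o1 o2).
have em : side_map (cid (pb1 x)) a 1 = amap (pb1 x) (a 1) by rewrite /side_map c1.
have om1 : ocat (side_map (cid (pb1 x)) a 1) = Some (hcell_src (pb2 x)).
  by rewrite em amap_some // ex.
have om2 : osrc (side_map (cid (pb1 x)) a 1) = side_map (cid (pb1 x)) a 1.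
  by rewrite em osrc_map o2.
rewrite (cell_at_cid om1 om2) em d0 hopK hm; set X := amap (pb2 x) _.
have eX : osrc X = X by rewrite /X !osrc_map o2.
by rewrite -{2}eX ocomp_src.
Qed.

Lemma hcomp_crot f g : cell_tgt f = cell_src g ->
  hcell_comp (crot f) (crot g) = crot (hcell_comp f g).
Proof.
move=> e; have e' : cell_tgt (crot f) = cell_src (crot g) by rewrite tgt_crot src_crot e.
have [es et eS _] := hcell_compP e; have [es' et' eS' _] := hcell_compP e'.
have [eng enh] := hcomp_arity e; have [_ enh'] := hcomp_arity e'.
have [_ _ eSf _] := crotP f; have [_ _ eSg _] := crotP g; have [_ _ eSh _] := crotP (hcell_comp f g).
have enf : carity (crot f) = carity f := crot_arity f.
have esrc : cell_src (hcell_comp (crot f) (crot g)) = cell_src (crot (hcell_comp f g)).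
  by rewrite es' !src_crot es.
apply: (@cell_ext_act 0) => //.
- by rewrite et' !tgt_crot et.
- move=> i; rewrite enh' enf => le_i; rewrite eS' ?enf // eSf // eSg ?eng // eSh ?enh //.
  by rewrite eS ?sh_leq.
move=> a x l; have l2 : elt (sU (crot (hcell_comp f g))) a 0 x by rewrite -esrc.
have l1 : elt (sU (crot f)) a 0 x by rewrite -es'.
have lf := proj1 (crot_elt a x (leq0n _)) l1.
have lp := cell_act_elt (leq0n _) l1.
have lg : elt (sU (crot g)) (side_map (crot f) a) 0 (cell_act (crot f) 0 a x) by rewrite -e'.
rewrite cell_act_hcomp // cell_act_rot // cell_act_rot // [RHS]cell_act_rot // enh cell_act_hcomp ?sh_leq // eng.
apply: cell_act_ext; rewrite ?eng ?sh_leq // => j le_j.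
by rewrite /side_map eSf ?unsh_leq // unshK.
Qed.

Lemma hcomp_rot (x : mmap pobj) : hcomp_mmap (sigma pM x) = crot (hcomp_mmap x).
Proof. exact: (hcomp_crot (pb_eq x)). Qed.

Section Interchange.
Variables (g1 g2 h1 h2 : cell) (F1 F2 : nat -> cell).
Hypothesis eg : cell_tgt g1 = cell_src g2.
Hypothesis eF : forall q, q < carity g1 -> cell_tgt (F1 q) = cell_src (F2 q).
Hypothesis ic1 : is_ccomp g1 F1 h1.
Hypothesis ic2 : is_ccomp g2 F2 h2.
Hypothesis eh : cell_tgt h1 = cell_src h2.
Local Notation gg := (hcell_comp g1 g2).
Local Notation FF := (fun q => hcell_comp (F1 q) (F2 q)).
Local Notation k := (carity g1).

(** After expanding both sides, the components of [g2] and the images under [g2] of the components of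
    the arguments [F1 q] occur in opposite orders; they are exchanged by the naturality of [g2]. *)
Lemma cell_at_interchange h a : is_ccomp gg FF h -> inputs (carity h1) (ucat (sU h1)) a ->
  inputs (carity h) (ucat (sU h)) a -> cell_at (hcell_comp h1 h2) a = cell_at h a.
Proof.
move=> ic o1 o.
have [esg etg eSg ecg] := hcell_compP eg; have [_ _ _ ech] := hcell_compP eh.
have [eng enh] := hcomp_arity eg; have [enh2 _] := hcomp_arity eh.
have oi := proj1 (ic_inputs ic1 _) o1.
have oi' := proj1 (ic_inputs ic _) o.
have em q : q < k -> carity (FF q) = carity (F1 q) by move=> /eF/hcomp_arity[].
have em2 q : q < k -> carity (F2 q) = carity (F1 q) by move=> /eF/hcomp_arity[].
have eo q : q <= k -> off (arities FF) q = off (arities F1) q.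
  by move=> le_q; apply: (off_le_eq le_q) => r /em.
have eo2 q : q <= k -> off (arities F2) q = off (arities F1) q.
  by move=> le_q; apply: (off_le_eq le_q) => r /em2.
set b := side_map h1 a.
have ob : inputs (carity h2) (ucat (sU h2)) b by rewrite enh2 -eh; exact: side_map_inputs.
have oi2 := proj1 (ic_inputs ic2 _) ob.
rewrite ech // (ic_at ic1) // (ic_at ic2) // (ic_at ic) // /pasting_at.
rewrite (ic_side ic2) // [side_pos g2 F2 0]/=.
have o1' := outer_inputs (ic_joint ic1) oi.
have o2' := outer_inputs (ic_joint ic2) oi2.
have eout q : q <= k -> outer (sV FF) a q = outer (sV F1) a q.
  case: q => [//|q] lt_q; rewrite -[LHS]/(ev (sU (FF q)) 0 (fun j => a (off (arities FF) q + j))).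
  by have [-> _ _ _] := hcell_compP (eF lt_q); rewrite eo // ltnW.
rewrite (cell_at_ext (f := gg) (b := outer (sV F1) a)); last by move=> j _; rewrite enh; exact: eout.
rewrite ecg // etg.
have ekq q : q < k -> arg_cells gg FF a q.+1 = ocomp (arg_cells g2 F2 b q.+1) (side_map g2 (arg_cells g1 F1 a) q.+1).
  move=> lt_q; have lt_q2 : q < carity g2 by rewrite eng.
  have [esF _ _ ecF] := hcell_compP (eF lt_q).
  have ei j : j <= carity (F1 q) -> 0 < j -> inner (sU gg) (sV FF) a q j = inner (sU g1) (sV F1) a q j.
    by case: j => //= j _ _; rewrite eo // ltnW.
  rewrite -[LHS]/(cell_at (FF q) (inner (sU gg) (sV FF) a q)).
  rewrite (cell_at_ext (f := FF q) (b := inner (sU g1) (sV F1) a q)); last first.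
    by move=> j lt0j; rewrite em // => le_j; apply: ei.
  rewrite ecF; last exact: inner_inputs.
  rewrite -[arg_cells g2 F2 b q.+1]/(cell_at (F2 q) (inner (sU g2) (sV F2) b q)).
  rewrite /side_map (ic_joint ic2) //; congr ocomp.
  apply: cell_at_ext => -[//|j] _; rewrite em2 // => le_j.
  rewrite -[RHS]/(b (off (arities F2) q + j.+1)) eo2 ?(ltnW lt_q) // /b /side_map (ic_side ic1); last exact: off_leq.
  by rewrite side_posE.
have eob q : q < k -> outer (sV F2) b q.+1 = otgt (arg_cells g1 F1 a q.+1).
  move=> lt_q; rewrite arg_cells_tgt // -[LHS]/(ev (sU (F2 q)) 0 (fun j => b (off (arities F2) q + j))) -eF //.
  apply: (@ev_ext (tU (F1 q)) 0) => // j le_j ne; rewrite eo2 ?(ltnW lt_q) //.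
  by rewrite /b /side_map (ic_side ic1) //; apply: off_leq.
have fitk q : q < k -> osrc (arg_cells g2 F2 b q.+1) = otgt (side_map g2 (arg_cells g1 F1 a) q.+1).
  move=> lt_q; have lt_q2 : q < carity g2 by rewrite eng.
  by rewrite (arg_cells_src (ic_joint ic2) lt_q2 oi2) side_map_tgt /side_map eob.
have -> : ev (tU g2) 0 (arg_cells gg FF a) =
    ocomp (ev (tU g2) 0 (arg_cells g2 F2 b)) (ev (tU g2) 0 (side_map g2 (arg_cells g1 F1 a))).
  rewrite -ev_comp //; last first.
    by case=> [//|q]; rewrite [uar _]eng => lt_q _; exact: fitk.
  by apply: (@ev_ext (tU g2) 0) => // -[//|q]; rewrite [uar _]eng => lt_q _; exact: ekq.
have tk : typed (carity g2) (ucat (sU g2)) 0 (arg_cells g1 F1 a).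
  by rewrite eng -eg => -[//|q] lt_q _; apply: arg_cells_cat => //; exact: (ic_joint ic1).
have nat2 := cell_at_nat tk.
rewrite (cell_at_ext (b := outer (sV F2) b)) in nat2; last first.
  by case=> [//|q] _; rewrite eng => lt_q; rewrite eob.
rewrite (cell_at_ext (a := fun j => osrc _) (b := side_map g1 (outer (sV F1) a))) in nat2; last first.
  by case=> [//|q] _; rewrite eng => lt_q; rewrite arg_cells_src //; exact: (ic_joint ic1).
rewrite -!ocompA; congr ocomp; rewrite amap_comp; last first.
  by rewrite (ev_arg_cells_src (ic_joint ic1)).
by rewrite !ocompA -nat2 eg.
Qed.

End Interchange.

Lemma hcomp_comp (g : mmap pobj) (fs : seq (mmap pobj)) (p : composable g fs)
    (q : @composable cell_graph (hcomp_mmap g) [seq hcomp_mmap f | f <- fs]) :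
  hcomp_mmap (mcomp pM p) = ccomp q.
Proof.
pose p1 : @composable cell_graph (pb1 g) [seq pb1 f | f <- fs] := pb_composable1 p.
pose p2 : @composable cell_graph (pb2 g) [seq pb2 f | f <- fs] := pb_composable2 p.
have eh : cell_tgt (ccomp p1) = cell_src (ccomp p2) := pb_eq (mcomp pM p).
have esz : size fs = carity (pb1 g) by have := ccomposable_size p1; rewrite size_map.
have esrc : cell_src (hcomp_mmap (mcomp pM p)) = cell_src (ccomp q).
  rewrite src_hcomp -[pb1 (mcomp pM p)]/(ccomp p1) !src_ccomp; apply: vcomp_congr2.
    by rewrite src_hcomp.
  by rewrite -!map_comp; apply: eq_map => f; rewrite /= src_hcomp.
apply: cell_ext_dom => //.
- rewrite tgt_hcomp -[pb2 (mcomp pM p)]/(ccomp p2) !tgt_ccomp; apply: vcomp_congr2.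
    by rewrite tgt_hcomp.
  by rewrite -!map_comp; apply: eq_map => f; rewrite /= tgt_hcomp.
- rewrite dom_hcomp (@dom_comp _ pM) dom_ccomp map_flatten -!map_comp; congr flatten.
  by apply: eq_map => f; exact: (esym (dom_hcomp f)).
- by rewrite cod_hcomp (@cod_comp _ pM) cod_ccomp cod_hcomp.
move=> a o; have [_ enh] := hcomp_arity eh.
pose F1 i := nth (pb1 g) [seq pb1 f | f <- fs] i.
pose F2 i := nth (pb2 g) [seq pb2 f | f <- fs] i.
have eFq i : i < carity (pb1 g) -> nth (hcomp_mmap g) [seq hcomp_mmap f | f <- fs] i =
    hcell_comp (F1 i) (F2 i) /\ cell_tgt (F1 i) = cell_src (F2 i).
  move=> lt_i; have lt_fs : i < size fs by rewrite esz.
  by rewrite /F1 /F2 !(nth_map g) //; split=> //; exact: (pb_eq (nth g fs i)).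
have [_ enh2] := hcomp_arity (pb_eq g : cell_tgt _ = cell_src _).
have ic : is_ccomp (hcomp_mmap g) (fun i => hcell_comp (F1 i) (F2 i)) (ccomp q).
  apply: is_ccomp_congr (ccomp_is q (hcomp_mmap g)) => i; rewrite enh2 => lt_i.
  by case: (eFq i lt_i).
have ic1 : is_ccomp (pb1 g) F1 (ccomp p1) := ccomp_is p1 _.
have ic2 : is_ccomp (pb2 g) F2 (ccomp p2) := ccomp_is p2 _.
apply: (cell_at_interchange (pb_eq g) (fun i lt_i => proj2 (eFq i lt_i)) ic1 ic2 eh ic).
  by move: o; rewrite src_hcomp [carity _]enh.
by move: o; rewrite esrc -[carity (hcomp_mmap _)]/(varity (cell_src (hcomp_mmap (mcomp pM p)))) esrc.
Qed.

Definition hcomp_map : cyclic_map pM cell_cyclic :=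
  @CyclicMap pobj cell_graph pM cell_cyclic hcomp_obj hcomp_mmap dom_hcomp cod_hcomp hcomp_id hcomp_comp
    hcomp_inv hcomp_rot.

Lemma laws_objects : @category_laws _ _ (on_obj src_map) (on_obj tgt_map) (on_obj hid_map)
  (on_obj hcomp_map).
Proof.
split=> //.
- by move=> x; have [es et _] := hcomp_funP (pb_eq x : hcell_tgt _ = hcell_src _).
- by move=> S e; exact: hcomp_fun_idl.
- by move=> S e; exact: hcomp_fun_idr.
by move=> S T U e e' e1 e2; exact: hcomp_fun_assoc.
Qed.

Lemma hcell_idl f : hcell_comp (hid_cell (cell_src f)) f = f.
Proof.
have e := tgt_hid (cell_src f); have [es et eS ec] := hcell_compP e.
have [_ enh] := hcomp_arity e.
rewrite src_hid in es.
apply: cell_ext => //.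
  by move=> i; rewrite enh => le_i; rewrite eS //; exact: (hcomp_fun_idl (side f i)).
move=> a; rewrite es => o; rewrite enh in o.
have o1 : inputs (carity (hid_cell (cell_src f))) (ucat (sU (hid_cell (cell_src f)))) a.
  by rewrite src_hid.
rewrite ec // cell_at_hid // -cell_at_src //.
rewrite (cell_at_ext (b := a)) ?ocomp_src // => j lt0j le_j.
by rewrite /side_map side_hid amap_id //; case: (o j).
Qed.

Lemma hcell_idr f : hcell_comp f (hid_cell (cell_tgt f)) = f.
Proof.
have e : cell_tgt f = cell_src (hid_cell (cell_tgt f)) by rewrite src_hid.
have [es et eS ec] := hcell_compP e.
have [_ enh] := hcomp_arity e.
rewrite tgt_hid in et.
apply: cell_ext => //.
  by move=> i; rewrite enh => le_i; rewrite eS //; exact: (hcomp_fun_idr (side f i)).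
move=> a; rewrite es enh => o.
rewrite ec // cell_at_hid; last exact: side_map_inputs.
rewrite side_hid hidt_op amap_id; last by rewrite cell_at_ocat.
by rewrite -cell_at_tgt // ocomp_tgt.
Qed.

Lemma hcell_assoc f g h : cell_tgt f = cell_src g -> cell_tgt g = cell_src h ->
  hcell_comp (hcell_comp f g) h = hcell_comp f (hcell_comp g h).
Proof.
move=> e e'; have [es et eS ec] := hcell_compP e; have [es' et' eS' ec'] := hcell_compP e'.
have e1 : cell_tgt (hcell_comp f g) = cell_src h by rewrite et.
have e2 : cell_tgt f = cell_src (hcell_comp g h) by rewrite es'.
have [es1 et1 eS1 ec1] := hcell_compP e1; have [es2 et2 eS2 ec2] := hcell_compP e2.
have [enh1 enh2] := hcomp_arity e1; have [eng _] := hcomp_arity e.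
have [_ enfg] := hcomp_arity e.
apply: cell_ext; rewrite ?es1 ?es2 ?es ?et1 ?et2 ?et' //.
  move=> i; rewrite enh2 enfg => le_i; rewrite eS1 ?enfg // eS2 // eS // eS' ?eng //.
  by apply: hcomp_fun_assoc; exact: side_joint.
move=> a; rewrite enh2 enfg => o.
have og : inputs (carity g) (ucat (sU g)) (side_map f a) by rewrite eng -e; exact: side_map_inputs.
rewrite ec1 ?es ?enfg // ec // ec2 // ec' // eS' //.
have [_ _ em] := hcomp_funP (side_joint e' 0).
rewrite amap_comp; last by rewrite cell_at_src // otgt_map cell_at_tgt // e.
rewrite ocompA; congr ocomp; last first.
  by rewrite !amap_hop oopK em.
congr ocomp; apply: cell_at_ext => j lt0j le_j.
have le_j' : j <= carity f by move: le_j; rewrite enh1 enfg.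
by rewrite /side_map eS //; have [_ _ ->] := hcomp_funP (side_joint e j).
Qed.

Lemma laws_cells : @category_laws _ _ (on_mmap src_map) (on_mmap tgt_map) (on_mmap hid_map)
  (on_mmap hcomp_map).
Proof.
split.
- by split=> F; [exact: src_hid | exact: tgt_hid].
- by move=> x; split; [exact: src_hcomp | exact: tgt_hcomp].
- by move=> f e; exact: hcell_idl.
- by move=> f e; exact: hcell_idr.
by move=> f g h e e' e1 e2; exact: hcell_assoc.
Qed.

Definition MAdj_double : cyclic_double_multicategory madj_graph cell_graph :=
  @CyclicDouble madj_graph cell_graph madj_cyclic cell_cyclic src_map tgt_map hid_map
    hcomp_map laws_objects laws_cells.

(** * Squares, pasting and mates *)

Lemma objects_full_family n (A : 'I_n.+1 -> category) (a : forall j, A j) :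
  objects n (ncat A) (full_family (fun j => idm (a j))).
Proof. by []. Qed.

Lemma paste_squares C D (T : functor C D) (c1 c2 c3 c4 : C) (d1 d2 : D)
    (x : Hom c1 c2) (q : Hom c2 c3) (q' : Hom c1 c4) (x' : Hom c4 c3)
    (p : Hom (T c3) d2) (p' : Hom (T c4) d1) (y : Hom d1 d2) :
  compm q x = compm x' q' -> compm p (fmap T x') = compm y p' ->
  compm (compm p (fmap T q)) (fmap T x) = compm y (compm p' (fmap T q')).
Proof.
by move=> e e'; rewrite -compm_assoc -fmap_comp e fmap_comp compm_assoc e' compm_assoc.
Qed.

Section HSquare.
Variables (n : nat) (A B C : 'I_n.+1 -> category) (F : madj A) (G : madj B) (K : madj C).
Variables (S : forall i, functor (A i) (B i)) (T : forall i, functor (B i) (C i)).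
Variables (alpha : square F G S) (beta : square G K T).

Definition hcomp_square : square F K (fun i => comp_functor (T i) (S i)).
Proof.
refine (@NatTrans _ _
  (comp_functor (op_functor (comp_functor (T ord0) (S ord0))) (F ord0))
  (comp_functor (K ord0) (prod_functor (fun j : but ord0 => comp_functor (T (val j)) (S (val j)))))
  (fun a => compm (beta (fun j => S (val j) (a j)))
                 (fmap (op_functor (T ord0)) (alpha a))) _).
move=> a b u.
exact: (@paste_squares (op (B ord0)) (op (C ord0)) (op_functor (T ord0)) _ _ _ _ _ _ _ _ _ _ _ _ _
  (naturality alpha u)
  (naturality beta (x := fun j => S (val j) (a j)) (y := fun j => S (val j) (b j))
     (fun j => fmap (S (val j)) (u j)))).
Defined.

Lemma hcell_comp_square : hcell_comp (Cell alpha) (Cell beta) = Cell hcomp_square.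
Proof.
have [es et eS ec] := @hcell_compP (Cell alpha) (Cell beta) erefl.
have [_ enh] := @hcomp_arity (Cell alpha) (Cell beta) erefl.
apply: cell_ext => //; first by move=> i le_i; rewrite eS -?enh // hcomp_funE.
move=> a; rewrite es enh => o; rewrite ec //.
have [b eb] := inputsP o.
rewrite (@cell_atE (Cell hcomp_square) a b eb) (cell_atE eb).
rewrite (@cell_atE (Cell beta) _ (fun j => S (val j) (b j))); last first.
  by move=> k; rewrite /side_map eb side_ord /aid amapE fmap_id.
by rewrite side0 /hop [amap _ _]amapE; exact: ocompE.
Qed.

End HSquare.

Lemma cell_recast (h : cell) n (A B : 'I_n.+1 -> category) (F : madj A) (G : madj B)
    (S : forall i, functor (A i) (B i)) :
  cell_src h = VCell F -> cell_tgt h = VCell G ->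
  (forall i : 'I_n.+1, side h i = HCell (S i)) -> exists alpha : square F G S, h = Cell alpha.
Proof.
case: h => n' A' B' F' G' S' al; rewrite /cell_src /cell_tgt /= => e1 e2.
have en := congr1 varity e1; rewrite /= in en; subst n'.
have e1' := vcell_inj e1; have eA := congr1 (@projT1 _ _) e1'; rewrite /= in eA; subst A'.
have eF := EqdepTheory.inj_pair2 _ _ _ _ _ e1'; subst F'.
have e2' := vcell_inj e2; have eB := congr1 (@projT1 _ _) e2'; rewrite /= in eB; subst B'.
have eG := EqdepTheory.inj_pair2 _ _ _ _ _ e2'; subst G'.
move=> es; have eS : S' = S.
  apply: functional_extensionality_dep => i.
  by have := es i; rewrite /side /= inord_val => /hcell_inj.
by subst S'; exists al.
Qed.

Lemma nth_map_src g l q : nth (cell_src g) (map cell_src l) q = cell_src (nth g l q).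
Proof.
have [lt|le] := ltnP q (size l); first by rewrite (nth_map g).
by rewrite !nth_default ?size_map.
Qed.

Lemma ccomp_pasting (g : cell) (f : 'I_(carity g) -> cell)
    (p : @composable cell_graph g [seq f q | q <- enum 'I_(carity g)]) :
  is_pasting f (ccomp p).
Proof.
move=> c a b cp b' v ev_.
set fs := [seq f q | q <- enum 'I_(carity g)] in p c cp *.
have ic := ccomp_is p g.
have efs : map cell_src fs = [seq cell_src (f q) | q <- enum 'I_(carity g)] by rewrite -map_comp.
have [p' ep] := vcomp_recast (composable_src p) erefl efs.
have eH := vcomp_congr p' (cell_src g); rewrite -ep -src_ccomp in eH.
set U := (fun q => under (nth (cell_src g) [seq cell_src (f q) | q <- enum 'I_(carity g)] q)) in eH.
have eU : sV (fun q => nth g fs q) = U.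
  by apply: functional_extensionality => q; rewrite /U -efs nth_map_src.
pose w := full_family (fun p => idm (c p)).
have ow : inputs (carity (ccomp p)) (ucat (sU (ccomp p))) w.
  exact: objects_inputs (objects_full_family c).
apply: Some_inj; rewrite -(@cell_atE (ccomp p) w (omit ord0 c)); last by move=> k; exact: full_familyE.
rewrite (ic_at ic); last by apply/(ic_inputs ic).
rewrite -ocompE /pasting_at eU; congr ocomp; last first.
  apply: cell_atE => k; rewrite (outer_compatible eH cp) ?leq_ord //.
  exact: full_familyE.
apply: (@ev_ord _ _ (ctgt g) ord0 _ (fun q : but ord0 => cfun g (val q) (b (val q)))
  (fun q => b' (val q)) v) => -[k ne].
case: (unliftP ord0 k) ne => [q -> ne|-> //]; rewrite ev_.
rewrite -[LHS]/(cell_at (nth g fs q) (inner (sU g) (sV (fun q => nth g fs q)) w q)) eU.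
have -> : nth g fs q = f q by rewrite /fs (nth_map q) ?size_enum_ord // nth_ord_enum.
apply: cell_atE => j; rewrite (inner_compatible eH (q := q) cp) ?leq_ord //.
exact: full_familyE.
Qed.

Section Mates.
Variables (n : nat) (A B : 'I_n.+1 -> category) (F : madj A) (G : madj B).
Variables (S : forall i, functor (A i) (B i)) (alpha : square F G S).
Variables (F' : madj (fun i => A (ordS i))) (G' : madj (fun i => B (ordS i))).
Variable alpha' : square F' G' (fun i => S (ordS i)).

(** The equation on epsilon says that its transpose is the universal element at the position 1, at
    which the value of the action is the component of the mate; and the action commutes with
    transposition. *)
Lemma crot_mate : crot (Cell alpha) = Cell alpha' -> is_mate alpha alpha'.
Proof.
move=> eh a epsilon eeps.
have [es _ _ ecm] := crotP (Cell alpha); rewrite eh in es ecm.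
have [_ ecs _ _] := under_vrot (VCell F); rewrite -[vrot _]es in ecs.
pose w := full_family (fun j => idm (a j)).
pose w' := full_family (fun j : 'I_n.+1 => idm (a (ordS j))).
have eun j : j <= n -> w' (unsh n j) = w j.
  move=> le_j; have [k ek] := leq_ordP (unsh_leq le_j).
  by rewrite /w' ek full_familyE -(unshK le_j) ek -val_ordS /w full_familyE.
have one : sh n 0 = (ordS ord0 : 'I_n.+1) by rewrite val_ordS.
set f := Cell alpha in ecm *.
have ow : objects n (ucat (sU f)) w := objects_full_family a.
have ow' : inputs n (rot_cat (sU f)) w'.
  by move=> j lt0j le_j; rewrite -[rot_cat _ _](ecs j le_j).
apply: Some_inj.
have -> : Some (Arrow_in (B (ordS ord0)) (alpha' (omit ord0 (fun j => a (ordS j))))) =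
    oop (cell_at (Cell alpha') w').
  rewrite (@cell_atE (Cell alpha') w' (omit ord0 (fun j => a (ordS j)))) /= ?aopE //.
  by move=> k; exact: full_familyE.
rewrite ecm // /mate_at oopK.
have ee : oop (ev (sU f) (sh n 0) (fun j => w' (unsh n j))) = Some (Arrow (transpose F epsilon)).
  rewrite one (@ev_ext (sU f) (ordS ord0) _ w) ?leq_ord //; last by move=> j le_j _; exact: eun.
  rewrite [ev _ _ _](@ev_ord _ _ F (ordS ord0) _ _ _ (omit _ (fun j => idm (a j)))); last first.
    by move=> k; exact: full_familyE.
  by rewrite eeps /= fmap_id aopE.
rewrite ee.
have ew j : j <= n -> upd (fun j => w' (unsh n j)) (sh n 0) (Some (Arrow (transpose F epsilon))) j = w j.
  move=> le_j; rewrite /upd; case: eqP => [->|_]; last exact: eun.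
  rewrite one /w full_familyE eeps; congr (Some _).
  by have [_ ->] := Arrow_ends eeps.
rewrite (cell_act_ext (b := w)) ?sh_leq //.
have et : Some (Arrow (transpose F epsilon)) = tr (sU f) 0 (sh n 0) w (Some (Arrow epsilon)).
  rewrite one; symmetry; apply: (@tr_ord _ _ F ord0); [exact: full_familyE | exact: corr_transpose].
have le : elt (sU f) w 0 (Some (Arrow epsilon)).
  apply/velementP => //; exists a.
  have e0 : inord 0 = ord0 :> 'I_n.+1 by exact: inord0.
  by rewrite e0; exists epsilon; split=> // k; rewrite /w full_familyE.
rewrite et cell_act_tr ?sh_leq // cell_act0 // one.
rewrite (@cell_atE f w (omit ord0 a)); last by move=> k; exact: full_familyE.
have -> : ocomp (amap (side f 0) (Some (Arrow epsilon))) (oop (Some (Arrow (cnat f (omit ord0 a))))) =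
    Some (Arrow (compm (fmap (S ord0) epsilon) (alpha (omit ord0 a)))).
  by rewrite side0 amapE /= aopE ocompE.
apply: (@tr_ord _ _ G ord0); last exact: corr_transpose.
by move=> k; rewrite /side_map /w full_familyE side_ord amapE fmap_id.
Qed.

End Mates.

Lemma square_rotation n (A B : 'I_n.+1 -> category) (F : madj A) (G : madj B)
    (S : forall i, functor (A i) (B i)) (alpha : square F G S) :
  exists F' G' (alpha' : square F' G' (fun i => S (ordS i))),
    [/\ crot (Cell alpha) = Cell alpha',
        is_rotation F F', is_rotation G G' & is_mate alpha alpha'].
Proof.
have [F' eF rF] := vrot_rotation F; have [G' eG rG] := vrot_rotation G.
have [es et eS _] := crotP (Cell alpha).
have [alpha' e] : exists alpha' : square F' G' (fun i => S (ordS i)), crot (Cell alpha) = Cell alpha'.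
  apply: cell_recast; rewrite ?es ?et //.
  by move=> i; rewrite eS ?leq_ord // -[carity _]/n -val_ordS side_ord.
by exists F', G', alpha'; split=> //; exact: crot_mate.
Qed.

Theorem theorem3p11 :
  exists D : cyclic_double_multicategory madj_graph cell_graph,
    is_MAdj (vert D) /\
    [/\ forall S : hcell, on_obj (hsrc D) S = hcell_src S,
        forall S : hcell, on_obj (htgt D) S = hcell_tgt S,
        forall f : cell, on_mmap (hsrc D) f = cell_src f &
        forall f : cell, on_mmap (htgt D) f = cell_tgt f] /\
    (forall A : category, on_obj (hid D) A = HCell (id_functor A)) /\
    (forall (n : nat) (A : 'I_n.+1 -> category) (F : madj A),
       exists2 iota : square F F (fun i => id_functor (A i)),
         on_mmap (hid D) (VCell F) = Cell iota &
         forall a, iota a = idm (F ord0 a)) /\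
    (forall (A B C : category) (S : functor A B) (T : functor B C)
       (e : on_obj (htgt D) (HCell S) = on_obj (hsrc D) (HCell T)),
       on_obj (hcomp D) (Pb (HCell S : obj cell_graph) (HCell T) e) =
       HCell (comp_functor T S)) /\
    (forall (n : nat) (A B C : 'I_n.+1 -> category)
       (F : madj A) (G : madj B) (K : madj C)
       (S : forall i, functor (A i) (B i)) (T : forall i, functor (B i) (C i))
       (alpha : square F G S) (beta : square G K T)
       (e : on_mmap (htgt D) (Cell alpha) = on_mmap (hsrc D) (Cell beta)),
       exists2 gamma : square F K (fun i => comp_functor (T i) (S i)),
         on_mmap (hcomp D) (Pb (Cell alpha : mmap cell_graph) (Cell beta) e) =
         Cell gamma &
         forall a, gamma a =
           compm (beta (fun j => S (val j) (a j)))
                 (fmap (op_functor (T ord0)) (alpha a))) /\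
    (forall (A B : category) (S : functor A B),
       invol (cells D) (HCell S) = HCell (op_functor S)) /\
    (forall (g : cell) (f : 'I_(carity g) -> cell)
       (p : @composable cell_graph g [seq f q | q <- enum 'I_(carity g)]),
       is_pasting f (mcomp (cells D) p)) /\
    (forall (n : nat) (A B : 'I_n.+1 -> category) (F : madj A) (G : madj B)
       (S : forall i, functor (A i) (B i)) (alpha : square F G S),
       exists F' G' (alpha' : square F' G' (fun i => S (ordS i))),
         [/\ sigma (cells D) (Cell alpha) = Cell alpha',
             is_rotation F F', is_rotation G G' & is_mate alpha alpha']).

Proof.
exists MAdj_double; split; [exact: madj_is_MAdj | split; [by split | split; [by [] |]]].
split; [|split; [|split; [|split; [by []|split]]]].
- by move=> n A F; exists (hid_square F).
- by move=> A B C S T e; exact: hcomp_funE.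
- move=> n A B C F G K S T alpha beta e; exists (hcomp_square alpha beta) => //.
  exact: hcell_comp_square.
- by move=> g f p; exact: ccomp_pasting.
- by move=> n A B F G S alpha; exact: square_rotation.
Qed.
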